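(* Let $k\in\mathbb{N}$, $i_1,\ldots,i_k\in\{1,\ldots,m\}$. Suppose that: 1. every $\psi_l$ $(l=1,\ldots,k)$ is a continuous non-random function on $[t,T]$; 2. $M_\tau^{(l,i_l)}\in Q_4(\rho,[t,T])$ and $M_\tau^{(l,i_l)}\in G_n(\rho,[t,T])$ with $n=2^{k+1}$, for $i_l=1,\ldots,m$, $l=1,\ldots,k$; 3. $\{\Psi_j(x)\}_{j=0}^{\infty}$ is a complete orthonormal with weight $r(x)\ge0$ system of functions in the space $L_2([t,T])$, each of which satisfies condition $(\star)$; moreover, $\rho(x)/r(x)\le C<\infty$ on $[t,T]$ for some constant $C$. Then for the iterated stochastic integral with respect to martingales $$J[\psi^{(k)}]_{T,t}^M=\int_t^T\psi_k(t_k)\ldots\int_t^{t_2}\psi_1(t_1)\,dM_{t_1}^{(1,i_1)}\ldots dM_{t_k}^{(k,i_k)}$$ the following expansion, converging in the mean-square sense, is valid: $$J[\psi^{(k)}]_{T,t}^M=\mathop{\rm l.i.m.}_{p_1,\ldots,p_k\to\infty}\sum_{j_1=0}^{p_1}\ldots\sum_{j_k=0}^{p_k}\tilde C_{j_k\ldots j_1}\Biggl(\prod_{l=1}^k\xi_{j_l}^{(l,i_l)}-\mathop{\rm l.i.m.}_{N\to\infty}\sum_{(l_1,\ldots,l_k)\in{\rm G}_k}\Psi_{j_1}(\tau_{l_1})\Delta M_{\tau_{l_1}}^{(1,i_1)}\ldots\Psi_{j_k}(\tau_{l_k})\Delta M_{\tau_{l_k}}^{(k,i_k)}\Biggr),$$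 where $\Delta M_{\tau_j}^{(r,i)}=M_{\tau_{j+1}}^{(r,i)}-M_{\tau_j}^{(r,i)}$ $(i=1,\ldots,m$, $r=1,\ldots,k)$, the random variables $$\xi_j^{(l,i_l)}=\int_t^T\Psi_j(s)\,dM_s^{(l,i_l)}$$ are independent for different $i_l=1,\ldots,m$ $(l=1,\ldots,k)$ and uncorrelated for different $j$ (if $i_l\ne0$ and $\rho(x)\equiv r(x)$), and $$\tilde C_{j_k\ldots j_1}=\int_{[t,T]^k}K(t_1,\ldots,t_k)\prod_{l=1}^k\bigl(\Psi_{j_l}(t_l)r(t_l)\bigr)dt_1\ldots dt_k,$$ with $K(t_1,\ldots,t_k)=\psi_1(t_1)\ldots\psi_k(t_k)$ if $t_1<\ldots<t_k$ and $K(t_1,\ldots,t_k)=0$ otherwise (for $k\ge2$, $t_1,\ldots,t_k\in[t,T]$), and $K(t_1)=\psi_1(t_1)$ for $k=1$.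
   Context: Let $0\le t<T$ and let $(\Omega,{\rm F},{\sf P})$ be a probability space with a non-decreasing family of $\sigma$-algebras $\{{\rm F}_s\}$, ${\rm F}_s\subset{\rm F}$; ${\sf M}$ denotes expectation; l.i.m. is the limit in the mean-square sense. ${\rm M}_2(\rho,[t,T])$ is the class of martingales $M_s$, ${\rm F}_s$-measurable for each $s\in[t,T]$, such that for $t\le u<s\le T$: ${\sf M}\{(M_s-M_u)^2\}=\int_u^s\rho(\tau)d\tau$ and ${\sf M}\{|M_s-M_u|^p\}\le C_p|s-u|$ for $p=3,4,\ldots$, where $\rho$ is a non-negative continuously differentiable non-random function and $C_p<\infty$ is a constant. $H_2(\rho,[t,T])$ is the class of processes $\xi_s$, ${\rm F}_s$-measurable for all $s\in[t,T]$, with $\int_t^T{\sf M}\{|\xi_s|^2\}\rho(s)ds<\infty$. For $\xi\in H_2(\rho,[t,T])$ the integral $\int_t^T\xi_\tau dM_\tau$ is the mean-square limit of $\sum_{j=0}^{N-1}\xi^{(N)}(\tau_j)(M_{\tau_{j+1}}-M_{\tau_j})$, where $\xi^{(N)}\in H_2(\rho,[t,T])$ are step processes, constant in time on each $[\tau_j,\tau_{j+1})$, with $\int_t^T{\sf M}\{|\xi^{(N)}_s-\xi_s|^2\}\rho(s)ds\to0$. $Q_4(\rho,[t,T])$ is the class of $M\in{\rm M}_2(\rho,[t,T])$ such that for some $\alpha>0$ and some constant $K_4<\infty$, ${\sf M}\{|\int_u^{\tau}g(s)dM_s|^4\}\le K_4\int_u^{\tau}|g(s)|^{\alpha}ds$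 for all $t\le u<\tau\le T$ and bounded non-random functions $g$. $G_n(\rho,[t,T])$ is the class of $M\in{\rm M}_2(\rho,[t,T])$ such that ${\sf M}\{|\int_u^{\tau}g(s)dM_s|^n\}<\infty$ for all such $u,\tau,g$. $M^{(r,i)}$ $(r=1,\ldots,k)$ are martingales, independent for different $i=1,\ldots,m$. ''Complete orthonormal with weight $r(x)$ in $L_2([t,T])$'' means that $\{\Psi_j(x)\sqrt{r(x)}\}_{j=0}^\infty$ is a complete orthonormal system in $L_2([t,T])$. Standing assumption: $K(t_1,\ldots,t_k)\prod_{l=1}^k\sqrt{r(t_l)}\in L_2([t,T]^k)$. Condition $(\star)$ for a function $f:[t,T]\to\mathbb{R}$: $f$ is continuous on $[t,T]$ except possibly at finitely many points of finite (jump) discontinuity, and $f$ is right-continuous on $[t,T]$. $\{\tau_j\}_{j=0}^N$ is a partition (depending on $N$) $t=\tau_0<\ldots<\tau_N=T$ with $\max_{0\le j\le N-1}(\tau_{j+1}-\tau_j)\to0$ as $N\to\infty$. ${\rm G}_k={\rm H}_k\setminus{\rm L}_k$, where ${\rm H}_k=\{(l_1,\ldots,l_k): l_1,\ldots,l_k=0,1,\ldots,N-1\}$ and ${\rm L}_k=\{(l_1,\ldots,l_k)\in{\rm H}_k: l_g\ne l_r \text{ for } g\ne r,\ g,r=1,\ldots,k\}$. *)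

(* Defs.v *)
From HB Require Import structures.
From mathcomp Require Import all_boot all_order all_algebra.
From mathcomp Require Import all_classical all_reals all_analysis.

Set Implicit Arguments.
Unset Strict Implicit.
Unset Printing Implicit Defensive.
Import Order.TTheory GRing.Theory Num.Theory.
Import numFieldNormedType.Exports.

Local Open Scope classical_set_scope.
Local Open Scope ring_scope.

Section cons_measure.
Context d (T : measurableType d) (R : realType).

Definition tuple_of_pair n (x : T * n.-tuple T) : n.+1.-tuple T :=
  [tuple of x.1 :: x.2].

Definition pair_of_tuple n (x : n.+1.-tuple T) : T * n.-tuple T :=
  (thead x, [tuple of behead x]).

Lemma tuple_of_pairK n : cancel (@tuple_of_pair n) (@pair_of_tuple n).
Proof.
by case=> x y; rewrite /pair_of_tuple theadE; congr pair; exact: val_inj.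
Qed.

Lemma measurable_tuple_of_pair n : measurable_fun setT (@tuple_of_pair n).
Proof. exact: measurable_cons. Qed.

Lemma measurable_pair_of_tuple n : measurable_fun setT (@pair_of_tuple n).
Proof.
apply: measurable_fun_pair; last exact: measurable_behead.
exact: measurable_tnth.
Qed.

Variables (m : {sigma_finite_measure set T -> \bar R}) (n : nat).
Variable mu : {sigma_finite_measure set (n.-tuple T) -> \bar R}.

Definition cons_measure : set (n.+1.-tuple T) -> \bar R :=
  pushforward (m \x mu)%E (@tuple_of_pair n).

Let cons_measure0 : cons_measure set0 = 0%E.
Proof. by rewrite /cons_measure /pushforward preimage_set0 measure0. Qed.

Let cons_measure_ge0 A : (0 <= cons_measure A)%E.
Proof. by apply: integral_ge0 => x _; exact: measure_ge0. Qed.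

Let cons_measure_sigma_additive : semi_sigma_additive cons_measure.
Proof.
have mf := @measurable_tuple_of_pair n.
have mpre A : measurable A -> measurable (@tuple_of_pair n @^-1` A).
  by move=> mA; rewrite -[X in measurable X]setTI; exact: mf.
move=> F mF tF mUF; rewrite /cons_measure /pushforward preimage_bigcup.
apply: measure_semi_sigma_additive.
- by move=> i; exact: mpre.
- apply/trivIsetP => /= i j _ _ ij; rewrite -preimage_setI.
  by move/trivIsetP : tF => /(_ _ _ _ _ ij) ->//; rewrite preimage_set0.
- by rewrite -preimage_bigcup; exact: mpre.
Qed.

HB.instance Definition _ := isMeasure.Build _ _ _ cons_measure
  cons_measure0 cons_measure_ge0 cons_measure_sigma_additive.

Let cons_measure_sigma_finite : sigma_finite setT cons_measure.
Proof.
have /sigma_finiteP[F [TF ndF Foo]] := sigma_finiteT m.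
have /sigma_finiteP[G [TG ndG Goo]] := sigma_finiteT mu.
exists (fun i => @pair_of_tuple n @^-1` (F i `*` G i)).
  rewrite -preimage_bigcup (_ : \bigcup_i _ = setT) ?preimage_setT//.
  apply/seteqP; split=> // -[x y] _.
  have [i _ Fx] : (\bigcup_i F i) x by rewrite -TF.
  have [j _ Gy] : (\bigcup_i G i) y by rewrite -TG.
  exists (maxn i j) => //; split=> /=.
  - by move: x Fx; exact/subsetPset/ndF/leq_maxl.
  - by move: y Gy; exact/subsetPset/ndG/leq_maxr.
move=> i; have [mF Fi] := Foo i; have [mG Gi] := Goo i; split.
  rewrite -[X in measurable X]setTI; apply: measurable_pair_of_tuple => //.
  exact: measurableX.
rewrite /cons_measure /pushforward (_ : _ @^-1` _ = F i `*` G i).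
  by rewrite product_measure1E// lte_mul_pinfty// ge0_fin_numE.
by rewrite -comp_preimage (_ : _ \o _ = id)//; apply/funext/tuple_of_pairK.
Qed.

HB.instance Definition _ :=
  Measure_isSigmaFinite.Build _ _ _ cons_measure cons_measure_sigma_finite.

End cons_measure.

(* n-fold product of the Lebesgue measure, on the n-tuples of reals *)
Fixpoint lebesgue_tuple (R : realType) n :
    {sigma_finite_measure set (n.-tuple (measurableTypeR R)) -> \bar R} :=
  match n with
  | 0 => @dirac _ (0.-tuple (measurableTypeR R)) [tuple] R
  | n'.+1 => cons_measure (@lebesgue_measure R) (lebesgue_tuple R n')
  end.

Section deterministic_notions.
Context (R : realType).
Local Notation mu := (@lebesgue_measure R).
Implicit Types (a b t T : R) (f g r rho : R -> R).

Definition square_integrable d (S : measurableType d)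
    (nu : {measure set S -> \bar R}) (D : set S) (f : S -> R) :=
  measurable_fun D f /\ (\int[nu]_(x in D) ((f x) ^+ 2)%:E < +oo)%E.

(* Completeness is density of the linear span in L_2([a,b]). *)
Definition complete_orthonormal a b (phi : nat -> R -> R) :=
  [/\ forall j, square_integrable mu `[a, b] (phi j),
      forall i j, \int[mu]_(x in `[a, b]) (phi i x * phi j x) = (i == j)%:R &
      forall f, square_integrable mu `[a, b] f ->
        forall e : R, 0 < e -> exists (n : nat) (c : nat -> R),
        (\int[mu]_(x in `[a, b])
          ((f x - \sum_(j < n) c j * phi j x) ^+ 2)%:E < e%:E)%E].

Definition complete_orthonormal_weight a b r (Psi : nat -> R -> R) :=
  [/\ measurable_fun `[a, b] r,
      forall x, x \in `[a, b] -> 0 <= r x &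
      complete_orthonormal a b (fun j x => Psi j x * Num.sqrt (r x))].

(* At the points of S the left limit is required to exist and to be finite;
   the right limit is f x by right-continuity. *)
Definition piecewise_right_continuous a b f :=
  exists S : seq R,
  [/\ forall x, x \in `[a, b] -> x \notin S ->
        f y @[y --> within [set` `[a, b]] (nbhs x)] --> f x,
      forall x, x \in `]a, b] -> x \in S -> cvg (f y @[y --> x^'-]) &
      forall x, x \in `[a, b[ -> f y @[y --> x^'+] --> f x].

(* The derivative at a and b is one-sided: a continuous function on [a,b]
   whose derivative on ]a,b[ extends continuously to [a,b] is C^1 on [a,b]. *)
Definition continuously_differentiable a b f :=
  {within `[a, b], continuous f} /\
  exists2 f' : R -> R, {within `[a, b], continuous f'} &
    forall x, x \in `]a, b[ -> is_derive x (1 : R) f (f' x).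

(* tau N is a partition of [a,b] into N intervals (N > 0), and the mesh tends
   to 0. *)
Definition partition_sequence a b (tau : nat -> nat -> R) :=
  [/\ forall N, (0 < N)%N -> tau N 0 = a /\ tau N N = b,
      forall N j, (j < N)%N -> tau N j < tau N j.+1 &
      (\big[Num.max/0]_(j < N) (tau N j.+1 - tau N j)) @[N --> \oo] --> 0].

Definition cube k a b : set (k.-tuple (measurableTypeR R)) :=
  [set x | forall l, tnth x l \in `[a, b]].

Definition iterated_kernel k (psi : 'I_k -> R -> R)
    (x : k.-tuple (measurableTypeR R)) : R :=
  if sorted (fun u v : R => u < v) x then \prod_(l < k) psi l (tnth x l) else 0.

Definition fourier_coefficient k t T (psi : 'I_k -> R -> R) r
    (Psi : nat -> R -> R) (j : 'I_k -> nat) : R :=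
  \int[lebesgue_tuple R k]_(x in cube t T)
    (iterated_kernel psi x * \prod_(l < k) (Psi (j l) (tnth x l) * r (tnth x l))).

End deterministic_notions.

Definition multi_indices k N : {set {ffun 'I_k -> 'I_N}} := [set: _]%SET.

Definition distinct_indices k N : {set {ffun 'I_k -> 'I_N}} :=
  [set l : {ffun 'I_k -> 'I_N} |
    [forall g, forall r, (g != r) ==> (l g != l r)]]%SET.

Definition coinciding_indices k N : {set {ffun 'I_k -> 'I_N}} :=
  (multi_indices k N :\: distinct_indices k N)%SET.

Section stochastic_notions.
Context (R : realType) d (Omega : measurableType d) (P : probability Omega R).
Local Notation mu := (@lebesgue_measure R).
Implicit Types (F : R -> set_system Omega) (M xi : R -> Omega -> R).
Implicit Types (X Y I : Omega -> R) (a b t T : R) (g rho : R -> R).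

Definition filtration F t T :=
  [/\ forall s, s \in `[t, T] -> sigma_algebra setT (F s),
      forall s, s \in `[t, T] -> F s `<=` measurable &
      forall u s, t <= u -> u <= s -> s <= T -> F u `<=` F s].

Definition measurable_wrt (G : set_system Omega) X :=
  forall B : set (measurableTypeR R), measurable B -> G (X @^-1` B).

(* X N --> Y in the mean-square sense *)
Definition ms_limit (X : nat -> Omega -> R) Y :=
  measurable_fun setT Y /\
  'E_P[fun w => ((X N w - Y w) ^+ 2)%R]%E @[N --> \oo] --> 0%E.

(* E[M_s | F_u] = M_u is expressed by its defining property. *)
Definition martingale F t T M :=
  [/\ forall s, s \in `[t, T] -> measurable_wrt (F s) (M s),
      forall s, s \in `[t, T] -> P.-integrable setT (EFin \o M s) &
      forall u s, t <= u -> u < s -> s <= T -> forall A, F u A ->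
        (\int[P]_(w in A) (M s w)%:E = \int[P]_(w in A) (M u w)%:E)%E].

Definition class_M2 F rho t T M :=
  [/\ (forall x, x \in `[t, T] -> 0 <= rho x) /\
        continuously_differentiable t T rho,
      martingale F t T M,
      forall u s, t <= u -> u < s -> s <= T ->
        ('E_P[fun w => ((M s w - M u w) ^+ 2)%R] =
         \int[mu]_(x in `[u, s]) (rho x)%:E)%E &
      forall p, (3 <= p)%N -> exists C : R, forall u s,
        t <= u -> u < s -> s <= T ->
        ('E_P[fun w => (`|M s w - M u w| ^+ p)%R] <= (C * `|s - u|)%:E)%E].

(* Joint measurability of (s, w) |-> xi s w is what makes the integral of
   E|xi_s|^2 rho(s), and the integrals of the differences of such processes,
   meaningful. *)
Definition class_H2 F rho a b xi :=
  [/\ forall s, s \in `[a, b] -> measurable_wrt (F s) (xi s),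
      measurable_fun (`[a, b] `*` [set: Omega])
        (fun z : measurableTypeR R * Omega => xi z.1 z.2) &
      (\int[mu]_(s in `[a, b])
        ('E_P[fun w => (`|xi s w| ^+ 2)%R] * (rho s)%:E) < +oo)%E].

Definition step_approximation F rho a b xi (tau : nat -> nat -> R)
    (xiN : nat -> R -> Omega -> R) :=
  [/\ partition_sequence a b tau,
      forall N, (0 < N)%N -> class_H2 F rho a b (xiN N),
      forall N j, (j < N)%N -> forall s, s \in `[tau N j, tau N j.+1[ ->
        xiN N s = xiN N (tau N j) &
      (\int[mu]_(s in `[a, b])
        ('E_P[fun w => (`|xiN N s w - xi s w| ^+ 2)%R] * (rho s)%:E))%E
        @[N --> \oo] --> 0%E].

(* I is (a version of) the integral of xi against M over [a,b], for a < b: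
   step approximations of xi exist, and the integral sums of each of them
   converge to I in mean square. *)
Definition stochastic_integral F rho M a b xi I :=
  [/\ class_H2 F rho a b xi,
      exists tau xiN, step_approximation F rho a b xi tau xiN &
      forall tau xiN, step_approximation F rho a b xi tau xiN ->
        ms_limit (fun N w => \sum_(j < N)
          xiN N (tau N j) w * (M (tau N j.+1) w - M (tau N j) w)) I].

Definition bounded_nonrandom a b g :=
  measurable_fun `[a, b] g /\
  exists B : R, forall s, s \in `[a, b] -> `|g s| <= B.

Definition class_Q4 F rho t T M :=
  class_M2 F rho t T M /\
  exists (alpha K4 : R), 0 < alpha /\
    forall u v g, t <= u -> u < v -> v <= T -> bounded_nonrandom u v g ->
    exists2 I, stochastic_integral F rho M u v (fun s _ => g s) I &
      ('E_P[fun w => (`|I w| ^+ 4)%R] <=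
       K4%:E * \int[mu]_(s in `[u, v]) (`|g s| `^ alpha)%:E)%E.

Definition class_G n F rho t T M :=
  class_M2 F rho t T M /\
  forall u v g, t <= u -> u < v -> v <= T -> bounded_nonrandom u v g ->
  exists2 I, stochastic_integral F rho M u v (fun s _ => g s) I &
    ('E_P[fun w => (`|I w| ^+ n)%R] < +oo)%E.

(* The layers (psi, M) are listed from the outermost to the innermost one; the
   integral over [t,t] is 0. The processes Y are the inner iterated integrals,
   up to the choice of a version at each time. *)
Fixpoint iterated_layers F rho t
    (layers : seq ((R -> R) * (R -> Omega -> R))) (s : R) I : Prop :=
  match layers with
  | [::] => I = cst 1
  | (psi, M) :: inner =>
      if s == t then I = cst 0 else
      exists Y : R -> Omega -> R,
        (forall u, u \in `[t, s] -> iterated_layers F rho t inner u (Y u)) /\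
        stochastic_integral F rho M t s (fun u w => psi u * Y u w) I
  end.

Definition iterated_integral F rho t T k (psi : 'I_k -> R -> R)
    (M : 'I_k -> R -> Omega -> R) I :=
  iterated_layers F rho t (rev [seq (psi l, M l) | l <- enum 'I_k]) T I.

Definition sigma_generated (X : set (Omega -> R)) : set_system Omega :=
  <<s [set A | exists2 Z, X Z &
        exists2 B : set (measurableTypeR R), measurable B & A = Z @^-1` B] >>.

Definition independent_families m (X : 'I_m -> set (Omega -> R)) :=
  forall A : 'I_m -> set Omega,
    (forall i, sigma_generated (X i) (A i)) ->
    P (\bigcap_i A i) = (\prod_(i < m) P (A i))%E.

(* convergence in the mean-square sense as p_1, ..., p_k --> oo jointly *)
Definition ms_limit_multi k (S : ('I_k -> nat) -> Omega -> R) Y :=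
  measurable_fun setT Y /\
  forall e : R, 0 < e -> exists p0 : nat, forall p : 'I_k -> nat,
    (forall l, (p0 <= p l)%N) ->
    ('E_P[fun w => ((S p w - Y w) ^+ 2)%R] < e%:E)%E.

End stochastic_notions.

(* Main.v *)
(* The second moments of the increments of M only control sums with
   deterministic coefficients. The bound
   E[Z^2 (M_v - M_u)^2] <= C E[Z^2] int_u^v rho for F_u-measurable Z comes from
   Q_4: since the zero function has an integral, the integral sums of every
   adapted step process that is small in H_2 are small. Hence a sum over
   pairwise distinct indices, S = sum_l a(l) prod_g (Delta M^g)_(l_g), satisfies
   E S^2 <= (k C)^k sum_l a(l)^2 prod_g int_(cell l_g) rho.

   The integral J is the limit of such sums with a = prod psi_g on increasing
   multi-indices. The integral sums of the xi_j have bounded moments of all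
   orders, so their products converge in L_2 to prod xi_j; the part over pairwise
   distinct indices is Cauchy, which yields the limit over G_k. Therefore
   J - sum_j C_j (prod xi_j - D_j) is the limit of the sums with
   a = K - sum_j C_j prod Psi_j at the partition points, and its second moment is
   at most a constant times
   int (K - sum_j C_j prod Psi_j)^2 prod rho
     <= const . || K prod sqrt r - sum_j C_j prod (Psi_j sqrt r) ||^2,
   the remainder of the Fourier series of K prod sqrt r in the tensor products of
   a complete orthonormal system. *)

Require Import Defs.
From HB Require Import structures.
From mathcomp Require Import all_boot all_order all_algebra.
From mathcomp Require Import all_classical all_reals all_analysis.
From mathcomp Require Import measurable_realfun.
From mathcomp Require Import ring lra zify.
Set Implicit Arguments.
Unset Strict Implicit.
Unset Printing Implicit Defensive.
Import Order.TTheory GRing.Theory Num.Theory.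
Import numFieldNormedType.Exports.
Local Open Scope classical_set_scope.
Local Open Scope ring_scope.

(** The existence of integrals is qualitative: convergence along each approximating sequence. It
    yields the uniform constant C because a linear map continuous at zero is bounded. The obstacle
    is that possible counterexamples live on different partitions and must be placed into a single
    sequence indexed by the number of cells. The k in (k C)^k has another origin. Only martingales
    with different i are independent, so those with equal i may be correlated. When the latest cell
    is peeled off, the k factors that may carry it give terms that need not be orthogonal to each
    other, and each peeling costs a Cauchy-Schwarz inequality with k terms. The Cauchy property over
    distinct indices rests on nested elementary integrals. Two of them on different partitions are
    compared on the common refinement, where the oscillation of the integrand is read off from the
    known convergence of the one-dimensional sums, so the jumps of Psi_j need no treatment there.
    The same nested integrals, with the latest factor prescribed, approximate J. *)

Lemma sqr_sum_le (R : realFieldType) (I : finType) (x : I -> R) :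
  (\sum_i x i) ^+ 2 <= #|I|%:R * \sum_i x i ^+ 2.
Proof.
have : 0 <= \sum_i \sum_j (x i - x j) ^+ 2.
  by apply: sumr_ge0 => i _; apply: sumr_ge0 => j _; exact: sqr_ge0.
have -> : \sum_i \sum_j (x i - x j) ^+ 2 =
    (#|I|%:R * \sum_i x i ^+ 2 - (\sum_i x i) ^+ 2) *+ 2.
  have eq1 i : \sum_j (x i - x j) ^+ 2 =
      #|I|%:R * x i ^+ 2 + \sum_j x j ^+ 2 - (x i * \sum_j x j) *+ 2.
    under eq_bigr do rewrite sqrrB.
    rewrite big_split sumrB/= sumr_const sumrMnl -mulr_sumr mulr_natl.
    by rewrite addrAC.
  under eq_bigr do rewrite eq1.
  rewrite sumrB big_split/= sumrMnl -mulr_sumr sumr_const -mulr_suml.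
  by rewrite -mulr_natl; ring.
by rewrite mulr2n => h; lra.
Qed.

(** * Square-integrable functions *)

Section L2.
Context d (T : measurableType d) (R : realType).
Variable mu : {measure set T -> \bar R}.
Implicit Types f g h : T -> R.
Local Notation mint f := (mu.-integrable setT (EFin \o f)).
Local Notation L2 f := (square_integrable mu setT f).

(** The square of the L_2 norm, as a real number. [Rintegral] turns an infinite integral into 0,
    which is why the estimates below ask for square integrability. *)
Definition nrm f : R := \int[mu]_x (f x ^+ 2).

Lemma L2P f : L2 f <-> measurable_fun setT f /\ mint (fun x => f x ^+ 2).
Proof.
split=> -[mf fi]; split=> //.
  apply/integrableP; split; first by apply/measurable_EFinP/measurable_funX.
  under eq_integral do rewrite /= ger0_norm ?sqr_ge0//.
  exact: fi.
move/integrableP : fi => [_]; under eq_integral do rewrite /= ger0_norm ?sqr_ge0//.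
by [].
Qed.

Lemma L2_meas f : L2 f -> measurable_fun setT f. Proof. by case. Qed.

Lemma L2_sqr f : L2 f -> mint (fun x => f x ^+ 2).
Proof. by move/L2P => []. Qed.

Lemma nrmE f : L2 f -> (nrm f)%:E = (\int[mu]_x (f x ^+ 2)%:E)%E.
Proof.
by move=> /L2_sqr fi; rewrite /nrm /Rintegral fineK// integrable_fin_num.
Qed.

Lemma mint_le f g : measurable_fun setT f -> mint g ->
  (forall x, `|f x| <= g x) -> mint f.
Proof.
move=> mf ig fg; apply: (le_integrable measurableT _ _ ig).
  exact/measurable_EFinP.
by move=> x _ /=; rewrite lee_fin (le_trans (fg x))// ler_norm.
Qed.

Lemma mintD f g : mint f -> mint g -> mint (fun x => f x + g x).
Proof. by move=> fi gi; exact: (integrableD measurableT fi gi). Qed.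

Lemma mintZ (c : R) f : mint f -> mint (fun x => c * f x).
Proof. by move=> fi; exact: (integrableZl measurableT c fi). Qed.

Lemma integrableZl_EFin (D : set T) (c : R) f : measurable D ->
  mu.-integrable D (EFin \o f) -> mu.-integrable D (fun x => (c * f x)%:E).
Proof. by move=> mD fi; exact: (integrableZl mD c fi). Qed.

Lemma mintB f g : mint f -> mint g -> mint (fun x => f x - g x).
Proof. by move=> fi gi; exact: (integrableB measurableT fi gi). Qed.

Lemma mint_sum (I : Type) (s : seq I) (P : pred I) (h : I -> T -> R) :
  (forall i, P i -> mint (h i)) -> mint (fun x => \sum_(i <- s | P i) h i x).
Proof.
move=> hi; have := @integrable_sum _ _ _ mu setT measurableT I s P
  (fun i x => (h i x)%:E) hi.
by apply: eq_integrable => //= x _; rewrite /= sumEFin.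
Qed.

Lemma Rint_sum (I : Type) (s : seq I) (P : pred I) (h : I -> T -> R) :
  (forall i, P i -> mint (h i)) ->
  \int[mu]_x (\sum_(i <- s | P i) h i x) = \sum_(i <- s | P i) \int[mu]_x h i x.
Proof.
move=> hi; elim: s => [|a s ih].
  rewrite big_nil (@eq_Rintegral _ _ _ mu _ (fun=> 0)) ?Rintegral_cst ?mul0r//.
  by move=> x _; rewrite big_nil.
rewrite big_cons; have [Pa|Pa] := boolP (P a); last first.
  by rewrite -ih; apply: eq_Rintegral => x _; rewrite big_cons (negbTE Pa).
rewrite -ih -RintegralD//; last by apply: mint_sum.
  by apply: eq_Rintegral => x _; rewrite big_cons Pa.
exact: hi.
Qed.

Lemma RintD f g : mint f -> mint g ->
  \int[mu]_x (f x + g x) = \int[mu]_x f x + \int[mu]_x g x.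
Proof. by move=> fi gi; rewrite RintegralD. Qed.

Lemma RintB f g : mint f -> mint g ->
  \int[mu]_x (f x - g x) = \int[mu]_x f x - \int[mu]_x g x.
Proof. by move=> fi gi; rewrite RintegralB. Qed.

Lemma RintZ (c : R) f : mint f -> \int[mu]_x (c * f x) = c * \int[mu]_x f x.
Proof. by move=> fi; rewrite RintegralZl. Qed.

Lemma Rint_le f g : mint f -> mint g -> (forall x, f x <= g x) ->
  \int[mu]_x f x <= \int[mu]_x g x.
Proof. by move=> fi gi fg; apply: le_Rintegral => // x _; exact: fg. Qed.

Lemma Rint_eq f g : (forall x, f x = g x) -> \int[mu]_x f x = \int[mu]_x g x.
Proof. by move=> fg; apply: eq_Rintegral => x _; exact: fg. Qed.

Lemma mint_eq f g : (forall x, f x = g x) -> mint f -> mint g.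
Proof. by move=> fg; rewrite (_ : f = g)//; apply/funext. Qed.

Lemma L2_eq f g : (forall x, f x = g x) -> L2 f -> L2 g.
Proof. by move=> fg; rewrite (_ : f = g)//; apply/funext. Qed.

Lemma nrm_eq f g : (forall x, f x = g x) -> nrm f = nrm g.
Proof. by move=> fg; congr nrm; apply/funext. Qed.

Lemma L2M_int f g : L2 f -> L2 g -> mint (fun x => f x * g x).
Proof.
move=> Lf Lg; apply: (@mint_le _ (fun x => f x ^+ 2 + g x ^+ 2)).
- by apply: measurable_funM; [exact: L2_meas Lf|exact: L2_meas Lg].
- by apply: mintD; exact: L2_sqr.
move=> x; rewrite normrM -(real_normK (num_real (f x))).
rewrite -(real_normK (num_real (g x))); move: (normr_ge0 (f x)) (normr_ge0 (g x)).
by move: `|f x| `|g x| => a b; nra.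
Qed.

Lemma L2_0 : L2 (fun=> 0).
Proof.
apply/L2P; split; first exact: measurable_cst.
by apply: (@mint_eq (fun=> 0)); [move=> x; rewrite expr0n|exact: integrable0].
Qed.

Lemma L2Z (c : R) f : L2 f -> L2 (fun x => c * f x).
Proof.
move=> Lf; apply/L2P; split.
  by apply: measurable_funM; [exact: measurable_cst|exact: L2_meas Lf].
apply: (@mint_eq (fun x => c ^+ 2 * f x ^+ 2)); first by move=> x; rewrite exprMn.
by apply: mintZ; exact: L2_sqr.
Qed.

Lemma L2D f g : L2 f -> L2 g -> L2 (fun x => f x + g x).
Proof.
move=> Lf Lg; apply/L2P; split.
  by apply: measurable_funD; [exact: L2_meas Lf|exact: L2_meas Lg].
apply: (@mint_eq (fun x => f x ^+ 2 + (f x * g x + f x * g x) + g x ^+ 2)).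
  by move=> x; rewrite sqrrD mulr2n.
by apply: mintD; [apply: mintD; [exact: L2_sqr|apply: mintD; exact: L2M_int]|
  exact: L2_sqr].
Qed.

Lemma L2B f g : L2 f -> L2 g -> L2 (fun x => f x - g x).
Proof.
move=> Lf Lg; apply: (@L2_eq (fun x => f x + (-1) * g x)).
  by move=> x; rewrite mulN1r.
by apply: L2D => //; exact: L2Z.
Qed.

Lemma L2_sum (I : Type) (s : seq I) (P : pred I) (h : I -> T -> R) :
  (forall i, P i -> L2 (h i)) -> L2 (fun x => \sum_(i <- s | P i) h i x).
Proof.
move=> hi; elim: s => [|a s ih].
  by apply: (L2_eq _ L2_0) => x; rewrite big_nil.
have [Pa|Pa] := boolP (P a).
  by apply: (L2_eq _ (L2D (hi a Pa) ih)) => x; rewrite big_cons Pa.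
by apply: (L2_eq _ ih) => x; rewrite big_cons (negbTE Pa).
Qed.

Lemma nrm_ge0 f : 0 <= nrm f.
Proof. by apply: Rintegral_ge0 => x _; exact: sqr_ge0. Qed.

Lemma nrm0 : nrm (fun=> 0) = 0.
Proof.
rewrite /nrm (Rint_eq (g := fun=> 0)) ?Rintegral_cst ?mul0r//.
by move=> x; rewrite expr0n.
Qed.

Lemma nrmZ (c : R) f : L2 f -> nrm (fun x => c * f x) = c ^+ 2 * nrm f.
Proof.
move=> /L2_sqr fi; rewrite /nrm -RintZ//; apply: Rint_eq => x.
by rewrite exprMn.
Qed.

Lemma nrmD f g : L2 f -> L2 g ->
  nrm (fun x => f x + g x) = nrm f + nrm g + 2 * \int[mu]_x (f x * g x).
Proof.
move=> Lf Lg; have fg := L2M_int Lf Lg; have f2 := L2_sqr Lf; have g2 := L2_sqr Lg.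
rewrite /nrm -RintZ// -RintD// -RintD//; last exact: mintZ.
- by apply: Rint_eq => x; rewrite sqrrD mulr2n; ring.
- exact: mintD.
Qed.

(** For squared norms this replaces the triangle inequality. It is the source of the quarters of [e]
    and of the factors 2 in the limit arguments below. *)
Lemma nrmD2 f g : L2 f -> L2 g ->
  nrm (fun x => f x + g x) <= 2 * nrm f + 2 * nrm g.
Proof.
move=> Lf Lg; have f2 := L2_sqr Lf; have g2 := L2_sqr Lg.
rewrite /nrm -!RintZ// -RintD//; [|exact: mintZ|exact: mintZ].
apply: Rint_le.
- exact: L2_sqr (L2D Lf Lg).
- by apply: mintD; exact: mintZ.
- by move=> x; have := sqr_ge0 (f x - g x); nra.
Qed.

Lemma nrmN f : nrm (fun x => - f x) = nrm f.
Proof. by apply: Rint_eq => x; rewrite sqrrN. Qed.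

Lemma L2N f : L2 f -> L2 (fun x => - f x).
Proof. by move=> /(L2Z (-1)); apply: L2_eq => x; rewrite mulN1r. Qed.

Lemma nrmB2 f g : L2 f -> L2 g ->
  nrm (fun x => f x - g x) <= 2 * nrm f + 2 * nrm g.
Proof. by move=> Lf Lg; rewrite -[in leRHS](nrmN g) nrmD2//; exact: L2N. Qed.

Lemma nrm_sum_le (I : finType) (h : I -> T -> R) : (forall i, L2 (h i)) ->
  nrm (fun x => \sum_i h i x) <= #|I|%:R * \sum_i nrm (h i).
Proof.
move=> Lh; rewrite /nrm -Rint_sum; last by move=> i _; exact: L2_sqr.
have hi : mint (fun x => \sum_i h i x ^+ 2).
  by apply: mint_sum => i _; exact: L2_sqr.
rewrite -RintZ//; apply: Rint_le; [|exact: mintZ|].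
- by apply: L2_sqr; apply: L2_sum.
- by move=> x; exact: sqr_sum_le.
Qed.

Lemma nrm_sum_orth (I : finType) (P : pred I) (h : I -> T -> R) :
  (forall i, P i -> L2 (h i)) ->
  (forall i j, P i -> P j -> i != j -> \int[mu]_x (h i x * h j x) = 0) ->
  nrm (fun x => \sum_(i | P i) h i x) = \sum_(i | P i) nrm (h i).
Proof.
move=> Lh orth; rewrite /nrm.
transitivity (\int[mu]_x (\sum_(i | P i) \sum_(j | P j) h i x * h j x)).
  by apply: Rint_eq => x; rewrite expr2 mulr_suml; apply: eq_bigr => i _;
    rewrite mulr_sumr.
have hij i j : P i -> P j -> mint (fun x => h i x * h j x).
  by move=> Pi Pj; apply: L2M_int; exact: Lh.
rewrite Rint_sum; last by move=> i Pi; apply: mint_sum => j Pj; exact: hij.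
apply: eq_bigr => i Pi; rewrite Rint_sum; last by move=> j Pj; exact: hij.
rewrite (bigD1 i)//= big1 ?addr0; last first.
  by move=> j /andP[Pj ji]; rewrite orth// eq_sym.
by apply: Rint_eq => x; rewrite expr2.
Qed.

Lemma Cauchy_Schwarz f g : L2 f -> L2 g ->
  (\int[mu]_x (f x * g x)) ^+ 2 <= nrm f * nrm g.
Proof.
move=> Lf Lg; set a := \int[mu]_x _.
have H (c : R) : 0 <= nrm f + 2 * c * a + c ^+ 2 * nrm g.
  have := nrm_ge0 (fun x => f x + c * g x).
  rewrite nrmD//; last exact: L2Z.
  rewrite nrmZ//.
  have -> : \int[mu]_x (f x * (c * g x)) = c * a.
    by rewrite -RintZ; [apply: Rint_eq => x; rewrite mulrCA|exact: L2M_int].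
  by move=> h; rewrite (le_trans h)//; rewrite le_eqVlt; apply/orP; left; apply/eqP; ring.
have := nrm_ge0 g; rewrite le_eqVlt => /orP[/eqP g0|g0].
  rewrite -g0 mulr0; suff -> : a = 0 by rewrite expr0n.
  (* With [nrm g = 0] the quadratic in c is affine; this c would give it the value -1. *)
  apply/eqP/negPn/negP => a0; have := H (- (nrm f + 1) / (2 * a)).
  rewrite -g0 mulr0 addr0.
  have -> : 2 * (- (nrm f + 1) / (2 * a)) * a = - (nrm f + 1) by field.
  by rewrite opprD addrA subrr add0r oppr_ge0 ler10.
(* The minimiser of the quadratic in c. *)
have := H (- a / nrm g).
have -> : nrm f + 2 * (- a / nrm g) * a + (- a / nrm g) ^+ 2 * nrm g =
   (nrm f * nrm g - a ^+ 2) / nrm g by field; rewrite gt_eqF.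
by rewrite pmulr_lge0 ?invr_gt0// subr_ge0.
Qed.

End L2.

(** * Mean-square convergence and completeness of L_2 *)

Section L2_convergence.
Context d (T : measurableType d) (R : realType).
Variable mu : {measure set T -> \bar R}.
Implicit Types f g h : T -> R.
Local Notation mint f := (mu.-integrable setT (EFin \o f)).
Local Notation L2 f := (square_integrable mu setT f).
Local Notation nrm := (nrm mu).

Definition cvg2 (X : nat -> T -> R) (Y : T -> R) :=
  forall e : R, 0 < e -> exists n0 : nat, forall n, (n0 <= n)%N ->
    nrm (fun x => X n x - Y x) < e.

Definition cauchy2 (X : nat -> T -> R) :=
  forall e : R, 0 < e -> exists n0 : nat, forall m n, (n0 <= m)%N -> (n0 <= n)%N ->
    nrm (fun x => X m x - X n x) < e.

(** By monotone convergence the series of the [Z n] has a finite integral, so it is finite almost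
    everywhere, and it dominates each of its terms. *)
Lemma ae_lt_pinfty_series (Z : nat -> T -> R) (b : nat -> R) :
  (forall n, measurable_fun setT (Z n)) -> (forall n x, 0 <= Z n x) ->
  (forall n, (\int[mu]_x (Z n x)%:E <= (b n)%:E)%E) ->
  (\sum_(n <oo) (b n)%:E < +oo)%E ->
  {ae mu, forall x, exists B : R, forall n, Z n x <= B}.
Proof.
move=> mZ Z0 Zb bfin.
have mS : measurable_fun setT (fun x => \sum_(n <oo) (Z n x)%:E)%E.
  apply: ge0_emeasurable_sum => //; first by move=> n x _ _; rewrite lee_fin.
  by move=> n _; exact/measurable_EFinP.
have fin : (\int[mu]_x (\sum_(n <oo) (Z n x)%:E) < +oo)%E.
  rewrite integral_nneseries//; [|by move=> n; exact/measurable_EFinP|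
    by move=> n x _; rewrite lee_fin].
  apply: le_lt_trans bfin; apply: lee_nneseries => // n _ _.
  by apply: integral_ge0 => x _; rewrite lee_fin.
have S0 x : (0 <= \sum_(n <oo) (Z n x)%:E)%E.
  by apply: nneseries_ge0 => n _ _; rewrite lee_fin.
have iS : mu.-integrable setT (fun x => \sum_(n <oo) (Z n x)%:E)%E.
  apply/integrableP; split=> //.
  by under eq_integral do rewrite gee0_abs//.
have := integrable_ae measurableT iS.
apply: filterS => x /(_ I) fx.
exists (fine (\sum_(n <oo) (Z n x)%:E))%E => n.
rewrite -lee_fin fineK//.
have /= := @nneseries_split _ (fun n => (Z n x)%:E) 0 n.+1.
rewrite add0n => ->; last by move=> k _; rewrite lee_fin.
rewrite big_nat_recr//= -addeA addeC -addeA leeDl// adde_ge0//.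
  by apply: nneseries_ge0 => k _ _; rewrite lee_fin.
by apply: sume_ge0 => k _; rewrite lee_fin.
Qed.

(** The weights 4^n leave integrals of order 2^-n, which are summable, and a bound on 4^n (D n)^2 is
    a bound on 2^n |D n|. The factor 1/2 adapts the majorant to the geometric series of sum 1. *)
Lemma ae_geometric_bound (D : nat -> T -> R) : (forall n, L2 (D n)) ->
  (forall n, nrm (D n) <= 8^-1 ^+ n) ->
  {ae mu, forall x, exists B : R, forall n, `|D n x| <= B * 2^-1 ^+ n}.
Proof.
move=> LD nD.
have H4 n : 2^-1 * 4 ^+ n * 8^-1 ^+ n = 1 / (2 ^ (n + 1))%:R :> R.
  rewrite -mulrA -exprMn natrX addn1 exprS div1r invfM -exprVn; congr (_ * _ ^+ _); lra.
have : {ae mu, forall x, exists B : R, forall n, 2^-1 * 4 ^+ n * D n x ^+ 2 <= B}.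
  apply: (@ae_lt_pinfty_series (fun n x => 2^-1 * 4 ^+ n * D n x ^+ 2)
    (fun n => 1 / (2 ^ (n + 1))%:R)).
  - move=> n; apply: measurable_funM; first exact: measurable_cst.
    by apply: measurable_funX; exact: L2_meas (LD n).
  - by move=> n x; rewrite mulr_ge0 ?sqr_ge0// mulr_ge0 ?exprn_ge0 ?invr_ge0.
  - move=> n; have /L2_sqr Di := LD n.
    under eq_integral do rewrite EFinM.
    rewrite ge0_integralZl//.
    + rewrite -nrmE// -EFinM lee_fin -H4 ler_wpM2l//.
    + exact: measurable_int Di.
    + by move=> x _; rewrite lee_fin sqr_ge0.
  - have := @cvg_geometric_eseries_half R 1 0.
    by move=> /cvg_lim; rewrite /eseries => -> //; rewrite ltry.
apply: filterS => x -[B HB].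
(* From a^2 <= 2 B with a = 2^n |D n x| follows a <= 2 B + 1, without square roots. *)
exists (2 * B + 1) => n.
have B0 : 0 <= B.
  by apply: le_trans (HB 0%N); rewrite mulr_ge0 ?sqr_ge0// mulr_ge0 ?exprn_ge0 ?invr_ge0.
have := HB n; rewrite -(real_normK (num_real (D n x))).
have -> : 4 ^+ n = 2 ^+ n ^+ 2 :> R by rewrite exprAC; congr (_ ^+ n); rewrite expr2; lra.
rewrite -mulrA -exprMn => h; rewrite exprVn ler_pdivlMr ?exprn_gt0// mulrC.
move: h; set a := 2 ^+ n * _ => h; rewrite leNgt; apply/negP => aB; nra.
Qed.

Lemma geometric_cvg (u : nat -> R) l B : (forall n, `|u n - l| <= B * 2^-1 ^+ n) ->
  u n @[n --> \oo] --> l.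
Proof.
move=> H; apply/subr_cvg0; apply/norm_cvg0P.
apply: (@squeeze_cvgr _ _ _ _ (fun=> 0) (fun n => B * 2^-1 ^+ n)).
- by apply: nearW => n; rewrite normr_ge0 H.
- exact: cvg_cst.
- rewrite -(mulr0 B); apply: cvgMr; apply: cvg_expr.
  by rewrite ger0_norm ?invr_ge0// invf_lt1// ltr1n.
Qed.

Lemma geometric_is_cvg (u : nat -> R) B :
  (forall n, `|u n.+1 - u n| <= B * 2^-1 ^+ n) -> cvgn u.
Proof.
move=> H.
have : cvgn (series (fun n => `|u n.+1 - u n|)).
  apply: (@series_le_cvg _ _ (geometric B 2^-1)).
  - by move=> n.
  - by move=> n; rewrite (le_trans _ (H n)).
  - by move=> n; exact: H.
  - by apply: is_cvg_geometric_series; rewrite ger0_norm ?invr_ge0// invf_lt1// ltr1n.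
move=> /normed_cvg.
have -> : series (fun n => u n.+1 - u n) = (fun n => u n - u 0%N).
  by apply/funext => n; rewrite /series/= telescope_sumr.
move=> /(is_cvgD (is_cvg_cst (u 0%N))).
by rewrite (_ : _ + _ = u)//; apply/funext => n /=; rewrite addrC subrK.
Qed.

(** Along indices where the squared distance is below 8^-n the differences are geometrically small
    almost everywhere. *)
Lemma cvg2_ae_subseq X Y : (forall n, L2 (X n)) -> L2 Y -> cvg2 X Y ->
  exists k : nat -> nat, (forall n, (n <= k n)%N) /\
    {ae mu, forall x, X (k n) x @[n --> \oo] --> Y x}.
Proof.
move=> LX LY XY.
have P8 n : (0 : R) < 8^-1 ^+ n by rewrite exprn_gt0// invr_gt0.
have [k0 Hk0] := choice (fun n => XY _ (P8 n)).
exists (fun n => maxn n (k0 n)); split; first by move=> n; exact: leq_maxl.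
apply: filterS (@ae_geometric_bound (fun n x => X (maxn n (k0 n)) x - Y x) _ _).
- by move=> x -[B]; exact: geometric_cvg.
- by move=> n; apply: L2B.
- by move=> n; apply/ltW/Hk0; exact: leq_maxr.
Qed.

(** Fatou's lemma for almost everywhere convergence and a bound that holds only from some index on:
    the lower limit is that of the sequence shifted by n0, and it is replaced by f off a null
    set. *)
Lemma fatou_ae (f_ : nat -> T -> R) f (c : R) :
  (forall n, measurable_fun setT (f_ n)) -> measurable_fun setT f ->
  (forall n x, 0 <= f_ n x) -> (forall x, 0 <= f x) ->
  {ae mu, forall x, f_ n x @[n --> \oo] --> f x} ->
  (exists n0, forall n, (n0 <= n)%N -> (\int[mu]_x (f_ n x)%:E <= c%:E)%E) ->
  (\int[mu]_x (f x)%:E <= c%:E)%E.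
Proof.
move=> mf_ mf f_0 f0 fae [n0 Hc].
have mE n : measurable_fun setT (fun x => (f_ (n + n0)%N x)%:E) by exact/measurable_EFinP.
have := @fatou _ _ _ mu setT measurableT (fun n x => (f_ (n + n0)%N x)%:E) mE
  (fun n x _ => f_0 (n + n0)%N x).
move=> /[dup] F.
have -> : (\int[mu]_x limn_einf (fun n => (f_ (n + n0)%N x)%:E) = \int[mu]_x (f x)%:E)%E.
  apply: ge0_ae_eq_integral => //.
  - by apply: measurableT_comp => //; apply: measurable_fun_limn_esup => // n; exact: measurableT_comp (mE n).
  - exact/measurable_EFinP.
  - move=> x _; rewrite limn_einf_lim; apply: lime_ge; first exact: is_cvg_einfs.
    by apply: nearW => n; apply: le_ereal_inf_tmp => _ [k _ <-]; rewrite lee_fin.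
  - by move=> x _; rewrite lee_fin.
  - move: fae; apply: filterS => x fx _.
    apply: (cvg_limn_einf_sup _).1.
    by apply: cvg_EFin; [exact: nearW|rewrite (cvg_shiftn n0 (fun n => f_ n x))].
move=> h; apply: le_trans h _.
rewrite limn_einf_lim; apply: lime_le.
  exact: is_cvg_einfs.
apply: nearW => n.
apply: le_trans (Hc (n + n0)%N (leq_addl _ _)).
by apply: ereal_inf_lbound; exists n => /=.
Qed.

(** Riesz-Fischer: a fast subsequence converges almost everywhere, and Fatou's lemma applied to the
    squares of [X m - X (K n)] gives the mean-square convergence of the whole sequence. *)
Lemma cauchy2_cvg X : (forall n, L2 (X n)) -> cauchy2 X ->
  exists2 Y, L2 Y & cvg2 X Y.
Proof.
move=> LX CX.
have P8 n : (0 : R) < 8^-1 ^+ n by rewrite exprn_gt0// invr_gt0.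
have [k0 Hk0] := choice (fun n => CX _ (P8 n)).
(* The running maximum places both [K n] and [K n.+1] beyond [k0 n], so consecutive differences are
   below 8^-n. *)
pose K n := (\max_(i < n.+1) maxn i (k0 i))%N.
have K0 n i : (i <= n)%N -> (k0 i <= K n)%N.
  move=> ni; apply: leq_trans (leq_maxr i _) _.
  by have := @leq_bigmax _ (fun i : 'I_n.+1 => maxn i (k0 i)) (Ordinal (ni : (i < n.+1)%N)).
have K1 n : (n <= K n)%N.
  apply: leq_trans (leq_maxl n (k0 n)) _.
  by have := @leq_bigmax _ (fun i : 'I_n.+1 => maxn i (k0 i)) ord_max.
(* The lower limit exists at every point and is measurable, so no null set has to be removed. *)
pose Y x := fine (limn_einf (fun n => (X (K n) x)%:E)).
have mX n : measurable_fun setT (X n) by exact: L2_meas.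
have mY : measurable_fun setT Y.
  apply: measurableT_comp => //; apply: measurableT_comp => //.
  apply: measurable_fun_limn_esup => // n; apply: measurableT_comp => //.
  exact/measurable_EFinP.
have aeY : {ae mu, forall x, X (K n) x @[n --> \oo] --> Y x}.
  apply: filterS (@ae_geometric_bound (fun n x => X (K n.+1) x - X (K n) x) _ _).
  - move=> x -[B HB]; have /cvg_ex[l ul] := @geometric_is_cvg (fun n => X (K n) x) B HB.
    rewrite /Y (_ : limn_einf _ = l%:E)//.
    by apply: (cvg_limn_einf_sup _).1; apply: cvg_EFin; [exact: nearW|].
  - by move=> n; apply: L2B.
  - by move=> n; apply/ltW/Hk0; apply: K0.
have key (e : R) : 0 < e -> exists n0, forall m, (n0 <= m)%N ->
    (\int[mu]_x ((X m x - Y x) ^+ 2)%:E <= e%:E)%E.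
  move=> e0; have [n0 Hn0] := CX e e0; exists n0 => m mn0.
  apply: (@fatou_ae (fun n x => (X m x - X (K n) x) ^+ 2)).
  - by move=> n; apply: measurable_funX; apply: measurable_funB.
  - by apply: measurable_funX; apply: measurable_funB.
  - by move=> n x; exact: sqr_ge0.
  - by move=> x; exact: sqr_ge0.
  - apply: filterS aeY => x Xx; rewrite expr2.
    under eq_fun do rewrite expr2.
    by apply: cvgM; apply: cvgB => //; exact: cvg_cst.
  - exists n0 => n n0n; rewrite -nrmE; last exact: L2B.
    by rewrite lee_fin; apply/ltW/Hn0 => //; exact: leq_trans n0n (K1 n).
have LB m e : (\int[mu]_x ((X m x - Y x) ^+ 2)%:E <= e%:E)%E -> L2 (fun x => X m x - Y x).
  move=> h; split; first exact: measurable_funB.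
  by rewrite (le_lt_trans h)// ltry.
exists Y.
  have [n0 Hn0] := key 1 ltr01.
  have /LB := Hn0 n0 (leqnn _) => h.
  by apply: (L2_eq _ (L2B (LX n0) h)) => x; rewrite opprB addrC subrK.
move=> e e0; have [n0 Hn0] := key (e / 2) (divr_gt0 e0 (ltr0n _ 2)).
exists n0 => n nn0; have h := Hn0 _ nn0.
have := h; rewrite -nrmE; last exact: LB h.
by rewrite lee_fin => /le_lt_trans; apply; rewrite ltr_pdivrMr// ltr_pMr// ltr1n.
Qed.

Lemma cvg2_cauchy X Y : (forall n, L2 (X n)) -> L2 Y -> cvg2 X Y -> cauchy2 X.
Proof.
move=> LX LY XY e e0; have [n0 Hn0] := XY (e / 4) (divr_gt0 e0 (ltr0n _ 4)).
exists n0 => m n mn0 nn0.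
apply: (@le_lt_trans _ _ (nrm (fun x => (X m x - Y x) - (X n x - Y x)))).
  by rewrite le_eqVlt; apply/orP; left; apply/eqP/nrm_eq => x; ring.
apply: le_lt_trans (nrmB2 (L2B (LX m) LY) (L2B (LX n) LY)) _.
by have := Hn0 m mn0; have := Hn0 n nn0; lra.
Qed.

Lemma cvg2D X Y Z W : (forall n, L2 (X n)) -> L2 Y -> (forall n, L2 (Z n)) -> L2 W ->
  cvg2 X Y -> cvg2 Z W -> cvg2 (fun n x => X n x + Z n x) (fun x => Y x + W x).
Proof.
move=> LX LY LZ LW XY ZW e e0.
have [n0 Hn0] := XY (e / 4) (divr_gt0 e0 (ltr0n _ 4)).
have [n1 Hn1] := ZW (e / 4) (divr_gt0 e0 (ltr0n _ 4)).
exists (maxn n0 n1) => n; rewrite geq_max => /andP[/Hn0 h0 /Hn1 h1].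
apply: (@le_lt_trans _ _ (nrm (fun x => (X n x - Y x) + (Z n x - W x)))).
  by rewrite le_eqVlt; apply/orP; left; apply/eqP/nrm_eq => x; ring.
apply: le_lt_trans (nrmD2 (L2B (LX n) LY) (L2B (LZ n) LW)) _.
lra.
Qed.

Lemma cvg2Z (c : R) X Y : (forall n, L2 (X n)) -> L2 Y ->
  cvg2 X Y -> cvg2 (fun n x => c * X n x) (fun x => c * Y x).
Proof.
move=> LX LY XY e e0.
have c0 : 0 < c ^+ 2 + 1 by rewrite ltr_wpDl// sqr_ge0.
have [n0 Hn0] := XY (e / (c ^+ 2 + 1)) (divr_gt0 e0 c0).
exists n0 => n /Hn0; rewrite ltr_pdivlMr// => h.
rewrite (_ : (fun x => _) = (fun x => c * (X n x - Y x))); last first.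
  by apply/funext => x; rewrite mulrBr.
rewrite nrmZ; last exact: L2B.
by have := nrm_ge0 mu (fun x => X n x - Y x); nra.
Qed.

Lemma cvg2_cst Y : cvg2 (fun=> Y) Y.
Proof.
move=> e e0; exists 0%N => n _.
by rewrite (_ : (fun x => _) = fun=> 0) ?nrm0//; apply/funext => x; rewrite subrr.
Qed.

Lemma cvg2_sum (I : Type) (s : seq I) (X : I -> nat -> T -> R) Y :
  (forall i n, L2 (X i n)) -> (forall i, L2 (Y i)) ->
  (forall i, cvg2 (X i) (Y i)) ->
  cvg2 (fun n x => \sum_(i <- s) X i n x) (fun x => \sum_(i <- s) Y i x).
Proof.
move=> LX LY XY; elim: s => [|a s ih].
  rewrite (_ : (fun n x => _) = fun=> fun=> 0); last first.
    by apply/funext => n; apply/funext => x; rewrite big_nil.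
  rewrite (_ : (fun x => \sum_(i <- [::]) _) = fun=> 0); first exact: cvg2_cst.
  by apply/funext => x; rewrite big_nil.
rewrite (_ : (fun n x => _) = (fun n x => X a n x + \sum_(i <- s) X i n x)); last first.
  by apply/funext => n; apply/funext => x; rewrite big_cons.
rewrite (_ : (fun x => \sum_(i <- _ :: _) _) = (fun x => Y a x + \sum_(i <- s) Y i x)).
  by apply: cvg2D => //; [move=> n; apply: L2_sum|apply: L2_sum].
by apply/funext => x; rewrite big_cons.
Qed.

(** The factor 2 in place of 1 comes from [nrmB2]; the size of the constant does not matter in the
    applications. *)
Lemma cvg2_nrm_le X Y (c : R) : (forall n, L2 (X n)) -> L2 Y -> cvg2 X Y ->
  (forall n, nrm (X n) <= c) -> nrm Y <= 2 * c.
Proof.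
move=> LX LY XY Xc; apply/ler_addgt0Pr => e e0.
have [n0 Hn0] := XY (e / 2) (divr_gt0 e0 (ltr0n _ 2)).
have := Hn0 n0 (leqnn _); have := Xc n0.
have := nrmB2 (LX n0) (L2B (LX n0) LY).
rewrite (_ : (fun x => _) = Y); last by apply/funext => x; ring.
lra.
Qed.

Lemma cvg2P X Y : cvg2 X Y <-> nrm (fun x => X n x - Y x) @[n --> \oo] --> 0.
Proof.
split=> [XY|/cvgrPdist_lt XY].
  apply/cvgrPdist_lt => e /XY[n0 Hn0]; near=> n.
  rewrite sub0r normrN ger0_norm ?nrm_ge0//; apply: Hn0.
  by near: n; exact: nbhs_infty_ge.
move=> e /XY[n0 _ Hn0]; exists n0 => n /= nn0; have := Hn0 _ nn0.
by rewrite /= sub0r normrN ger0_norm ?nrm_ge0.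
Unshelve. all: by end_near. Qed.

Lemma Cauchy_Schwarz_sqrt f g : L2 f -> L2 g ->
  `|\int[mu]_x (f x * g x)| <= Num.sqrt (nrm f) * Num.sqrt (nrm g).
Proof.
move=> Lf Lg; rewrite -sqrtrM ?nrm_ge0// -sqrtr_sqr ler_sqrt ?mulr_ge0 ?nrm_ge0//.
exact: Cauchy_Schwarz.
Qed.

(** X Z - Y W = (X - Y) W + X (Z - W), and Cauchy-Schwarz applies to each term; the norm of [X n] is
    bounded through that of Y. *)
Lemma cvg2_Rint_mul X Y Z W : (forall n, L2 (X n)) -> L2 Y ->
  (forall n, L2 (Z n)) -> L2 W -> cvg2 X Y -> cvg2 Z W ->
  \int[mu]_x (X n x * Z n x) @[n --> \oo] --> \int[mu]_x (Y x * W x).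
Proof.
move=> LX LY LZ LW /cvg2P XY /cvg2P ZW.
pose a n := nrm (fun x => X n x - Y x); pose b n := nrm (fun x => Z n x - W x).
have sq (u : nat -> R) (l : R) : u n @[n --> \oo] --> l -> Num.sqrt (u n) @[n --> \oo] --> Num.sqrt l.
  by move=> ul; apply: continuous_cvg => //; exact: sqrt_continuous.
apply/subr_cvg0/norm_cvg0P.
apply: (@squeeze_cvgr _ _ _ _ (fun=> 0) (fun n => Num.sqrt (a n) * Num.sqrt (nrm W) +
   Num.sqrt (2 * a n + 2 * nrm Y) * Num.sqrt (b n))).
- apply: nearW => n; rewrite normr_ge0/=.
  have -> : \int[mu]_x (X n x * Z n x) - \int[mu]_x (Y x * W x) =
    \int[mu]_x ((X n x - Y x) * W x) + \int[mu]_x (X n x * (Z n x - W x)).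
    rewrite -RintB; [|exact: L2M_int|exact: L2M_int].
    rewrite -RintD; [|by apply: L2M_int => //; exact: L2B|by apply: L2M_int => //; exact: L2B].
    by apply: Rint_eq => x; ring.
  apply: le_trans (ler_normD _ _) _; apply: lerD.
    by apply: Cauchy_Schwarz_sqrt => //; exact: L2B.
  apply: le_trans (Cauchy_Schwarz_sqrt (LX n) (L2B (LZ n) LW)) _.
  rewrite ler_wpM2r ?sqrtr_ge0// ler_sqrt; last first.
    by rewrite addr_ge0// mulr_ge0// nrm_ge0.
  have := nrmD2 (L2B (LX n) LY) LY.
  by rewrite (_ : (fun x => _) = X n); last by apply/funext => x; ring.
- exact: cvg_cst.
- rewrite (_ : 0 = Num.sqrt 0 * Num.sqrt (nrm W) + Num.sqrt (2 * 0 + 2 * nrm Y) * Num.sqrt 0); last first.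
    by rewrite sqrtr0 mul0r mulr0 addr0.
  apply: cvgD; first by apply: cvgMl; exact: sq.
  apply: cvgM; last exact: sq.
  by apply: sq; apply: cvgD; [apply: cvgMr; exact: XY|exact: cvg_cst].
Qed.

End L2_convergence.

(** * Sequences with bounded moments of all orders *)

Section bounded_moments.
Context d (T : measurableType d) (R : realType) (P : probability T R).
Local Notation mint f := (P.-integrable setT (EFin \o f)).
Local Notation L2 f := (square_integrable P setT f).

(** Even powers keep the moments free of absolute values. A bound uniform in n for every order makes
    the class closed under products, and lets mean-square limits be multiplied. *)
Definition bounded_moments (X : nat -> T -> R) :=
  (forall n, measurable_fun setT (X n)) /\
  forall q : nat, exists B : R, forall n, mint (fun x => X n x ^+ (2 * q)) /\
    \int[P]_x (X n x ^+ (2 * q)) <= B.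

Lemma even_pow_ge0 (a : R) q : 0 <= a ^+ (2 * q).
Proof. by rewrite exprM exprn_ge0// sqr_ge0. Qed.

Lemma even_powN (a : R) q : (- a) ^+ (2 * q) = a ^+ (2 * q).
Proof. by rewrite exprM sqrrN -exprM. Qed.

Lemma bounded_moments_L2 X n : bounded_moments X -> L2 (X n).
Proof. by move=> [mX /(_ 1%N)[B /(_ n)[h _]]]; apply/L2P. Qed.

Lemma even_powD_le (a b : R) q :
  (a + b) ^+ (2 * q) <= 2 ^+ (2 * q) * (a ^+ (2 * q) + b ^+ (2 * q)).
Proof.
have H (x y : R) : `|x| <= `|y| -> (x + y) ^+ (2 * q) <= 2 ^+ (2 * q) * y ^+ (2 * q).
  move=> xy; rewrite -exprMn !(exprM _ 2).
  rewrite lerXn2r ?nnegrE ?sqr_ge0// -(real_normK (num_real (x + y))).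
  rewrite -[leRHS](real_normK (num_real (2 * y))) lerXn2r ?nnegrE//.
  apply: (le_trans (ler_normD _ _)); rewrite normrM (ger0_norm (ler0n _ 2)); lra.
have p0 : 0 <= 2 ^+ (2 * q) :> R by rewrite exprn_ge0.
rewrite mulrDr; have [ab|/ltW ba] := leP `|a| `|b|.
  by apply: le_trans (H _ _ ab) _; rewrite lerDr mulr_ge0// even_pow_ge0.
by rewrite addrC; apply: le_trans (H _ _ ba) _; rewrite lerDl mulr_ge0// even_pow_ge0.
Qed.

Lemma bounded_momentsD X Y : bounded_moments X -> bounded_moments Y ->
  bounded_moments (fun n x => X n x + Y n x).
Proof.
move=> [mX bX] [mY bY]; split; first by move=> n; exact: measurable_funD.
move=> q; have [B1 H1] := bX q; have [B2 H2] := bY q.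
exists (2 ^+ (2 * q) * (B1 + B2)) => n; have [i1 l1] := H1 n; have [i2 l2] := H2 n.
have i12 := mintZ (2 ^+ (2 * q)) (mintD i1 i2).
have i3 : mint (fun x => (X n x + Y n x) ^+ (2 * q)).
  apply: mint_le i12 _; first by apply: measurable_funX; exact: measurable_funD.
  by move=> x; rewrite ger0_norm ?even_pow_ge0// even_powD_le.
split=> //; apply: le_trans (Rint_le i3 i12 _) _; first by move=> x; exact: even_powD_le.
rewrite RintZ; last exact: mintD.
by rewrite RintD// ler_wpM2l ?exprn_ge0// lerD.
Qed.

Lemma bounded_momentsN X : bounded_moments X -> bounded_moments (fun n x => - X n x).
Proof.
move=> [mX bX]; split; first by move=> n; exact: measurable_funN.
by move=> q; have [B H] := bX q; exists B => n; have [h1 h2] := H n; split;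
  [apply: mint_eq h1 => x|apply: le_trans h2; rewrite le_eqVlt; apply/orP; left; apply/eqP; apply: Rint_eq => x];
  rewrite even_powN.
Qed.

Lemma bounded_momentsM X Y : bounded_moments X -> bounded_moments Y ->
  bounded_moments (fun n x => X n x * Y n x).
Proof.
move=> [mX bX] [mY bY]; split; first by move=> n; exact: measurable_funM.
move=> q; have [B1 H1] := bX (2 * q)%N; have [B2 H2] := bY (2 * q)%N.
exists (B1 + B2) => n; have [i1 l1] := H1 n; have [i2 l2] := H2 n.
have le12 x : (X n x * Y n x) ^+ (2 * q) <= X n x ^+ (2 * (2 * q)) + Y n x ^+ (2 * (2 * q)).
  rewrite exprMn (mulnC 2 (2 * q)%N) !(exprM _ (2 * q)%N 2).
  by set a := X n x ^+ _; set b := Y n x ^+ _; nra.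
have i3 : mint (fun x => (X n x * Y n x) ^+ (2 * q)).
  apply: mint_le (mintD i1 i2) _; first by apply: measurable_funX; exact: measurable_funM.
  by move=> x; rewrite ger0_norm ?even_pow_ge0// le12.
split=> //; apply: le_trans (Rint_le i3 (mintD i1 i2) le12) _.
by rewrite RintD// lerD.
Qed.

Lemma bounded_moments_cst c : bounded_moments (fun _ _ => c).
Proof.
split=> [n|q]; first exact: measurable_cst.
exists (c ^+ (2 * q)) => n; split; first exact: finite_measure_integrable_cst.
rewrite Rintegral_cst//=.
by have := probability_setT P; rewrite /= => ->; rewrite mulr1.
Qed.

(** An almost everywhere convergent subsequence and Fatou's lemma pass the moment bounds to the
    limit. *)
Lemma bounded_moments_lim X Y : bounded_moments X -> L2 Y -> cvg2 P X Y ->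
  bounded_moments (fun=> Y).
Proof.
move=> /[dup] bX [mX HX] LY XY; have mY := L2_meas LY.
split=> // q; have [B HB] := HX q; exists B.
suff h : (\int[P]_x (Y x ^+ (2 * q))%:E <= B%:E)%E.
  have i : mint (fun x => Y x ^+ (2 * q)).
    apply/integrableP; split; first by apply/measurable_EFinP/measurable_funX.
    under eq_integral do rewrite /= ger0_norm ?even_pow_ge0//.
    by rewrite (le_lt_trans h)// ltry.
  move=> _; split=> //; rewrite -lee_fin /Rintegral fineK//.
  exact: integrable_fin_num i.
have [k [kn kY]] := cvg2_ae_subseq (fun n => bounded_moments_L2 n bX) LY XY.
apply: (@fatou_ae _ _ _ P (fun n x => X (k n) x ^+ (2 * q))).
- by move=> n; exact: measurable_funX.
- exact: measurable_funX.
- by move=> n x; exact: even_pow_ge0.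
- by move=> x; exact: even_pow_ge0.
- apply: filterS kY => x h; elim: (2 * q)%N => [|m ih]; first exact: cvg_cst.
  by under eq_fun do rewrite exprS; rewrite exprS; exact: cvgM.
- exists 0%N => n _; have [i l] := HB (k n).
  by rewrite -lee_fin /Rintegral fineK// in l; exact: integrable_fin_num i.
Qed.

(** Mean-square convergence alone does not pass to products. The squared norm of (U - V) V' is the
    inner product of U - V with (U - V) V'^2; Cauchy-Schwarz leaves the vanishing norm of U - V
    times a norm that the higher moments keep bounded. *)
Lemma cvg2_bounded_momentsM X Y Z W :
  bounded_moments X -> bounded_moments Z -> L2 Y -> L2 W ->
  cvg2 P X Y -> cvg2 P Z W ->
  cvg2 P (fun n x => X n x * Z n x) (fun x => Y x * W x).
Proof.
move=> bX bZ LY LW XY ZW.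
have bY := bounded_moments_lim bX LY XY; have bW := bounded_moments_lim bZ LW ZW.
have key U V V' : bounded_moments U -> L2 V -> bounded_moments (fun=> V) ->
    cvg2 P U V -> bounded_moments V' ->
    nrm P (fun x => (U n x - V x) * V' n x) @[n --> \oo] --> 0.
  move=> bU LV bV UV bV'.
  have bD := bounded_momentsD bU (bounded_momentsN bV).
  have bDV := bounded_momentsM bD (bounded_momentsM bV' bV').
  have [B HB] := bDV.2 1%N.
  have /cvg2P nD := UV.
  have LD n := bounded_moments_L2 n bD.
  have LDV n := bounded_moments_L2 n bDV.
  have B0 : 0 <= B by apply: le_trans (HB 0%N).2; exact: nrm_ge0.
  apply: (@squeeze_cvgr _ _ _ _ (fun=> 0) (fun n => Num.sqrt (nrm P (fun x => U n x - V x)) * Num.sqrt B)).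
  + apply: nearW => n; rewrite nrm_ge0/=.
    have -> : nrm P (fun x => (U n x - V x) * V' n x) =
      \int[P]_x ((U n x - V x) * ((U n x - V x) * (V' n x * V' n x))).
      by apply: Rint_eq => x; ring.
    apply: le_trans (ler_norm _) _.
    apply: le_trans (Cauchy_Schwarz_sqrt (LD n) (LDV n)) _.
    by rewrite ler_wpM2l ?sqrtr_ge0// ler_sqrt//; exact: (HB n).2.
  + exact: cvg_cst.
  + rewrite -(mul0r (Num.sqrt B)); apply: cvgMl.
    rewrite -(@sqrtr0 R); apply: continuous_cvg => //; exact: sqrt_continuous.
have h1 := key _ _ _ bX LY bY XY bZ.
have h2 := key _ _ _ bZ LW bW ZW bY.
apply/cvg2P.
apply: (@squeeze_cvgr _ _ _ _ (fun=> 0) (fun n => 2 * nrm P (fun x => (X n x - Y x) * Z n x) +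
  2 * nrm P (fun x => (Z n x - W x) * Y x))).
- apply: nearW => n; rewrite nrm_ge0/=.
  rewrite (_ : (fun x => X n x * Z n x - _) =
    (fun x => (X n x - Y x) * Z n x + (Z n x - W x) * Y x)).
    apply: nrmD2.
      exact: bounded_moments_L2 n (bounded_momentsM (bounded_momentsD bX (bounded_momentsN bY)) bZ).
    exact: bounded_moments_L2 n (bounded_momentsM (bounded_momentsD bZ (bounded_momentsN bW)) bY).
  by apply/funext => x; ring.
- exact: cvg_cst.
- rewrite (_ : 0 = 2 * 0 + 2 * 0 :> R); last by rewrite mulr0 addr0.
  by apply: cvgD; apply: cvgMr.
Qed.

Lemma cvg2_bounded_moments_prod (I : Type) (s : seq I) (X : I -> nat -> T -> R) Y :
  (forall i, bounded_moments (X i)) -> (forall i, L2 (Y i)) ->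
  (forall i, cvg2 P (X i) (Y i)) ->
  [/\ bounded_moments (fun n x => \prod_(i <- s) X i n x),
     L2 (fun x => \prod_(i <- s) Y i x) &
     cvg2 P (fun n x => \prod_(i <- s) X i n x) (fun x => \prod_(i <- s) Y i x)].
Proof.
move=> bX LY XY; elim: s => [|a s [b L c]].
  rewrite (_ : (fun n x => _) = fun _ _ => 1); last first.
    by apply/funext => n; apply/funext => x; rewrite big_nil.
  rewrite (_ : (fun x => \prod_(i <- [::]) _) = fun=> 1).
    split; [exact: bounded_moments_cst| |exact: cvg2_cst].
    exact: bounded_moments_L2 0%N (bounded_moments_cst 1).
  by apply/funext => x; rewrite big_nil.
rewrite (_ : (fun n x => _) = (fun n x => X a n x * \prod_(i <- s) X i n x)); last first.
  by apply/funext => n; apply/funext => x; rewrite big_cons.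
rewrite (_ : (fun x => \prod_(i <- _ :: _) _) = (fun x => Y a x * \prod_(i <- s) Y i x)).
  split; first exact: bounded_momentsM.
  - apply: (@bounded_moments_L2 (fun=> (fun x => Y a x * \prod_(i <- s) Y i x)) 0%N).
    apply: bounded_momentsM; first exact: bounded_moments_lim (XY a).
    exact: bounded_moments_lim c.
  - exact: cvg2_bounded_momentsM.
by apply/funext => x; rewrite big_cons.
Qed.

End bounded_moments.

(** * Martingales and step processes *)

Section measurable_wrt.
Context d (Omega : measurableType d) (R : realType).
Variable G : set_system Omega.
Hypothesis sG : sigma_algebra setT G.
Implicit Types X Y : Omega -> R.

(** Since G is already a sigma-algebra, it coincides with the one it generates. The closure
    properties of measurable functions thus become available on the measurable space that G
    defines. *)
Lemma measurable_wrtE X : measurable_wrt G X <->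
  @measurable_fun _ _ (g_sigma_algebraType G) _ setT X.
Proof.
split=> [mX _ Y mY|mX Y mY].
  by rewrite setTI /measurable/= sigma_algebra_id//; exact: mX.
have := mX measurableT Y mY.
by rewrite setTI /measurable/= sigma_algebra_id.
Qed.

Lemma measurable_wrt_cst (c : R) : measurable_wrt G (cst c : Omega -> R).
Proof. by apply/measurable_wrtE; exact: measurable_cst. Qed.

Lemma measurable_wrtD X Y : measurable_wrt G X -> measurable_wrt G Y ->
  measurable_wrt G (fun w => X w + Y w).
Proof.
by move=> /measurable_wrtE mX /measurable_wrtE mY; apply/measurable_wrtE;
  exact: measurable_funD.
Qed.

Lemma measurable_wrtM X Y : measurable_wrt G X -> measurable_wrt G Y ->
  measurable_wrt G (fun w => X w * Y w).
Proof.
by move=> /measurable_wrtE mX /measurable_wrtE mY; apply/measurable_wrtE;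
  exact: measurable_funM.
Qed.

Lemma measurable_wrtB X Y : measurable_wrt G X -> measurable_wrt G Y ->
  measurable_wrt G (fun w => X w - Y w).
Proof.
by move=> /measurable_wrtE mX /measurable_wrtE mY; apply/measurable_wrtE;
  exact: measurable_funB.
Qed.

Lemma measurable_wrtX X n : measurable_wrt G X -> measurable_wrt G (fun w => X w ^+ n).
Proof.
by move=> /measurable_wrtE mX; apply/measurable_wrtE; exact: measurable_funX.
Qed.

Lemma measurable_wrt_max X (c : R) : measurable_wrt G X ->
  measurable_wrt G (fun w => Num.max (X w) c).
Proof.
move=> /measurable_wrtE mX; apply/measurable_wrtE.
by apply: measurable_maxr => //; exact: measurable_cst.
Qed.

Lemma measurable_wrt_sum (I : Type) (s : seq I) (Q : pred I) (X : I -> Omega -> R) :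
  (forall i, Q i -> measurable_wrt G (X i)) ->
  measurable_wrt G (fun w => \sum_(i <- s | Q i) X i w).
Proof.
move=> mX; elim: s => [|a s ih].
  rewrite (_ : (fun w => _) = cst 0); first exact: measurable_wrt_cst.
  by apply/funext => w; rewrite big_nil.
have [Qa|Qa] := boolP (Q a).
  rewrite (_ : (fun w => _) = (fun w => X a w + \sum_(i <- s | Q i) X i w)).
    by apply: measurable_wrtD => //; exact: mX.
  by apply/funext => w; rewrite big_cons Qa.
rewrite (_ : (fun w => _) = (fun w => \sum_(i <- s | Q i) X i w))//.
by apply/funext => w; rewrite big_cons (negbTE Qa).
Qed.

End measurable_wrt.

Section filtration.
Context (R : realType) d (Omega : measurableType d).
Variables (t T : R) (F : R -> set_system Omega).
Hypothesis filt : filtration F t T.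

Lemma filtration_sigma s : t <= s -> s <= T -> sigma_algebra setT (F s).
Proof. by move=> ts sT; case: filt => + _ _; apply; rewrite in_itv/= ts. Qed.

Lemma measurable_wrt_measurable s (X : Omega -> R) : t <= s -> s <= T ->
  measurable_wrt (F s) X -> measurable_fun setT X.
Proof.
move=> ts sT mX _ B mB; rewrite setTI.
by case: filt => _ + _; apply; [|exact: mX]; rewrite in_itv/= ts.
Qed.

Lemma measurable_wrt_mono u s (X : Omega -> R) : t <= u -> u <= s -> s <= T ->
  measurable_wrt (F u) X -> measurable_wrt (F s) X.
Proof. by move=> tu us sT mX B /mX; case: filt => _ _; apply. Qed.

End filtration.

(** * Orthogonality of martingale increments to the past *)

Section martingale_orthogonality.
Context (R : realType) d (Omega : measurableType d) (P : probability Omega R).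
Variables (t T : R) (F : R -> set_system Omega) (M : R -> Omega -> R).
Hypothesis filt : filtration F t T.
Hypothesis mart : martingale P F t T M.
Local Notation mint f := (P.-integrable setT (EFin \o f)).

Lemma martingale_adapted s : t <= s -> s <= T -> measurable_wrt (F s) (M s).
Proof. by move=> ts sT; case: mart => + _ _; apply; rewrite in_itv/= ts. Qed.

Lemma martingale_integrable s : t <= s -> s <= T -> mint (M s).
Proof. by move=> ts sT; case: mart => _ + _; apply; rewrite in_itv/= ts. Qed.

Lemma martingale_measurable s : t <= s -> s <= T -> measurable_fun setT (M s).
Proof.
move=> ts sT; apply: (measurable_wrt_measurable filt ts sT).
exact: martingale_adapted.
Qed.

Lemma integrable_indicM A (f : Omega -> R) : measurable A -> mint f ->
  mint (fun w => \1_A w * f w).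
Proof.
move=> mA fi; apply: (@mint_le _ _ _ P _ (fun w => `|f w|)).
- apply: measurable_funM; first exact: measurable_indic.
  by apply/measurable_EFinP; exact: measurable_int fi.
- exact: integrable_norm.
- move=> w; rewrite normrM ler_piMl//= indicE.
  by case: (w \in A) => /=; rewrite ?normr1 ?normr0.
Qed.

Lemma Rint_indicM A (f : Omega -> R) :
  \int[P]_w (\1_A w * f w) = \int[P]_(w in A) f w.
Proof.
rewrite [RHS]Rintegral_mkcond; apply: Rint_eq => w.
by rewrite indicE patchE; case: (w \in A); rewrite ?mul1r ?mul0r.
Qed.

Lemma martingale_indic u v A : t <= u -> u <= v -> v <= T -> F u A ->
  \int[P]_w (\1_A w * (M v w - M u w)) = 0.
Proof.
move=> tu uv vT FA.
have tv := le_trans tu uv; have uT := le_trans uv vT.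
have mA : measurable A by case: filt => _ + _; apply; [|exact: FA]; rewrite in_itv/= tu.
have [->|nuv] := eqVneq u v.
  rewrite (Rint_eq P (g := fun=> 0)) ?Rintegral_cst ?mul0r// => w.
  by rewrite subrr mulr0.
rewrite (Rint_eq P (g := fun w => \1_A w * M v w - \1_A w * M u w)); last first.
  by move=> w; rewrite mulrBr.
rewrite RintB; [|apply: integrable_indicM => //; exact: martingale_integrable..].
rewrite !Rint_indicM; apply/eqP; rewrite subr_eq0; apply/eqP.
have ltuv : u < v by rewrite lt_neqAle nuv.
by case: mart => _ _ /(_ u v tu ltuv vT A FA); rewrite /Rintegral => ->.
Qed.

(** The defining property of a martingale settles indicators of events of [F u]. Z is approached
    from below by simple functions on its level sets, and the integrable bound |Z (M v - M u)|
    allows the passage to the limit. *)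
Lemma martingale_orth_ge0 u v (Z : Omega -> R) : t <= u -> u <= v -> v <= T ->
  measurable_wrt (F u) Z -> (forall w, 0 <= Z w) ->
  mint (fun w => Z w * (M v w - M u w)) ->
  \int[P]_w (Z w * (M v w - M u w)) = 0.
Proof.
move=> tu uv vT mZ Z0 Zi.
have tv := le_trans tu uv; have uT := le_trans uv vT.
pose A n (j : nat) := Z @^-1` `[j%:R / n.+1%:R, j.+1%:R / n.+1%:R[%classic.
have FA n j : F u (A n j) by apply: mZ; exact: measurable_itv.
have mA n j : measurable (A n j).
  by case: filt => _ + _; apply; [|exact: FA]; rewrite in_itv/= tu.
have iA n j w : (w \in A n j) = (j == Num.truncn (n.+1%:R * Z w)).
  rewrite eq_sym truncn_eq ?mulr_ge0//; apply/idP/idP.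
    by rewrite inE /A/= in_itv/= ler_pdivrMr// ltr_pdivlMr// mulrC.
  by move=> h; rewrite inE /A/= in_itv/= ler_pdivrMr// ltr_pdivlMr// mulrC.
(* Levels of width 1/(n+1); (n+1)^2 of them cover [0, n+1[, and [Zn n] is 0 where Z >= n+1. *)
pose Zn (n : nat) w : R := \sum_(j < n.+1 * n.+1) (j%:R / n.+1%:R) * \1_(A n j) w.
have ZnE n w : Zn n w = if (Num.truncn (n.+1%:R * Z w)%R < n.+1 * n.+1)%N
    then (Num.truncn (n.+1%:R * Z w))%:R / n.+1%:R else 0.
  rewrite /Zn; case: ifPn => [lt|].
    rewrite (bigD1 (Ordinal lt))//= indicE iA eqxx mulr1 big1 ?addr0// => j ji.
    by rewrite indicE iA (negbTE (_ : _ != _)) ?mulr0.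
  rewrite -leqNgt => ge; apply: big1 => j _; rewrite indicE iA.
  by rewrite (ltn_eqF (leq_trans (ltn_ord j) ge)) mulr0.
have tr n w : (Num.truncn (n.+1%:R * Z w))%:R / n.+1%:R <= Z w <
    (Num.truncn (n.+1%:R * Z w))%:R / n.+1%:R + n.+1%:R^-1.
  have /andP[h1 h2] := truncn_itv (mulr_ge0 (ler0n R n.+1) (Z0 w)).
  rewrite ler_pdivrMr// (mulrC (Z w)) h1/= -[X in _ + X]mul1r -mulrDl ltr_pdivlMr//.
  by rewrite (mulrC (Z w)) natr1.
have Zn0 n w : 0 <= Zn n w by rewrite ZnE; case: ifP => // _; rewrite divr_ge0.
have ZnZ n w : Zn n w <= Z w by rewrite ZnE; case: ifP => // _; case/andP: (tr n w).
have mM := martingale_measurable.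
have mD : measurable_fun setT (fun w => M v w - M u w).
  by apply: measurable_funB; exact: mM.
have iD : mint (fun w => M v w - M u w) by apply: mintB; exact: martingale_integrable.
have Zn_int n : \int[P]_w (Zn n w * (M v w - M u w)) = 0.
  rewrite (Rint_eq P (g := fun w => \sum_(j < n.+1 * n.+1) (j%:R / n.+1%:R) * (\1_(A n j) w * (M v w - M u w)))).
    rewrite Rint_sum => [|j _]; last by apply: mintZ; exact: integrable_indicM.
    apply: big1 => j _; rewrite RintZ; last exact: integrable_indicM.
    by rewrite martingale_indic ?mulr0.
  by move=> w; rewrite /Zn mulr_suml; apply: eq_bigr => j _; rewrite mulrA.
have mZn n : measurable_fun setT (Zn n).
  apply: measurable_sum => j; apply: measurable_funM; first exact: measurable_cst.
  exact: measurable_indic.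
have Zncvg w : Zn n w @[n --> \oo] --> Z w.
  apply/cvgrPdist_lt => e e0.
  near=> n.
  have nZ : Z w < n.+1%:R.
    have /andP[_ h] := truncn_itv (Z0 w); apply: lt_le_trans h _.
    by rewrite ler_nat ltnS; near: n; exact: nbhs_infty_ge.
  rewrite ZnE ifT; last first.
    rewrite -(ltr_nat R); have /andP[h _] := truncn_itv (mulr_ge0 (ler0n R n.+1) (Z0 w)).
    by apply: le_lt_trans h _; rewrite natrM ltr_pM2l.
  have /andP[h1 h2] := tr n w.
  rewrite ger0_norm ?subr_ge0// ltrBlDl (lt_trans h2)// ltrD2l.
  near: n; exact: near_infty_natSinv_lt (PosNum e0).
have := @dominated_convergence _ _ _ P setT measurableT
  (fun n w => (Zn n w * (M v w - M u w))%:E) (fun w => (Z w * (M v w - M u w))%:E)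
  (fun w => `|Z w * (M v w - M u w)|%:E).
case.
- by move=> n; apply/measurable_EFinP; exact: measurable_funM.
- exact: measurable_int Zi.
- apply: aeW => w _; apply: cvg_EFin; first exact: nearW.
  by apply: cvgMl; exact: Zncvg.
- exact: integrable_norm Zi.
- apply: aeW => w n _; rewrite /= lee_fin !normrM ler_wpM2r// !ger0_norm//.
move=> _ _; rewrite (_ : [sequence _]_n = fun=> 0%E); last first.
  apply/funext => n /=; rewrite -[RHS]/(0%:E) -(Zn_int n) /Rintegral fineK//.
  apply: integrable_fin_num => //.
  apply: mint_le (integrable_norm Zi) _; first exact: measurable_funM.
  by move=> w; rewrite /= !normrM ler_wpM2r// !ger0_norm.
move=> /cvg_lim; rewrite lim_cst// => h.
by rewrite /Rintegral -h.
Unshelve. all: by end_near. Qed.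

Lemma martingale_orth u v (Z : Omega -> R) : t <= u -> u <= v -> v <= T ->
  measurable_wrt (F u) Z -> mint (fun w => Z w * (M v w - M u w)) ->
  \int[P]_w (Z w * (M v w - M u w)) = 0.
Proof.
move=> tu uv vT mZ Zi.
have tv := le_trans tu uv; have uT := le_trans uv vT.
have sF := filtration_sigma filt tu uT.
pose Zp w := Num.max (Z w) 0; pose Zm w := Num.max ((-1) * Z w) 0.
have mZp : measurable_wrt (F u) Zp by exact: measurable_wrt_max.
have mZm : measurable_wrt (F u) Zm.
  apply: measurable_wrt_max => //; apply: measurable_wrtM => //.
  exact: measurable_wrt_cst.
have mD : measurable_fun setT (fun w => M v w - M u w).
  by apply: measurable_funB; exact: martingale_measurable.
have leZ (W : Omega -> R) : measurable_wrt (F u) W -> (forall w, 0 <= W w <= `|Z w|) ->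
    mint (fun w => W w * (M v w - M u w)).
  move=> mW WZ; apply: mint_le (integrable_norm Zi) _.
    by apply: measurable_funM mD; exact: (measurable_wrt_measurable filt tu uT mW).
  move=> w; have /andP[W0 WleZ] := WZ w.
  by rewrite /= !normrM ler_wpM2r// ger0_norm.
have Zp0 w : 0 <= Zp w <= `|Z w|.
  by rewrite /Zp le_max lexx orbT ge_max ler_norm normr_ge0.
have Zm0 w : 0 <= Zm w <= `|Z w|.
  by rewrite /Zm le_max lexx orbT ge_max mulN1r -normrN ler_norm normr_ge0.
rewrite (Rint_eq P (g := fun w => Zp w * (M v w - M u w) - Zm w * (M v w - M u w))).
  rewrite RintB; [|exact: leZ..].
  rewrite !martingale_orth_ge0 ?subrr//; try exact: leZ.
  - by move=> w; case/andP: (Zm0 w).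
  - by move=> w; case/andP: (Zp0 w).
move=> w; rewrite -mulrBl; congr (_ * _); rewrite /Zp /Zm mulN1r.
case: (leP (Z w) 0) => h.
  by rewrite max_l ?oppr_ge0// sub0r opprK.
by rewrite max_r ?subr0// oppr_le0 ltW.
Qed.

End martingale_orthogonality.

(** * Partitions of an interval *)

Section partitions.
Context (R : realType).
Implicit Types (a b h x : R) (p : nat -> R).

Definition is_partition a b N p h :=
  [/\ p 0%N = a, p N = b, forall j, (j < N)%N -> p j < p j.+1 &
    forall j, (j < N)%N -> p j.+1 - p j <= h].

Lemma partition_le N p : (forall j, (j < N)%N -> p j < p j.+1) ->
  forall i j, (i <= j)%N -> (j <= N)%N -> p i <= p j.
Proof.
move=> pS i j ij jN; elim: j ij jN => [|j ih]; first by rewrite leqn0 => /eqP ->.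
rewrite leq_eqVlt => /orP[/eqP ->//|ij] jN.
by apply: le_trans (ltW (pS _ jN)); apply: ih => //; exact: ltnW.
Qed.

Lemma partition_cell N p : (forall j, (j < N)%N -> p j < p j.+1) ->
  forall x, p 0%N <= x -> x < p N -> exists2 j, (j < N)%N & p j <= x < p j.+1.
Proof.
move=> pS x x0 xN.
have ex : exists j, x < p j by exists N.
case: (ex_minnP ex) => -[|j] xj jmin; first by move: xj; rewrite ltNge x0.
exists j; first by exact: jmin _ xN.
rewrite xj andbT leNgt; apply/negP => /jmin; by rewrite ltnn.
Qed.

Lemma uniform_partition a b N : a < b -> (0 < N)%N ->
  is_partition a b N (fun j => a + j%:R * ((b - a) / N%:R)) ((b - a) / N%:R).
Proof.
move=> ab N0; have NR : N%:R != 0 :> R by rewrite pnatr_eq0 -lt0n.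
have E j : a + j.+1%:R * ((b - a) / N%:R) =
   a + j%:R * ((b - a) / N%:R) + (b - a) / N%:R.
  by rewrite -natr1 mulrDl mul1r addrA.
split; first by rewrite mul0r addr0.
- by rewrite mulrC divfK// addrC subrK.
- by move=> j _; rewrite E ltrDl divr_gt0 ?subr_gt0// ltr0n.
- by move=> j _; rewrite E addrAC subrr add0r.
Qed.

Lemma partition_insert a b N p h x : is_partition a b N p h -> a <= x <= b ->
  exists N' p', [/\ (N <= N' <= N.+1)%N, is_partition a b N' p' h,
    exists2 i, (i <= N')%N & p' i = x &
    forall i, (i <= N)%N -> exists2 i', (i' <= N')%N & p' i' = p i].
Proof.
move=> [p0 pN pS ph] /andP[ax xb].
have [[i iN pi]|nex] := pselect (exists2 i, (i <= N)%N & p i = x).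
  by exists N, p; split=> //; [rewrite leqnn leqnSn|exists i|move=> k kN; exists k].
have xN : x < p N.
  by rewrite lt_neqAle pN xb andbT; apply/eqP => xE; apply: nex; exists N; rewrite ?pN.
have [j jN /andP[pjx xpj]] := partition_cell pS (x := x) ltac:(by rewrite p0) xN.
have {}pjx : p j < x.
  rewrite lt_neqAle pjx andbT; apply/eqP => E; apply: nex; exists j => //; exact: ltnW.
pose p' k := if (k <= j)%N then p k else if k == j.+1 then x else p k.-1.
have p'1 k : (k <= j)%N -> p' k = p k by rewrite /p' => ->.
have p'2 : p' j.+1 = x by rewrite /p' ltnn eqxx.
have p'3 k : (j < k)%N -> p' k.+1 = p k.
  by move=> jk; rewrite /p' leqNgt (ltnW _)// eqSS gtn_eqF.
exists N.+1, p'; split; first by rewrite leqnSn leqnn.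
- split.
  + by rewrite p'1.
  + by rewrite p'3.
  + move=> k kN; case: (ltngtP k j) => [kj|jk|->].
    * by rewrite !p'1 ?(ltnW kj)//; apply: pS; exact: ltn_trans kj jN.
    * case: k jk kN => // k; rewrite ltnS leq_eqVlt => /orP[/eqP <-|jk] kN.
        by rewrite p'2 p'3.
      by rewrite !p'3 ?(leqW jk)//; exact: pS.
    * by rewrite p'1// p'2.
  + move=> k kN; case: (ltngtP k j) => [kj|jk|->].
    * by rewrite !p'1 ?(ltnW kj)//; apply: ph; exact: ltn_trans kj jN.
    * case: k jk kN => // k; rewrite ltnS leq_eqVlt => /orP[/eqP <-|jk] kN.
        by rewrite p'2 p'3//; apply: le_trans (ph j jN); rewrite lerD2l lerN2 ltW.
      by rewrite !p'3 ?(leqW jk)//; exact: ph.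
    * by rewrite p'2 p'1//; apply: le_trans (ph j jN); rewrite lerD2r ltW.
- by exists j.+1 => //; rewrite ltnS ltnW.
- move=> i iN; case: (leqP i j) => ij; first by exists i; rewrite ?p'1// ltnW.
  by exists i.+1 => //; rewrite p'3.
Qed.

(** Two insertions into the uniform partition with 3 n cells add at most two cells. The ranges [3 n,
    3 n + 3[ are disjoint for different n, so N determines n, and partitions built for different n
    never compete for the same number of cells. *)
Lemma partition_two_points a b n x y : a < b -> (0 < n)%N -> a <= x -> x < y -> y <= b ->
  exists N p, [/\ (3 * n <= N < 3 * n + 3)%N, is_partition a b N p ((b - a) / (3 * n)%:R) &
    exists i j, [/\ (i < j)%N, (j <= N)%N, p i = x & p j = y]].
Proof.
move=> ab n0 ax xy yb.
have n30 : (0 < 3 * n)%N by rewrite muln_gt0.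
have [N1 [p1 [/andP[h1 h1'] P1 [i1 i1N pi1] _]]] :=
  partition_insert (uniform_partition ab n30) (x := x)
   ltac:(by rewrite ax (ltW (lt_le_trans xy yb))).
have [N2 [p2 [/andP[h2 h2'] P2 [j2 j2N pj2] sub]]] :=
  partition_insert P1 (x := y) ltac:(by rewrite yb (le_trans ax (ltW xy))).
exists N2, p2; split=> //.
  by lia.
have [i2 i2N pi2] := sub _ i1N.
exists i2, j2; split=> //; last by rewrite pi2.
rewrite ltnNge; apply/negP => ji; have [_ _ pS _] := P2.
by have := partition_le pS ji i2N; rewrite pi2 pi1 pj2 leNgt xy.
Qed.

Lemma partition_sequence_mesh a b (tau : nat -> nat -> R) (K : R) :
  (forall N, (0 < N)%N -> is_partition a b N (tau N) (K / N%:R)) ->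
  partition_sequence a b tau.
Proof.
move=> H; split.
- by move=> N /H[].
- by move=> N j jN; have [] := H N (leq_ltn_trans (leq0n _) jN) => _ _ pS _; exact: pS.
- have K0 : 0 <= K.
    have [_ _ h1 h2] := H 1%N isT; have := h1 0%N isT; have := h2 0%N isT.
    by rewrite divr1 -subr_gt0 => h3 /ltW /le_trans; apply.
  apply: (@squeeze_cvgr _ _ _ _ (fun=> 0) (fun N => K * N%:R^-1)).
  + near=> N; have N0 : (0 < N)%N by near: N; exact: nbhs_infty_gt.
    have [_ _ h1 h2] := H N N0.
    rewrite bigmax_ge_id/=; apply: bigmax_le; first by rewrite divr_ge0.
    by move=> j _; exact: h2.
  + exact: cvg_cst.
  + by rewrite -(mulr0 K); apply: cvgMr; rewrite -(cvg_shiftS _); exact: cvg_harmonic.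
Unshelve. all: by end_near. Qed.

End partitions.

(** * The variance function of the class M_2 *)

Section intensity.
Context (R : realType).
Variables (t T : R) (rho : R -> R).
Hypothesis rho0 : forall x, x \in `[t, T] -> 0 <= rho x.
Hypothesis rhoC : {within `[t, T], continuous rho}.
Local Notation mu := (@lebesgue_measure R).

(** The variance function: E (M_v - M_u)^2 = [Lam v - Lam u] for M in the class M_2. The sums over
    cells below are weighted by its increments. *)
Definition Lam (s : R) : R := \int[mu]_(x in `[t, s]) rho x.

Lemma rho_integrable u v : t <= u -> v <= T -> mu.-integrable `[u, v] (EFin \o rho).
Proof.
move=> tu vT; have i : mu.-integrable `[t, T] (EFin \o rho).
  by apply: continuous_compact_integrable => //; exact: segment_compact.
apply: (integrableS _ _ _ i) => //.
by move=> x /=; rewrite !in_itv/= => /andP[ux xv]; rewrite (le_trans tu ux) (le_trans xv vT).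
Qed.

Lemma rho_measurable : measurable_fun `[t, T] rho.
Proof. exact: subspace_continuous_measurable_fun. Qed.

Lemma rho_bounded : t <= T -> exists2 B : R, 0 <= B & forall x, t <= x -> x <= T -> rho x <= B.
Proof.
move=> tT; have [c cI cmax] := EVT_max tT rhoC.
exists (rho c); first exact: rho0.
by move=> x tx xT; apply: cmax; rewrite in_itv/= tx.
Qed.

Lemma integral_rho u v : t <= u -> u <= v -> v <= T ->
  (\int[mu]_(x in `[u, v]) (rho x)%:E = (Lam v - Lam u)%:E)%E.
Proof.
move=> tu uv vT.
have iv := rho_integrable (lexx t) vT.
have iuv := rho_integrable tu vT.
rewrite /Lam Rintegral_itvB//= ?bnd_simp//.
rewrite Rintegral_itv_obnd_cbnd; last first.
  apply: (integrableS _ _ _ iuv) => //.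
  by move=> x /=; rewrite !in_itv/= => /andP[/ltW -> ->].
by rewrite /Rintegral fineK//; exact: integrable_fin_num.
Qed.

Lemma Lam_le u v : t <= u -> u <= v -> v <= T -> Lam u <= Lam v.
Proof.
move=> tu uv vT; rewrite -subr_ge0 -lee_fin -integral_rho//.
apply: integral_ge0 => x /=; rewrite in_itv/= => /andP[ux xv].
by rewrite lee_fin rho0// in_itv/= (le_trans tu ux) (le_trans xv vT).
Qed.

Lemma Lam_lip : t <= T -> exists2 B : R, 0 <= B &
  forall u v, t <= u -> u <= v -> v <= T -> Lam v - Lam u <= B * (v - u).
Proof.
move=> tT; have [B B0 HB] := rho_bounded tT.
exists B => // u v tu uv vT; rewrite -lee_fin -integral_rho//.
have -> : (B * (v - u))%:E = (\int[mu]_(x in `[u, v]) B%:E)%E.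
  by rewrite integral_cst//= lebesgue_measure_itv/= lte_fin; case: ltP => [_|vu];
    [rewrite EFinM|rewrite mule0 (@le_anti _ _ u v) ?uv// subrr mulr0].
apply: ge0_le_integral => //.
- move=> x /=; rewrite in_itv/= => /andP[ux xv].
  by rewrite lee_fin rho0// in_itv/= (le_trans tu ux) (le_trans xv vT).
- exact: measurable_int (rho_integrable tu vT).
- move=> x /=; rewrite in_itv/= => /andP[ux xv].
  by rewrite lee_fin HB// ?(le_trans tu ux)// (le_trans xv vT).
Qed.

End intensity.

Lemma partition_cell_uniq (R : realType) (p : nat -> R) N :
  (forall j, (j < N)%N -> p j < p j.+1) ->
  forall x i j, (i < N)%N -> (j < N)%N -> p i <= x < p i.+1 -> p j <= x < p j.+1 -> i = j.
Proof.
move=> pS x i j iN jN /andP[ix xi] /andP[jx xj].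
have H k l : (l < N)%N -> p k <= x -> x < p k.+1 -> p l <= x -> x < p l.+1 -> ~ (k < l)%N.
  move=> lN kx xk lx xl kl.
  by have := partition_le pS kl (ltnW lN); rewrite leNgt (le_lt_trans lx xk).
case: (ltngtP i j) => // ij; exfalso.
  exact: (H i j jN ix xi jx xj ij).
exact: (H j i iN jx xj ix xi ij).
Qed.

(** * Step processes and their energy *)

Section step_process.
Context (R : realType) d (Omega : measurableType d).

(** A sum of indicators, so that joint measurability is that of a finite sum. At the right end [p N]
    the value is 0, which an integral over time does not see. *)
Definition step_process N (p : nat -> R) (c : nat -> Omega -> R) (s : R) (w : Omega) : R :=
  \sum_(j < N) (p j <= s < p j.+1)%R%:R * c j w.

Lemma step_processE N p c j s : (forall j, (j < N)%N -> p j < p j.+1) ->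
  (j < N)%N -> p j <= s < p j.+1 -> step_process N p c s = c j.
Proof.
move=> pS jN js; apply/funext => w; rewrite /step_process (bigD1 (Ordinal jN))//= js mul1r.
rewrite big1 ?addr0// => i ij; rewrite (_ : (_ && _) = false) ?mul0r//.
apply/negP => is_; move/eqP : ij; apply; apply: val_inj => /=.
exact: partition_cell_uniq pS _ _ _ (ltn_ord i) jN is_ js.
Qed.

Lemma step_process_last N p c s : (forall j, (j < N)%N -> p j < p j.+1) ->
  p N <= s -> step_process N p c s = cst 0.
Proof.
move=> pS Ns; apply/funext => w; rewrite /step_process big1// => i _.
rewrite [in X in X%:R](_ : (_ && _) = false) ?mul0r//.
apply/negP => /andP[_]; rewrite ltNge (le_trans _ Ns)//.
exact: partition_le pS _ _ (ltn_ord i) (leqnn _).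
Qed.

End step_process.

Section adapted.
Context (R : realType) d (Omega : measurableType d) (P : probability Omega R).
Variables (t T : R) (F : R -> set_system Omega) (rho : R -> R).
Hypothesis filt : filtration F t T.
Hypothesis rho0 : forall x, x \in `[t, T] -> 0 <= rho x.
Hypothesis rhoC : {within `[t, T], continuous rho}.
Local Notation mu := (@lebesgue_measure R).
Local Notation L2 f := (square_integrable P setT f).
Local Notation Lam := (Lam t rho).

Lemma expectation_sqr (X : Omega -> R) : L2 X ->
  'E_P[fun w => (X w ^+ 2)%R]%E = (nrm P X)%:E.
Proof. by move=> LX; rewrite unlock nrmE. Qed.

Lemma expectation_normsqr (X : Omega -> R) : L2 X ->
  'E_P[fun w => (`|X w| ^+ 2)%R]%E = (nrm P X)%:E.
Proof.
by move=> /expectation_sqr <-; congr ('E_P[_])%E; apply/funext => w; rewrite real_normK ?num_real.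
Qed.

Definition adaptedL2 s (Z : Omega -> R) := measurable_wrt (F s) Z /\ L2 Z.

Section step_H2.
Variables (a b : R) (N : nat) (p : nat -> R) (c : nat -> Omega -> R).
Hypotheses (ta : t <= a) (ab : a < b) (bT : b <= T).
Hypotheses (p0 : p 0%N = a) (pN : p N = b) (pS : forall j, (j < N)%N -> p j < p j.+1).
Hypothesis cA : forall j, (j < N)%N -> adaptedL2 (p j) (c j).

Let pa j : (j <= N)%N -> a <= p j.
Proof. by move=> jN; rewrite -p0; exact: partition_le pS _ _ _ _. Qed.

Let pb j : (j <= N)%N -> p j <= b.
Proof. by move=> jN; rewrite -pN; exact: partition_le pS _ _ _ _. Qed.

Lemma step_process_L2 s : L2 (step_process N p c s).
Proof. by apply: L2_sum => j _; apply: L2Z; case: (cA (ltn_ord j)). Qed.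

Lemma step_energy :
  (\int[mu]_(s in `[a, b]) ('E_P[fun w => (`|step_process N p c s w| ^+ 2)%R] * (rho s)%:E))%E =
  (\sum_(j < N) nrm P (c j) * (Lam (p j.+1) - Lam (p j)))%:E.
Proof.
pose g (j : 'I_N) s := (nrm P (c j) * ((rho \_ `[p j, p j.+1[) s))%:E.
have rho_ab s : s \in `[a, b]%classic -> 0 <= rho s.
  rewrite inE/= in_itv/= => /andP[as_ sb].
  by rewrite rho0// in_itv/= (le_trans ta as_) (le_trans sb bT).
transitivity (\int[mu]_(s in `[a, b]) \sum_(j < N) g j s)%E.
  apply: eq_integral => s sab; rewrite expectation_normsqr; last exact: step_process_L2.
  move: (sab); rewrite inE/= in_itv/= => /andP[as_ sb].
  rewrite -EFinM sumEFin; congr EFin.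
  have [sb'|bs] := ltP s b; last first.
    rewrite step_process_last// ?pN// nrm0 mul0r big1// => j _.
    rewrite patchE ifF ?mulr0//; apply/negP; rewrite inE/= in_itv/= => /andP[_].
    by rewrite ltNge (le_trans (pb (ltn_ord j)) bs).
  have [j jN js] := partition_cell pS (x := s) ltac:(by rewrite p0) ltac:(by rewrite pN).
  rewrite (step_processE c pS jN js) (bigD1 (Ordinal jN))//= patchE mem_set/=; last first.
    by rewrite in_itv.
  rewrite big1 ?addr0// => i ij; rewrite patchE ifF ?mulr0//.
  apply/negP; rewrite inE/= in_itv/= => is_; move/eqP : ij; apply; apply: val_inj => /=.
  exact: partition_cell_uniq pS _ _ _ (ltn_ord i) jN is_ js.
have mI j : measurable `[p j, p j.+1[%classic by exact: measurable_itv.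
have cell_sub j : (j < N)%N -> `[a, b] `&` `[p j, p j.+1[ = `[p j, p j.+1[%classic.
  move=> jN; apply: setIidr => x /=; rewrite !in_itv/= => /andP[px xp].
  by rewrite (le_trans (pa (ltnW jN)) px)/= (le_trans (ltW xp) (pb jN)).
have irho j : (j < N)%N -> mu.-integrable `[a, b] (EFin \o (rho \_ `[p j, p j.+1[)).
  move=> jN; rewrite -restrict_EFin; apply/integrable_restrict => //.
  rewrite cell_sub//; apply: (integrableS _ _ _ (rho_integrable rhoC ta bT)) => //.
  by rewrite -[X in X `<=` _](cell_sub _ jN); exact: subIsetl.
have ig (j : 'I_N) : mu.-integrable `[a, b] (g j).
  by apply: integrableZl_EFin; [exact: measurable_itv|exact: irho].
rewrite ge0_integral_sum//=; last 2 first.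
- by move=> j; exact: measurable_int (ig j).
- move=> j s sab; rewrite lee_fin mulr_ge0 ?nrm_ge0// patchE; case: ifP => // _.
  by apply: rho_ab; rewrite inE.
rewrite -sumEFin; apply: eq_bigr => j _.
rewrite /g; under eq_integral do rewrite EFinM.
rewrite integralZl//; last exact: irho.
rewrite EFinM; congr (_ * _)%E.
have -> : (\int[mu]_(x in `[a, b]) ((rho \_ `[p j, p j.+1[) x)%:E =
    \int[mu]_(x in `[p j, p j.+1[) (rho x)%:E)%E.
  rewrite -[in RHS](cell_sub j)// integral_mkcondr; apply: eq_integral => x _.
  by rewrite restrict_EFin.
rewrite integral_itv_bndo_bndc; last first.
  apply: (measurable_funS (measurable_itv `[a, b])).
    by rewrite -[X in X `<=` _](cell_sub _ (ltn_ord j)); exact: subIsetl.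
  exact: measurable_int (rho_integrable rhoC ta bT).
have tj := le_trans ta (pa (ltnW (ltn_ord j))).
exact: (integral_rho rhoC tj (ltW (pS (ltn_ord j))) (le_trans (pb (ltn_ord j)) bT)).
Qed.

Lemma step_class_H2 : class_H2 P F rho a b (step_process N p c).
Proof.
split.
- move=> s; rewrite in_itv/= => /andP[as_ sb].
  have ts := le_trans ta as_; have sT := le_trans sb bT.
  have sF := filtration_sigma filt ts sT.
  apply: measurable_wrt_sum => // j _.
  have [/andP[ps _]|_] := boolP (p j <= s < p j.+1).
    apply: measurable_wrtM => //; first exact: measurable_wrt_cst.
    have [cj _] := cA (ltn_ord j).
    apply: (measurable_wrt_mono filt _ ps sT cj).
    by rewrite (le_trans ta)// pa// ltnW.
  rewrite (_ : (fun w => _) = cst 0); first exact: measurable_wrt_cst.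
  by apply/funext => w; rewrite mul0r.
- apply: measurable_funTS; apply: measurable_sum => j.
  apply: measurable_funM.
    rewrite (_ : (fun z => _) = (\1_(`[p j, p j.+1[%classic) : measurableTypeR R -> R) \o fst).
      by apply: measurableT_comp => //; exact: measurable_indic.
    by apply/funext => z /=; rewrite indicE mem_setE/= in_itv.
  have [_ cj] := cA (ltn_ord j).
  by apply: (measurableT_comp (L2_meas cj)); exact: measurable_snd.
- by rewrite step_energy ltry.
Qed.

End step_H2.

(** The expectation in [ms_limit] is an extended real; once it is finite, the difference is square
    integrable, although neither term is assumed to be. Index 0 is excluded because a partition into
    0 cells carries no information. *)
Lemma ms_limit_L2 (X : nat -> Omega -> R) Y : ms_limit P X Y ->
  (forall n, (0 < n)%N -> measurable_fun setT (X n)) ->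
  forall e : R, 0 < e -> exists n0, forall n, (n0 <= n)%N ->
    L2 (fun w => X n w - Y w) /\ nrm P (fun w => X n w - Y w) < e.
Proof.
move=> [mY XY] mX e e0.
have /XY[n0 _ Hn0] : nbhs 0%E [set x : \bar R | (x < e%:E)%E].
  by apply: open_nbhs_nbhs; split; [exact: open_ereal_lt_ereal|rewrite /= lte_fin].
exists (maxn n0 1) => n; rewrite geq_max => /andP[n0n n1].
have := Hn0 n n0n; rewrite /= unlock => h.
have L : L2 (fun w => X n w - Y w).
  by split; [apply: measurable_funB => //; exact: mX|rewrite (lt_trans h)// ltry].
by split=> //; rewrite -lte_fin nrmE.
Qed.

Lemma cvg2_ms_limit (X : nat -> Omega -> R) Y : (forall n, (0 < n)%N -> L2 (X n)) -> L2 Y ->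
  cvg2 P X Y -> ms_limit P X Y.
Proof.
move=> LX LY XY; split; first exact: L2_meas LY.
have XY' : (nrm P (fun w => X n w - Y w))%:E @[n --> \oo] --> 0%E.
  by apply: cvg_EFin; [exact: nearW|apply/cvg2P].
apply: cvg_trans XY'; apply: near_eq_cvg; near=> n.
rewrite expectation_sqr//; apply: L2B => //; apply: LX.
by near: n; exact: nbhs_infty_gt.
Unshelve. all: by end_near. Qed.

Section orthogonal_sums.
Variables (M : R -> Omega -> R) (C : R).
Hypothesis mart : martingale P F t T M.

(** The integrated form of E[(M_v - M_u)^2 | F_u] <= C (Lam v - Lam u), free of conditional
    expectations. Square integrability of the product is part of the claim, since two
    square-integrable factors do not ensure it. *)
Definition conditional_variance_bound := forall u v Z, t <= u -> u <= v -> v <= T ->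
  adaptedL2 u Z -> L2 (fun w => Z w * (M v w - M u w)) /\
  nrm P (fun w => Z w * (M v w - M u w)) <= C * (Lam v - Lam u) * nrm P Z.

Hypothesis CV : conditional_variance_bound.

(** The conditional variance bound makes Z (M v - M u) square integrable, hence the triple product
    integrable, so that orthogonality applies with the [F u]-measurable factor X Z. *)
Lemma martingale_L2_orth u v (X Z : Omega -> R) : t <= u -> u <= v -> v <= T ->
  adaptedL2 u X -> adaptedL2 u Z ->
  \int[P]_w (X w * (Z w * (M v w - M u w))) = 0.
Proof.
move=> tu uv vT [aX LX] AZ; have [aZ LZ] := AZ.
have [L _] := CV tu uv vT AZ.
rewrite (Rint_eq P (g := fun w => (X w * Z w) * (M v w - M u w))); last first.
  by move=> w; rewrite mulrA.
apply: (martingale_orth filt mart) => //.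
  by apply: (measurable_wrtM (filtration_sigma filt tu (le_trans uv vT))).
by apply: (mint_eq _ (L2M_int LX L)) => w; rewrite mulrA.
Qed.

Lemma increment_adaptedL2 u v s Z : t <= u -> u <= v -> v <= s -> s <= T ->
  adaptedL2 u Z -> adaptedL2 s (fun w => Z w * (M v w - M u w)).
Proof.
move=> tu uv vs sT AZ; have vT := le_trans vs sT; have tv := le_trans tu uv.
have us := le_trans uv vs; have ts := le_trans tu us.
have [L _] := CV tu uv vT AZ; split=> //.
have sF := filtration_sigma filt ts sT.
apply: measurable_wrtM => //; first exact: (measurable_wrt_mono filt tu us sT AZ.1).
apply: measurable_wrtB => //.
  exact: (measurable_wrt_mono filt tv vs sT (martingale_adapted mart tv vT)).
exact: (measurable_wrt_mono filt tu us sT (martingale_adapted mart tu (le_trans us sT))).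
Qed.

(** Over disjoint intervals the summands are orthogonal: the earlier one is known when the later
    increment starts. Degenerate intervals are allowed because common refinements produce them. *)
Lemma orthogonal_sum_bound (A : finType) (u v : A -> R) (Z : A -> Omega -> R) :
  (forall x, [/\ t <= u x, u x <= v x & v x <= T]) ->
  (forall x, adaptedL2 (u x) (Z x)) ->
  (forall x y, x != y -> [\/ v x <= u y, v y <= u x, u x = v x | u y = v y]) ->
  L2 (fun w => \sum_x Z x w * (M (v x) w - M (u x) w)) /\
  nrm P (fun w => \sum_x Z x w * (M (v x) w - M (u x) w)) <=
    C * \sum_x (Lam (v x) - Lam (u x)) * nrm P (Z x).
Proof.
move=> uvP AZ sep.
have LX x : L2 (fun w => Z x w * (M (v x) w - M (u x) w)).
  by have [tu uv vT] := uvP x; have [] := CV tu uv vT (AZ x).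
split; first exact: L2_sum.
rewrite (nrm_sum_orth (h := fun x w => Z x w * (M (v x) w - M (u x) w)))//.
  rewrite mulr_sumr; apply: ler_sum => x _; rewrite mulrA.
  by have [tu uv vT] := uvP x; have [] := CV tu uv vT (AZ x).
have H x y : v x <= u y -> \int[P]_w (Z x w * (M (v x) w - M (u x) w) *
    (Z y w * (M (v y) w - M (u y) w))) = 0.
  move=> vu; have [tu uv vT] := uvP x; have [tu' uv' vT'] := uvP y.
  apply: martingale_L2_orth => //.
  by apply: increment_adaptedL2 => //; exact: le_trans uv' vT'.
move=> x y _ _ /sep[vu|vu|uv|uv].
- exact: H.
- by rewrite -(H _ _ vu); apply: Rint_eq => w; rewrite mulrC.
- rewrite (Rint_eq P (g := fun=> 0)) ?Rintegral_cst ?mul0r// => w.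
  by rewrite uv subrr mulr0 mul0r.
- rewrite (Rint_eq P (g := fun=> 0)) ?Rintegral_cst ?mul0r// => w.
  by rewrite uv subrr !mulr0.
Qed.

End orthogonal_sums.
End adapted.

Lemma telescope_range (R : pzRingType) (f : nat -> R) (x : R) N i j :
  (i <= j)%N -> (j <= N)%N ->
  \sum_(l < N) (if (i <= l < j)%N then x * (f l.+1 - f l) else 0) = x * (f j - f i).
Proof.
move=> ij jN; suff -> : forall n, \sum_(l < n) (if (i <= l < j)%N then x * (f l.+1 - f l) else 0) =
    x * (f (minn n j) - f (minn n i)) by rewrite (minn_idPr jN) (minn_idPr (leq_trans ij jN)).
elim=> [|n ih]; first by rewrite big_ord0 !min0n subrr mulr0.
rewrite big_ord_recr/= ih; have [ni|ni] := leqP i n; last first.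
  have nj := leq_trans ni ij.
  by rewrite /= addr0 (minn_idPl nj) (minn_idPl ni) (minn_idPl (ltnW nj)) ?(minn_idPl (ltnW ni)) !subrr !mulr0.
have [jn|nj] := leqP j n.
  rewrite /= addr0 (minn_idPr (leqW jn)) ?(minn_idPr jn).
  by rewrite (minn_idPr (leqW ni)) ?(minn_idPr ni).
rewrite /= (minn_idPl nj) ?(minn_idPl (ltnW nj)) (minn_idPr (leqW ni)) ?(minn_idPr ni).
by rewrite -mulrDr addrC addrA subrK.
Qed.

(** * The conditional variance bound *)

Section conditional_variance.
Context (R : realType) d (Omega : measurableType d) (P : probability Omega R).
Variables (t T : R) (F : R -> set_system Omega) (rho : R -> R) (M : R -> Omega -> R).
Hypothesis tT : t < T.
Hypothesis filt : filtration F t T.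
Hypothesis MQ : class_Q4 P F rho t T M.
Local Notation mu := (@lebesgue_measure R).
Local Notation L2 f := (square_integrable P setT f).
Local Notation Lam := (Lam t rho).

Let rho0 : forall x, x \in `[t, T] -> 0 <= rho x.
Proof. by case: MQ => -[[]]. Qed.

Let rhoC : {within `[t, T], continuous rho}.
Proof. by case: MQ => -[[_ []]]. Qed.

Let mart : martingale P F t T M.
Proof. by case: MQ => -[]. Qed.

Let mM s : t <= s -> s <= T -> measurable_fun setT (M s).
Proof. exact: (martingale_measurable filt mart). Qed.

(* The integral of the zero integrand is the limit of the integral sums of every
   sequence of step processes tending to zero in H_2, which makes the elementary
   integral continuous at zero. *)
Lemma vanishing_integral_sums : forall (p : nat -> nat -> R) c (K : R),
  (forall N, (0 < N)%N -> is_partition t T N (p N) (K / N%:R)) ->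
  (forall N j, (j < N)%N -> adaptedL2 P F (p N j) (c N j)) ->
  (forall N, (0 < N)%N -> \sum_(j < N) nrm P (c N j) * (Lam (p N j.+1) - Lam (p N j)) <= K / N%:R) ->
  forall e : R, 0 < e -> exists n0, forall N, (n0 <= N)%N ->
    L2 (fun w => \sum_(j < N) c N j w * (M (p N j.+1) w - M (p N j) w)) /\
    nrm P (fun w => \sum_(j < N) c N j w * (M (p N j.+1) w - M (p N j) w)) < e.
Proof.
have [I [_ _ SI] _] : exists2 I, stochastic_integral P F rho M t T (fun _ _ => 0) I & True.
  case: MQ => _ [alpha [K4 [_ /(_ t T (fun=> 0) (lexx t) tT (lexx T))]]].
  case; first by split; [exact: measurable_cst|exists 0 => s _; rewrite normr0].
  by move=> I SI _; exists I.
(* Convergence to [I] is the definition of the integral of 0; that [I] vanishes is shown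
   afterwards. *)
have main (p : nat -> nat -> R) c (K : R) :
    (forall N, (0 < N)%N -> is_partition t T N (p N) (K / N%:R)) ->
    (forall N j, (j < N)%N -> adaptedL2 P F (p N j) (c N j)) ->
    (forall N, (0 < N)%N -> \sum_(j < N) nrm P (c N j) * (Lam (p N j.+1) - Lam (p N j)) <= K / N%:R) ->
  forall e : R, 0 < e -> exists n0, forall N, (n0 <= N)%N ->
    L2 (fun w => \sum_(j < N) c N j w * (M (p N j.+1) w - M (p N j) w) - I w) /\
    nrm P (fun w => \sum_(j < N) c N j w * (M (p N j.+1) w - M (p N j) w) - I w) < e.
  move=> Pp Ac cK.
  have pS N j : (j < N)%N -> p N j < p N j.+1.
    by move=> jN; have [_ _ pS _] := Pp N (leq_ltn_trans (leq0n _) jN); exact: pS.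
  have pI N j : (0 < N)%N -> (j <= N)%N -> t <= p N j <= T.
    move=> N0 jN; have [p0 pN _ _] := Pp N N0.
    by rewrite -{1}p0 -pN !(partition_le (@pS N)).
  have SA : step_approximation P F rho t T (fun _ _ => 0) p (fun N => step_process N (p N) (c N)).
    split.
    - exact: partition_sequence_mesh Pp.
    - move=> N N0; have [p0 pN _ _] := Pp N N0.
      apply: (step_class_H2 filt rho0 rhoC (lexx t) (lexx T) p0 pN (@pS N)); exact: Ac.
    - move=> N j jN s; rewrite in_itv/= => js.
      rewrite (step_processE _ (@pS N) jN js) (step_processE _ (@pS N) jN)//.
      by rewrite lexx pS.
    - have E N : (0 < N)%N -> (\int[mu]_(s in `[t, T]) ('E_P[fun w => (`|step_process N (p N) (c N) s w - 0| ^+ 2)%R] * (rho s)%:E) =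
        (\sum_(j < N) nrm P (c N j) * (Lam (p N j.+1) - Lam (p N j)))%:E)%E.
        move=> N0; have [p0 pN _ _] := Pp N N0.
        rewrite -(step_energy rho0 rhoC (lexx t) (lexx T) p0 pN (@pS N) (Ac N)).
        by apply: eq_integral => s _; congr ('E_P[_] * _)%E; apply/funext => w; rewrite subr0.
      apply: (@squeeze_cvge _ _ _ _ (fun=> 0%E) _ (fun N => (K * N%:R^-1)%:E)).
      + near=> N; have N0 : (0 < N)%N by near: N; exact: nbhs_infty_gt.
        rewrite E// lee_fin lee_fin cK// andbT; apply: sumr_ge0 => j _.
        rewrite mulr_ge0 ?nrm_ge0// subr_ge0.
        have /andP[h1 _] := pI N j N0 (ltnW (ltn_ord j)).
        have /andP[_ h2] := pI N j.+1 N0 (ltn_ord j).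
        by apply: (Lam_le rho0 rhoC h1 (ltW (pS _ _ (ltn_ord j))) h2).
      + exact: cvg_cst.
      + apply: cvg_EFin; first exact: nearW.
        by rewrite -(mulr0 K); apply: cvgMr; rewrite -(cvg_shiftS _); exact: cvg_harmonic.
  have /= ms := SI _ _ SA.
  move=> e e0; have [n0 Hn0] := ms_limit_L2 ms (e := e) ltac:(
    move=> N N0; apply: measurable_sum => j; apply: measurable_funM;
    [by apply: L2_meas; apply: step_process_L2 => k; exact: Ac
    |have /andP[h1 h2] := pI N j N0 (ltnW (ltn_ord j));
     have /andP[h3 h4] := pI N j.+1 N0 (ltn_ord j);
     by apply: measurable_funB; apply: mM]) e0.
  exists n0 => N /Hn0.
  rewrite (_ : (fun w => \sum_(j < N) _ - I w) =
    (fun w => \sum_(j < N) c N j w * (M (p N j.+1) w - M (p N j) w) - I w))//.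
  apply/funext => w; congr (_ - _); apply: eq_bigr => j _.
  by rewrite (step_processE _ (@pS N) (ltn_ord j))// lexx pS.
pose u N (j : nat) := t + j%:R * ((T - t) / N%:R).
have LI e : 0 < e -> L2 I /\ nrm P I < e.
  move=> e0.
  have [|||n0 /(_ _ (leqnn n0))[LI NI]] := main u (fun _ _ => cst 0) (T - t) _ _ _ e e0.
  - by move=> N N0; exact: uniform_partition.
  - move=> N j jN; have N0 := leq_ltn_trans (leq0n _) jN.
    have [u0 uN uS _] := uniform_partition tT N0.
    have tu : t <= u N j by rewrite -u0; exact: (partition_le uS (leq0n _) (ltnW jN)).
    have uT : u N j <= T by rewrite -uN; exact: (partition_le uS (ltnW jN) (leqnn _)).
    split; [exact: (measurable_wrt_cst (filtration_sigma filt tu uT))|exact: L2_0].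
  - move=> N N0; rewrite big1 => [|j _]; first by rewrite divr_ge0// subr_ge0 ltW.
    by rewrite (nrm0 P) mul0r.
  have E w : \sum_(j < n0) cst 0 w * (M (u n0 j.+1) w - M (u n0 j) w) - I w = - I w.
    by rewrite big1 ?sub0r// => j _; rewrite /cst mul0r.
  rewrite (nrm_eq P E) nrmN in NI; split=> //.
  by apply: (L2_eq _ (L2N LI)) => w; rewrite E opprK.
move=> p c K Pp Ac cK e e0; have [n0 Hn0] := main p c K Pp Ac cK (e / 4) (divr_gt0 e0 (ltr0n _ 4)).
have [L N] := LI _ (divr_gt0 e0 (ltr0n _ 4)).
exists n0 => k /Hn0[L1 N1].
have E w : \sum_(j < k) c k j w * (M (p k j.+1) w - M (p k j) w) - I w + I w =
  \sum_(j < k) c k j w * (M (p k j.+1) w - M (p k j) w) by rewrite subrK.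
split; first by apply: (L2_eq _ (L2D L1 L)) => w; rewrite E.
by rewrite -(nrm_eq P E); apply: le_lt_trans (nrmD2 L1 L) _; lra.
Unshelve. all: by end_near. Qed.

(** Boundedness from continuity at zero: if an energy of at most 1/(n+1) forces a norm of at most 1,
    homogeneity gives the bound with C = n+1. *)
Lemma class_Q4_conditional_variance :
  exists2 C : R, 0 <= C & conditional_variance_bound P t T F rho M C.
Proof.
suff [n Hn] : exists n : nat, forall u v Z, t <= u -> u < v -> v <= T ->
    adaptedL2 P F u Z -> (Lam v - Lam u) * nrm P Z <= n.+1%:R^-1 ->
    L2 (fun w => Z w * (M v w - M u w)) /\ nrm P (fun w => Z w * (M v w - M u w)) <= 1.
  exists n.+1%:R => // u v Z tu uv vT [aZ LZ].
  move: uv; rewrite le_eqVlt => /orP[/eqP <-|uv].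
    rewrite (_ : (fun w => _) = fun=> 0).
      by rewrite nrm0 subrr mulr0 mul0r; split => //; exact: L2_0.
    by apply/funext => w; rewrite subrr mulr0.
  set a := (Lam v - Lam u) * nrm P Z.
  have a0 : 0 <= a by rewrite mulr_ge0 ?nrm_ge0// subr_ge0 (Lam_le rho0 rhoC tu (ltW uv) vT).
  have key e : 0 < e -> L2 (fun w => Z w * (M v w - M u w)) /\
     nrm P (fun w => Z w * (M v w - M u w)) <= n.+1%:R * a + e.
    move=> e0; have s0 : 0 < n.+1%:R * a + e by rewrite ltr_wpDl// mulr_ge0.
    (* Scales the energy of k Z down to at most 1/(n+1); the summand e avoids a division by 0 when
       the energy [a] is 0. *)
    pose k := Num.sqrt (n.+1%:R * a + e)^-1.
    have k2 : k ^+ 2 = (n.+1%:R * a + e)^-1 by rewrite sqr_sqrtr// invr_ge0 ltW.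
    have k0 : k != 0 by rewrite sqrtr_eq0 -ltNge invr_gt0.
    have uT : u <= T := le_trans (ltW uv) vT.
    have AkZ : adaptedL2 P F u (fun w => k * Z w).
      split; last exact: L2Z.
      apply: (measurable_wrtM (filtration_sigma filt tu uT)) => //.
      exact: (measurable_wrt_cst (filtration_sigma filt tu uT)).
    have [] := Hn u v _ tu uv vT AkZ.
      rewrite nrmZ// mulrCA -/a k2 ler_pdivrMl// ler_pdivlMr// mulrC.
      by rewrite lerDl ltW.
    move=> L1 N1.
    have E w : k^-1 * (k * Z w * (M v w - M u w)) = Z w * (M v w - M u w) by field.
    split; first by apply: (L2_eq _ (L2Z k^-1 L1)) => w; rewrite E.
    rewrite -(nrm_eq P E) nrmZ// exprVn k2 invrK.
    by rewrite ler_piMr// ltW.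
  split; first by have [] := key 1 ltr01.
  rewrite -mulrA -/a; apply/ler_addgt0Pr => e e0.
  by have [] := key e e0.
(* Otherwise some triple (u, v, Z) of energy at most 1/n gives an increment sum of
   norm above 1, for every n. Inserting u and v into the uniform partition with
   3n cells puts all these triples into one sequence of step processes. *)
apply: contrapT => nex.
have bad n : exists x : nat * (nat -> R) * nat * nat * (Omega -> R),
    let: (N, p, i, j, Z) := x in
    [/\ (3 * n.+1 <= N < 3 * n.+1 + 3)%N, is_partition t T N p ((T - t) / (3 * n.+1)%:R),
      (i < j)%N /\ (j <= N)%N, adaptedL2 P F (p i) Z /\ (Lam (p j) - Lam (p i)) * nrm P Z <= n.+1%:R^-1 &
      ~ (L2 (fun w => Z w * (M (p j) w - M (p i) w)) /\
         nrm P (fun w => Z w * (M (p j) w - M (p i) w)) <= 1)].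
  apply: contrapT => nb; apply: nex; exists n => u v Z tu uv vT AZ aZ.
  apply: contrapT => H; apply: nb.
  have [N [p [hN Pp [i [j [ij jN pi pj]]]]]] := partition_two_points tT (ltn0Sn n) tu uv vT.
  by exists (N, p, i, j, Z); split=> //; rewrite ?pi ?pj.
have [x Hx] := choice bad.
pose Nn m := (x m).1.1.1.1; pose pn m := (x m).1.1.1.2.
pose i_ m := (x m).1.1.2; pose j_ m := (x m).1.2; pose Zn m := (x m).2.
have {}Hx m : [/\ (3 * m.+1 <= Nn m < 3 * m.+1 + 3)%N,
      is_partition t T (Nn m) (pn m) ((T - t) / (3 * m.+1)%:R),
      (i_ m < j_ m)%N /\ (j_ m <= Nn m)%N,
      adaptedL2 P F (pn m (i_ m)) (Zn m) /\ (Lam (pn m (j_ m)) - Lam (pn m (i_ m))) * nrm P (Zn m) <= m.+1%:R^-1 &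
      ~ (L2 (fun w => Zn m w * (M (pn m (j_ m)) w - M (pn m (i_ m)) w)) /\
         nrm P (fun w => Zn m w * (M (pn m (j_ m)) w - M (pn m (i_ m)) w)) <= 1)].
  by have := Hx m; rewrite /Nn /pn /i_ /j_ /Zn; case: (x m) => [[[[N p] i] j] Z].
(* Left inverse of [Nn], because [Nn m] lies in [3 (m+1), 3 (m+1) + 3[. *)
pose m_ N := (N %/ 3).-1.
pose hit N := (2 < N)%N && (Nn (m_ N) == N).
have hitN m : hit (Nn m) /\ m_ (Nn m) = m.
  have [h _ _ _ _] := Hx m.
  have E : m_ (Nn m) = m by rewrite /m_; lia.
  by split=> //; rewrite /hit E eqxx andbT; lia.
(* The term 3 (T - t) absorbs the mesh (T - t) / (3 (m+1)), since N <= 9 (m+1); the term 5 absorbs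
   the energy 1/(m+1), since N <= 5 (m+1). *)
pose K := 3 * (T - t) + 5.
have TK : 0 < T - t by rewrite subr_gt0.
(* The numbers of cells that no triple occupies get the uniform partition with zero coefficients. *)
pose p N := if hit N then pn (m_ N) else (fun j => t + j%:R * ((T - t) / N%:R)).
pose c N l := if hit N && (i_ (m_ N) <= l < j_ (m_ N))%N then Zn (m_ N) else cst 0.
have := @vanishing_integral_sums p c K.
have Pp N : (0 < N)%N -> is_partition t T N (p N) (K / N%:R).
  move=> N0; rewrite /p; have NR : 0 < N%:R :> R by rewrite ltr0n.
  case: ifPn => [/andP[N2 /eqP NE]|_].
    have [h [p0 pN pS ph] _ _ _] := Hx (m_ N).
    rewrite {}NE in h p0 pN pS ph.
    split=> // j jN; apply: le_trans (ph j jN) _.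
    rewrite ler_pdivrMr ?ltr0n ?muln_gt0// mulrAC ler_pdivlMr//.
    have : N%:R <= 3 * (3 * (m_ N).+1)%:R :> R by rewrite -natrM ler_nat; lia.
    have := ler0n R (3 * (m_ N).+1); rewrite /K.
    move: (3 * (m_ N).+1)%:R N%:R NR TK => y z z0 TK y0 yz; nra.
  have [p0 pN pS ph] := uniform_partition tT N0; split=> // j /ph h.
  by apply: le_trans h _; rewrite ler_pM2r ?invr_gt0// /K; lra.
have pI N j : (0 < N)%N -> (j <= N)%N -> t <= p N j <= T.
  move=> N0 jN; have [p0 pN pS _] := Pp N N0.
  by rewrite -{1}p0 -pN !(partition_le pS).
move=> /(_ Pp).
have ijN N : hit N -> (i_ (m_ N) <= j_ (m_ N))%N /\ (j_ (m_ N) <= N)%N.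
  by move=> /andP[_ /eqP E]; have [_ _ [/ltnW h1 h2] _ _] := Hx (m_ N); rewrite E in h2.
have Ac N j : (j < N)%N -> adaptedL2 P F (p N j) (c N j).
  move=> jN; have N0 := leq_ltn_trans (leq0n _) jN.
  have /andP[tp pT] := pI N j N0 (ltnW jN).
  have sF := filtration_sigma filt tp pT.
  rewrite /c; case: ifPn => [/andP[hN /andP[ij ji]]|_]; last first.
    by split; [exact: (measurable_wrt_cst sF)|exact: L2_0].
  have [_ _ _ [[aZ LZ] _] _] := Hx (m_ N); split=> //.
  have [p0 pN pS _] := Pp N N0.
  have pi : p N (i_ (m_ N)) <= p N j by exact: (partition_le pS ij (ltnW jN)).
  have pE : pn (m_ N) (i_ (m_ N)) = p N (i_ (m_ N)) by rewrite /p hN.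
  rewrite pE in aZ; apply: (measurable_wrt_mono filt _ pi pT aZ).
  by rewrite -p0; exact: (partition_le pS (leq0n _) (leq_trans ij (ltnW jN))).
move=> /(_ Ac).
have cK N : (0 < N)%N ->
   \sum_(j < N) nrm P (c N j) * (Lam (p N j.+1) - Lam (p N j)) <= K / N%:R.
  move=> N0; have NR : 0 < N%:R :> R by rewrite ltr0n.
  have K0 : 0 <= K by rewrite /K; lra.
  have [hN|hN] := boolP (hit N); last first.
    rewrite big1 ?divr_ge0// => j _.
    by rewrite /c (negbTE hN)/= (nrm0 P) mul0r.
  rewrite (eq_bigr (fun j : 'I_N => if (i_ (m_ N) <= j < j_ (m_ N))%N then
     nrm P (Zn (m_ N)) * (Lam (p N j.+1) - Lam (p N j)) else 0)); last first.
    by move=> j _; rewrite /c hN/=; case: ifP => // _; rewrite (nrm0 P) mul0r.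
  have [h1 h2] := ijN N hN.
  rewrite (telescope_range (fun l => Lam (p N l)) _ h1 h2) /p hN.
  have [h _ _ [_ h3] _] := Hx (m_ N).
  rewrite mulrC; apply: le_trans h3 _; move/andP : hN => [N2 /eqP NE]; rewrite {}NE in h.
  rewrite ler_pdivlMr// ler_pdivrMl ?ltr0n//.
  have : N%:R <= 5 * (m_ N).+1%:R :> R by rewrite -natrM ler_nat; lia.
  have : (1 : R) <= (m_ N).+1%:R by rewrite ler1n.
  rewrite /K; move: (m_ N).+1%:R N%:R NR TK => y z z0 TK y1 zy; nra.
move=> /(_ cK) conv.
have [n0 Hn0] := conv 1 ltr01.
have [h _ [ij jN] _ H] := Hx n0.
have [hN mN] := hitN n0; have n0N : (n0 <= Nn n0)%N by lia.
apply: H.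
have E w : \sum_(j < Nn n0) c (Nn n0) j w * (M (p (Nn n0) j.+1) w - M (p (Nn n0) j) w) =
   Zn n0 w * (M (pn n0 (j_ n0)) w - M (pn n0 (i_ n0)) w).
  rewrite -(telescope_range (fun l => M (pn n0 l) w) _ (ltnW ij) jN).
  apply: eq_bigr => j _; rewrite /c /p hN mN/=.
  by case: ifP => // _; rewrite /cst mul0r.
have [L1 N1] := Hn0 _ n0N.
split; first by apply: L2_eq L1.
by rewrite -(nrm_eq P E) ltW.
Qed.

End conditional_variance.

(** * Integrals of deterministic functions *)

Section piecewise_functions.
Context (R : realType).
Variables (t T : R).
Local Notation mu := (@lebesgue_measure R).

Lemma within_near_bounded (f : R -> R) x : f y @[y --> within [set` `[t, T]] (nbhs x)] --> f x ->
  \forall y \near x, y \in `[t, T] -> `|f y| <= `|f x| + 1.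
Proof.
move=> /cvgrPdist_lt /(_ 1 ltr01); rewrite !near_withinE => h.
near=> y => yI; have /(_ yI) : y \in `[t, T] -> `|f x - f y| < 1 by near: y.
by move=> /ltW; rewrite distrC => /(le_trans (lerB_dist _ _)); rewrite lerBlDl.
Unshelve. all: by end_near. Qed.

(** At a point of S the right limit is the value and the left limit is finite. At the end points of
    the interval one side lies outside, and any bound serves there. *)
Lemma piecewise_near_bounded (f : R -> R) x : piecewise_right_continuous t T f ->
  x \in `[t, T] -> exists B : R, \forall y \near x, y \in `[t, T] -> `|f y| <= B.
Proof.
move=> [S [fC fL fR]] xI; have [xS|xS] := boolP (x \in S); last first.
  by exists (`|f x| + 1); apply: within_near_bounded; exact: fC.
have [BR hR] : exists B : R, \forall y \near x^'+, y \in `[t, T] -> `|f y| <= B.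
  move: xI; rewrite in_itv/= => /andP[tx]; rewrite le_eqVlt => /orP[/eqP xT|xT].
    exists 0; near=> y; rewrite in_itv/= => /andP[_]; rewrite -xT leNgt => /negP[].
    by near: y; exact: nbhs_right_gt.
  have /fR /cvgrPdist_lt /(_ 1 ltr01) h : x \in `[t, T[ by rewrite in_itv/= tx.
  exists (`|f x| + 1); near=> y => _.
  have : `|f x - f y| < 1 by near: y.
  by move=> /ltW; rewrite distrC => /(le_trans (lerB_dist _ _)); rewrite lerBlDl.
have [BL hL] : exists B : R, \forall y \near x^'-, y \in `[t, T] -> `|f y| <= B.
  move: xI; rewrite in_itv/= => /andP[+ xT]; rewrite le_eqVlt => /orP[/eqP tx|tx].
    exists 0; near=> y; rewrite in_itv/= => /andP[+ _]; rewrite tx leNgt => /negP[].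
    by near: y; exact: nbhs_left_lt.
  have xI' : x \in `]t, T] by rewrite in_itv/= tx.
  have /cvg_ex[l /cvgrPdist_lt /(_ 1 ltr01) h] := fL x xI' xS.
  exists (`|l| + 1); near=> y => _.
  have : `|l - f y| < 1 by near: y.
  by move=> /ltW; rewrite distrC => /(le_trans (lerB_dist _ _)); rewrite lerBlDl.
exists (`|f x| + `|BR| + `|BL|).
move: hR hL; rewrite !near_withinE => hR hL; near=> y => yI.
have [yx|xy|->] := ltgtP y x.
- apply: (@le_trans _ _ BL); first by move: yx yI; near: y.
  by rewrite (le_trans (ler_norm _))// lerDr addr_ge0.
- apply: (@le_trans _ _ BR); first by move: xy yI; near: y.
  by rewrite (le_trans (ler_norm _))// addrAC lerDr addr_ge0.
- by rewrite -addrA lerDl addr_ge0.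
Unshelve. all: by end_near. Qed.

Lemma near_bounded_itv (f : R -> R) :
  (forall x, x \in `[t, T] -> exists B : R, \forall y \near x, y \in `[t, T] -> `|f y| <= B) ->
  exists2 B : R, 0 <= B & forall x, x \in `[t, T] -> `|f x| <= B.
Proof.
move=> H.
have cpt : compact [set` `[t, T]] by exact: segment_compact.
move: cpt => /compact_near_coveringP /(_ R (pinfty_nbhs R) (fun B y => y \in `[t, T] -> `|f y| <= B)) /(_ _).
case.
  move=> x xI; have [B hB] := H x xI.
  exists ([set y | y \in `[t, T] -> `|f y| <= B], [set i | B <= i]).
    by split=> //; apply: nbhs_pinfty_ge; exact: num_real.
  by move=> [y i] /= [yB Bi] yI; exact: le_trans (yB yI) Bi.
move=> B0 [_ hB]; exists (`|B0| + 1); first by rewrite addr_ge0.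
move=> x xI; apply: (hB (`|B0| + 1)) => //.
by rewrite (le_lt_trans (ler_norm _))// ltrDl.
Unshelve. all: by end_near. Qed.

Lemma partition_mesh (tau : nat -> nat -> R) : partition_sequence t T tau ->
  forall e : R, 0 < e -> exists N0, forall N, (N0 <= N)%N ->
    forall j, (j < N)%N -> tau N j.+1 - tau N j < e.
Proof.
move=> [_ _ /cvgrPdist_lt mesh] e /mesh[N0 _ HN0]; exists N0 => N /HN0/=.
rewrite sub0r normrN => h j jN; apply: le_lt_trans h.
apply: le_trans (ler_norm _).
exact: (le_bigmax 0 (fun j : 'I_N => tau N j.+1 - tau N j) (Ordinal jN)).
Qed.

Lemma left_point_cvg (tau : nat -> nat -> R) (f : R -> R) x : partition_sequence t T tau ->
  f y @[y --> within [set` `[t, T]] (nbhs x)] --> f x ->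
  forall e : R, 0 < e -> exists N0, forall N, (N0 <= N)%N ->
    forall j, (j < N)%N -> tau N j <= x < tau N j.+1 -> `|f (tau N j) - f x| < e.
Proof.
move=> ptau /cvgrPdist_lt fx e /fx; rewrite near_withinE => -[del /= del0 Hdel].
have [N0 HN0] := partition_mesh ptau del0.
exists (maxn N0 1) => N; rewrite geq_max => /andP[/HN0 mesh N1] j jN /andP[jx xj].
have [/(_ N N1)[p0 pN] /(_ N) pS _] := ptau.
rewrite distrC; apply: Hdel => /=.
  rewrite ger0_norm ?subr_ge0//; apply: le_lt_trans (mesh j jN).
  by rewrite lerD2r ltW.
rewrite in_itv/= -{1}p0 -pN (partition_le pS (leq0n _) (ltnW jN)).
exact: (partition_le pS (ltnW jN) (leqnn _)).
Qed.

(** Dominated convergence over the indices N > 0, with a finite exceptional set S that is to hold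
    discontinuities and end points. *)
Lemma dominated_cvg0 (a b : R) (S : seq R) (g : nat -> R -> \bar R) (B : R) :
  (forall N, (0 < N)%N -> measurable_fun `[a, b] (g N)) ->
  (forall N x, (0 < N)%N -> x \in `[a, b] -> (0 <= g N x <= B%:E)%E) ->
  (forall x, x \in `[a, b] -> x \notin S -> g N x @[N --> \oo] --> 0%E) ->
  (\int[mu]_(x in `[a, b]) g N x)%E @[N --> \oo] --> 0%E.
Proof.
move=> mg gB gcvg; rewrite -(cvg_shiftS _).
have := @dominated_convergence _ _ _ mu `[a, b] (measurable_itv _)
  (fun N => g N.+1) (fun=> 0%E) (fun=> B%:E).
case.
- by move=> N; exact: mg.
- exact: measurable_cst.
- have S0 : mu.-negligible [set` S].
    have cS : countable [set` S] by apply: finite_set_countable; exact: finite_seq.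
    exists [set` S]; split=> //; last exact: countable_lebesgue_measure0.
    by apply: countable_measurable => // x; exact: measurable_set1.
  apply: (negligibleS _ S0) => x /= nx; apply: contrapT => xS; apply: nx => xI.
  by rewrite (cvg_shiftS (fun N => g N x)); apply: gcvg => //; apply/negP.
- apply/integrableP; split; first exact: measurable_cst.
  by rewrite integral_cst//= lebesgue_measure_itv/=; case: ifP => _; rewrite ?mule0// -EFinD -EFinM ltry.
- apply: aeW => x N xI; have /andP[g0 gB'] := gB N.+1 x isT xI.
  by rewrite gee0_abs.
- by move=> _ _; rewrite integral0.
Qed.

End piecewise_functions.

Section left_point_steps.
Context (R : realType) d (Omega : measurableType d) (P : probability Omega R).
Variables (t T : R) (F : R -> set_system Omega) (rho : R -> R).
Hypothesis tT : t < T.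
Hypothesis filt : filtration F t T.
Hypothesis rho0 : forall x, x \in `[t, T] -> 0 <= rho x.
Hypothesis rhoC : {within `[t, T], continuous rho}.
Local Notation mu := (@lebesgue_measure R).
Local Notation L2 f := (square_integrable P setT f).

Lemma class_H2_measurable a b (f : R -> R) :
  class_H2 P F rho a b (fun s _ => f s) -> measurable_fun `[a, b] f.
Proof.
move=> [_ mf _].
apply: (@measurable_comp _ _ _ _ _ _ (`[a, b] `*` [set: Omega])
  (fun z : measurableTypeR R * Omega => f z.1) _ (fun x => (x, point))) => //.
- by apply: measurableX => //; exact: measurable_itv.
- by move=> _ [x xab <-].
- by apply: measurable_funTS; apply: measurable_fun_pair => //; exact: measurable_cst.
Qed.

Definition left_step (tau : nat -> R) N (f : R -> R) (s : R) : R :=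
  \sum_(j < N) (tau j <= s < tau j.+1)%R%:R * f (tau j).

(** The step process with deterministic values is evaluated at an arbitrary sample point, which is
    why Omega is an argument of purely deterministic lemmas. *)
Lemma left_stepE tau N f j s : (forall j, (j < N)%N -> tau j < tau j.+1) ->
  (j < N)%N -> tau j <= s < tau j.+1 -> left_step tau N f s = f (tau j).
Proof.
move=> pS jN js.
by have := congr1 (fun g => g point) (step_processE (Omega := Omega) (fun j => cst (f (tau j))) pS jN js).
Qed.

Lemma measurable_left_step tau N f : measurable_fun setT (left_step tau N f).
Proof.
apply: measurable_sum => j; apply: measurable_funM; last exact: measurable_cst.
rewrite (_ : (fun s => _) = \1_(`[tau j, tau j.+1[%classic)); first exact: measurable_indic.
by apply/funext => z /=; rewrite indicE mem_setE/= in_itv.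
Qed.

Variables (tau : nat -> nat -> R) (f : R -> R) (S : seq R) (B : R).
Hypothesis ptau : partition_sequence t T tau.
Hypothesis mf : measurable_fun `[t, T] f.
Hypothesis fB : forall x, x \in `[t, T] -> `|f x| <= B.
Hypothesis fC : forall x, x \in `[t, T] -> x \notin S ->
  f y @[y --> within [set` `[t, T]] (nbhs x)] --> f x.

Lemma partition_seq_itv N j : (0 < N)%N -> (j <= N)%N -> tau N j \in `[t, T].
Proof.
move=> N0 jN; have [/(_ N N0)[p0 pN] /(_ N) pS _] := ptau.
by rewrite in_itv/= -{1}p0 -pN (partition_le pS (leq0n _) jN) (partition_le pS jN (leqnn _)).
Qed.

Let B0 : 0 <= B.
Proof. by apply: le_trans (fB (x := t) _) => //; rewrite in_itv/= lexx ltW. Qed.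

Lemma left_step_bound N x : (0 < N)%N -> `|left_step (tau N) N f x| <= B.
Proof.
move=> N0; have [/(_ N N0)[p0 pN] /(_ N) pS _] := ptau.
have [[j jN js]|nj] := pselect (exists2 j, (j < N)%N & tau N j <= x < tau N j.+1).
  by rewrite (left_stepE f pS jN js) fB// partition_seq_itv// ltnW.
rewrite /left_step big1 ?normr0// => j _.
have [h|_] := boolP (tau N j <= x < tau N j.+1); last by rewrite mul0r.
by exfalso; apply: nj; exists j.
Qed.

(** T is exceptional because the last cell is open on the right and [left_step] is 0 there. *)
Lemma left_step_cvg x : x \in `[t, T] -> x \notin T :: S ->
  left_step (tau N) N f x @[N --> \oo] --> f x.
Proof.
move=> xI; rewrite inE negb_or => /andP[xT xS].
apply/cvgrPdist_lt => e e0; have [N0 HN0] := left_point_cvg ptau (fC xI xS) e0.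
near=> N; have N1 : (0 < N)%N by near: N; exact: nbhs_infty_gt.
have [/(_ N N1)[p0 pN] /(_ N) pS _] := ptau.
move: xI; rewrite in_itv/= => /andP[tx xT'].
have xltT : x < T by rewrite lt_neqAle xT.
have [j jN js] := partition_cell pS (x := x) ltac:(by rewrite p0) ltac:(by rewrite pN).
rewrite (left_stepE f pS jN js) distrC; apply: HN0 => //.
by near: N; exact: nbhs_infty_ge.
Unshelve. all: by end_near. Qed.

Let g N s := (((left_step (tau N) N f s - f s) ^+ 2) * rho s)%:E.

Lemma left_step_energy_measurable N : measurable_fun `[t, T] (g N).
Proof.
apply/measurable_EFinP; apply: measurable_funM; last exact: rho_measurable.
apply: measurable_funX; apply: measurable_funB => //.
by apply: measurable_funTS; exact: measurable_left_step.
Qed.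

Lemma left_step_energy_cvg : (\int[mu]_(s in `[t, T]) g N s)%E @[N --> \oo] --> 0%E.
Proof.
have [Br Br0 HBr] := rho_bounded rho0 rhoC (ltW tT).
apply: (@dominated_cvg0 _ t T (T :: S) g ((2 * B) ^+ 2 * Br)).
- by move=> N _; exact: left_step_energy_measurable.
- move=> N x N0 xI; rewrite !lee_fin mulr_ge0 ?sqr_ge0 ?rho0//=.
  move: (xI); rewrite in_itv/= => /andP[tx xT].
  apply: ler_pM; rewrite ?sqr_ge0 ?rho0 ?HBr//.
  rewrite -(real_normK (num_real (_ - _))) lerXn2r ?nnegrE ?mulr_ge0//.
  rewrite (le_trans (ler_normB _ _))// mulr_natl mulr2n lerD ?fB//.
  exact: left_step_bound.
- move=> x xI xS; apply: cvg_EFin; first exact: nearW.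
  rewrite -(mul0r (rho x)); apply: cvgMl.
  rewrite [X in _ --> X](_ : 0 = (f x - f x) * (f x - f x)); last by rewrite subrr mulr0.
  under eq_fun do rewrite expr2.
  by apply: cvgM; apply: cvgB; (exact: cvg_cst || exact: left_step_cvg).
Qed.

(** Ties the abstract definition of the integral to the given partitions: with boundedness and
    continuity off a finite set, left-point values are one of the step approximations over which the
    definition quantifies. *)
Lemma left_step_approximation :
  class_H2 P F rho t T (fun s _ => f s) ->
  step_approximation P F rho t T (fun s _ => f s) tau
    (fun N => step_process N (tau N) (fun j => cst (f (tau N j)))).
Proof.
move=> fH; split=> //.
- move=> N N0; have [/(_ N N0)[p0 pN] /(_ N) pS _] := ptau.
  apply: (step_class_H2 filt rho0 rhoC (lexx t) (lexx T) p0 pN pS) => j jN.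
  have := partition_seq_itv N0 (ltnW jN); rewrite in_itv/= => /andP[tj jT].
  split; first exact: (measurable_wrt_cst (filtration_sigma filt tj jT)).
  apply/L2P; split; first exact: measurable_cst.
  apply: (mint_eq (f := fun=> f (tau N j) ^+ 2)) => //; exact: finite_measure_integrable_cst.
- move=> N j jN s; rewrite in_itv/= => js; have [_ /(_ N) pS _] := ptau.
  rewrite (step_processE _ pS jN js) (step_processE _ pS jN)//.
  by rewrite lexx pS.
- have := left_step_energy_cvg.
  rewrite (_ : (fun N => _) = (fun N => \int[mu]_(s in `[t, T])
   ('E_P[fun w => (`|step_process N (tau N) (fun j => cst (f (tau N j))) s w - f s| ^+ 2)%R] * (rho s)%:E))%E)//.
  apply/funext => N; apply: eq_integral => s _; rewrite /g EFinM; congr (_ * _)%E.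
  rewrite -(expectation_cst P ((left_step (tau N) N f s - f s) ^+ 2)).
  by congr ('E_P[_])%E; apply/funext => w; rewrite real_normK ?num_real.
Qed.

End left_point_steps.

(** Binomial expansion around x. The term linear in y is kept exactly, because its mean is 0 for a
    martingale increment y. The terms of order at least 2 in y are bounded by x^(2q) y^2 + y^(2q+2),
    and their coefficients sum to at most 2^(2q+2). *)
Lemma even_power_expansion (R : realFieldType) (x y : R) q :
  (x + y) ^+ (2 * q.+1) <= x ^+ (2 * q.+1) + (2 * q.+1)%:R * (x ^+ (2 * q).+1 * y) +
    2 ^+ (2 * q.+1) * (x ^+ (2 * q) * y ^+ 2 + y ^+ (2 * q.+1)).
Proof.
set m := (2 * q)%N; have -> : (2 * q.+1 = m.+2)%N by rewrite /m mulnS.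
have ev (z : R) : 0 <= z ^+ m by rewrite /m exprM exprn_ge0// sqr_ge0.
have ev2 (z : R) : 0 <= z ^+ m.+2 by rewrite -addn2 exprD mulr_ge0// sqr_ge0.
have mono i : (i <= m)%N -> x ^+ (m - i) * y ^+ i.+2 <= x ^+ m * y ^+ 2 + y ^+ m.+2.
  move=> im; apply: le_trans (ler_norm _) _; rewrite normrM !normrX.
  have -> : x ^+ m = `|x| ^+ m by rewrite -normrX ger0_norm.
  have -> : y ^+ m.+2 = `|y| ^+ m.+2 by rewrite -normrX ger0_norm.
  have -> : y ^+ 2 = `|y| ^+ 2 by rewrite real_normK ?num_real.
  have := normr_ge0 x; have := normr_ge0 y; move: `|x| `|y| => a b b0 a0.
  have [ba|/ltW ab] := leP b a.
    apply: (@le_trans _ _ (a ^+ m * b ^+ 2)); last by rewrite lerDl exprn_ge0.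
    rewrite -addn2 exprD mulrA ler_wpM2r ?exprn_ge0//.
    rewrite -[in leRHS](subnK im) exprD ler_wpM2l ?exprn_ge0//.
    by rewrite lerXn2r ?nnegrE.
  apply: (@le_trans _ _ (b ^+ m.+2)); last by rewrite lerDr mulr_ge0 ?exprn_ge0.
  have -> : m.+2 = (m - i + i.+2)%N by rewrite -{1}(subnK im) !addnS.
  by rewrite exprD ler_wpM2r ?exprn_ge0// lerXn2r ?nnegrE.
have b2 : 2 ^+ m.+2 = \sum_(i < m.+3) ('C(m.+2, i))%:R :> R.
  rewrite -[2%:R]/(1 + 1) exprDn; apply: eq_bigr => i _.
  by rewrite !expr1n mulr1.
rewrite 2!big_ord_recl in b2.
rewrite exprDn 2!big_ord_recl subn0 expr0 mulr1 bin0 mulr1n -addrA lerD2l.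
rewrite [X in X + _ <= _](_ : _ = m.+2%:R * (x ^+ m.+1 * y)); last first.
  by rewrite /bump/= subSS subn0 bin1 mulr_natl expr1.
rewrite lerD2l b2.
set W := _ + y ^+ m.+2.
have W0 : 0 <= W by rewrite addr_ge0// mulr_ge0// sqr_ge0.
rewrite addrA mulrDl; apply: ler_wpDl; first by rewrite mulr_ge0// addr_ge0.
rewrite mulr_suml; apply: ler_sum => i _.
rewrite /bump/= ?add1n !subSS -mulr_natl ler_wpM2l//.
by apply: mono; rewrite -ltnS.
Qed.

(** * Moments of integral sums with deterministic coefficients *)

Section increment_sums.
Context (R : realType) d (Omega : measurableType d) (P : probability Omega R).
Variables (t T : R) (F : R -> set_system Omega) (rho : R -> R) (M : R -> Omega -> R).
Hypothesis tT : t < T.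
Hypothesis filt : filtration F t T.
Hypothesis M2 : class_M2 P F rho t T M.
Variable C : R.
Hypothesis C0 : 0 <= C.
Hypothesis CV : conditional_variance_bound P t T F rho M C.
Local Notation mu := (@lebesgue_measure R).
Local Notation L2 f := (square_integrable P setT f).
Local Notation mint f := (P.-integrable setT (EFin \o f)).
Local Notation Lam := (Lam t rho).

Lemma M2_rho0 : forall x, x \in `[t, T] -> 0 <= rho x.
Proof. by case: M2 => -[]. Qed.

Lemma M2_rhoC : {within `[t, T], continuous rho}.
Proof. by case: M2 => -[_ []]. Qed.

Lemma M2_mart : martingale P F t T M.
Proof. by case: M2. Qed.

Let mM s : t <= s -> s <= T -> measurable_fun setT (M s).
Proof. exact: (martingale_measurable filt M2_mart). Qed.

Let mD u v : t <= u -> u <= v -> v <= T -> measurable_fun setT (fun w => M v w - M u w).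
Proof.
by move=> tu uv vT; apply: measurable_funB; apply: mM => //;
  [exact: le_trans tu uv|exact: le_trans uv vT].
Qed.

Lemma increment_L2 u v : t <= u -> u <= v -> v <= T ->
  L2 (fun w => M v w - M u w) /\ nrm P (fun w => M v w - M u w) = Lam v - Lam u.
Proof.
move=> tu; rewrite le_eqVlt => /orP[/eqP <-|uv] vT.
  rewrite (_ : (fun w => _) = fun=> 0); first by rewrite nrm0 subrr; split=> //; exact: L2_0.
  by apply/funext => w; rewrite subrr.
have [_ _ /(_ u v tu uv vT) + _] := M2.
rewrite (integral_rho M2_rhoC tu (ltW uv) vT) unlock => E.
have L : L2 (fun w => M v w - M u w).
  by split; [exact: mD (ltW uv) vT|rewrite E ltry].
by split=> //; move: E; rewrite -nrmE// => -[].
Qed.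

(** Order 2 is the variance, bounded through the Lipschitz constant of [Lam]; the orders 4, 6, ...
    are among those prescribed by the class M_2. *)
Lemma increment_moment q : exists2 L : R, 0 <= L & forall u v, t <= u -> u < v -> v <= T ->
  mint (fun w => (M v w - M u w) ^+ (2 * q.+1)) /\
  \int[P]_w ((M v w - M u w) ^+ (2 * q.+1)) <= L * (v - u).
Proof.
case: q => [|q].
  have [B B0 HB] := Lam_lip M2_rho0 M2_rhoC (ltW tT).
  exists B => // u v tu uv vT; have [/L2_sqr h1 h2] := increment_L2 tu (ltW uv) vT.
  by rewrite muln1; split=> //; rewrite -/(nrm P _) h2; apply: HB => //; exact: ltW.
have [_ _ _ /(_ (2 * q.+2)%N ltac:(by rewrite mulnS))[L HL]] := M2.
exists `|L| => // u v tu uv vT.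
have := HL u v tu uv vT; rewrite unlock => h.
have E w : `|M v w - M u w| ^+ (2 * q.+2) = (M v w - M u w) ^+ (2 * q.+2).
  by rewrite exprM real_normK ?num_real// -exprM.
have h' : (\int[P]_w ((M v w - M u w) ^+ (2 * q.+2))%:E <= (L * `|v - u|)%:E)%E.
  by apply: le_trans h; rewrite le_eqVlt; apply/orP; left; apply/eqP; apply: eq_integral => w _; rewrite E.
have i : mint (fun w => (M v w - M u w) ^+ (2 * q.+2)).
  apply/integrableP; split; first by apply/measurable_EFinP; apply: measurable_funX; exact: mD (ltW uv) vT.
  under eq_integral do rewrite /= ger0_norm ?even_pow_ge0//.
  by rewrite (le_lt_trans h')// ltry.
split=> //; rewrite -lee_fin /Rintegral fineK; last exact: integrable_fin_num i.
apply: le_trans h' _; rewrite lee_fin ger0_norm ?subr_ge0 ?(ltW uv)//.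
by rewrite ler_wpM2r ?subr_ge0 ?(ltW uv)// ler_norm.
Qed.

Definition increment_sum (p : nat -> R) (a : nat -> R) n (w : Omega) : R :=
  \sum_(j < n) a j * (M (p j.+1) w - M (p j) w).

Lemma increment_sum_moments (B : R) q : exists K : R, forall N p a,
  (forall j, (j < N)%N -> p j < p j.+1) -> t <= p 0%N -> p N <= T ->
  (forall j, (j < N)%N -> `|a j| <= B) -> forall n, (n <= N)%N ->
  mint (fun w => increment_sum p a n w ^+ (2 * q)) /\
  \int[P]_w (increment_sum p a n w ^+ (2 * q)) <= K.
Proof.
have [BL BL0 HBL] := Lam_lip M2_rho0 M2_rhoC (ltW tT).
elim: q => [|q [K' IH]].
  exists 1 => N p a _ _ _ _ n _; rewrite muln0; split.
    by apply: (mint_eq (f := fun=> 1)) => //; exact: finite_measure_integrable_cst.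
  rewrite (Rint_eq P (g := fun=> 1))//= Rintegral_cst//=.
  by have := probability_setT P; rewrite /= => ->; rewrite mulr1.
(* |S|^(2q+2-i) |D|^i <= S^(2q) D^2 + D^(2q+2) for i >= 2 bounds the growth of
   E S^(2q+2) over a cell by a multiple of the length of the cell. *)
have [L L0 HL] := increment_moment q.
(* The binomial factor; then the variance of the increment against S^(2q), whose mean the induction
   on q bounds by K'; then the moment of order 2q+2 of the increment itself. *)
pose G := 2 ^+ (2 * q.+1) * (B ^+ 2 * (C * BL * `|K'|) + B ^+ (2 * q.+1) * L).
have G0 : 0 <= G.
  apply: mulr_ge0; first exact: exprn_ge0.
  apply: addr_ge0; first by rewrite mulr_ge0 ?sqr_ge0// mulr_ge0// mulr_ge0.
  by rewrite mulr_ge0// even_pow_ge0.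
exists (G * (T - t)) => N p a pS tp pT aB.
have pI j : (j <= N)%N -> t <= p j /\ p j <= T.
  move=> jN; split.
    by apply: le_trans tp _; exact: (partition_le pS (leq0n _) jN).
  by apply: le_trans pT; exact: (partition_le pS jN (leqnn _)).
suff H n : (n <= N)%N -> mint (fun w => increment_sum p a n w ^+ (2 * q.+1)) /\
    \int[P]_w (increment_sum p a n w ^+ (2 * q.+1)) <= G * (p n - p 0%N).
  move=> n nN; have [h1 h2] := H n nN; split=> //; apply: le_trans h2 _.
  by rewrite ler_wpM2l// lerB//; have [] := pI n nN.
elim: n => [|n ihn] nN.
  split.
    apply: (mint_eq (f := fun=> 0)); last exact: finite_measure_integrable_cst.
    by move=> w; rewrite /increment_sum big_ord0 mulnS expr0n.
  rewrite subrr mulr0 (Rint_eq P (g := fun=> 0)) ?Rintegral_cst ?mul0r// => w.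
  by rewrite /increment_sum big_ord0 mulnS expr0n.
have [i1 l1] := ihn (ltnW nN); have [tn nT] := pI n (ltnW nN); have [tn1 n1T] := pI n.+1 nN.
have pn := pS n nN.
have [iq lq] := IH N p a pS tp pT aB n (ltnW nN).
have sF := filtration_sigma filt tn nT.
set S := increment_sum p a n in i1 l1 iq lq *.
pose D w := M (p n.+1) w - M (p n) w.
have aS : measurable_wrt (F (p n)) S.
  apply: (measurable_wrt_sum sF) => j _.
  apply: (measurable_wrtM sF); first exact: (measurable_wrt_cst sF).
  have jn := ltn_ord j; have jN := leq_trans jn (ltnW nN).
  have [tj jT] := pI j (ltnW jN); have [tj1 j1T] := pI j.+1 jN.
  apply: (measurable_wrtB sF).
    exact: (measurable_wrt_mono filt tj1 (partition_le pS jn (ltnW nN)) nT (martingale_adapted M2_mart tj1 j1T)).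
  exact: (measurable_wrt_mono filt tj (partition_le pS (ltnW jn) (ltnW nN)) nT (martingale_adapted M2_mart tj jT)).
have mS := measurable_wrt_measurable filt tn nT aS.
have mDn : measurable_fun setT D := mD tn (ltW pn) n1T.
have [iD lD] := HL _ _ tn pn n1T.
(* The conditional variance bound with Z = S^q. *)
have [LSD nSD] : L2 (fun w => S w ^+ q * D w) /\
    nrm P (fun w => S w ^+ q * D w) <= C * (Lam (p n.+1) - Lam (p n)) * nrm P (fun w => S w ^+ q).
  apply: CV => //; first exact: ltW.
  split; first exact: (measurable_wrtX sF).
  apply/L2P; split; first exact: measurable_funX.
  by apply: mint_eq iq => w; rewrite mulnC exprM.
have nSq : nrm P (fun w => S w ^+ q) <= `|K'|.
  apply: le_trans (ler_norm K'); apply: le_trans lq; rewrite le_eqVlt; apply/orP; left; apply/eqP.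
  by apply: Rint_eq => w; rewrite mulnC exprM.
have E w : increment_sum p a n.+1 w = S w + a n * D w.
  by rewrite /increment_sum big_ord_recr.
have iaD : mint (fun w => (a n * D w) ^+ (2 * q.+1)).
  by apply: (mint_eq _ (mintZ (a n ^+ (2 * q.+1)) iD)) => w; rewrite exprMn.
have i2 : mint (fun w => (S w + a n * D w) ^+ (2 * q.+1)).
  apply: (mint_le _ (mintZ (2 ^+ (2 * q.+1)) (mintD i1 iaD))).
    by apply: measurable_funX; apply: measurable_funD => //; apply: measurable_funM.
  by move=> w; rewrite ger0_norm ?even_pow_ge0//; exact: even_powD_le.
have i3 : mint (fun w => S w ^+ (2 * q).+1 * D w).
  apply: (mint_le _ (mintD i1 iD)).
    by apply: measurable_funM => //; exact: measurable_funX.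
  move=> w; rewrite normrM normrX.
  have -> : S w ^+ (2 * q.+1) = `|S w| ^+ (2 * q.+1).
    by rewrite [in RHS]exprM real_normK ?num_real// -exprM.
  have -> : (M (p n.+1) w - M (p n) w) ^+ (2 * q.+1) = `|D w| ^+ (2 * q.+1).
    by rewrite [in RHS]exprM real_normK ?num_real// -exprM.
  have := normr_ge0 (S w); have := normr_ge0 (D w); move: `|S w| `|D w| => x y y0 x0.
  rewrite mulnS addnC addn2; have [yx|/ltW xy] := leP y x.
    apply: (@le_trans _ _ (x ^+ (2 * q).+2)); last by rewrite lerDl exprn_ge0.
    by rewrite [leRHS]exprSr ler_wpM2l ?exprn_ge0.
  apply: (@le_trans _ _ (y ^+ (2 * q).+2)); last by rewrite lerDr exprn_ge0.
  by rewrite [leRHS]exprSr ler_wpM2r// lerXn2r ?nnegrE.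
have z3 : \int[P]_w (S w ^+ (2 * q).+1 * D w) = 0.
  by apply: (martingale_orth filt M2_mart tn (ltW pn) n1T _ i3); exact: (measurable_wrtX sF).
have i4 := L2_sqr LSD.
split; first by apply: mint_eq i2 => w; rewrite E.
rewrite (Rint_eq P (g := fun w => (S w + a n * D w) ^+ (2 * q.+1))); last by move=> w; rewrite E.
have i5 : mint (fun w => a n ^+ 2 * (S w ^+ q * D w) ^+ 2 + a n ^+ (2 * q.+1) * D w ^+ (2 * q.+1)).
  by apply: mintD; exact: mintZ.
apply: (@le_trans _ _ (\int[P]_w ((S w ^+ (2 * q.+1) + ((2 * q.+1)%:R * a n) * (S w ^+ (2 * q).+1 * D w)) +
    2 ^+ (2 * q.+1) * (a n ^+ 2 * (S w ^+ q * D w) ^+ 2 + a n ^+ (2 * q.+1) * D w ^+ (2 * q.+1))))).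
  apply: Rint_le => //.
    by apply: mintD; [apply: mintD => //; exact: mintZ|exact: mintZ].
  move=> w; apply: le_trans (even_power_expansion (S w) (a n * D w) q) _.
  rewrite le_eqVlt; apply/orP; left; apply/eqP.
  have X : S w ^+ (2 * q) = S w ^+ q ^+ 2 by rewrite mulnC exprM.
  by rewrite !exprMn X; ring.
rewrite RintD; [|by apply: mintD => //; exact: mintZ|exact: mintZ].
rewrite RintD//; last exact: mintZ.
rewrite RintZ// z3 mulr0 addr0 RintZ// RintD; [|exact: mintZ..].
rewrite !RintZ// -/(nrm P _).
have -> : G * (p n.+1 - p 0%N) = G * (p n - p 0%N) + G * (p n.+1 - p n) by ring.
apply: lerD => //; rewrite /G -mulrA ler_wpM2l ?exprn_ge0//.
rewrite mulrDl; apply: lerD.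
  apply: (@le_trans _ _ (B ^+ 2 * (C * (BL * (p n.+1 - p n)) * `|K'|))); last first.
    by rewrite le_eqVlt; apply/orP; left; apply/eqP; ring.
  apply: ler_pM; rewrite ?sqr_ge0 ?nrm_ge0//.
    rewrite -(real_normK (num_real (a n))) lerXn2r ?nnegrE ?(le_trans _ (aB n nN))//.
  apply: le_trans nSD _; apply: ler_pM; rewrite ?nrm_ge0//.
    by rewrite mulr_ge0// subr_ge0 (Lam_le M2_rho0 M2_rhoC tn (ltW pn) n1T).
  by rewrite ler_wpM2l//; exact: (HBL _ _ tn (ltW pn) n1T).
rewrite -mulrA; apply: ler_pM => //; first exact: even_pow_ge0.
  by apply: Rintegral_ge0 => w _; exact: even_pow_ge0.
rewrite !exprM lerXn2r ?nnegrE ?sqr_ge0//.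
rewrite -(real_normK (num_real (a n))) lerXn2r ?nnegrE ?(le_trans _ (aB n nN))//.
Qed.

End increment_sums.

Section cell_integrals.
Context (R : realType).
Variables (t T : R) (rho : R -> R).
Hypothesis tT : t < T.
Hypothesis rho0 : forall x, x \in `[t, T] -> 0 <= rho x.
Hypothesis rhoC : {within `[t, T], continuous rho}.
Local Notation mu := (@lebesgue_measure R).
Local Notation Lam := (Lam t rho).
Variables (p : nat -> R) (N : nat).
Hypotheses (p0 : p 0%N = t) (pN : p N = T) (pS : forall j, (j < N)%N -> p j < p j.+1).

Lemma partition_point_itv j : (j <= N)%N -> t <= p j /\ p j <= T.
Proof.
by move=> jN; rewrite -{1}p0 -pN (partition_le pS (leq0n _) jN) (partition_le pS jN (leqnn _)).
Qed.

Definition cell_rho j : R -> R := rho \_ `[p j, p j.+1[.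

Lemma cell_rho_integrable j : (j < N)%N -> mu.-integrable setT (EFin \o cell_rho j).
Proof.
move=> jN; have [tj _] := partition_point_itv (ltnW jN); have [_ jT] := partition_point_itv jN.
rewrite /cell_rho -restrict_EFin; apply/integrable_restrict => //.
rewrite setTI; apply: (integrableS _ _ _ (rho_integrable rhoC tj jT)) => //.
by move=> x /=; rewrite !in_itv/= => /andP[-> /ltW ->].
Qed.

Lemma cell_rho_integral j : (j < N)%N -> \int[mu]_x cell_rho j x = Lam (p j.+1) - Lam (p j).
Proof.
move=> jN; have [tj _] := partition_point_itv (ltnW jN); have [_ jT] := partition_point_itv jN.
rewrite /cell_rho -Rintegral_mkcond Rintegral_itv_bndo_bndc; last first.
  apply: (integrableS _ _ _ (rho_integrable rhoC tj jT)) => //.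
  by move=> x /=; rewrite !in_itv/= => /andP[-> /ltW ->].
by rewrite /Rintegral (integral_rho rhoC tj (ltW (pS jN)) jT).
Qed.

Lemma left_step_rho (h : R -> R) :
  ((fun x => left_step p N h x * rho x) \_ `[t, T]) =
  (fun x => \sum_(j < N) h (p j) * cell_rho j x).
Proof.
apply/funext => x; rewrite patchE; case: ifPn => [xI|/negP xI].
  rewrite /left_step mulr_suml; apply: eq_bigr => j _.
  rewrite /cell_rho patchE mem_setE in_itv/=.
  by case: (_ && _); rewrite ?mul1r// !mul0r mulr0.
rewrite big1// => j _; rewrite /cell_rho patchE mem_setE in_itv/=.
have [/andP[jx xj]|_] := boolP (_ <= _ < _); last by rewrite mulr0.
exfalso; apply: xI; rewrite mem_setE in_itv/=.
have [tj _] := partition_point_itv (ltnW (ltn_ord j)); have [_ jT] := partition_point_itv (ltn_ord j).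
by rewrite (le_trans tj jx) (le_trans (ltW xj) jT).
Qed.

Lemma left_step_rho_integrable (h : R -> R) :
  mu.-integrable `[t, T] (EFin \o (fun x => left_step p N h x * rho x)).
Proof.
apply/integrable_mkcond => //; rewrite restrict_EFin left_step_rho.
by apply: mint_sum => j _; apply: mintZ; exact: cell_rho_integrable.
Qed.

Lemma left_step_rho_integral (h : R -> R) :
  \int[mu]_(x in `[t, T]) (left_step p N h x * rho x) =
  \sum_(j < N) h (p j) * (Lam (p j.+1) - Lam (p j)).
Proof.
rewrite Rintegral_mkcond left_step_rho Rint_sum.
  by apply: eq_bigr => j _; rewrite RintZ ?cell_rho_integral//; exact: cell_rho_integrable.
by move=> j _; apply: mintZ; exact: cell_rho_integrable.
Qed.

End cell_integrals.

Section riemann_sums.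
Context (R : realType) d (Omega : measurableType d).
Variables (t T : R) (rho : R -> R).
Hypothesis tT : t < T.
Hypothesis rho0 : forall x, x \in `[t, T] -> 0 <= rho x.
Hypothesis rhoC : {within `[t, T], continuous rho}.
Local Notation mu := (@lebesgue_measure R).
Local Notation Lam := (Lam t rho).
Variables (tau : nat -> nat -> R) (f : R -> R) (S : seq R) (B : R).
Hypothesis ptau : partition_sequence t T tau.
Hypothesis mf : measurable_fun `[t, T] f.
Hypothesis fB : forall x, x \in `[t, T] -> `|f x| <= B.
Hypothesis fC : forall x, x \in `[t, T] -> x \notin S ->
  f y @[y --> within [set` `[t, T]] (nbhs x)] --> f x.

(** Riemann-Stieltjes sums with respect to [Lam] are integrals of left-point step functions against
    rho, so dominated convergence applies, and continuity off a finite set is enough. *)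
Lemma riemann_sum_cvg :
  \sum_(j < N) f (tau N j) * (Lam (tau N j.+1) - Lam (tau N j)) @[N --> \oo] -->
  \int[mu]_(x in `[t, T]) (f x * rho x).
Proof.
have [Br Br0 HBr] := rho_bounded rho0 rhoC (ltW tT).
have B0 : 0 <= B by apply: le_trans (fB (x := t) _) => //; rewrite in_itv/= lexx ltW.
have mrho : measurable_fun `[t, T] rho := rho_measurable rhoC.
have ifr : mu.-integrable `[t, T] (EFin \o (fun x => f x * rho x)).
  apply: (measurable_bounded_integrable _) => //.
  - by rewrite /= lebesgue_measure_itv/=; case: ifP => _; rewrite ?ltry// -EFinD ltry.
  - exact: measurable_funM.
  - exists (B * Br); split; first exact: num_real.
    move=> x xB y /= yI; rewrite normrM (le_trans _ (ltW xB))// ler_pM ?fB//.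
    by rewrite ger0_norm ?rho0// HBr//; move: yI; rewrite in_itv/= => /andP[].
have main : (\int[mu]_(x in `[t, T]) (`|left_step (tau N) N f x - f x| * rho x)%:E)%E @[N --> \oo] --> 0%E.
  apply: (@dominated_cvg0 _ t T (T :: S) (fun N x => (`|left_step (tau N) N f x - f x| * rho x)%:E) ((2 * B) * Br)).
  - move=> N N0; apply/measurable_EFinP; apply: measurable_funM => //.
    apply: measurableT_comp => //; apply: measurable_funB => //.
    by apply: measurable_funTS; exact: (measurable_left_step (tau N)).
  - move=> N x N0 xI; rewrite !lee_fin mulr_ge0 ?rho0//=.
    move: (xI); rewrite in_itv/= => /andP[tx xT].
    apply: ler_pM; rewrite ?rho0 ?HBr// (le_trans (ler_normB _ _))//.
    by rewrite mulr_natl mulr2n lerD ?fB//; apply: (left_step_bound Omega tT ptau fB).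
  - move=> x xI xS; apply: cvg_EFin; first exact: nearW.
    rewrite -(mul0r (rho x)); apply: cvgMl; apply/norm_cvg0P; apply/subr_cvg0.
    exact: (left_step_cvg Omega ptau fC).
have /fine_cvgP[_ main'] := main.
apply/subr_cvg0/norm_cvg0P; rewrite -(cvg_shiftS _).
apply: (@squeeze_cvgr _ _ _ _ (fun=> 0) (fun N => \int[mu]_(x in `[t, T]) (`|left_step (tau N.+1) N.+1 f x - f x| * rho x))); last 2 first.
- exact: cvg_cst.
- by rewrite (cvg_shiftS (fun N => \int[mu]_(x in `[t, T]) (`|left_step (tau N) N f x - f x| * rho x))); exact: main'.
apply: nearW => n; rewrite normr_ge0/=; set N := n.+1.
have N0 : (0 < N)%N by [].
have [/(_ N N0)[p0 pN] /(_ N) pS _] := ptau.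
have iN := left_step_rho_integrable rhoC p0 pN pS f.
rewrite -(left_step_rho_integral rhoC p0 pN pS) -RintegralB//.
have iD : mu.-integrable `[t, T] (EFin \o (fun x => left_step (tau N) N f x * rho x - f x * rho x)).
  exact: (integrableB _ iN ifr).
apply: le_trans (le_normr_Rintegral _ iD) _ => //.
rewrite le_eqVlt; apply/orP; left; apply/eqP; apply: eq_Rintegral => x xI.
by rewrite -mulrBl normrM (ger0_norm (rho0 _))//; move: xI; rewrite inE.
Qed.

End riemann_sums.

(** * Integrals of deterministic functions as limits of left-point sums *)

Section integral_limits.
Context (R : realType) d (Omega : measurableType d) (P : probability Omega R).
Variables (t T : R) (F : R -> set_system Omega) (rho : R -> R) (M : R -> Omega -> R).
Hypothesis tT : t < T.
Hypothesis filt : filtration F t T.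
Hypothesis M2 : class_M2 P F rho t T M.
Variable C : R.
Hypothesis C0 : 0 <= C.
Hypothesis CV : conditional_variance_bound P t T F rho M C.
Local Notation mu := (@lebesgue_measure R).
Local Notation L2 f := (square_integrable P setT f).
Local Notation mint f := (P.-integrable setT (EFin \o f)).
Local Notation Lam := (Lam t rho).
Variable tau : nat -> nat -> R.
Hypothesis ptau : partition_sequence t T tau.

Lemma partition_sequence_itv N j : (0 < N)%N -> (j <= N)%N -> t <= tau N j /\ tau N j <= T.
Proof. by move=> N0 jN; have := partition_seq_itv ptau N0 jN; rewrite in_itv/= => /andP[]. Qed.

Lemma increment_cell_L2 N j : (j < N)%N ->
  L2 (fun w => M (tau N j.+1) w - M (tau N j) w) /\
  nrm P (fun w => M (tau N j.+1) w - M (tau N j) w) = Lam (tau N j.+1) - Lam (tau N j).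
Proof.
move=> jN; have N0 := leq_ltn_trans (leq0n _) jN; have [_ /(_ N) pS _] := ptau.
have [tj _] := partition_sequence_itv N0 (ltnW jN); have [_ jT] := partition_sequence_itv N0 jN.
exact: (increment_L2 filt M2 tj (ltW (pS _ jN)) jT).
Qed.

Lemma increment_sum_L2 (a : nat -> R) N : L2 (increment_sum M (tau N) a N).
Proof.
by apply: L2_sum => j _; apply: L2Z; have [] := increment_cell_L2 (ltn_ord j).
Qed.

Lemma adaptedL2_cst (c : R) s : t <= s -> s <= T -> adaptedL2 P F s (fun=> c).
Proof.
move=> ts sT; split; first exact: (measurable_wrt_cst (filtration_sigma filt ts sT)).
apply/L2P; split; first exact: measurable_cst.
by apply: (mint_eq (f := fun=> c ^+ 2)) => //; exact: finite_measure_integrable_cst.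
Qed.

(** The factor 1 writes the expectation as an inner product with a constant, the form in which
    [cvg2_Rint_mul] passes to the limit. *)
Lemma increment_sum_expectation (a : nat -> R) N : \int[P]_w (increment_sum M (tau N) a N w * 1) = 0.
Proof.
rewrite (Rint_eq P (g := fun w => \sum_(j < N) 1 * (a j * (M (tau N j.+1) w - M (tau N j) w)))); last first.
  by move=> w; rewrite mulr1; apply: eq_bigr => j _; rewrite mul1r.
have H (j : 'I_N) : mint (fun w => 1 * (a j * (M (tau N j.+1) w - M (tau N j) w))) /\
    \int[P]_w (1 * (a j * (M (tau N j.+1) w - M (tau N j) w))) = 0.
  have jN := ltn_ord j; have N0 := leq_ltn_trans (leq0n _) jN; have [_ /(_ N) pS _] := ptau.
  have [tj jT'] := partition_sequence_itv N0 (ltnW jN); have [_ jT] := partition_sequence_itv N0 jN.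
  split.
    apply: L2M_int; first by case: (adaptedL2_cst 1 tj jT').
    by apply: L2Z; have [] := increment_cell_L2 jN.
  exact: (martingale_L2_orth filt (M2_mart M2) CV tj (ltW (pS _ jN)) jT (adaptedL2_cst 1 tj jT')
    (adaptedL2_cst (a j) tj jT')).
by rewrite Rint_sum => [|j _]; [apply: big1 => j _; case: (H j)|case: (H j)].
Qed.

Lemma increment_sum_product (a b : nat -> R) N :
  \int[P]_w (increment_sum M (tau N) a N w * increment_sum M (tau N) b N w) =
  \sum_(j < N) a j * b j * (Lam (tau N j.+1) - Lam (tau N j)).
Proof.
pose D j w := M (tau N j.+1) w - M (tau N j) w.
have LD (c : R) (j : 'I_N) : L2 (fun w => c * D j w).
  by apply: L2Z; have [] := increment_cell_L2 (ltn_ord j).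
have iij (i j : 'I_N) : mint (fun w => (a i * D i w) * (b j * D j w)) by exact: L2M_int.
rewrite (Rint_eq P (g := fun w => \sum_(i < N) \sum_(j < N) (a i * D i w) * (b j * D j w))); last first.
  by move=> w; rewrite /increment_sum mulr_suml; apply: eq_bigr => i _; rewrite mulr_sumr.
rewrite Rint_sum; last by move=> i _; apply: mint_sum => j _; exact: iij.
apply: eq_bigr => i _; rewrite Rint_sum; last by move=> j _; exact: iij.
have [_ /(_ N) pS _] := ptau.
have z (x y : R) k l : (k < l)%N -> (l < N)%N -> \int[P]_w ((x * D k w) * (y * D l w)) = 0.
  move=> kl lN; have kN := ltn_trans kl lN; have N0 := leq_ltn_trans (leq0n _) lN.
  have [tk kT] := partition_sequence_itv N0 (ltnW kN).
  have [tl lT] := partition_sequence_itv N0 (ltnW lN); have [_ lT1] := partition_sequence_itv N0 lN.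
  apply: (martingale_L2_orth filt (M2_mart M2) CV tl (ltW (pS _ lN)) lT1); last exact: adaptedL2_cst.
  apply: (increment_adaptedL2 filt (M2_mart M2) CV tk (ltW (pS _ kN)) _ lT (adaptedL2_cst x tk kT)).
  exact: (partition_le pS kl (ltnW lN)).
rewrite (bigD1 i)//= big1 ?addr0; last first.
  move=> j ji; case: (ltngtP i j) => ij; first exact: z.
    by rewrite -(z (b j) (a i) j i ij (ltn_ord i)); apply: Rint_eq => w; rewrite mulrC.
  by move/eqP : ji; case; apply: val_inj.
rewrite (Rint_eq P (g := fun w => a i * b i * D i w ^+ 2)); last by move=> w; ring.
have [LDi nDi] := increment_cell_L2 (ltn_ord i).
by rewrite RintZ; [rewrite -/(nrm P _) nDi|exact: L2_sqr].
Qed.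

Lemma increment_sum_bounded_moments (a : nat -> nat -> R) (B : R) :
  (forall N j, (j < N)%N -> `|a N j| <= B) ->
  bounded_moments P (fun N => increment_sum M (tau N) (a N) N).
Proof.
move=> aB; split; first by move=> N; exact: L2_meas (increment_sum_L2 _ _).
move=> q; have [K HK] := increment_sum_moments tT filt M2 C0 CV B q.
have [K0 HK0] := increment_sum_moments tT filt M2 C0 CV B q.
exists K => N; case: N => [|N].
  (* The row [tau 0] is no partition; the empty sum is rewritten over a constant sequence of
     times. *)
  have := HK 0%N (fun=> t) (fun=> 0) ltac:(by []) (lexx _) (ltW tT) ltac:(by []) 0%N (leqnn _).
  rewrite (_ : increment_sum M (tau 0) _ 0 = increment_sum M (fun=> t) (fun=> 0) 0)//.
  by apply/funext => w; rewrite /increment_sum !big_ord0.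
have [/(_ N.+1 isT)[p0 pN] /(_ N.+1) pS _] := ptau.
by apply: HK (leqnn _) => //; [rewrite p0|rewrite pN|move=> j jN; exact: aB].
Qed.

Variables (f : R -> R) (S : seq R) (B : R).
Hypothesis fB : forall x, x \in `[t, T] -> `|f x| <= B.
Hypothesis fC : forall x, x \in `[t, T] -> x \notin S ->
  f y @[y --> within [set` `[t, T]] (nbhs x)] --> f x.

(** Left-point sums are the integral sums of one particular step approximation, so they converge.
    The limit is square integrable, being the difference of a square-integrable sum and a
    square-integrable error. *)
Lemma stochastic_integral_limit X : stochastic_integral P F rho M t T (fun s _ => f s) X ->
  [/\ L2 X, cvg2 P (fun N => increment_sum M (tau N) (fun j => f (tau N j)) N) X &
    bounded_moments P (fun N => increment_sum M (tau N) (fun j => f (tau N j)) N)].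
Proof.
move=> [H2f _ SI].
have mf := class_H2_measurable H2f.
have := SI _ _ (left_step_approximation tT filt (M2_rho0 M2) (M2_rhoC M2) ptau mf fB fC H2f).
have E N : (fun w => \sum_(j < N) step_process N (tau N) (fun j => cst (f (tau N j))) (tau N j) w *
   (M (tau N j.+1) w - M (tau N j) w)) = increment_sum M (tau N) (fun j => f (tau N j)) N.
  apply/funext => w; apply: eq_bigr => j _; have [_ /(_ N) pS _] := ptau.
  by rewrite (step_processE _ pS (ltn_ord j))// lexx pS.
under eq_fun do rewrite E.
move=> /ms_limit_L2 ms.
have {}ms := ms (fun n _ => L2_meas (increment_sum_L2 _ n)).
have LX : L2 X.
  have [n0 /(_ _ (leqnn n0))[L _]] := ms 1 ltr01.
  by apply: (L2_eq _ (L2B (increment_sum_L2 (fun j => f (tau n0 j)) n0) L)) => w; rewrite subKr.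
split=> //; first by move=> e /ms[n0 Hn0]; exists n0 => n /Hn0[].
apply: increment_sum_bounded_moments => N j jN; apply: fB.
by apply: (partition_seq_itv ptau _ (ltnW jN)); exact: leq_ltn_trans jN.
Qed.

Lemma stochastic_integral_expectation X : stochastic_integral P F rho M t T (fun s _ => f s) X ->
  \int[P]_w X w = 0.
Proof.
move=> /stochastic_integral_limit[LX cX _].
have L1 : L2 (fun=> 1) by case: (adaptedL2_cst 1 (lexx t) (ltW tT)).
have := cvg2_Rint_mul (fun n => increment_sum_L2 _ n) LX (fun=> L1) L1 cX (@cvg2_cst _ _ _ P (fun=> 1)).
under eq_fun do rewrite increment_sum_expectation.
move=> /cvg_lim; rewrite lim_cst// => ->//.
by apply: Rint_eq => w; rewrite mulr1.
Qed.

End integral_limits.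

Section covariance_integrals.
Context (R : realType) d (Omega : measurableType d) (P : probability Omega R).
Variables (t T : R) (F : R -> set_system Omega) (rho : R -> R) (M : R -> Omega -> R).
Hypothesis tT : t < T.
Hypothesis filt : filtration F t T.
Hypothesis M2 : class_M2 P F rho t T M.
Variable C : R.
Hypothesis C0 : 0 <= C.
Hypothesis CV : conditional_variance_bound P t T F rho M C.
Variable tau : nat -> nat -> R.
Hypothesis ptau : partition_sequence t T tau.
Local Notation mu := (@lebesgue_measure R).
Local Notation L2 f := (square_integrable P setT f).

(** The mean of the product of two left-point sums is a Riemann sum of f g rho, and both sides pass
    to the limit. *)
Lemma covariance_stochastic_integrals (f g : R -> R) (Sf Sg : seq R) (Bf Bg : R) X Y :
  (forall x, x \in `[t, T] -> `|f x| <= Bf) ->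
  (forall x, x \in `[t, T] -> `|g x| <= Bg) ->
  (forall x, x \in `[t, T] -> x \notin Sf -> f y @[y --> within [set` `[t, T]] (nbhs x)] --> f x) ->
  (forall x, x \in `[t, T] -> x \notin Sg -> g y @[y --> within [set` `[t, T]] (nbhs x)] --> g x) ->
  stochastic_integral P F rho M t T (fun s _ => f s) X ->
  stochastic_integral P F rho M t T (fun s _ => g s) Y ->
  covariance P X Y = (\int[mu]_(x in `[t, T]) (f x * g x * rho x))%:E.
Proof.
move=> fB gB fC gC SX SY.
have [LX cX _] := stochastic_integral_limit tT filt M2 C0 CV ptau fB fC SX.
have [LY cY _] := stochastic_integral_limit tT filt M2 C0 CV ptau gB gC SY.
have EX := stochastic_integral_expectation tT filt M2 C0 CV ptau fB fC SX.
have EY := stochastic_integral_expectation tT filt M2 C0 CV ptau gB gC SY.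
have fin Z : \int[P]_w Z w = 0 -> fine ('E_P[Z])%E = 0 by rewrite unlock.
rewrite unlock (fin _ EX) (fin _ EY).
have -> : ('E_P[((X \- cst 0) * (Y \- cst 0))%R])%E = (\int[P]_w (X w * Y w))%:E.
  rewrite unlock /Rintegral fineK; last exact: integrable_fin_num (L2M_int LX LY).
  by apply: eq_integral => w _; rewrite /= /GRing.mul/= !subr0.
congr EFin.
have c1 := cvg2_Rint_mul (fun n => increment_sum_L2 filt M2 ptau _ n) LX
  (fun n => increment_sum_L2 filt M2 ptau _ n) LY cX cY.
have c2 : \int[P]_w (increment_sum M (tau n) (fun j => f (tau n j)) n w *
    increment_sum M (tau n) (fun j => g (tau n j)) n w) @[n --> \oo] -->
    \int[mu]_(x in `[t, T]) (f x * g x * rho x).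
  under eq_fun do rewrite (increment_sum_product filt M2 CV ptau).
  apply: (@riemann_sum_cvg _ _ Omega t T rho tT (M2_rho0 M2) (M2_rhoC M2) tau (fun x => f x * g x) (Sf ++ Sg) (Bf * Bg) ptau).
  - apply: measurable_funM.
      by case: SX => /class_H2_measurable.
    by case: SY => /class_H2_measurable.
  - by move=> x xI; rewrite normrM ler_pM ?fB ?gB.
  - move=> x xI; rewrite mem_cat negb_or => /andP[xf xg].
    by apply: cvgM; [exact: fC|exact: gC].
by have -> := cvg_unique _ c1 c2.
Qed.

End covariance_integrals.

(** * Sums over distinct and increasing multi-indices *)

Section injective_sums.
Variables (k N : nat) (R : comPzRingType).
Implicit Types (A : {set 'I_k}) (n : nat) (l : {ffun 'I_k -> 'I_N}) (g h : 'I_k).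

(** Multi-indices that are injective on A with values below n there, and frozen to l0 off A. The
    cut-off n lets sums be built cell by cell in time. *)
Definition inj_below A n l0 l :=
  [&& [forall g in A, l g < n]%N, [forall g, (g \notin A) ==> (l g == l0 g)] &
    [forall g in A, forall h in A, (g != h) ==> (l g != l h)]].

Lemma inj_belowP A n l0 l : reflect
  [/\ forall g, g \in A -> (l g < n)%N, forall g, g \notin A -> l g = l0 g &
    forall g h, g \in A -> h \in A -> g != h -> l g != l h]
  (inj_below A n l0 l).
Proof.
apply: (iffP and3P) => [[/forall_inP h1 /forallP h2 /forall_inP h3]|[h1 h2 h3]]; split.
- by [].
- by move=> g gA; apply/eqP; apply: (implyP (h2 g)).
- by move=> g h gA hA; have /forall_inP/(_ h hA)/implyP := h3 g gA.
- exact/forall_inP.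
- by apply/forallP => g; apply/implyP => gA; rewrite h2.
- by apply/forall_inP => g gA; apply/forall_inP => h hA; apply/implyP; exact: h3.
Qed.

(* l0 records the indices already assigned off A. *)
Definition update l0 g (i : 'I_N) : {ffun 'I_k -> 'I_N} := [ffun h => if h == g then i else l0 h].

Variables (a : {ffun 'I_k -> 'I_N} -> R) (f : 'I_k -> nat -> R).

Definition inj_sum A n l0 : R :=
  \sum_(l | inj_below A n l0 l) a l * \prod_(g in A) f g (l g).

Lemma inj_sum_set0 n l0 : inj_sum finset.set0 n l0 = a l0.
Proof.
rewrite /inj_sum (big_pred1 l0); first by rewrite big_set0 mulr1.
move=> l /=; apply/inj_belowP/eqP => [[_ h _]|->].
  by apply/ffunP => g; apply: h; rewrite inE.
by split => [g|//|g h]; rewrite inE.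
Qed.

Lemma inj_sum0 A l0 : A != finset.set0 -> inj_sum A 0 l0 = 0.
Proof.
move=> /finset.set0Pn[g gA]; rewrite /inj_sum big_pred0// => l.
by apply/negP => /inj_belowP[/(_ g gA)].
Qed.

(** Raising the cut-off adds the multi-indices that use the cell n. By injectivity exactly one g in
    A uses it; the other indices of A stay below n. *)
Lemma inj_sumS A n l0 (nN : (n < N)%N) :
  inj_sum A n.+1 l0 = inj_sum A n l0 +
    \sum_(g in A) f g n * inj_sum (A :\ g) n (update l0 g (Ordinal nN)).
Proof.
rewrite /inj_sum (bigID (fun l => [exists g in A, l g == n :> nat])) /= addrC; congr (_ + _).
  apply: eq_bigl => l; apply/idP/idP.
    move=> /andP[/inj_belowP[h1 h2 h3] /exists_inPn nn]; apply/inj_belowP; split=> // g gA.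
    by have := h1 g gA; rewrite ltnS leq_eqVlt (negbTE (nn g gA)).
  move=> /inj_belowP[h1 h2 h3]; apply/andP; split.
    by apply/inj_belowP; split=> // g gA; exact: ltnW (h1 g gA).
  by apply/exists_inPn => g gA; rewrite ltn_eqF// h1.
pose Fl l := a l * \prod_(g in A) f g (l g).
transitivity (\sum_(l | inj_below A n.+1 l0 l && [exists g in A, l g == n :> nat])
   \sum_(g | (g \in A) && (l g == n :> nat)) Fl l).
  apply: eq_bigr => l /andP[/inj_belowP[h1 h2 h3] /exists_inP[g gA lg]].
  rewrite [RHS](big_pred1 g)// => h /=; apply/andP/eqP => [[hA lh]|->//].
  apply/eqP; apply: contraT => hg; have := h3 h g hA gA hg.
  by rewrite -val_eqE/= (eqP lh) (eqP lg) eqxx.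
rewrite (exchange_big_dep (fun g => g \in A))/=; last by move=> l g _ /andP[].
apply: eq_bigr => g gA; rewrite mulr_sumr.
apply: eq_big => [l|l /andP[/andP[_ _] /andP[_ /eqP lg]]].
  apply/idP/idP.
    move=> /andP[/andP[/inj_belowP[h1 h2 h3] _] /andP[_ /eqP lg]]; apply/inj_belowP; split.
    - move=> h; rewrite !inE => /andP[hg hA].
      have := h1 h hA; rewrite ltnS leq_eqVlt => /orP[/eqP lh|//].
      by have := h3 h g hA gA hg; rewrite -val_eqE/= lh lg eqxx.
    - move=> h; rewrite !inE negb_and negbK ffunE; case: eqP => [->|_ /= hA]; last exact: h2.
      by move=> _; apply: val_inj.
    - by move=> h h'; rewrite !inE => /andP[_ hA] /andP[_ hA']; exact: h3.
  move=> /inj_belowP[h1 h2 h3].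
  have lg : l g = n :> nat by rewrite h2 ?ffunE ?eqxx// !inE eqxx.
  have lh h : h \in A -> h != g -> (l h < n)%N by move=> hA hg; apply: h1; rewrite !inE hg.
  apply/andP; split; last by rewrite gA lg eqxx.
  apply/andP; split; last by apply/exists_inP; exists g => //; rewrite lg.
  apply/inj_belowP; split.
  - move=> h hA; have [->|hg] := eqVneq h g; first by rewrite lg.
    by rewrite ltnW// ltnS lh.
  - move=> h hA; rewrite h2 ?ffunE; last by rewrite !inE negb_and hA orbT.
    by case: eqP => // hg; rewrite hg gA in hA.
  - move=> h h' hA hA' hh'; rewrite -val_eqE/=.
    have [hg|hg] := eqVneq h g.
      by rewrite hg lg gtn_eqF// lh// -hg eq_sym.
    have [hg'|hg'] := eqVneq h' g; first by rewrite hg' lg ltn_eqF// lh.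
    by have := h3 h h'; rewrite !inE hg hg' => /(_ hA hA' hh'); rewrite -val_eqE.
rewrite /Fl (big_setD1 g)//= lg; ring.
Qed.

Lemma inj_sumT l0 : inj_sum [set: 'I_k] N l0 =
  \sum_(l in distinct_indices k N) a l * \prod_g f g (l g).
Proof.
apply: eq_big => [l|l _]; last by apply: congr2 => //; apply: eq_bigl => g; rewrite inE.
rewrite inE; apply/inj_belowP/forallP => [[_ _ h3] g|h3].
  by apply/forallP => h; apply/implyP; apply: h3; rewrite inE.
split=> // g; first by rewrite inE.
by move=> h _ _; apply/implyP; have /forallP := h3 g; exact.
Qed.

(** The place of A in [inj_below] is taken by the first i indices, the only kind of set met when the
    largest index of an increasing multi-index is removed repeatedly. *)
Definition incr_below (i n : nat) l0 l :=
  [&& [forall g : 'I_k, (g < i) ==> (l g < n)]%N, [forall g : 'I_k, (i <= g)%N ==> (l g == l0 g)] &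
    [forall g : 'I_k, forall h : 'I_k, (g < h < i)%N ==> (l g < l h)%N]].

Lemma incr_belowP i n l0 l : reflect
  [/\ forall g : 'I_k, (g < i)%N -> (l g < n)%N, forall g : 'I_k, (i <= g)%N -> l g = l0 g &
    forall g h : 'I_k, (g < h)%N -> (h < i)%N -> (l g < l h)%N]
  (incr_below i n l0 l).
Proof.
apply: (iffP and3P) => [[/forallP h1 /forallP h2 /forallP h3]|[h1 h2 h3]]; split.
- by move=> g; apply/implyP.
- by move=> g gA; apply/eqP; apply: (implyP (h2 g)).
- by move=> g h gh hi; have /forallP/(_ h)/implyP := h3 g; rewrite gh hi; exact.
- by apply/forallP => g; apply/implyP; exact: h1.
- by apply/forallP => g; apply/implyP => gA; rewrite h2.
- by apply/forallP => g; apply/forallP => h; apply/implyP => /andP[]; exact: h3.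
Qed.

Definition incr_sum i n l0 : R :=
  \sum_(l | incr_below i n l0 l) \prod_(g : 'I_k | (g < i)%N) f g (l g).

Lemma incr_sum_empty n l0 : incr_sum 0 n l0 = 1.
Proof.
rewrite /incr_sum (big_pred1 l0); first by rewrite big_pred0.
move=> l /=; apply/incr_belowP/eqP => [[_ h _]|->]; last by [].
by apply/ffunP => g; apply: h.
Qed.

Lemma incr_sum0 i l0 : (i < k)%N -> incr_sum i.+1 0 l0 = 0.
Proof.
move=> ik; rewrite /incr_sum big_pred0// => l.
by apply/negP => /incr_belowP[/(_ (Ordinal ik))/(_ (ltnSn _))].
Qed.

(** Only the last index can take the largest cell n, so a single term stands in place of the sum
    over g. *)
Lemma incr_sumS i n l0 (ik : (i < k)%N) (nN : (n < N)%N) :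
  incr_sum i.+1 n.+1 l0 = incr_sum i.+1 n l0 +
    f (Ordinal ik) n * incr_sum i n (update l0 (Ordinal ik) (Ordinal nN)).
Proof.
set g0 := Ordinal ik.
rewrite /incr_sum (bigID (fun l => l g0 == n :> nat)) /= addrC; congr (_ + _).
  apply: eq_bigl => l; apply/idP/idP.
    move=> /andP[/incr_belowP[h1 h2 h3] nn]; apply/incr_belowP; split=> // g gi.
    have l0n : (l g0 < n)%N.
      by have := h1 g0 (ltnSn _); rewrite ltnS leq_eqVlt (negbTE nn).
    move: (gi); rewrite ltnS leq_eqVlt => /orP[/eqP gE|gi'].
      by rewrite (_ : g = g0)//; apply: val_inj.
    by apply: ltn_trans l0n; apply: h3.
  move=> /incr_belowP[h1 h2 h3]; apply/andP; split.
    by apply/incr_belowP; split=> // g gA; exact: ltnW (h1 g gA).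
  by rewrite ltn_eqF// h1//= ltnS.
rewrite mulr_sumr; apply: eq_big => [l|l /andP[_ /eqP lg]].
  apply/idP/idP.
    move=> /andP[/incr_belowP[h1 h2 h3] /eqP lg]; apply/incr_belowP; split.
    - by move=> g gi; rewrite -lg; apply: h3 => //=.
    - move=> g; rewrite leq_eqVlt ffunE => /orP[/eqP gi|gi].
        by rewrite (_ : g = g0) ?eqxx; apply: val_inj.
      by rewrite h2//; case: eqP => // gE; rewrite gE /= ltnn in gi.
    - by move=> g h gh hi; apply: h3 => //; exact: ltnW.
  move=> /incr_belowP[h1 h2 h3].
  have lg : l g0 = n :> nat by rewrite h2 ?ffunE ?eqxx.
  apply/andP; split; last by rewrite lg.
  apply/incr_belowP; split.
  - move=> g; rewrite ltnS leq_eqVlt => /orP[/eqP gi|gi].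
      by rewrite (_ : g = g0) ?lg//; apply: val_inj.
    by rewrite ltnW// ltnS h1.
  - move=> g gi; rewrite h2 ?ffunE ?(ltnW gi)//.
    by case: eqP => // gE; rewrite gE /= ltnn in gi.
  - move=> g h gh; rewrite ltnS leq_eqVlt => /orP[/eqP hi|hi]; last exact: h3.
    by rewrite (_ : h = g0) ?lg ?h1 -?hi//; apply: val_inj.
rewrite (bigD1 g0)//= lg; congr (_ * _); apply: eq_bigl => g.
by rewrite ltnS -val_eqE/= ltn_neqAle andbC.
Qed.

(** As a weighted sum over distinct indices, the increasing sum can be subtracted term by term from
    those of the expansion. *)
Lemma incr_sumT l0 : incr_sum k N l0 =
  \sum_(l in distinct_indices k N)
    [forall g : 'I_k, forall h : 'I_k, (g < h)%N ==> (l g < l h)%N]%:R * \prod_g f g (l g).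
Proof.
rewrite /incr_sum [RHS](bigID (fun l : {ffun 'I_k -> 'I_N} =>
  [forall g : 'I_k, forall h : 'I_k, (g < h)%N ==> (l g < l h)%N])) /=.
rewrite [X in _ + X]big1 ?addr0; last by move=> l /andP[_ /negbTE ->]; rewrite mul0r.
apply: eq_big => [l|l /incr_belowP[_ _ h3]]; last first.
  rewrite (_ : [forall _, _] = true) ?mul1r.
    by apply: eq_bigl => g; rewrite ltn_ord.
  by apply/forallP => g; apply/forallP => h; apply/implyP => gh; apply: h3.
apply/incr_belowP/andP => [[_ _ h3]|[_ /forallP h3]].
  split; last by apply/forallP => g; apply/forallP => h; apply/implyP => gh; apply: h3.
  rewrite inE; apply/forallP => g; apply/forallP => h; apply/implyP => gh.
  rewrite -val_eqE/= neq_ltn; move: gh; rewrite -val_eqE/= neq_ltn => /orP[gh|hg].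
    by rewrite (h3 g h gh (ltn_ord h)).
  by rewrite (h3 h g hg (ltn_ord g)) orbT.
split=> [g _|g|g h gh _]; first exact: ltn_ord.
- by rewrite leqNgt ltn_ord.
- by have /forallP/(_ h)/implyP := h3 g; exact.
Qed.

End injective_sums.

(** * Iterated elementary integrals *)

Section clamped_telescope.
Context (R : realDomainType).
Implicit Types (a b x y : R) (g : R -> R) (beta : nat -> R).

Lemma nondecreasing_steps_le beta N : (forall j, (j < N)%N -> beta j <= beta j.+1) ->
  forall i j, (i <= j)%N -> (j <= N)%N -> beta i <= beta j.
Proof.
move=> bS i j ij jN; elim: j ij jN => [|j ih]; first by rewrite leqn0 => /eqP ->.
rewrite leq_eqVlt => /orP[/eqP ->//|ij] jN.
by apply: le_trans (bS _ jN); apply: ih => //; exact: ltnW.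
Qed.

(** For a <= b, the point of [a, b] nearest to x. Clamping both ends of an interval intersects it
    with [a, b]; a disjoint interval becomes degenerate. *)
Definition clamp a b x := Num.max a (Num.min b x).

Lemma clamp_telescope g a b beta N : a <= b -> beta 0%N <= a -> b <= beta N ->
  \sum_(i < N) (g (clamp a b (beta i.+1)) - g (clamp a b (beta i))) = g b - g a.
Proof.
move=> ab b0 bN.
rewrite -(big_mkord xpredT (fun i => g (clamp a b (beta i.+1)) - g (clamp a b (beta i)))).
rewrite telescope_sumr// /clamp (min_idPl bN) (max_idPr ab).
by rewrite (min_idPr (le_trans b0 ab)) (max_idPl b0).
Qed.

(** Both sides are the increment of g over the intersection of [a, b] and [x, y], and both are 0
    when the two are disjoint. The symmetry lets a common refinement be summed along either
    partition. *)
Lemma clamp_swap g a b x y : a <= b -> x <= y ->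
  g (clamp a b y) - g (clamp a b x) = g (clamp x y b) - g (clamp x y a).
Proof.
move=> ab xy; rewrite /clamp; have [bx|/ltW xb] := leP b x.
  rewrite ?(min_l (le_trans bx xy)) ?(min_l bx) subrr.
  by rewrite ?(min_r (le_trans bx xy)) ?(max_l bx) ?(min_r (le_trans ab (le_trans bx xy))) ?(max_l (le_trans ab bx)) subrr.
have [ya|/ltW ay] := leP y a.
  rewrite ?(min_r (le_trans ya ab)) ?(min_r xb) ?(max_l ya) ?(max_l (le_trans xy ya)) subrr.
  by rewrite ?(min_l (le_trans ya ab)) ?(min_l ya) subrr.
rewrite ?(max_r (_ : a <= Num.min b y)) ?le_min ?ab// ?(min_r xb).
by rewrite ?(max_r (_ : x <= Num.min y b)) ?le_min ?xy// ?(min_r ay) minC maxC.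
Qed.

Lemma clamp_ge a b x : a <= clamp a b x.
Proof. by rewrite /clamp le_max lexx. Qed.

Lemma clamp_le a b x : a <= b -> clamp a b x <= b.
Proof. by move=> ab; rewrite /clamp ge_max ab ge_min lexx. Qed.

Lemma clamp_homo a b x y : x <= y -> clamp a b x <= clamp a b y.
Proof. by move=> xy; rewrite /clamp le_max2 ?le_min2. Qed.

(** A nondegenerate intersection starts at the larger of the two left ends, where the coefficients
    of both partitions are already measurable. *)
Lemma clamp_lt a b x y : a <= b -> x <= y -> clamp a b x < clamp a b y ->
  [/\ a < b, x < y & clamp a b x = Num.max a x].
Proof.
move=> ab xy h; split.
- by apply: le_lt_trans (clamp_ge a b x) (lt_le_trans h (clamp_le _ ab)).
- by rewrite lt_neqAle xy andbT; apply: contraTneq h => ->; rewrite ltxx.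
- rewrite /clamp; congr Num.max; apply: min_r; rewrite leNgt; apply/negP => bx.
  move: h; rewrite /clamp (min_l (ltW bx)) (min_l (le_trans (ltW bx) xy)).
  by rewrite ltxx.
Qed.

End clamped_telescope.

Section elementary_integrals.
Context (R : realType) d (Omega : measurableType d) (P : probability Omega R).
Variables (t T : R) (F : R -> set_system Omega) (rho : R -> R) (M : R -> Omega -> R).
Hypothesis tT : t <= T.
Hypothesis filt : filtration F t T.
Hypothesis rho0 : forall x, x \in `[t, T] -> 0 <= rho x.
Hypothesis rhoC : {within `[t, T], continuous rho}.
Hypothesis mart : martingale P F t T M.
Variable C : R.
Hypothesis C0 : 0 <= C.
Hypothesis CV : conditional_variance_bound P t T F rho M C.
Local Notation L2 f := (square_integrable P setT f).
Local Notation Lam := (Lam t rho).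

Lemma adaptedL2_0 s : t <= s -> s <= T -> adaptedL2 P F s (fun=> 0).
Proof. by move=> ts sT; exact: (adaptedL2_cst P filt 0 ts sT). Qed.

(** Coefficients on degenerate intervals are replaced by 0, which is adapted. In a stopped sum the
    coefficients beyond the stopping time are not measurable at that time, so adaptedness can be
    asked on proper intervals only. *)
Lemma orthogonal_sum_bound_lt (A : finType) (u v : A -> R) (Z : A -> Omega -> R) :
  (forall x, [/\ t <= u x, u x <= v x & v x <= T]) ->
  (forall x, u x < v x -> adaptedL2 P F (u x) (Z x)) ->
  (forall x y, x != y -> u x < v x -> u y < v y -> v x <= u y \/ v y <= u x) ->
  L2 (fun w => \sum_x Z x w * (M (v x) w - M (u x) w)) /\
  nrm P (fun w => \sum_x Z x w * (M (v x) w - M (u x) w)) <=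
    C * \sum_x (Lam (v x) - Lam (u x)) * nrm P (Z x).
Proof.
move=> uvP AZ sep.
pose Z' x := if u x < v x then Z x else fun=> 0.
have [||L N] := orthogonal_sum_bound filt mart CV (Z := Z') uvP.
- move=> x; rewrite /Z'; case: ifPn => [/AZ//|_].
  by have [tu uv vT] := uvP x; apply: adaptedL2_0 => //; exact: le_trans uv vT.
- move=> x y xy; have [_ uvx _] := uvP x; have [_ uvy _] := uvP y.
  move: uvx uvy; rewrite le_eqVlt => /orP[/eqP ->|uvx]; first by constructor 3.
  rewrite le_eqVlt => /orP[/eqP ->|uvy]; first by constructor 4.
  by have [h|h] := sep _ _ xy uvx uvy; [constructor 1|constructor 2].
have E w : \sum_x Z' x w * (M (v x) w - M (u x) w) = \sum_x Z x w * (M (v x) w - M (u x) w).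
  apply: eq_bigr => x _; rewrite /Z'; case: ifPn => // /negP uv.
  rewrite (_ : u x = v x) ?subrr ?mulr0//; have [_ + _] := uvP x.
  by rewrite le_eqVlt => /orP[/eqP|/uv].
split; first exact: (L2_eq E L).
rewrite -(nrm_eq P E); apply: le_trans N _; rewrite ler_wpM2l//; apply: ler_sum => x _.
rewrite /Z'; case: ifPn => // _; have [tu uv vT] := uvP x.
by rewrite (nrm0 P) mulr0 mulr_ge0 ?nrm_ge0// subr_ge0 (Lam_le rho0 rhoC tu uv vT).
Qed.

Definition elem_sum (al : nat -> R) (c : nat -> Omega -> R) N (w : Omega) : R :=
  \sum_(j < N) c j w * (M (al j.+1) w - M (al j) w).

Section monotone_times.
Variables (al : nat -> R) (N : nat).
Hypotheses (al0 : t <= al 0%N) (alN : al N <= T) (alS : forall j, (j < N)%N -> al j <= al j.+1).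

Lemma times_itv j : (j <= N)%N -> t <= al j /\ al j <= T.
Proof.
move=> jN; split; first exact: le_trans al0 (nondecreasing_steps_le alS (leq0n _) jN).
exact: le_trans (nondecreasing_steps_le alS jN (leqnn _)) alN.
Qed.

(** The times are merely nondecreasing, since those of a partition stopped at s repeat s. *)
Lemma elem_sum_bound c : (forall j, (j < N)%N -> al j < al j.+1 -> adaptedL2 P F (al j) (c j)) ->
  L2 (elem_sum al c N) /\
  nrm P (elem_sum al c N) <= C * \sum_(j < N) (Lam (al j.+1) - Lam (al j)) * nrm P (c j).
Proof.
move=> Ac; apply: (orthogonal_sum_bound_lt (Z := fun j : 'I_N => c j)).
- move=> j; have [h1 _] := times_itv (ltnW (ltn_ord j)); have [_ h2] := times_itv (ltn_ord j).
  by split=> //; exact: alS.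
- by move=> j; apply: Ac.
- move=> i j ij _ _; have := ij; rewrite -val_eqE/= neq_ltn => /orP[h|h]; [left|right].
    exact: (nondecreasing_steps_le alS h (ltnW (ltn_ord j))).
  exact: (nondecreasing_steps_le alS h (ltnW (ltn_ord i))).
Qed.

Lemma elem_sum_adapted c s : al N <= s -> s <= T ->
  (forall j, (j < N)%N -> al j < al j.+1 -> adaptedL2 P F (al j) (c j)) ->
  adaptedL2 P F s (elem_sum al c N).
Proof.
move=> Ns sT Ac; split; last by case: (elem_sum_bound Ac).
have ts : t <= s by have [h _] := times_itv (leqnn N); exact: le_trans Ns.
have sF := filtration_sigma filt ts sT.
apply: (measurable_wrt_sum sF) => j _.
have [tj _] := times_itv (ltnW (ltn_ord j)); have [tj1 j1T] := times_itv (ltn_ord j).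
have j1s : al j.+1 <= s by exact: le_trans (nondecreasing_steps_le alS (ltn_ord j) (leqnn _)) Ns.
have := alS (ltn_ord j); rewrite le_eqVlt => /orP[/eqP ->|jj].
  rewrite (_ : (fun w => _) = fun=> 0); first exact: (measurable_wrt_cst sF).
  by apply/funext => w; rewrite subrr mulr0.
have [] := increment_adaptedL2 filt mart CV tj (ltW jj) j1s sT (Ac _ (ltn_ord j) jj).
by [].
Qed.

End monotone_times.

Section merge.
Variables (al be : nat -> R) (N N' : nat).
Hypotheses (al0 : t <= al 0%N) (alN : al N <= T) (alS : forall j, (j < N)%N -> al j <= al j.+1).
Hypotheses (beS : forall j, (j < N')%N -> be j <= be j.+1).
Hypotheses (abe0 : al 0%N = be 0%N) (abeN : al N = be N').

(* The common refinement of two partitions is indexed by all pairs of cells; the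
   pairs of disjoint cells give degenerate intervals. *)
Definition merge_lo (x : 'I_N * 'I_N') := clamp (al x.1) (al x.1.+1) (be x.2).
Definition merge_hi (x : 'I_N * 'I_N') := clamp (al x.1) (al x.1.+1) (be x.2.+1).

(** Each cell of one partition is cut by all cells of the other; telescoping over either component
    of the pair restores the original sum. *)
Lemma elem_sum_merge c c' w : elem_sum al c N w - elem_sum be c' N' w =
  \sum_(x : 'I_N * 'I_N') (c x.1 w - c' x.2 w) * (M (merge_hi x) w - M (merge_lo x) w).
Proof.
have alm i j : (i <= j)%N -> (j <= N)%N -> al i <= al j by exact: nondecreasing_steps_le.
have bem i j : (i <= j)%N -> (j <= N')%N -> be i <= be j by exact: nondecreasing_steps_le.
rewrite -(pair_bigA _ (fun (i : 'I_N) (j : 'I_N') => (c i w - c' j w) * (M (merge_hi (i, j)) w - M (merge_lo (i, j)) w)))/=.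
under [RHS]eq_bigr do under eq_bigr do rewrite mulrBl.
under [RHS]eq_bigr do rewrite sumrB.
rewrite sumrB; congr (_ - _).
  apply: eq_bigr => i _; rewrite -mulr_sumr; congr (_ * _).
  rewrite /merge_hi /merge_lo/= (clamp_telescope (fun s => M s w))//.
  - exact: alS.
  - by rewrite -abe0; apply: alm => //; exact: ltnW.
  - by rewrite -abeN; apply: alm.
rewrite exchange_big; apply: eq_bigr => j _; rewrite -mulr_sumr; congr (_ * _).
rewrite /merge_hi /merge_lo/=.
under eq_bigr => i _ do rewrite (clamp_swap (fun s => M s w) (alS (ltn_ord i)) (beS (ltn_ord j))).
rewrite (clamp_telescope (fun s => M s w))//.
- exact: beS.
- by rewrite abe0; apply: bem => //; exact: ltnW.
- by rewrite abeN; apply: bem.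
Qed.

Lemma merge_itv x : [/\ t <= merge_lo x, merge_lo x <= merge_hi x & merge_hi x <= T].
Proof.
have [h1 _] := times_itv al0 alN alS (ltnW (ltn_ord x.1)).
have [_ h2] := times_itv al0 alN alS (ltn_ord x.1).
split.
- exact: le_trans h1 (clamp_ge _ _ _).
- by apply: clamp_homo; exact: beS.
- by apply: le_trans h2; apply: clamp_le; exact: alS.
Qed.

Lemma merge_sep x y : x != y -> merge_hi x <= merge_lo y \/ merge_hi y <= merge_lo x.
Proof.
case: x y => [i j] [i' j'] ne; rewrite /merge_hi /merge_lo/=.
have H (a b : 'I_N) (l l' : 'I_N') : (a < b)%N -> clamp (al a) (al a.+1) (be l.+1) <= clamp (al b) (al b.+1) (be l').
  move=> ab; apply: le_trans (clamp_le _ (alS (ltn_ord a))) _.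
  apply: le_trans (clamp_ge _ _ _).
  exact: (nondecreasing_steps_le alS ab (ltnW (ltn_ord b))).
case: (ltngtP i i') => ii'; [by left; exact: H|by right; exact: H|].
have {ii'}E : i = i' by exact: val_inj.
subst i'.
case: (ltngtP j j') => jj'; last by move: ne; rewrite (val_inj jj') eqxx.
- by left; apply: clamp_homo; exact: (nondecreasing_steps_le beS jj' (ltnW (ltn_ord j'))).
- by right; apply: clamp_homo; exact: (nondecreasing_steps_le beS jj' (ltnW (ltn_ord j))).
Qed.

Lemma elem_sum_merge_bound c c' :
  (forall j, (j < N)%N -> al j < al j.+1 -> adaptedL2 P F (al j) (c j)) ->
  (forall j, (j < N')%N -> be j < be j.+1 -> adaptedL2 P F (be j) (c' j)) ->
  nrm P (fun w => elem_sum al c N w - elem_sum be c' N' w) <=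
  C * \sum_(x : 'I_N * 'I_N') (Lam (merge_hi x) - Lam (merge_lo x)) *
    nrm P (fun w => c x.1 w - c' x.2 w).
Proof.
move=> Ac Ac'; rewrite (nrm_eq P (elem_sum_merge c c')).
have [||_ h //] := @orthogonal_sum_bound_lt _ merge_lo merge_hi
  (fun x w => c x.1 w - c' x.2 w) merge_itv.
- move=> x lh; have [tl lh' hT] := merge_itv x; have lT := le_trans lh' hT.
  have [aS bS E] := clamp_lt (alS (ltn_ord x.1)) (beS (ltn_ord x.2)) lh.
  have [Ac1 Ac2] := Ac _ (ltn_ord x.1) aS; have [Ac1' Ac2'] := Ac' _ (ltn_ord x.2) bS.
  have [ta _] := times_itv al0 alN alS (ltnW (ltn_ord x.1)).
  have tb : t <= be x.2.
    by apply: le_trans al0 _; rewrite abe0; exact: (nondecreasing_steps_le beS (leq0n _) (ltnW (ltn_ord x.2))).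
  split; last exact: L2B.
  apply: (measurable_wrtB (filtration_sigma filt tl lT)).
    apply: (measurable_wrt_mono filt ta _ lT Ac1).
    by rewrite /merge_lo E le_max lexx.
  apply: (measurable_wrt_mono filt tb _ lT Ac1').
  by rewrite /merge_lo E le_max lexx orbT.
- by move=> x y xy _ _; exact: merge_sep.
Qed.

End merge.
End elementary_integrals.

(** Makes the refinement of two stopped partitions the stopped refinement, so that the weights of
    the stopped cells can be compared with those of the full ones. *)
Lemma min_clamp (R : realDomainType) (a b x s : R) :
  clamp (Num.min a s) (Num.min b s) (Num.min x s) = Num.min (clamp a b x) s.
Proof. by rewrite /clamp minACA minxx min_maxl. Qed.

Section merge_deterministic.
Context (R : realType) d (Omega : measurableType d) (P : probability Omega R).
Variables (t T : R) (F : R -> set_system Omega) (rho : R -> R) (M : R -> Omega -> R).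
Hypothesis filt : filtration F t T.
Hypothesis M2 : class_M2 P F rho t T M.
Variable C : R.
Hypothesis CV : conditional_variance_bound P t T F rho M C.
Local Notation L2 f := (square_integrable P setT f).
Local Notation Lam := (Lam t rho).
Variables (al be : nat -> R) (N N' : nat).
Hypotheses (al0 : t <= al 0%N) (alN : al N <= T) (alS : forall j, (j < N)%N -> al j <= al j.+1).
Hypotheses (beS : forall j, (j < N')%N -> be j <= be j.+1).
Hypotheses (abe0 : al 0%N = be 0%N) (abeN : al N = be N').

(** An equality, because the coefficients are deterministic. It is later read from right to left:
    the distance of two integral sums controls the weighted oscillation of the coefficients over the
    common refinement, whatever their discontinuities. *)
Lemma merge_deterministic_nrm (x y : nat -> R) :
  nrm P (fun w => increment_sum M al x N w - increment_sum M be y N' w) =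
  \sum_(z : 'I_N * 'I_N') (Lam (merge_hi al be z) - Lam (merge_lo al be z)) * (x z.1 - y z.2) ^+ 2.
Proof.
have mart := M2_mart M2.
rewrite (nrm_eq P (elem_sum_merge M alS beS abe0 abeN (fun j => cst (x j)) (fun i => cst (y i)))).
rewrite (nrm_sum_orth (h := fun (z : 'I_N * 'I_N') w => (cst (x z.1) w - cst (y z.2) w) * (M (merge_hi al be z) w - M (merge_lo al be z) w))).
- apply: eq_bigr => z _; have [h1 h2 h3] := merge_itv al0 alN alS beS z.
  have [L N_] := increment_L2 filt M2 h1 h2 h3.
  by rewrite (nrmZ (x z.1 - y z.2) L) N_ mulrC.
- move=> z _; have [h1 h2 h3] := merge_itv al0 alN alS beS z.
  by apply: (L2Z (x z.1 - y z.2)); have [] := increment_L2 filt M2 h1 h2 h3.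
have H (z z' : 'I_N * 'I_N') : merge_hi al be z <= merge_lo al be z' ->
   \int[P]_w ((cst (x z.1) w - cst (y z.2) w) * (M (merge_hi al be z) w - M (merge_lo al be z) w) *
     ((cst (x z'.1) w - cst (y z'.2) w) * (M (merge_hi al be z') w - M (merge_lo al be z') w))) = 0.
  move=> hl; have [h1 h2 h3] := merge_itv al0 alN alS beS z.
  have [h1' h2' h3'] := merge_itv al0 alN alS beS z'.
  have lT := le_trans h2' h3'.
  apply: (martingale_L2_orth filt mart CV h1' h2' h3').
    apply: (increment_adaptedL2 filt mart CV h1 h2 hl lT).
    exact: (adaptedL2_cst P filt (x z.1 - y z.2) h1 (le_trans h2 h3)).
  exact: (adaptedL2_cst P filt (x z'.1 - y z'.2) h1' lT).
move=> z z' _ _ zz'; have [h|h] := merge_sep alS beS zz'; first exact: H.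
by rewrite -(H _ _ h); apply: Rint_eq => w; rewrite mulrC.
Qed.

Lemma merge_Lam_sum :
  \sum_(z : 'I_N * 'I_N') (Lam (merge_hi al be z) - Lam (merge_lo al be z)) = Lam (al N) - Lam (al 0%N).
Proof.
rewrite -(pair_bigA _ (fun (i : 'I_N) (j : 'I_N') => Lam (merge_hi al be (i, j)) - Lam (merge_lo al be (i, j))))/=.
have alm i j : (i <= j)%N -> (j <= N)%N -> al i <= al j by exact: nondecreasing_steps_le.
rewrite -(telescope_sumr (fun i => Lam (al i)) (leq0n N)) big_mkord; apply: eq_bigr => i _.
rewrite /merge_hi /merge_lo/= (clamp_telescope Lam)//.
- exact: alS.
- by rewrite -abe0; apply: alm => //; exact: ltnW.
- by rewrite -abeN; apply: alm.
Qed.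

End merge_deterministic.

(** * Nested elementary integrals: bounds uniform in the partition *)

Section injective_process.
Context (R : realType) d (Omega : measurableType d) (P : probability Omega R).
Variables (t T : R) (F : R -> set_system Omega) (rho : R -> R) (k : nat).
Variable M : 'I_k -> R -> Omega -> R.
Hypothesis tT : t < T.
Hypothesis filt : filtration F t T.
Hypothesis M2 : forall g, class_M2 P F rho t T (M g).
Hypothesis rho0 : forall x, x \in `[t, T] -> 0 <= rho x.
Hypothesis rhoC : {within `[t, T], continuous rho}.
Variable C : R.
Hypothesis C0 : 0 <= C.
Hypothesis CV : forall g, conditional_variance_bound P t T F rho (M g) C.
Local Notation L2 f := (square_integrable P setT f).
Local Notation Lam := (Lam t rho).
Variable phi : 'I_k -> R -> R.
Variable Bphi : R.
Hypothesis phiB : forall g x, x \in `[t, T] -> `|phi g x| <= Bphi.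
Variable tau : nat -> nat -> R.
Hypothesis ptau : partition_sequence t T tau.
Variable S : {set 'I_k} -> {set 'I_k}.

Let mart g : martingale P F t T (M g).
Proof. exact: M2_mart (M2 g). Qed.

(* S A is the set of the factors that may carry the latest time: S = id gives the
   sums over pairwise distinct indices, S = last_index those over increasing
   ones. m is only fuel. *)
Fixpoint nested_sum (m : nat) (A : {set 'I_k}) (N : nat) (s : R) (w : Omega) : R :=
  if A == finset.set0 then 1 else
  match m with
  | 0 => 0
  | m'.+1 => \sum_(g in S A) elem_sum (M g) (fun j => Num.min (tau N j) s)
      (fun j w => phi g (tau N j) * nested_sum m' (A :\ g) N (tau N j) w) N w
  end.

Lemma nested_sum_set0 m N s : nested_sum m finset.set0 N s = fun=> 1.
Proof. by apply/funext => w; case: m => [|m] /=; rewrite eqxx. Qed.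

Lemma nested_sum_next m A N s : A != finset.set0 -> nested_sum m.+1 A N s =
  fun w => \sum_(g in S A) elem_sum (M g) (fun j => Num.min (tau N j) s)
      (fun j w => phi g (tau N j) * nested_sum m (A :\ g) N (tau N j) w) N w.
Proof. by move=> A0; apply/funext => w /=; rewrite (negbTE A0). Qed.

Lemma nested_sum_stop A N s : A != finset.set0 -> nested_sum 0 A N s = fun=> 0.
Proof. by move=> A0; apply/funext => w /=; rewrite (negbTE A0). Qed.

Lemma stopped_times N s : (0 < N)%N -> t <= s -> s <= T ->
  [/\ Num.min (tau N 0) s = t, Num.min (tau N N) s = s &
    forall j, (j < N)%N -> Num.min (tau N j) s <= Num.min (tau N j.+1) s].
Proof.
move=> N0 ts sT; have [/(_ N N0)[p0 pN] /(_ N) pS _] := ptau.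
rewrite p0 pN; split; [exact: min_l|exact: min_r|].
by move=> j jN; rewrite le_min2// ltW// pS.
Qed.

(** One factor k from squaring a sum of at most k terms, another from adding up their bounds. *)
Lemma nrm_sum_in_le (A : {set 'I_k}) (h : 'I_k -> Omega -> R) (b : R) : 0 <= b ->
  (forall g, g \in A -> L2 (h g) /\ nrm P (h g) <= b) ->
  L2 (fun w => \sum_(g in A) h g w) /\ nrm P (fun w => \sum_(g in A) h g w) <= k%:R ^+ 2 * b.
Proof.
move=> b0 hb; split; first by apply: L2_sum => g /hb[].
pose h' g := if g \in A then h g else fun=> 0.
have E w : \sum_(g in A) h g w = \sum_g h' g w.
  by rewrite big_mkcond; apply: eq_bigr => g _; rewrite /h'; case: ifP.
have Lh g : L2 (h' g) /\ nrm P (h' g) <= b.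
  rewrite /h'; case: ifPn => [/hb//|_]; split; first exact: L2_0.
  by rewrite nrm0.
rewrite (nrm_eq P E); apply: le_trans (nrm_sum_le (fun g => (Lh g).1)) _.
rewrite card_ord expr2 -mulrA ler_wpM2l//.
apply: (@le_trans _ _ (\sum_(g < k) b)); first by apply: ler_sum => g _; exact: (Lh g).2.
by rewrite sumr_const card_ord mulr_natl.
Qed.

Let nrm_phi g x (X : Omega -> R) (b : R) : x \in `[t, T] -> L2 X -> nrm P X <= b ->
  nrm P (fun w => phi g x * X w) <= Bphi ^+ 2 * b.
Proof.
move=> xI LX Xb; rewrite nrmZ//; apply: ler_pM; rewrite ?sqr_ge0 ?nrm_ge0//.
by rewrite -(real_normK (num_real (phi g x))) lerXn2r ?nnegrE ?(le_trans _ (phiB g xI))// phiB.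
Qed.

Let tI N j : (0 < N)%N -> (j <= N)%N -> tau N j \in `[t, T].
Proof. exact: (partition_seq_itv ptau). Qed.

Lemma stopped_adapted (X : R -> Omega -> R) N j s (c : R) : (0 < N)%N -> (j < N)%N -> t <= s -> s <= T ->
  (forall u, t <= u -> u <= T -> adaptedL2 P F u (X u)) ->
  Num.min (tau N j) s < Num.min (tau N j.+1) s ->
  adaptedL2 P F (Num.min (tau N j) s) (fun w => c * X (tau N j) w).
Proof.
move=> N0 jN ts sT AX lt.
have js : tau N j <= s.
  by rewrite leNgt; apply/negP => sj; move: lt; rewrite (min_r (ltW sj)) lt_min ltxx andbF.
have := tI N0 (ltnW jN); rewrite in_itv/= => /andP[tj jT].
rewrite (min_l js); have [a L] := AX _ tj jT; split; last exact: L2Z.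
have sF := filtration_sigma filt tj jT.
by apply: (measurable_wrtM sF) => //; exact: (measurable_wrt_cst sF).
Qed.

(** The bound has to be uniform in A, N and s, since the inner sums are evaluated at all times of
    the partition and with each factor removed. *)
Lemma nested_sum_bound m : exists2 B : R, 0 <= B & forall A N s, (0 < N)%N -> t <= s -> s <= T ->
  adaptedL2 P F s (nested_sum m A N s) /\ nrm P (nested_sum m A N s) <= B.
Proof.
have one s : t <= s -> s <= T -> adaptedL2 P F s (fun=> 1) /\ nrm P (fun=> 1) <= 1.
  move=> ts sT; split; first exact: (adaptedL2_cst P filt 1 ts sT).
  rewrite /nrm (Rint_eq P (g := fun=> 1)); last by move=> w; rewrite expr1n.
  rewrite Rintegral_cst//=.
  by have := probability_setT P; rewrite /= => ->; rewrite mulr1.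
elim: m => [|m [B B0 IH]].
  exists 1 => // A N s N0 ts sT; have [->|A0] := eqVneq A finset.set0.
    by rewrite nested_sum_set0; exact: one.
  rewrite (nested_sum_stop _ _ A0).
  by split; [exact: (adaptedL2_cst P filt 0 ts sT)|rewrite nrm0].
have [BL BL0 HBL] := Lam_lip rho0 rhoC (ltW tT).
(* The bound for one outer integral: C from the conditional variance, Bphi^2 B for the coefficients,
   BL (T - t) for the total variance. *)
pose b := C * (Bphi ^+ 2 * B * (BL * (T - t))).
have b0 : 0 <= b.
  by rewrite mulr_ge0// mulr_ge0// mulr_ge0 ?sqr_ge0// ?subr_ge0// ltW.
have kb0 : 0 <= k%:R ^+ 2 * b by rewrite mulr_ge0// sqr_ge0.
exists (1 + k%:R ^+ 2 * b) => [|A N s N0 ts sT]; first by rewrite addr_ge0.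
have [->|A0] := eqVneq A finset.set0.
  by rewrite nested_sum_set0; have [h1 h2] := one s ts sT; split=> //; rewrite (le_trans h2)// lerDl.
rewrite (nested_sum_next _ _ _ A0).
have [a0 aN aS] := stopped_times N0 ts sT.
have Ac g j : (j < N)%N -> Num.min (tau N j) s < Num.min (tau N j.+1) s ->
   adaptedL2 P F (Num.min (tau N j) s) (fun w => phi g (tau N j) * nested_sum m (A :\ g) N (tau N j) w).
  by move=> jN; apply: (@stopped_adapted (nested_sum m (A :\ g) N) N j s _ N0 jN ts sT) => u tu uT; exact: (IH _ _ _ N0 tu uT).1.
have h1 : t <= Num.min (tau N 0) s by rewrite a0.
have h2 : Num.min (tau N N) s <= T by rewrite aN.
have Eg g : g \in S A -> L2 (elem_sum (M g) (fun j => Num.min (tau N j) s)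
      (fun j w => phi g (tau N j) * nested_sum m (A :\ g) N (tau N j) w) N) /\
    nrm P (elem_sum (M g) (fun j => Num.min (tau N j) s)
      (fun j w => phi g (tau N j) * nested_sum m (A :\ g) N (tau N j) w) N) <= b.
  move=> gA; have [L n] := elem_sum_bound filt rho0 rhoC (mart g) C0 (@CV g) h1 h2 aS (Ac g).
  split=> //; apply: le_trans n _; rewrite ler_wpM2l//.
  apply: (@le_trans _ _ (\sum_(j < N) (Lam (Num.min (tau N j.+1) s) - Lam (Num.min (tau N j) s)) * (Bphi ^+ 2 * B))).
    apply: ler_sum => j _; rewrite ler_wpM2l//.
      have [u1 _] := times_itv h1 h2 aS (ltnW (ltn_ord j)); have [_ u2] := times_itv h1 h2 aS (ltn_ord j).
      by rewrite subr_ge0 (Lam_le rho0 rhoC u1 (aS _ (ltn_ord j)) u2).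
    have jI := tI N0 (ltnW (ltn_ord j)); have := jI; rewrite in_itv/= => /andP[tj jT].
    have [[_ LQ] nQ] := IH (A :\ g) N _ N0 tj jT; exact: nrm_phi.
  rewrite -mulr_suml mulrC ler_wpM2l ?(mulr_ge0 (sqr_ge0 _) B0)//.
  rewrite -(big_mkord xpredT (fun j => Lam (Num.min (tau N j.+1) s) - Lam (Num.min (tau N j) s))).
  rewrite (telescope_sumr (fun j => Lam (Num.min (tau N j) s)))// aN a0.
  apply: le_trans (HBL _ _ (lexx t) ts sT) _.
  by rewrite ler_wpM2l// lerD2r.
have [L n] := nrm_sum_in_le b0 Eg.
split; last by rewrite (le_trans n)// lerDr.
split=> //; apply: (measurable_wrt_sum (filtration_sigma filt ts sT)) => g gA.
have [] := elem_sum_adapted filt rho0 rhoC (mart g) C0 (@CV g) h1 h2 aS (s := s) _ sT (Ac g).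
  by rewrite aN.
by [].
Qed.

(** The difference between the times s and s' is an elementary integral over [s, s'] alone, along
    the times clamped to that interval, and its variance is at most proportional to the length. *)
Lemma nested_sum_lipschitz m : exists2 D : R, 0 <= D & forall A N s s', (0 < N)%N ->
  t <= s -> s <= s' -> s' <= T ->
  nrm P (fun w => nested_sum m A N s' w - nested_sum m A N s w) <= D * (s' - s).
Proof.
case: m => [|m].
  exists 0 => // A N s s' N0 ts ss' sT.
  rewrite mul0r (nrm_eq P (g := fun=> 0)) ?nrm0// => w /=.
  by case: ifP; rewrite subrr.
have [B B0 HB] := nested_sum_bound m.
have [BL BL0 HBL] := Lam_lip rho0 rhoC (ltW tT).
exists (k%:R ^+ 2 * (C * (Bphi ^+ 2 * B * BL))).
  by rewrite mulr_ge0 ?sqr_ge0// mulr_ge0// mulr_ge0// mulr_ge0 ?sqr_ge0.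
move=> A N s s' N0 ts ss' sT; have ts' := le_trans ts ss'; have sT' := le_trans ss' sT.
have [->|A0] := eqVneq A finset.set0.
  rewrite !nested_sum_set0 (nrm_eq P (g := fun=> 0)) ?nrm0; last by move=> w; rewrite subrr.
  by rewrite mulr_ge0 ?subr_ge0// mulr_ge0 ?sqr_ge0// mulr_ge0// mulr_ge0// mulr_ge0 ?sqr_ge0.
rewrite !(nested_sum_next _ _ _ A0).
pose ga j := clamp s s' (tau N j).
have [/(_ N N0)[p0 pN] /(_ N) pS _] := ptau.
have gaS j : (j < N)%N -> ga j <= ga j.+1.
  by move=> jN; apply: clamp_homo; exact: ltW (pS _ jN).
have ga0 : ga 0%N = s.
  by rewrite /ga /clamp p0; apply: max_l; rewrite ge_min ts orbT.
have gaN : ga N = s'.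
  by rewrite /ga /clamp pN (min_l sT) (max_r ss').
have h1 : t <= ga 0%N by rewrite ga0.
have h2 : ga N <= T by rewrite gaN.
pose c g j w := phi g (tau N j) * nested_sum m (A :\ g) N (tau N j) w.
have Eg g w : elem_sum (M g) (fun j => Num.min (tau N j) s') (c g) N w -
    elem_sum (M g) (fun j => Num.min (tau N j) s) (c g) N w = elem_sum (M g) ga (c g) N w.
  rewrite /elem_sum -sumrB; apply: eq_bigr => j _; rewrite -mulrBr; congr (_ * _).
  have H x : M g (Num.min x s') w - M g (Num.min x s) w = M g (clamp s s' x) w - M g s w.
    rewrite /clamp; have [xs|/ltW sx] := leP x s.
      by rewrite (min_l (le_trans xs ss')) (min_r (le_trans xs ss')) (max_l xs) !subrr.
    by rewrite minC max_r// le_min ss'.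
  have -> (a b x y : R) : a - b - (x - y) = (a - x) - (b - y) by ring.
  rewrite !H; ring.
have Ac g j : (j < N)%N -> ga j < ga j.+1 -> adaptedL2 P F (ga j) (c g j).
  move=> jN lt; have [_ _ E] := clamp_lt ss' (ltW (pS _ jN)) lt.
  have jI := tI N0 (ltnW jN); have := jI; rewrite in_itv/= => /andP[tj jT].
  have [[aQ LQ] _] := HB (A :\ g) N _ N0 tj jT.
  have [tg gT] := times_itv h1 h2 gaS (ltnW jN).
  split; last exact: L2Z.
  have sF := filtration_sigma filt tg gT.
  apply: (measurable_wrtM sF); first exact: (measurable_wrt_cst sF).
  by apply: (measurable_wrt_mono filt tj _ gT aQ); rewrite /ga E le_max lexx orbT.
rewrite (nrm_eq P (g := fun w => \sum_(g in S A) elem_sum (M g) ga (c g) N w)); last first.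
  by move=> w; rewrite -sumrB; apply: eq_bigr => g _; exact: Eg.
rewrite -mulrA; apply: (nrm_sum_in_le _ _).2.
  by rewrite mulr_ge0 ?subr_ge0// mulr_ge0// mulr_ge0// mulr_ge0 ?sqr_ge0.
move=> g gA; have [L n] := elem_sum_bound filt rho0 rhoC (mart g) C0 (@CV g) h1 h2 gaS (Ac g).
split=> //; apply: le_trans n _; rewrite -mulrA ler_wpM2l//.
apply: (@le_trans _ _ (\sum_(j < N) (Lam (ga j.+1) - Lam (ga j)) * (Bphi ^+ 2 * B))).
  apply: ler_sum => j _; rewrite ler_wpM2l//.
    have [u1 _] := times_itv h1 h2 gaS (ltnW (ltn_ord j)); have [_ u2] := times_itv h1 h2 gaS (ltn_ord j).
    by rewrite subr_ge0 (Lam_le rho0 rhoC u1 (gaS _ (ltn_ord j)) u2).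
  have jI := tI N0 (ltnW (ltn_ord j)); have := jI; rewrite in_itv/= => /andP[tj jT].
  have [[_ LQ] nQ] := HB (A :\ g) N _ N0 tj jT; exact: nrm_phi.
rewrite -mulr_suml mulrC -[leRHS]mulrA ler_wpM2l ?(mulr_ge0 (sqr_ge0 _) B0)//.
rewrite -(big_mkord xpredT (fun j => Lam (ga j.+1) - Lam (ga j))).
rewrite (telescope_sumr (fun j => Lam (ga j)))// gaN ga0.
exact: HBL.
Qed.

End injective_process.

Lemma small_factor (R : realType) (c e : R) : 0 <= c -> 0 < e -> exists2 x : R, 0 < x & c * x <= e.
Proof.
move=> c0 e0; have c1 : 0 < c + 1 by rewrite ltr_wpDl.
exists (e / (c + 1)); first by rewrite divr_gt0.
by rewrite mulrA ler_pdivrMr// mulrC ler_wpM2l ?(ltW e0)// lerDl.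
Qed.

(** * Comparison of nested integrals on different partitions *)

Section nested_sum_convergence.
Context (R : realType) d (Omega : measurableType d) (P : probability Omega R).
Variables (t T : R) (F : R -> set_system Omega) (rho : R -> R) (k : nat).
Variable M : 'I_k -> R -> Omega -> R.
Hypothesis tT : t < T.
Hypothesis filt : filtration F t T.
Hypothesis M2 : forall g, class_M2 P F rho t T (M g).
Hypothesis rho0 : forall x, x \in `[t, T] -> 0 <= rho x.
Hypothesis rhoC : {within `[t, T], continuous rho}.
Variable C : R.
Hypothesis C0 : 0 <= C.
Hypothesis CV : forall g, conditional_variance_bound P t T F rho (M g) C.
Local Notation L2 f := (square_integrable P setT f).
Local Notation Lam := (Lam t rho).
Variable phi : 'I_k -> R -> R.
Variable Bphi : R.
Hypothesis phiB : forall g x, x \in `[t, T] -> `|phi g x| <= Bphi.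
Variable tau : nat -> nat -> R.
Hypothesis ptau : partition_sequence t T tau.
Variable S : {set 'I_k} -> {set 'I_k}.
Hypothesis cau : forall g, cauchy2 P (fun N => increment_sum (M g) (tau N) (fun j => phi g (tau N j)) N).

Let mart g : martingale P F t T (M g).
Proof. exact: M2_mart (M2 g). Qed.
Local Notation Q := (nested_sum M phi tau S).

Lemma Lam_stopped_le s a b : t <= s -> s <= T -> t <= a -> a <= b -> b <= T ->
  Lam (Num.min b s) - Lam (Num.min a s) <= Lam b - Lam a.
Proof.
move=> ts sT ta ab bT; have [sa|/ltW as_] := leP s a.
  by rewrite ?(min_r sa) ?(min_r (le_trans sa ab)) subrr subr_ge0 (Lam_le rho0 rhoC).
rewrite lerD2r; have [//|/ltW sb] := leP b s.
exact: (Lam_le rho0 rhoC ts sb bT).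
Qed.

(** On a common cell phi X - phi' X' = (phi - phi') X + phi' (X - X'). The first part is small
    because the one-dimensional sums of phi are close (e1), the second because the inner processes
    are close on overlapping cells (e2). *)
Lemma nested_sum_merge_bound (g : 'I_k) (N N' : nat) s (X X' : R -> Omega -> R) (B e1 e2 : R) :
  (0 < N)%N -> (0 < N')%N -> t <= s -> s <= T -> 0 <= B -> 0 <= e2 ->
  (forall u, t <= u -> u <= T -> adaptedL2 P F u (X u) /\ adaptedL2 P F u (X' u)) ->
  (forall u, t <= u -> u <= T -> nrm P (X u) <= B) ->
  (forall j i, (j < N)%N -> (i < N')%N -> tau N j < tau N' i.+1 -> tau N' i < tau N j.+1 ->
     nrm P (fun w => X (tau N j) w - X' (tau N' i) w) <= e2) ->
  nrm P (fun w => increment_sum (M g) (tau N) (fun j => phi g (tau N j)) N w -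
                  increment_sum (M g) (tau N') (fun j => phi g (tau N' j)) N' w) <= e1 ->
  nrm P (fun w =>
    elem_sum (M g) (fun j => Num.min (tau N j) s) (fun j w => phi g (tau N j) * X (tau N j) w) N w -
    elem_sum (M g) (fun j => Num.min (tau N' j) s) (fun j w => phi g (tau N' j) * X' (tau N' j) w) N' w) <=
  C * (2 * B * e1 + 2 * Bphi ^+ 2 * e2 * (Lam T - Lam t)).
Proof.
move=> N0 N0' ts sT B0 e20 AX XB XX' e1P.
have [a0 aN aS] := stopped_times ptau N0 ts sT.
have [b0 bN bS] := stopped_times ptau N0' ts sT.
have [/[dup] /(_ N N0)[p0 pN] /(_ N' N0')[q0 qN] /[dup] /(_ N) pS /(_ N') qS _] := ptau.
have h1 : t <= Num.min (tau N 0) s by rewrite a0.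
have h2 : Num.min (tau N N) s <= T by rewrite aN.
have E1 : Num.min (tau N 0) s = Num.min (tau N' 0) s by rewrite a0 b0.
have E2 : Num.min (tau N N) s = Num.min (tau N' N') s by rewrite aN bN.
have [AX1 AX2] : (forall u, t <= u -> u <= T -> adaptedL2 P F u (X u)) /\
   (forall u, t <= u -> u <= T -> adaptedL2 P F u (X' u)).
  by split=> u tu uT; have [] := AX u tu uT.
have LX u : u \in `[t, T] -> L2 (X u).
  by rewrite in_itv/= => /andP[tu uT]; case: (AX1 _ tu uT).
have LX' u : u \in `[t, T] -> L2 (X' u).
  by rewrite in_itv/= => /andP[tu uT]; case: (AX2 _ tu uT).
have H := elem_sum_merge_bound filt rho0 rhoC (mart g) C0 (@CV g) h1 h2 aS bS E1 E2.
apply: le_trans (H _ _ _ _) _.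
- by move=> j jN; apply: (stopped_adapted filt ptau _ N0 jN ts sT AX1).
- by move=> j jN; apply: (stopped_adapted filt ptau _ N0' jN ts sT AX2).
rewrite ler_wpM2l//.
have pS' j : (j < N)%N -> tau N j <= tau N j.+1 by move=> /pS/ltW.
have qS' j : (j < N')%N -> tau N' j <= tau N' j.+1 by move=> /qS/ltW.
have t0 : t <= tau N 0 by rewrite p0.
have tN : tau N N <= T by rewrite pN.
have F1 : tau N 0 = tau N' 0 by rewrite p0 q0.
have F2 : tau N N = tau N' N' by rewrite pN qN.
pose D (z : 'I_N * 'I_N') := Lam (merge_hi (tau N) (tau N') z) - Lam (merge_lo (tau N) (tau N') z).
have D0 z : 0 <= D z.
  have [k1 k2 k3] := merge_itv t0 tN pS' qS' z.
  by rewrite subr_ge0 (Lam_le rho0 rhoC).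
apply: (@le_trans _ _ (\sum_(z : 'I_N * 'I_N') (2 * B * (D z * (phi g (tau N z.1) - phi g (tau N' z.2)) ^+ 2) +
    2 * Bphi ^+ 2 * e2 * D z))); last first.
  rewrite big_split/= -!mulr_sumr; apply: lerD.
    rewrite ler_wpM2l ?mulr_ge0//; apply: le_trans e1P.
    by rewrite (merge_deterministic_nrm filt (M2 g) (@CV g) t0 tN pS' qS' F1 F2).
  by rewrite (merge_Lam_sum t rho pS' F1 F2) p0 pN.
apply: ler_sum => z _.
have [k1 k2 k3] := merge_itv t0 tN pS' qS' z.
have -> : merge_hi (fun j => Num.min (tau N j) s) (fun j => Num.min (tau N' j) s) z =
   Num.min (merge_hi (tau N) (tau N') z) s by exact: min_clamp.
have -> : merge_lo (fun j => Num.min (tau N j) s) (fun j => Num.min (tau N' j) s) z =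
   Num.min (merge_lo (tau N) (tau N') z) s by exact: min_clamp.
have Ds := Lam_stopped_le ts sT k1 k2 k3.
(* Degenerate common cells contribute nothing; on the others the two original cells overlap, which
   is what the hypothesis on X and X' asks for. *)
move: (k2); rewrite le_eqVlt => /orP[/eqP E|lh].
  have n1 := mulr_ge0 (D0 z) (sqr_ge0 (phi g (tau N z.1) - phi g (tau N' z.2))).
  have n2 := mulr_ge0 (mulr_ge0 (ler0n R 2) (sqr_ge0 Bphi)) e20.
  by rewrite -E subrr mul0r; apply: addr_ge0; apply: mulr_ge0 => //; exact: mulr_ge0.
have [u1 u2 E] := clamp_lt (pS' _ (ltn_ord z.1)) (qS' _ (ltn_ord z.2)) lh.
have E' := lh; rewrite {1}/merge_lo E /merge_hi /clamp in E'.
have jI := partition_seq_itv ptau N0 (ltnW (ltn_ord z.1)).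
have iI := partition_seq_itv ptau N0' (ltnW (ltn_ord z.2)).
have jP : tau N z.1 < tau N' z.2.+1.
  move: lh; rewrite /merge_lo E /merge_hi /clamp gt_max => /andP[]. 
  rewrite lt_max ltxx/= lt_min => /andP[]//.
have iP : tau N' z.2 < tau N z.1.+1.
  rewrite ltNge; apply/negP => h; move: lh; rewrite /merge_lo /merge_hi /clamp.
  by rewrite ?(min_l h) ?(min_l (le_trans h (ltW u2))) ltxx.
have nX := XX' _ _ (ltn_ord z.1) (ltn_ord z.2) jP iP.
have L := L2B (LX _ jI) (LX' _ iI).
have nc : nrm P (fun w => phi g (tau N z.1) * X (tau N z.1) w - phi g (tau N' z.2) * X' (tau N' z.2) w) <=
   2 * B * (phi g (tau N z.1) - phi g (tau N' z.2)) ^+ 2 + 2 * Bphi ^+ 2 * e2.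
  rewrite (nrm_eq P (g := fun w => (phi g (tau N z.1) - phi g (tau N' z.2)) * X (tau N z.1) w +
     phi g (tau N' z.2) * (X (tau N z.1) w - X' (tau N' z.2) w))); last by move=> w; ring.
  apply: le_trans (nrmD2 (L2Z _ (LX _ jI)) (L2Z _ L)) _.
  rewrite !nrmZ//; last exact: LX.
  apply: lerD.
    rewrite -mulrA ler_wpM2l// mulrC ler_wpM2r ?sqr_ge0//.
    by move: jI; rewrite in_itv/= => /andP[]; exact: XB.
  rewrite -mulrA ler_wpM2l//; apply: ler_pM; rewrite ?sqr_ge0 ?nrm_ge0//.
  by rewrite -(real_normK (num_real (phi g _))) lerXn2r ?nnegrE ?(le_trans _ (phiB g iI))// phiB.
apply: (@le_trans _ _ (D z * (2 * B * (phi g (tau N z.1) - phi g (tau N' z.2)) ^+ 2 + 2 * Bphi ^+ 2 * e2))).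
  apply: ler_pM => //; last exact: nrm_ge0.
  by rewrite subr_ge0 (Lam_le rho0 rhoC)// ?le_min2// ?le_min ?k1// ge_min sT orbT.
by rewrite mulrDr le_eqVlt; apply/orP; left; apply/eqP; ring.
Qed.

(** Induction on the depth, uniformly in the time and in the set of factors. The inner sums at the
    left ends of overlapping cells differ by a time shift, small by the Lipschitz bound and the
    mesh, and by a change of partition, small by induction. *)
Lemma nested_sum_cauchy m (e : R) : 0 < e -> exists2 N0 : nat, (0 < N0)%N &
  forall N N' A s, (N0 <= N)%N -> (N0 <= N')%N -> t <= s -> s <= T ->
  nrm P (fun w => Q m A N s w - Q m A N' s w) <= e.
Proof.
have triv A N N' s n : A = finset.set0 \/ n = 0%N -> nrm P (fun w => Q n A N s w - Q n A N' s w) = 0.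
  move=> h; rewrite -(nrm0 P); apply: nrm_eq => w; case: h => ->; first by rewrite !nested_sum_set0 subrr.
  by rewrite /=; case: ifP; rewrite subrr.
elim: m e => [|m IH] e e0.
  by exists 1%N => // N N' A s _ _ _ _; rewrite triv ?ltW//; right.
have [B B0 HB] := nested_sum_bound tT filt M2 rho0 rhoC C0 CV phiB ptau S m.
have [D D0 HD] := nested_sum_lipschitz tT filt M2 rho0 rhoC C0 CV phiB ptau S m.
set LT := Lam T - Lam t.
have LT0 : 0 <= LT by rewrite subr_ge0 (Lam_le rho0 rhoC)// ltW.
pose c1 := k%:R ^+ 2 * (C * (2 * B)); pose c2 := k%:R ^+ 2 * (C * (2 * Bphi ^+ 2 * LT)).
have c10 : 0 <= c1 by rewrite mulr_ge0 ?sqr_ge0// mulr_ge0// mulr_ge0.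
have c20 : 0 <= c2 by rewrite mulr_ge0 ?sqr_ge0// mulr_ge0// mulr_ge0// mulr_ge0 ?sqr_ge0.
have e20 : 0 < e / 2 by rewrite divr_gt0.
have [e1 e1P He1] := small_factor c10 e20.
have [e2 e2P He2] := small_factor c20 e20.
(* A quarter for each of the two contributions, which [nrmD2] doubles. *)
have e24 : 0 < e2 / 4 by rewrite divr_gt0.
have [N1 N10 HN1] := IH _ e24.
have [de deP Hde] := small_factor D0 e24.
have [N2 HN2] := partition_mesh ptau deP.
have [n3 Hn3] : exists n3 : 'I_k -> nat, forall g N N', (n3 g <= N)%N -> (n3 g <= N')%N ->
   nrm P (fun w => increment_sum (M g) (tau N) (fun j => phi g (tau N j)) N w -
                  increment_sum (M g) (tau N') (fun j => phi g (tau N' j)) N' w) <= e1.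
  have H g := cau g e1P.
  exists (fun g => sval (cid (H g))) => g N N' hN hN'.
  by apply: ltW; apply: (svalP (cid (H g))).
exists (maxn N1 (maxn N2 (\max_g n3 g))); first by rewrite leq_max N10.
move=> N N' A s; rewrite !geq_max => /and3P[a1 a2 a3] /and3P[b1 b2 b3] ts sT.
have [->|A0] := eqVneq A finset.set0; first by rewrite triv ?ltW//; left.
rewrite !(nested_sum_next _ _ _ _ _ _ _ A0).
have N0 := leq_trans N10 a1; have N0' := leq_trans N10 b1.
rewrite (nrm_eq P (g := fun w => \sum_(g in S A)
  (elem_sum (M g) (fun j => Num.min (tau N j) s) (fun j w => phi g (tau N j) * Q m (A :\ g) N (tau N j) w) N w -
  elem_sum (M g) (fun j => Num.min (tau N' j) s) (fun j w => phi g (tau N' j) * Q m (A :\ g) N' (tau N' j) w) N' w)));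
  last by move=> w; rewrite sumrB.
pose b := C * (2 * B * e1 + 2 * Bphi ^+ 2 * e2 * LT).
have b0 : 0 <= b.
  rewrite mulr_ge0// addr_ge0//; first by rewrite !mulr_ge0// ltW.
  by rewrite mulr_ge0// mulr_ge0 ?(ltW e2P)// mulr_ge0 ?sqr_ge0.
apply: le_trans (nrm_sum_in_le b0 _).2 _; last first.
  rewrite /b mulrDr mulrDr [leRHS](splitr e); apply: lerD.
    by apply: le_trans He1; rewrite /c1 le_eqVlt; apply/orP; left; apply/eqP; ring.
  by apply: le_trans He2; rewrite /c2 le_eqVlt; apply/orP; left; apply/eqP; ring.
move=> g gA.
have Aw N'' : (0 < N'')%N -> forall u, t <= u -> u <= T -> adaptedL2 P F u (Q m (A :\ g) N'' u).
  by move=> N0'' u tu uT; case: (HB (A :\ g) N'' u N0'' tu uT).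
have [a0_ aN aS] := stopped_times ptau N0 ts sT.
have [b0_ bN bS] := stopped_times ptau N0' ts sT.
split.
  apply: L2B.
    have h1 : t <= Num.min (tau N 0) s by rewrite a0_.
    have h2 : Num.min (tau N N) s <= T by rewrite aN.
    apply: (elem_sum_bound filt rho0 rhoC (mart g) C0 (@CV g) h1 h2 aS _).1.
    by move=> j jN; apply: (stopped_adapted filt ptau _ N0 jN ts sT (Aw _ N0)).
  have h1 : t <= Num.min (tau N' 0) s by rewrite b0_.
  have h2 : Num.min (tau N' N') s <= T by rewrite bN.
  apply: (elem_sum_bound filt rho0 rhoC (mart g) C0 (@CV g) h1 h2 bS _).1.
  by move=> j jN; apply: (stopped_adapted filt ptau _ N0' jN ts sT (Aw _ N0')).
apply: nested_sum_merge_bound => //.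
- exact: ltW.
- by move=> u tu uT; split; exact: Aw.
- by move=> u tu uT; have [] := HB (A :\ g) N u N0 tu uT.
- move=> j i jN iN' ji ij.
  have jI := partition_seq_itv ptau N0 (ltnW jN); have iI := partition_seq_itv ptau N0' (ltnW iN').
  have LQ n u : (0 < n)%N -> u \in `[t, T] -> L2 (Q m (A :\ g) n u).
    by move=> n0; rewrite in_itv/= => /andP[tu uT]; case: (Aw n n0 u tu uT).
  have dj := HN2 _ a2 _ jN; have di := HN2 _ b2 _ iN'.
  rewrite (nrm_eq P (g := fun w => (Q m (A :\ g) N (tau N j) w - Q m (A :\ g) N (tau N' i) w) +
     (Q m (A :\ g) N (tau N' i) w - Q m (A :\ g) N' (tau N' i) w))); last by move=> w; ring.
  apply: le_trans (nrmD2 (L2B (LQ _ _ N0 jI) (LQ _ _ N0 iI)) (L2B (LQ _ _ N0 iI) (LQ _ _ N0' iI))) _.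
  have -> : e2 = 2 * (e2 / 4) + 2 * (e2 / 4) by field.
  move: (jI) (iI); rewrite !in_itv/= => /andP[tj jT] /andP[ti iT].
  apply: lerD; rewrite ler_wpM2l//; last exact: HN1.
  have [le|/ltW le] := leP (tau N j) (tau N' i).
    rewrite (nrm_eq P (g := fun w => - (Q m (A :\ g) N (tau N' i) w - Q m (A :\ g) N (tau N j) w))); last by move=> w; ring.
    rewrite nrmN; apply: le_trans (HD _ _ _ _ N0 tj le iT) _.
    apply: le_trans Hde; rewrite ler_wpM2l// ltW//.
    by apply: lt_trans dj; rewrite ltrD2r.
  apply: le_trans (HD _ _ _ _ N0 ti le jT) _.
  apply: le_trans Hde; rewrite ler_wpM2l// ltW//.
  by apply: lt_trans di; rewrite ltrD2r.
- by apply: Hn3; [apply: leq_trans a3|apply: leq_trans b3]; apply: (leq_bigmax g).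
Qed.

End nested_sum_convergence.

(** * Nested integrals as sums over multi-indices *)

Section stopped_sums.
Context (R : realType) d (Omega : measurableType d).
Variables (k N : nat) (M : 'I_k -> R -> Omega -> R) (phi : 'I_k -> R -> R) (tau : nat -> nat -> R).
Hypothesis pS : forall j, (j < N)%N -> tau N j < tau N j.+1.

Lemma elem_sum_stopped (g : 'I_k) c n w : (n <= N)%N ->
  elem_sum (M g) (fun j => Num.min (tau N j) (tau N n)) c N w =
  \sum_(j < n) c j w * (M g (tau N j.+1) w - M g (tau N j) w).
Proof.
move=> nN; have pm i j : (i <= j)%N -> (j <= N)%N -> tau N i <= tau N j by exact: partition_le.
rewrite /elem_sum (big_ord_widen N (fun j => c j w * (M g (tau N j.+1) w - M g (tau N j) w)) nN).
rewrite [RHS]big_mkcond; apply: eq_bigr => j _; case: ifPn => [jn|].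
  by rewrite ?(min_l (pm _ _ jn nN)) ?(min_l (pm _ _ (ltnW jn) nN)).
rewrite -leqNgt => nj; have jN := ltn_ord j.
by rewrite ?(min_r (pm _ _ nj (ltnW jN))) ?(min_r (pm _ _ (leqW nj) jN)) subrr mulr0.
Qed.

Let f w (g : 'I_k) j := phi g (tau N j) * (M g (tau N j.+1) w - M g (tau N j) w).

Lemma nested_sum_step (S : {set 'I_k} -> {set 'I_k}) m A n w : A != finset.set0 -> (n < N)%N ->
  nested_sum M phi tau S m.+1 A N (tau N n.+1) w = nested_sum M phi tau S m.+1 A N (tau N n) w +
  \sum_(g in S A) f w g n * nested_sum M phi tau S m (A :\ g) N (tau N n) w.
Proof.
move=> A0 nN; rewrite !(nested_sum_next _ _ _ _ _ _ _ A0) -big_split/=; apply: eq_bigr => g gA.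
rewrite !elem_sum_stopped//; last exact: ltnW.
by rewrite big_ord_recr/=; congr (_ + _); rewrite /f; ring.
Qed.

Lemma nested_sum_start (S : {set 'I_k} -> {set 'I_k}) m A w : A != finset.set0 ->
  nested_sum M phi tau S m A N (tau N 0) w = 0.
Proof.
move=> A0; case: m => [|m]; first by rewrite (nested_sum_stop _ _ _ _ _ _ A0).
rewrite (nested_sum_next _ _ _ _ _ _ _ A0) big1// => g _.
by rewrite elem_sum_stopped// big_ord0.
Qed.

(** Both sides have the same initial values and the same recursion in n: an inner integral stopped
    at the left end of the cell n uses earlier cells only, so no index is repeated. *)
Lemma nested_sum_inj m (A : {set 'I_k}) n l0 w : (#|A| <= m)%N -> (n <= N)%N ->
  nested_sum M phi tau id m A N (tau N n) w = inj_sum (N := N) (fun=> 1) (f w) A n l0.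
Proof.
elim: m A n l0 => [|m IH] A n l0 Am nN.
  move: Am; rewrite leqn0 cards_eq0 => /eqP ->.
  by rewrite nested_sum_set0 inj_sum_set0.
have [->|A0] := eqVneq A finset.set0; first by rewrite nested_sum_set0 inj_sum_set0.
elim: n nN => [|n ihn] nN; first by rewrite nested_sum_start// inj_sum0.
rewrite nested_sum_step// (inj_sumS _ _ _ _ nN) ihn; last exact: ltnW.
congr (_ + _); apply: eq_bigr => g gA; congr (_ * _); apply: IH; last exact: ltnW.
by move: Am; rewrite (cardsD1 g A) gA.
Qed.

(** The largest element of A, as a set, to serve as the parameter S of [nested_sum]. *)
Definition last_index (A : {set 'I_k}) : {set 'I_k} := [set g in A | [forall h in A, h <= g]%N]%SET.

Definition initial i : {set 'I_k} := [set g : 'I_k | (g < i)%N]%SET.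

Lemma initial0 : initial 0 = finset.set0.
Proof. by apply/finset.setP => g; rewrite !inE. Qed.

Lemma last_index_initial i (ik : (i < k)%N) : last_index (initial i.+1) = [set Ordinal ik]%SET.
Proof.
apply/finset.setP => g; rewrite !inE; apply/andP/eqP => [[gi /forallP/(_ (Ordinal ik))]|->]; last first.
  by rewrite /= ltnS leqnn; split=> //; apply/forall_inP => h; rewrite inE.
rewrite inE/= ltnSn/= => ig; apply: val_inj; apply/eqP => /=.
by rewrite eqn_leq ig -ltnS gi.
Qed.

Lemma initialD1 i (ik : (i < k)%N) : initial i.+1 :\ Ordinal ik = initial i.
Proof.
apply/finset.setP => g; rewrite !inE -val_eqE/= ltnS.
by rewrite [RHS]ltn_neqAle.
Qed.

Lemma nested_sum_incr m i n l0 w : (i <= m)%N -> (i <= k)%N -> (n <= N)%N ->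
  nested_sum M phi tau last_index m (initial i) N (tau N n) w =
  incr_sum (N := N) (f w) i n l0.
Proof.
elim: m i n l0 => [|m IH] i n l0.
  rewrite leqn0 => /eqP -> _ nN; rewrite incr_sum_empty.
  by rewrite initial0 nested_sum_set0.
case: i => [|i] im ik nN.
  by rewrite incr_sum_empty initial0 nested_sum_set0.
have A0 : initial i.+1 != finset.set0.
  by apply/finset.set0Pn; exists (Ordinal ik); rewrite inE/=.
elim: n nN => [|n ihn] nN; first by rewrite nested_sum_start// incr_sum0.
rewrite nested_sum_step// (incr_sumS _ _ ik nN) ihn; last exact: ltnW.
congr (_ + _); rewrite last_index_initial big_set1 initialD1.
by rewrite -(IH i)//; [exact: ltnW|exact: ltnW].
Qed.

End stopped_sums.

(** * Energy and limits of sums over distinct indices *)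

Section multiple_sums.
Context (R : realType) d (Omega : measurableType d) (P : probability Omega R).
Variables (t T : R) (F : R -> set_system Omega) (rho : R -> R) (k : nat).
Variable M : 'I_k -> R -> Omega -> R.
Hypothesis tT : t < T.
Hypothesis filt : filtration F t T.
Hypothesis M2 : forall g, class_M2 P F rho t T (M g).
Hypothesis rho0 : forall x, x \in `[t, T] -> 0 <= rho x.
Hypothesis rhoC : {within `[t, T], continuous rho}.
Variable C : R.
Hypothesis C0 : 0 <= C.
Hypothesis CV : forall g, conditional_variance_bound P t T F rho (M g) C.
Local Notation L2 f := (square_integrable P setT f).
Local Notation Lam := (Lam t rho).
Variable tau : nat -> nat -> R.
Hypothesis ptau : partition_sequence t T tau.

Let mart g : martingale P F t T (M g).
Proof. exact: M2_mart (M2 g). Qed.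

(* Peeling off the cell n splits the sum into two orthogonal parts. *)
Lemma inj_sum_energy N (a : {ffun 'I_k -> 'I_N} -> R) m (A : {set 'I_k}) n l0 :
  (#|A| <= m)%N -> (0 < N)%N -> (n <= N)%N ->
  let V w := inj_sum a (fun g j => M g (tau N j.+1) w - M g (tau N j) w) A n l0 in
  adaptedL2 P F (tau N n) V /\
  nrm P V <= (k%:R * C) ^+ #|A| *
    inj_sum (fun l => a l ^+ 2) (fun g j => Lam (tau N j.+1) - Lam (tau N j)) A n l0.
Proof.
move=> + N0; have pI := partition_sequence_itv ptau N0; have [_ /(_ N) pS _] := ptau.
have kC0 : 0 <= k%:R * C by rewrite mulr_ge0.
have cst_case n' (c : R) : (n' <= N)%N -> adaptedL2 P F (tau N n') (fun=> c) /\ nrm P (fun=> c) = c ^+ 2.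
  move=> nN; have [tn nT] := pI _ nN; split; first exact: (adaptedL2_cst P filt c tn nT).
  by rewrite /nrm Rintegral_cst//=; have := probability_setT P; rewrite /= => ->; rewrite mulr1.
elim: m A n l0 => [|m IH] A n l0 Am nN /=.
  move: Am; rewrite leqn0 cards_eq0 => /eqP ->; rewrite cards0 expr0 mul1r inj_sum_set0.
  under [X in adaptedL2 _ _ _ X]eq_fun do rewrite inj_sum_set0.
  under [X in nrm _ X]eq_fun do rewrite inj_sum_set0.
  by have [h ->] := cst_case n (a l0) nN.
have [->|A0] := eqVneq A finset.set0.
  rewrite cards0 expr0 mul1r inj_sum_set0.
  under [X in adaptedL2 _ _ _ X]eq_fun do rewrite inj_sum_set0.
  under [X in nrm _ X]eq_fun do rewrite inj_sum_set0.
  by have [h ->] := cst_case n (a l0) nN.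
elim: n nN => [|n ihn] nN.
  rewrite inj_sum0// mulr0.
  under [X in adaptedL2 _ _ _ X]eq_fun do rewrite inj_sum0//.
  under [X in nrm _ X]eq_fun do rewrite inj_sum0//.
  by have [h ->] := cst_case 0 0 (leq0n N); rewrite expr0n.
have nN' := ltnW nN; have [[aV LV] nV] := ihn nN'.
have [tn nT] := pI _ nN'; have [tn1 n1T] := pI _ nN; have nn1 := ltW (pS _ nN).
under [X in adaptedL2 _ _ _ X]eq_fun do rewrite (inj_sumS _ _ _ _ nN).
under [X in nrm _ X]eq_fun do rewrite (inj_sumS _ _ _ _ nN).
rewrite (inj_sumS _ _ _ _ nN).
set V := (fun w => inj_sum a _ A n l0) in aV LV nV.
pose U g w := inj_sum a (fun g j => M g (tau N j.+1) w - M g (tau N j) w) (A :\ g) n (update l0 g (Ordinal nN)).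
pose h g := if g \in A then (fun w => U g w * (M g (tau N n.+1) w - M g (tau N n) w)) else fun=> 0.
have HU g : g \in A -> adaptedL2 P F (tau N n) (U g) /\
   nrm P (U g) <= (k%:R * C) ^+ #|A|.-1 * inj_sum (fun l => a l ^+ 2)
     (fun g j => Lam (tau N j.+1) - Lam (tau N j)) (A :\ g) n (update l0 g (Ordinal nN)).
  move=> gA; have cA : #|A :\ g| = #|A|.-1 by rewrite (cardsD1 g A) gA.
  by rewrite -cA; apply: IH => //; rewrite cA; case: #|A| Am.
have Eh w : \sum_(g in A) (M g (tau N n.+1) w - M g (tau N n) w) * U g w = \sum_g h g w.
  by rewrite big_mkcond; apply: eq_bigr => g _; rewrite /h; case: (g \in A) => //; rewrite mulrC.
have Lh g : L2 (h g).
  rewrite /h; case: ifPn => [gA|_]; last exact: L2_0.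
  by have [AU _] := HU g gA; have [] := CV g tn nn1 n1T AU.
have Ah g : measurable_wrt (F (tau N n.+1)) (h g).
  rewrite /h; case: ifPn => [gA|_]; last exact: (measurable_wrt_cst (filtration_sigma filt tn1 n1T)).
  by have [AU _] := HU g gA; case: (increment_adaptedL2 filt (mart g) (@CV g) tn nn1 (lexx _) n1T AU).
have sF := filtration_sigma filt tn1 n1T.
have EV w : V w + \sum_(g in A) (M g (tau N n.+1) w - M g (tau N n) w) * U g w = V w + \sum_g h g w.
  by rewrite Eh.
have LS : L2 (fun w => \sum_g h g w) by apply: L2_sum => g _; exact: Lh.
split.
  rewrite (_ : (fun w => _) = fun w => V w + \sum_g h g w); last by apply/funext => w; exact: EV.
  split; last exact: L2D.
  apply: (measurable_wrtD sF); first exact: (measurable_wrt_mono filt tn nn1 n1T aV).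
  exact: (measurable_wrt_sum sF).
rewrite (nrm_eq P EV) nrmD//.
(* V uses only the cells before n, so it is known at [tau N n] and orthogonal to every increment
   over the cell n. *)
have -> : \int[P]_w (V w * \sum_g h g w) = 0.
  rewrite (Rint_eq P (g := fun w => \sum_g V w * h g w)); last by move=> w; rewrite mulr_sumr.
  rewrite Rint_sum; last by move=> g _; exact: L2M_int.
  rewrite big1// => g _; rewrite /h; case: ifPn => gA; last first.
    by rewrite (Rint_eq P (g := fun=> 0)) ?Rintegral_cst ?mul0r// => w; rewrite mulr0.
  have [AU _] := HU g gA.
  exact: (martingale_L2_orth filt (mart g) (@CV g) tn nn1 n1T (conj aV LV) AU).
rewrite mulr0 addr0 mulrDr; apply: lerD => //.
(* The terms of different g share the same cell and need not be orthogonal; the square of their sum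
   costs the factor k. *)
apply: le_trans (nrm_sum_le Lh) _; rewrite card_ord.
have cA : (0 < #|A|)%N by rewrite card_gt0.
rewrite -(prednK cA) exprS -!mulrA ler_wpM2l// mulrA.
rewrite [in leRHS]big_mkcond mulr_sumr; apply: ler_sum => g _; rewrite /h.
case: ifPn => gA; last by rewrite nrm0 mulr0.
have [AU nU] := HU g gA; have [_ n1] := CV g tn nn1 n1T AU.
apply: le_trans n1 _.
rewrite -!mulrA ler_wpM2l// mulrCA ler_wpM2l ?subr_ge0 ?(Lam_le rho0 rhoC)//.
Qed.

Variables (phi : 'I_k -> R -> R) (Bphi : R).
Hypothesis phiB : forall g x, x \in `[t, T] -> `|phi g x| <= Bphi.
Variable xi : 'I_k -> Omega -> R.
Hypothesis Lxi : forall g, L2 (xi g).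
Hypothesis cxi : forall g,
  cvg2 P (fun N => increment_sum (M g) (tau N) (fun j => phi g (tau N j)) N) (xi g).
Hypothesis bxi : forall g,
  bounded_moments P (fun N => increment_sum (M g) (tau N) (fun j => phi g (tau N j)) N).

Definition product_sum N (A : {set {ffun 'I_k -> 'I_N}}) (w : Omega) : R :=
  \sum_(l in A) \prod_g (phi g (tau N (l g)) * (M g (tau N (l g).+1) w - M g (tau N (l g)) w)).

Lemma distinct_sum_nested N w : (0 < N)%N ->
  product_sum (distinct_indices k N) w = nested_sum M phi tau id k [set: 'I_k]%SET N T w.
Proof.
move=> N0; have [/(_ N N0)[_ pN] /(_ N) pS _] := ptau.
rewrite -pN (nested_sum_inj _ _ pS [ffun=> Ordinal N0])//; last by rewrite cardsT card_ord.
rewrite inj_sumT; apply: eq_bigr => l _; by rewrite mul1r.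
Qed.

Lemma increment_cauchy g : cauchy2 P (fun N => increment_sum (M g) (tau N) (fun j => phi g (tau N j)) N).
Proof. by apply: (cvg2_cauchy (fun n => bounded_moments_L2 n (bxi g)) (Lxi g) (cxi g)). Qed.

(** At depth k and time T the nested integrals are the sums over distinct indices, which thus
    inherit the Cauchy property. The sequence starts at N = 1 because the row [tau 0] is no
    partition. *)
Lemma distinct_sum_limit : exists V, [/\ L2 V,
  forall N, (0 < N)%N -> L2 (product_sum (distinct_indices k N)) &
  cvg2 P (fun N => product_sum (distinct_indices k N)) V].
Proof.
pose Q N := nested_sum M phi tau id k [set: 'I_k]%SET N.+1 T.
have [B B0 HB] := nested_sum_bound tT filt M2 rho0 rhoC C0 CV phiB ptau id k.
have LQ N : L2 (Q N).
  by have [[]] := HB [set: 'I_k]%SET N.+1 T (ltn0Sn _) (ltW tT) (lexx T).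
have cQ : cauchy2 P Q.
  move=> e e0; have e20 : 0 < e / 2 by rewrite divr_gt0.
  have [N0 _ HN0] := nested_sum_cauchy tT filt M2 rho0 rhoC C0 CV phiB ptau id increment_cauchy k e20.
  exists N0 => m n mN nN; apply: (@le_lt_trans _ _ (e / 2)).
    by apply: (HN0 m.+1 n.+1); rewrite ?leqW// ltW.
  by rewrite ltr_pdivrMr// ltr_pMr// ltr1n.
have [V LV cV] := cauchy2_cvg LQ cQ.
exists V; split=> // [N N0|].
  case: N N0 => // N _; apply: (L2_eq _ (LQ N)) => w; by rewrite distinct_sum_nested.
move=> e /cV[n0 Hn0]; exists n0.+1 => -[//|n] nn.
rewrite (nrm_eq P (g := fun w => Q n w - V w)); first exact: Hn0.
by move=> w; rewrite distinct_sum_nested.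
Qed.

Lemma multi_sum_prod N w : product_sum (multi_indices k N) w =
  \prod_g increment_sum (M g) (tau N) (fun j => phi g (tau N j)) N w.
Proof.
rewrite /increment_sum bigA_distr_bigA/=; apply: eq_bigl => l; by rewrite inE.
Qed.

Lemma coinciding_sumE N w : product_sum (coinciding_indices k N) w =
  \prod_g increment_sum (M g) (tau N) (fun j => phi g (tau N j)) N w -
  product_sum (distinct_indices k N) w.
Proof.
rewrite -multi_sum_prod /product_sum [in RHS](big_setID (A := multi_indices k N) (distinct_indices k N))/= addrC.
have -> : (multi_indices k N :&: distinct_indices k N)%SET = distinct_indices k N.
  by apply/finset.setP => l; rewrite !inE.
by rewrite addrK.
Qed.

Lemma coinciding_sum_limit V : L2 V ->
  (forall N, (0 < N)%N -> L2 (product_sum (distinct_indices k N))) ->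
  cvg2 P (fun N => product_sum (distinct_indices k N)) V ->
  ms_limit P (fun N => product_sum (coinciding_indices k N)) (fun w => \prod_g xi g w - V w) /\
  L2 (fun w => \prod_g xi g w).
Proof.
move=> LV Ld cV.
have [bp Lp cp] := cvg2_bounded_moments_prod (index_enum 'I_k) bxi Lxi cxi.
split=> //.
have LN n := bounded_moments_L2 n bp.
have Lc n : (0 < n)%N -> L2 (product_sum (coinciding_indices k n)).
  by move=> n0; apply: (L2_eq _ (L2B (LN n) (Ld n n0))) => w; rewrite coinciding_sumE.
apply: cvg2_ms_limit => //; first exact: L2B.
move=> e e0; have e40 : 0 < e / 4 by rewrite divr_gt0.
have [n1 H1] := cV _ e40; have [n2 H2] := cp _ e40.
exists (maxn 1 (maxn n1 n2)) => n; rewrite !geq_max => /and3P[n0 nn1 nn2].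
rewrite (nrm_eq P (g := fun w => (\prod_g increment_sum (M g) (tau n) (fun j => phi g (tau n j)) n w - \prod_g xi g w)
   - (product_sum (distinct_indices k n) w - V w))); last by move=> w; rewrite coinciding_sumE; ring.
apply: le_lt_trans (nrmB2 (L2B (LN n) Lp) (L2B (Ld n n0) LV)) _.
have := H1 _ nn1; have := H2 _ nn2; lra.
Qed.

End multiple_sums.

(** * Convergence of iterated sums to the iterated integral *)

Section cut_partition.
Context (R : realType).
Variables (t T s : R) (tau : nat -> nat -> R).
Hypotheses (ts : t < s) (sT : s <= T).
Hypothesis ptau : partition_sequence t T tau.

(* The partition tau N, stopped at s, whose last cell is subdivided to keep N cells. *)
Lemma cut_partition : exists (p : nat -> nat -> R) (a : nat -> nat),
  partition_sequence t s p /\ forall N, (0 < N)%N ->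
  [/\ (a N < N)%N, forall j, (j <= a N)%N -> p N j = tau N j & s <= tau N (a N).+1].
Proof.
have H N : exists pa : (nat -> R) * nat, (0 < N)%N ->
  [/\ (pa.2 < N)%N, forall j, (j <= pa.2)%N -> pa.1 j = tau N j, s <= tau N pa.2.+1, pa.1 N = s &
    forall j, (j < N)%N -> pa.1 j < pa.1 j.+1 /\ exists2 i, (i < N)%N & pa.1 j.+1 - pa.1 j <= tau N i.+1 - tau N i].
  have [->|N0] := posnP N; first by exists (fun=> 0, 0%N).
  have [/(_ N N0)[p0 pN] /(_ N) pS _] := ptau.
  have [a aN [as_ sa]] : exists2 a, (a < N)%N & tau N a < s /\ s <= tau N a.+1.
    have ex : exists j, s <= tau N j by exists N; rewrite pN.
    case: (ex_minnP ex) => -[|a] sa amin; first by move: sa; rewrite p0 leNgt ts.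
    exists a; first by apply: amin; rewrite pN.
    by split=> //; rewrite ltNge; apply/negP => /amin; rewrite ltnn.
  have Na : 0 < (N - a)%:R :> R by rewrite ltr0n subn_gt0.
  pose h := (s - tau N a) / (N - a)%:R.
  have h0 : 0 < h by rewrite divr_gt0// subr_gt0.
  exists (fun j => if (j <= a)%N then tau N j else tau N a + (j - a)%:R * h, a) => _ /=.
  split=> //; first by move=> j ->.
    rewrite leqNgt aN/= /h mulrCA divff ?mulr1 ?gt_eqF//; ring.
  move=> j jN; case: (ltngtP j a) => ja.
  - by split; [exact: pS|exists j].
  - have -> : (j.+1 - a)%:R * h = (j - a)%:R * h + h by rewrite subSn ?(ltnW ja)// -natr1 mulrDl mul1r.
    rewrite addrA; split; first by rewrite ltrDl.
    exists a => //; rewrite [leLHS]addrAC subrr add0r /h ler_pdivrMr//.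
    apply: (@le_trans _ _ (tau N a.+1 - tau N a)); first by rewrite lerD2r.
    by rewrite ler_peMr//; [rewrite subr_ge0 ltW// pS|rewrite ler1n subn_gt0].
  - rewrite ja subSnn mul1r; split; first by rewrite ltrDl.
    exists a => //; rewrite addrAC subrr add0r /h ler_pdivrMr//.
    apply: (@le_trans _ _ (tau N a.+1 - tau N a)); first by rewrite lerD2r.
    by rewrite ler_peMr//; [rewrite subr_ge0 ltW// pS|rewrite ler1n subn_gt0].
have {H}[pa Hpa] := choice H.
exists (fun N => (pa N).1), (fun N => (pa N).2); split; last by move=> N /Hpa[].
split.
- move=> N N0; have [_ p0 _ pN _] := Hpa N N0; split=> //; rewrite p0//.
  by have [/(_ N N0)[]] := ptau.
- by move=> N j jN; have [_ _ _ _ /(_ j jN)[]] := Hpa N (leq_ltn_trans (leq0n _) jN).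
apply/cvgrPdist_lt => e /(partition_mesh ptau)[N0 HN0].
exists (maxn N0 1) => // N /=; rewrite geq_max => /andP[/HN0 h N1].
rewrite sub0r normrN ger0_norm ?bigmax_ge_id//.
have e0 : 0 < e.
  by apply: le_lt_trans (h _ N1); have [_ pS _] := ptau; rewrite subr_ge0 ltW// pS.
apply: bigmax_lt => // j _.
have [_ _ _ _ /(_ j (ltn_ord j))[_ [i iN le]]] := Hpa N N1.
exact: le_lt_trans le (h _ iN).
Qed.

(** On the subdivided last cell the coefficient stays frozen at the index a, so the increments
    telescope to the stopped increment from [tau N a] to s; the later stopped increments vanish. *)
Lemma cut_partition_sum (p : nat -> R) N a (Z : nat -> R) (M : R -> R) : (0 < N)%N ->
  (a < N)%N -> (forall j, (j <= a)%N -> p j = tau N j) -> s <= tau N a.+1 -> p N = s ->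
  (forall j, (j < N)%N -> p j < p j.+1) ->
  \sum_(j < N) Z (minn j a) * (M (p j.+1) - M (p j)) =
  \sum_(j < N) Z j * (M (Num.min (tau N j.+1) s) - M (Num.min (tau N j) s)).
Proof.
move=> N0 aN pa sa pN pS; have [/(_ N N0)[p0 _] /(_ N) tS _] := ptau.
have as_ : tau N a <= s by rewrite -(pa _ (leqnn a)) -pN (partition_le pS (ltnW aN)).
rewrite -(big_mkord xpredT (fun j => Z (minn j a) * (M (p j.+1) - M (p j)))).
rewrite -(big_mkord xpredT (fun j => Z j * (M (Num.min (tau N j.+1) s) - M (Num.min (tau N j) s)))).
rewrite !(big_cat_nat (leq0n a) (ltnW aN))/=; congr (_ + _).
  apply: eq_big_nat => j /andP[_ ja]; rewrite (minn_idPl (ltnW ja)) !pa ?(ltnW ja)//.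
  have h i : (i <= a)%N -> tau N i <= s by move=> ia; rewrite (le_trans _ as_)// (partition_le tS ia (ltnW aN)).
  by rewrite ?(min_l (h _ ja)) ?(min_l (h _ (ltnW ja))).
rewrite (@eq_big_nat _ _ _ a N _ (fun j => Z a * (M (p j.+1) - M (p j)))); last first.
  by move=> j /andP[aj _]; rewrite (minn_idPr aj).
rewrite -mulr_sumr telescope_sumr; last exact: ltnW.
rewrite pN (pa _ (leqnn a)) big_ltn// (min_r sa) (min_l as_).
rewrite big_nat big1 ?addr0// => j /andP[aj jN].
have h : s <= tau N j by apply: le_trans sa _; exact: (partition_le tS aj (ltnW jN)).
by rewrite ?(min_r h) ?(min_r (le_trans h (ltW (tS _ jN)))) subrr mulr0.
Qed.

End cut_partition.

Section energy_measurable.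
Context (R : realType) d (Omega : measurableType d) (P : probability Omega R).

(** Tonelli: the energy at time s is a partial integral of a nonnegative jointly measurable
    function, extended by 0 beyond [a, b]. *)
Lemma measurable_energy (a b : R) (X : R -> Omega -> R) :
  measurable_fun (`[a, b] `*` [set: Omega]) (fun z : measurableTypeR R * Omega => X z.1 z.2) ->
  measurable_fun `[a, b] (fun s => 'E_P[fun w => (`|X s w| ^+ 2)%R])%E.
Proof.
move=> mX; have mD : measurable (`[a, b]%classic `*` [set: Omega]) by exact: measurableX.
pose f (z : measurableTypeR R * Omega) := (`|X z.1 z.2| ^+ 2)%:E.
have mf : measurable_fun setT (f \_ (`[a, b] `*` [set: Omega])).
  apply/measurable_restrict => //; rewrite setTI.
  apply/measurable_EFinP; apply: measurable_funX.
  by apply: (measurableT_comp _ mX); exact: normr_measurable.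
have f0 z : (0 <= (f \_ (`[a, b] `*` [set: Omega])) z)%E.
  by rewrite patchE; case: ifP => // _; rewrite lee_fin exprn_ge0.
have := @measurable_fun_fubini_tonelli_F _ _ _ _ _ P _ mf f0.
move=> /(measurable_funS (E := [set: measurableTypeR R]) (D := `[a, b]%classic) measurableT (@subsetT _ _)).
apply: eq_measurable_fun => s sI; rewrite unlock /fubini_F; apply: eq_integral => w _.
by rewrite patchE ifT// in_setX sI/= in_setT.
Qed.

End energy_measurable.

Section integral_of_sums.
Context (R : realType) d (Omega : measurableType d) (P : probability Omega R).
Variables (t T : R) (F : R -> set_system Omega) (rho : R -> R) (M : R -> Omega -> R).
Hypothesis tT : t < T.
Hypothesis filt : filtration F t T.
Hypothesis rho0 : forall x, x \in `[t, T] -> 0 <= rho x.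
Hypothesis rhoC : {within `[t, T], continuous rho}.
Hypothesis mart : martingale P F t T M.
Variable C : R.
Hypothesis CV : conditional_variance_bound P t T F rho M C.
Local Notation L2 f := (square_integrable P setT f).
Local Notation mu := (@lebesgue_measure R).
Variables (psi : R -> R) (Bpsi : R).
Hypothesis psiC : {within `[t, T], continuous psi}.
Hypothesis psiB : forall x, x \in `[t, T] -> `|psi x| <= Bpsi.
Variable tau : nat -> nat -> R.
Hypothesis ptau : partition_sequence t T tau.
Variables (X : nat -> R -> Omega -> R) (Y : R -> Omega -> R) (B D s : R).
Hypotheses (ts : t < s) (sT : s <= T) (B0 : 0 <= B) (D0 : 0 <= D).
Hypothesis XA : forall N u, (0 < N)%N -> t <= u -> u <= T ->
  adaptedL2 P F u (X N u) /\ nrm P (X N u) <= B.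
Hypothesis XD : forall N u v, (0 < N)%N -> t <= u -> u <= v -> v <= T ->
  nrm P (fun w => X N v w - X N u w) <= D * (v - u).
Hypothesis LY : forall u, t <= u -> u <= s -> L2 (Y u).
Hypothesis XY : forall u, t <= u -> u <= s -> cvg2 P (fun N => X N u) (Y u).

Let nrm_psi x (Z : Omega -> R) (b : R) : x \in `[t, T] -> L2 Z -> nrm P Z <= b ->
  nrm P (fun w => psi x * Z w) <= Bpsi ^+ 2 * b.
Proof.
move=> xI LZ Zb; rewrite nrmZ//; apply: ler_pM; rewrite ?sqr_ge0 ?nrm_ge0//.
by rewrite -(real_normK (num_real (psi x))) lerXn2r ?nnegrE ?(le_trans _ (psiB xI))// psiB.
Qed.

Let LX N u : (0 < N)%N -> t <= u -> u <= T -> L2 (X N u).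
Proof. by move=> N0 tu uT; case: (XA N0 tu uT) => -[]. Qed.

Let Y_bound u : t <= u -> u <= s -> nrm P (Y u) <= 2 * B.
Proof.
move=> tu us; have uT := le_trans us sT.
apply: (@cvg2_nrm_le _ _ _ P (fun N => X N.+1 u)).
- by move=> n; exact: LX.
- exact: LY.
- by move=> e /(XY tu us)[n0 Hn0]; exists n0 => n nn; apply: Hn0; exact: leqW.
- by move=> n; case: (XA (ltn0Sn n) tu uT).
Qed.

(** The difference splits into three parts, controlled by the continuity of psi, the Lipschitz bound
    of X in time, and the convergence at the fixed time u. *)
Lemma left_point_process_cvg u : t <= u -> u < s -> forall e : R, 0 < e ->
  exists2 N0 : nat, (0 < N0)%N & forall N j, (N0 <= N)%N -> (j < N)%N -> tau N j <= u < tau N j.+1 ->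
    nrm P (fun w => psi (tau N j) * X N (tau N j) w - psi u * Y u w) <= e.
Proof.
move=> tu us e e0; have uT := ltW (lt_le_trans us sT).
have uI : u \in `[t, T] by rewrite in_itv/= tu.
have e20 : 0 < e / 2 by rewrite divr_gt0.
(* Two of the three terms pass twice through [nrmD2]: 2 (2 e/16 + 2 e/16) = e/2. *)
have e80 : 0 < e / 16 by rewrite divr_gt0.
have c10 : 0 <= 2 * B by rewrite mulr_ge0.
have c20 : 0 <= Bpsi ^+ 2 * D by rewrite mulr_ge0 ?sqr_ge0.
have [e1 e1P He1] := small_factor c10 e20.
have [e2 e2P He2] := small_factor c20 e80.
have [e3 e3P He3] := small_factor (sqr_ge0 Bpsi) e80.
have h1 : 0 < Num.sqrt e1 by rewrite sqrtr_gt0.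
have psiu : psi y @[y --> within [set` `[t, T]] (nbhs u)] --> psi u.
  by move/subspace_continuousP : psiC; apply.
have [n1 H1] := left_point_cvg ptau psiu h1.
have [n2 H2] := partition_mesh ptau e2P.
have [n3 H3] := XY tu (ltW us) e3P.
exists (maxn 1 (maxn n1 (maxn n2 n3))) => [|N j]; first by rewrite leq_max.
rewrite !geq_max => /and4P[N0 a1 a2 a3] jN ju; have /andP[ju1 ju2] := ju.
have [tj jT] := partition_sequence_itv ptau N0 (ltnW jN).
have jI := partition_seq_itv ptau N0 (ltnW jN).
have L1 := LX N0 tj jT; have L2u := LX N0 tu uT; have L3 := LY tu (ltW us).
rewrite (nrm_eq P (g := fun w => (psi (tau N j) - psi u) * X N (tau N j) w +
  (psi u * (X N (tau N j) w - X N u w) + psi u * (X N u w - Y u w)))); last by move=> w; ring.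
apply: le_trans (nrmD2 (L2Z _ L1) (L2D (L2Z _ (L2B L1 L2u)) (L2Z _ (L2B L2u L3)))) _.
rewrite [leRHS](splitr e); apply: lerD.
  rewrite nrmZ//; apply: le_trans He1; rewrite -mulrA ler_wpM2l// mulrC.
  apply: ler_pM; rewrite ?sqr_ge0 ?nrm_ge0//; first by case: (XA N0 tj jT).
  rewrite -(real_normK (num_real (_ - _))) -(sqr_sqrtr (ltW e1P)) lerXn2r ?nnegrE ?sqrtr_ge0// ltW//.
  exact: H1.
apply: (@le_trans _ _ (2 * (2 * (e / 16) + 2 * (e / 16)))); last by rewrite le_eqVlt; apply/orP; left; apply/eqP; field.
rewrite ler_wpM2l//.
apply: le_trans (nrmD2 (L2Z _ (L2B L1 L2u)) (L2Z _ (L2B L2u L3))) _.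
apply: lerD; rewrite ler_wpM2l//.
  apply: le_trans He2; rewrite -mulrA; apply: nrm_psi => //; first exact: L2B.
  rewrite (nrm_eq P (g := fun w => - (X N u w - X N (tau N j) w))); last by move=> w; ring.
  rewrite nrmN; apply: le_trans (XD N0 tj ju1 uT) _; rewrite ler_wpM2l//.
  by apply: ltW; apply: lt_trans (H2 _ a2 _ jN); rewrite ltrD2r.
apply: le_trans He3; apply: nrm_psi => //; first exact: L2B.
exact: ltW (H3 _ a3).
Qed.

(** The definition of the integral over [t, s] tests only partitions of [t, s] with exactly N cells,
    so the stopped sums are rewritten on cut partitions. Their step processes approach psi Y in H_2:
    pointwise in time by [left_point_process_cvg], and boundedly because Y inherits a bound from
    X. *)
Lemma iterated_step_limit I :
  stochastic_integral P F rho M t s (fun u w => psi u * Y u w) I ->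
  L2 I /\ cvg2 P (fun N => elem_sum M (fun j => Num.min (tau N j) s)
    (fun j w => psi (tau N j) * X N (tau N j) w) N) I.
Proof.
move=> [H2Y _ SI].
have [p [a [pp Hpa]]] := cut_partition ts sT ptau.
(* The values are taken at the points of tau, not of p, so that the integral sum over p equals the
   stopped sum over tau. *)
pose c N j w := psi (tau N (minn j (a N))) * X N (tau N (minn j (a N))) w.
pose xiN N := step_process N (p N) (c N).
have cell N j : (0 < N)%N -> (j < N)%N -> [/\ (minn j (a N) < N)%N, tau N (minn j (a N)) <= p N j &
   p N j.+1 <= tau N (minn j (a N)).+1].
  move=> N0 jN; have [aN pa sa] := Hpa N N0.
  have [/(_ N N0)[_ pN] /(_ N) pS _] := pp.
  have mN : (minn j (a N) < N)%N by rewrite gtn_min jN.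
  split=> //; first by rewrite -pa ?geq_minr// (partition_le pS (geq_minl _ _) (ltnW jN)).
  case: (ltnP j (a N)) => ja; first by rewrite pa.
  by apply: le_trans sa; rewrite -pN (partition_le pS jN).
have cA N j : (0 < N)%N -> (j < N)%N -> adaptedL2 P F (p N j) (c N j) /\ nrm P (c N j) <= Bpsi ^+ 2 * B.
  move=> N0 jN; have [mN mp _] := cell N j N0 jN.
  have [tm mT] := partition_sequence_itv ptau N0 (ltnW mN).
  have mI := partition_seq_itv ptau N0 (ltnW mN).
  have [tp ps] := partition_sequence_itv pp N0 (ltnW jN).
  have pT := le_trans ps sT.
  have [[AX LX'] BX] := XA N0 tm mT.
  split; last exact: nrm_psi.
  have sF := filtration_sigma filt tp pT.
  split; last exact: L2Z.
  apply: (measurable_wrtM sF); first exact: (measurable_wrt_cst sF).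
  exact: (measurable_wrt_mono filt tm mp pT AX).
have HN N : (0 < N)%N -> class_H2 P F rho t s (xiN N).
  move=> N0; have [/(_ N N0)[p0 pN] /(_ N) pS _] := pp.
  apply: (step_class_H2 filt rho0 rhoC (lexx t) sT p0 pN pS) => j jN.
  by case: (cA N j N0 jN).
have Lxi N u : (0 < N)%N -> L2 (xiN N u).
  move=> N0; apply: (step_process_L2 (F := F) (p := p N)) => j jN.
  by case: (cA N j N0 jN).
have bxi N u : (0 < N)%N -> t <= u -> u <= s -> nrm P (xiN N u) <= Bpsi ^+ 2 * B.
  move=> N0 tu; rewrite le_eqVlt => us.
  have [/(_ N N0)[p0 pN] /(_ N) pS _] := pp.
  case/orP : us => [/eqP us|us].
    rewrite /xiN step_process_last//; last by rewrite pN us.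
    by rewrite nrm0 mulr_ge0 ?sqr_ge0.
  have [||j jN ju] := partition_cell pS (x := u); rewrite ?p0 ?pN//.
  by rewrite /xiN (step_processE _ pS jN ju); case: (cA N j N0 jN).
have LpY u : t <= u -> u <= s -> L2 (fun w => psi u * Y u w) by move=> tu us; exact: L2Z (LY tu us).
have energyE N u : (0 < N)%N -> t <= u -> u <= s ->
  ('E_P[fun w => (`|xiN N u w - psi u * Y u w| ^+ 2)%R] * (rho u)%:E =
  (nrm P (fun w => xiN N u w - psi u * Y u w) * rho u)%:E)%E.
  by move=> N0 tu us; rewrite expectation_normsqr ?EFinM//; exact: L2B (Lxi N u N0) (LpY u tu us).
have approx : step_approximation P F rho t s (fun u w => psi u * Y u w) p xiN.
  split=> //.
    move=> N j jN u; rewrite in_itv/= => ju; have [_ /(_ N) pS _] := pp.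
    rewrite /xiN (step_processE _ pS jN ju) (step_processE _ pS jN)//.
    by rewrite lexx pS.
  have [Br Br0 HBr] := rho_bounded rho0 rhoC (ltW tT).
  have b1 : 0 <= Bpsi ^+ 2 * B by rewrite mulr_ge0 ?sqr_ge0.
  (* Only the end point s is exceptional: the step processes are 0 there. *)
  apply: (@dominated_cvg0 _ t s [:: s] _ ((2 * (Bpsi ^+ 2 * B) + 2 * (Bpsi ^+ 2 * (2 * B))) * Br)).
  - move=> N N0; apply: emeasurable_funM.
      apply: measurable_energy; apply: measurable_funB; first by case: (HN N N0).
      by case: H2Y.
    apply/measurable_EFinP.
    by apply: (measurable_funS _ _ (rho_measurable rhoC)) => //; apply: subset_itvl; rewrite bnd_simp.
  - move=> N x N0; rewrite in_itv/= => /andP[tx xs]; have xT := le_trans xs sT.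
    have xI : x \in `[t, T] by rewrite in_itv/= tx.
    rewrite energyE// !lee_fin mulr_ge0 ?nrm_ge0 ?rho0//=.
    apply: ler_pM; rewrite ?nrm_ge0 ?rho0 ?HBr//.
    apply: le_trans (nrmB2 (Lxi N x N0) (LpY x tx xs)) _.
    apply: lerD; rewrite ler_wpM2l ?bxi//.
    by apply: nrm_psi => //; [exact: LY|exact: Y_bound].
  - move=> x; rewrite in_itv/= mem_seq1 => /andP[tx xs] xns.
    have {}xs : x < s by rewrite lt_neqAle xns.
    have xI : x \in `[t, T] by rewrite in_itv/= tx (ltW (lt_le_trans xs sT)).
    have H : (nrm P (fun w => xiN N x w - psi x * Y x w) * rho x)%:E @[N --> \oo] --> 0%E.
      apply: cvg_EFin; first exact: nearW.
      apply/cvgrPdist_lt => e e0.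
      have [e1 e1P He1] := small_factor (rho0 xI) (divr_gt0 e0 (ltr0n _ 2)).
      have [N0 N00 HN0] := left_point_process_cvg tx xs e1P.
      exists N0 => // N /= nN; have N1 := leq_trans N00 nN.
      rewrite sub0r normrN ger0_norm ?mulr_ge0 ?nrm_ge0 ?rho0//.
      have [/(_ N N1)[p0 pN] /(_ N) pS _] := pp.
      have [||j jN ju] := partition_cell pS (x := x); rewrite ?p0 ?pN//.
      have [mN m1 m2] := cell N j N1 jN; have /andP[ju1 ju2] := ju.
      rewrite /xiN (step_processE _ pS jN ju).
      apply: (@le_lt_trans _ _ (e / 2)); last by rewrite ltr_pdivrMr// ltr_pMr// ltr1n.
      apply: le_trans He1; rewrite mulrC ler_wpM2l ?rho0//.
      by apply: (HN0 N _ nN mN); rewrite (le_trans m1 ju1) (lt_le_trans ju2 m2).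
    apply: cvg_trans H; apply: near_eq_cvg; near=> N.
    by rewrite energyE//; [near: N; exact: nbhs_infty_gt|exact: ltW].
have := SI _ _ approx => /ms_limit_L2 ms.
have E N w : (0 < N)%N -> \sum_(j < N) xiN N (p N j) w * (M (p N j.+1) w - M (p N j) w) =
   elem_sum M (fun j => Num.min (tau N j) s) (fun j w => psi (tau N j) * X N (tau N j) w) N w.
  move=> N0; have [aN pa sa] := Hpa N N0; have [/(_ N N0)[p0 pN] /(_ N) pS _] := pp.
  rewrite /elem_sum -(cut_partition_sum ptau (fun j => psi (tau N j) * X N (tau N j) w) (fun u => M u w) N0 aN pa sa pN pS).
  apply: eq_bigr => j _; rewrite /xiN (step_processE _ pS (ltn_ord j))//.
  by rewrite lexx pS.
have LE N : (0 < N)%N -> L2 (fun w => \sum_(j < N) xiN N (p N j) w * (M (p N j.+1) w - M (p N j) w)).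
  move=> N0; have [/(_ N N0)[p0 pN] /(_ N) pS _] := pp.
  apply: L2_sum => j _; have jN := ltn_ord j.
  have [tj _] := partition_sequence_itv pp N0 (ltnW jN); have [_ js] := partition_sequence_itv pp N0 jN.
  have [Ac _] := cA N j N0 jN.
  have [L _] := CV tj (ltW (pS _ jN)) (le_trans js sT) Ac.
  apply: (L2_eq _ L) => w; rewrite /xiN (step_processE _ pS jN)//.
  by rewrite lexx pS.
have {}ms := ms (fun N N0 => L2_meas (LE N N0)).
split.
  have [n0 Hn0] := ms 1 ltr01.
  have [L _] := Hn0 n0.+1 (leqW (leqnn _)).
  by apply: (L2_eq _ (L2B (LE n0.+1 (ltn0Sn _)) L)) => w; rewrite subKr.
move=> e /ms[n0 Hn0]; exists n0.+1 => -[//|N] nN.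
have [_ h] := Hn0 N.+1 (ltnW nN).
by rewrite (nrm_eq P (g := fun w => \sum_(j < N.+1) xiN N.+1 (p N.+1 j) w * (M (p N.+1 j.+1) w - M (p N.+1 j) w) - I w))// => w; rewrite E.
Unshelve. all: by end_near. Qed.

End integral_of_sums.

#[local] Arguments nested_sum : simpl never.

Section iterated_integral_limit.
Context (R : realType) d (Omega : measurableType d) (P : probability Omega R).
Variables (t T : R) (F : R -> set_system Omega) (rho : R -> R) (k : nat).
Variable M : 'I_k -> R -> Omega -> R.
Hypothesis tT : t < T.
Hypothesis filt : filtration F t T.
Hypothesis M2 : forall g, class_M2 P F rho t T (M g).
Hypothesis rho0 : forall x, x \in `[t, T] -> 0 <= rho x.
Hypothesis rhoC : {within `[t, T], continuous rho}.
Variable C : R.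
Hypothesis C0 : 0 <= C.
Hypothesis CV : forall g, conditional_variance_bound P t T F rho (M g) C.
Local Notation L2 f := (square_integrable P setT f).
Variables (psi : 'I_k -> R -> R) (Bpsi : R).
Hypothesis psiC : forall g, {within `[t, T], continuous (psi g)}.
Hypothesis psiB : forall g x, x \in `[t, T] -> `|psi g x| <= Bpsi.
Variable tau : nat -> nat -> R.
Hypothesis ptau : partition_sequence t T tau.

(** Induction over the layers: at each time the inner process is the limit of the inner nested sums,
    which is what [iterated_step_limit] asks for. The list is reversed because the layers are listed
    from the outside in, so that the outermost of the first i + 1 layers is the one of index i. *)
Lemma iterated_layers_limit i s I : (i <= k)%N -> t <= s -> s <= T ->
  iterated_layers P F rho t (rev (take i [seq (psi l, M l) | l <- enum 'I_k])) s I ->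
  L2 I /\ cvg2 P (fun N => nested_sum M psi tau (@last_index k) i (initial k i) N s) I.
Proof.
elim: i s I => [|i IH] s I ik ts sT.
  rewrite take0/= => ->; split.
    by case: (adaptedL2_cst P filt 1 ts sT).
  rewrite initial0 => e e0; exists 0%N => n _.
  by rewrite nested_sum_set0 (nrm_eq P (g := fun=> 0)) ?nrm0// => w; rewrite subrr.
have sz : (i < size [seq (psi l, M l) | l <- enum 'I_k])%N by rewrite size_map size_enum_ord.
set g := Ordinal ik.
rewrite (take_nth (psi g, M g) sz) rev_rcons /=.
have -> : nth (psi g, M g) [seq (psi l, M l) | l <- enum 'I_k] i = (psi g, M g).
  rewrite (nth_map g) ?size_enum_ord//.
  by rewrite (_ : nth g (enum 'I_k) i = g)//; apply: val_inj; rewrite /= nth_enum_ord.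
have A0 : initial k i.+1 != finset.set0 by apply/finset.set0Pn; exists g; rewrite inE/=.
case: eqP => [-> ->|/eqP st [Y [HY SI]]].
  split; first by case: (adaptedL2_cst P filt 0 (lexx t) (ltW tT)).
  move=> e e0; exists 1%N => n n0; have [/(_ n n0)[p0 _] /(_ n) pS _] := ptau.
  rewrite (nrm_eq P (g := fun=> 0)) ?nrm0// => w.
  by rewrite -p0 nested_sum_start// subrr.
have {}ts : t < s by rewrite lt_neqAle eq_sym st.
have [B B0 HB] := nested_sum_bound tT filt M2 rho0 rhoC C0 CV psiB ptau (@last_index k) i.
have [D D0 HD] := nested_sum_lipschitz tT filt M2 rho0 rhoC C0 CV psiB ptau (@last_index k) i.
have HYu u : t <= u -> u <= s -> L2 (Y u) /\
    cvg2 P (fun N => nested_sum M psi tau (@last_index k) i (initial k i) N u) (Y u).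
  move=> tu us; apply: IH => //; [exact: ltnW|exact: le_trans us sT|].
  by apply: HY; rewrite in_itv/= tu.
have [LI cI] := iterated_step_limit tT filt rho0 rhoC (@CV g) (@psiC g) (@psiB g) ptau ts sT B0 D0
  (fun N u N0 tu uT => HB (initial k i) N u N0 tu uT)
  (fun N u v N0 tu uv vT => HD (initial k i) N u v N0 tu uv vT)
  (fun u tu us => (HYu u tu us).1) (fun u tu us => (HYu u tu us).2) SI.
split=> // e /cI[n0 Hn0]; exists n0 => n /Hn0.
rewrite (nested_sum_next _ _ _ _ _ _ _ A0).
congr (_ < e); apply: nrm_eq => w.
by rewrite last_index_initial big_set1 initialD1.
Qed.

Lemma iterated_integral_limit J : iterated_integral P F rho t T psi M J ->
  L2 J /\ cvg2 P (fun N w => \sum_(l in distinct_indices k N)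
    [forall g : 'I_k, forall h : 'I_k, (g < h)%N ==> (l g < l h)%N]%:R *
    \prod_g (psi g (tau N (l g)) * (M g (tau N (l g).+1) w - M g (tau N (l g)) w))) J.
Proof.
rewrite /iterated_integral => HJ.
have [|LJ cJ] := @iterated_layers_limit k T J (leqnn _) (ltW tT) (lexx T).
  by rewrite take_oversize// size_map size_enum_ord.
split=> // e /cJ[n0 Hn0]; exists (maxn 1 n0) => n; rewrite geq_max => /andP[n1 /Hn0].
have [/(_ n n1)[_ pN] /(_ n) pS _] := ptau.
congr (_ < e); apply: nrm_eq => w; congr (_ - _).
by rewrite -{1}pN (nested_sum_incr _ _ pS [ffun=> Ordinal n1])// incr_sumT.
Qed.

End iterated_integral_limit.

(** * Independence *)

Section null_equivalence.
Context (R : realType) d (Omega : measurableType d) (P : probability Omega R).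

(** Stated with [negligible], so that the differences need not be measurable. *)
Definition null_equal (A B : set Omega) :=
  P.-negligible (A `\` B) /\ P.-negligible (B `\` A).

Lemma null_equal_measure A B : measurable A -> measurable B -> null_equal A B -> P A = P B.
Proof.
move=> mA mB [nAB nBA].
have H (C D : set Omega) : measurable C -> measurable D -> P.-negligible (C `\` D) -> P C = P (C `&` D).
  move=> mC mD /negligibleP -/(_ (measurableD mC mD)) CD0.
  rewrite -[in LHS](setUIDK C D).
  rewrite measureU//; [|exact: measurableI|exact: measurableD|].
    by rewrite CD0 adde0.
  by apply/seteqP; split=> // w [[_ Dw] [_]]; exact.
rewrite (H A B mA mB nAB) (H B A mB mA nBA); by rewrite setIC.
Qed.

Lemma null_equal_bigcup (A B : nat -> set Omega) : (forall n, null_equal (A n) (B n)) ->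
  null_equal (\bigcup_n A n) (\bigcup_n B n).
Proof.
move=> AB.
have H (C D : nat -> set Omega) : (forall n, P.-negligible (C n `\` D n)) ->
   P.-negligible (\bigcup_n C n `\` \bigcup_n D n).
  move=> CD; apply: negligibleS (negligible_bigcup CD) => w [[n _ Cw] nD].
  by exists n => //; split=> // Dw; apply: nD; exists n.
by split; apply: H => n; case: (AB n).
Qed.

Lemma null_equalC A B : null_equal A B -> null_equal (~` A) (~` B).
Proof. by move=> [h1 h2]; split; rewrite setDE setCK setIC -setDE. Qed.

Lemma null_equal_bigcap m (A B : 'I_m -> set Omega) : (forall i, null_equal (A i) (B i)) ->
  null_equal (\bigcap_i A i) (\bigcap_i B i).
Proof.
move=> AB.
have H (C D : 'I_m -> set Omega) : (forall n, P.-negligible (C n `\` D n)) ->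
   P.-negligible (\bigcap_n C n `\` \bigcap_n D n).
  move=> CD; pose E n := if insub n is Some i then C i `\` D i else set0.
  have nE n : P.-negligible (E n).
    by rewrite /E; case: insub => [i|]; [exact: CD|exact: negligible_set0].
  apply: negligibleS (negligible_bigcup nE) => w [Cw nD].
  have /existsNP[i nDi] : ~ forall i, D i w by move=> Dw; apply: nD => i _.
  by exists (val i) => //; rewrite /E valK; split=> //; exact: Cw.
by split; apply: H => n; case: (AB n).
Qed.

Lemma sigma_generated_measurable (X : set (Omega -> R)) A :
  (forall Z, X Z -> measurable_fun setT Z) -> sigma_generated X A -> measurable A.
Proof.
move=> mX; apply: smallest_sub; first exact: sigma_algebra_measurable.
by move=> _ [Z XZ [B mB ->]]; rewrite -[X in measurable X]setTI; exact: mX.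
Qed.

Lemma sigma_generated_wrt (X : set (Omega -> R)) Z : X Z -> measurable_wrt (sigma_generated X) Z.
Proof. by move=> XZ B mB; apply: sub_sigma_algebra; exists Z => //; exists B. Qed.

Lemma sigma_generated_sigma (X : set (Omega -> R)) : sigma_algebra setT (sigma_generated X).
Proof. exact: smallest_sigma_algebra. Qed.

Definition ae_limit_of (X : set (Omega -> R)) (Z : Omega -> R) :=
  exists2 S : nat -> Omega -> R, forall n, measurable_wrt (sigma_generated X) (S n) &
    {ae P, forall w, S n w @[n --> \oo] --> Z w}.

(** The generated sigma-algebra need not contain the null sets, so an almost everywhere limit is
    measurable only up to a null set. The upper limit of S is defined everywhere, measurable, and
    equal to Z almost everywhere. *)
Lemma ae_limit_null_equal (X : set (Omega -> R)) Z (B : set R) :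
  ae_limit_of X Z -> measurable B ->
  exists2 A, sigma_generated X A & null_equal (Z @^-1` B) A.
Proof.
move=> [S mS SZ] mB.
pose U w := limn_esup (fun n => (S n w)%:E).
have sX := sigma_generated_sigma X.
have mU : @measurable_fun _ _ (g_sigma_algebraType (sigma_generated X)) _ setT U.
  apply: measurable_fun_limn_esup => n; apply/measurable_EFinP.
  by apply/(measurable_wrtE sX).
exists (U @^-1` (EFin @` B)).
  have := mU measurableT (EFin @` B) (measurable_image_EFin mB).
  by rewrite setTI /measurable/= sigma_algebra_id.
have UZ : {ae P, forall w, U w = (Z w)%:E}.
  move: SZ; apply: filterS => w Sw; apply: (cvg_limn_einf_sup _).2.
  by apply: cvg_EFin; [exact: nearW|].
split; apply: negligibleS UZ => w [h1 h2] h.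
  by apply: h2; rewrite /= h; exists (Z w).
by apply: h2; move: h1; rewrite /= h => -[z Bz [<-]].
Qed.

(** The events that equal some event of [sigma_generated (X i)] up to null sets form a
    sigma-algebra, which contains the generators of that of [X' i]; the product formula does not see
    null sets. *)
Lemma independent_families_limits m (X X' : 'I_m -> set (Omega -> R)) :
  (forall i Z, X i Z -> measurable_fun setT Z) ->
  (forall i Z, X' i Z -> measurable_fun setT Z /\ ae_limit_of (X i) Z) ->
  independent_families P X -> independent_families P X'.
Proof.
move=> mX HX' indep A HA.
have approx i : exists B, sigma_generated (X i) B /\ null_equal (A i) B.
  have mX'i Z : X' i Z -> measurable_fun setT Z by move=> /HX'[].
  pose H := [set C | exists B, sigma_generated (X i) B /\ null_equal C B].
  have sX := sigma_generated_sigma (X i).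
  suff : sigma_generated (X' i) `<=` H by apply; exact: HA.
  apply: smallest_sub; last first.
    move=> _ [Z XZ [B mB ->]]; have [_ lZ] := HX' i Z XZ.
    by have [C GC nC] := ae_limit_null_equal lZ mB; exists C.
  have [s0 sC sU] := sX; split.
  - exists set0; split=> //; split; rewrite setDv; exact: negligible_set0.
  - move=> C [B [GB nB]]; exists (~` B); split; first by rewrite -setTD; exact: sC.
    by rewrite setTD; exact: null_equalC.
  - move=> C HC; have [B HB] := choice HC.
    exists (\bigcup_n B n); split; first by apply: sU => n; case: (HB n).
    by apply: null_equal_bigcup => n; case: (HB n).
have [B HB] := choice approx.
have mA i : measurable (A i) by apply: (sigma_generated_measurable _ (HA i)) => Z /HX'[].
have mB i : measurable (B i) by apply: (sigma_generated_measurable (mX i)); case: (HB i).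
rewrite (@null_equal_measure _ (\bigcap_i B i)).
- rewrite indep; last by move=> i; case: (HB i).
  by apply: eq_bigr => i _; apply/esym/null_equal_measure => //; case: (HB i).
- by apply: fin_bigcap_measurable => // i _.
- by apply: fin_bigcap_measurable => // i _.
- by apply: null_equal_bigcap => i; case: (HB i).
Qed.

End null_equivalence.

(** * Fourier series of functions of several variables *)

Section best_approximation.
Context d (T : measurableType d) (R : realType).
Variable mu : {measure set T -> \bar R}.
Local Notation L2 f := (square_integrable mu setT f).
Local Notation nrm := (nrm mu).

Variables (I : finType) (e : I -> T -> R).
Hypothesis Le : forall i, L2 (e i).
Hypothesis orth : forall i j, \int[mu]_x (e i x * e j x) = (i == j)%:R.

Lemma nrm_orthonormal_sub f (b : I -> R) : L2 f ->
  nrm (fun x => f x - \sum_i b i * e i x) =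
  nrm f - 2 * \sum_i b i * \int[mu]_x (f x * e i x) + \sum_i b i ^+ 2.
Proof.
move=> Lf; have Lb i : L2 (fun x => - b i * e i x) by exact: L2Z.
have LS : L2 (fun x => \sum_i - b i * e i x) by exact: L2_sum.
rewrite (nrm_eq mu (g := fun x => f x + \sum_i - b i * e i x)); last first.
  by move=> x; rewrite -sumrN; congr (_ + _); apply: eq_bigr => i _; rewrite mulNr.
rewrite nrmD// (nrm_sum_orth (h := fun i x => - b i * e i x)); last first.
- move=> i j _ _ ij; rewrite (Rint_eq mu (g := fun x => (b i * b j) * (e i x * e j x))); last by move=> x; ring.
  by rewrite RintZ ?orth ?(negbTE ij) ?mulr0//; exact: L2M_int.
- by move=> i _; exact: Lb.
rewrite addrAC -addrA [RHS]addrAC -!addrA; congr (_ + _); rewrite addrC; congr (_ + _).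
  apply: eq_bigr => i _; rewrite nrmZ// sqrrN /nrm.
  by rewrite (Rint_eq mu (g := fun x => e i x * e i x)) ?orth ?eqxx ?mulr1// => x; rewrite expr2.
rewrite -mulrN -sumrN; congr (_ * _).
rewrite (Rint_eq mu (g := fun x => \sum_i - b i * (f x * e i x))); last first.
  by move=> x; rewrite mulr_sumr; apply: eq_bigr => i _; ring.
rewrite Rint_sum => [|i _]; last by apply: mintZ; exact: L2M_int.
by apply: eq_bigr => i _; rewrite RintZ ?mulNr//; exact: L2M_int.
Qed.

(** With c_i the Fourier coefficients, the right side exceeds the left side by the sum of the
    squares (b_i - c_i)^2. *)
Lemma best_approximation f (b : I -> R) : L2 f ->
  nrm (fun x => f x - \sum_i (\int[mu]_x (f x * e i x)) * e i x) <=
  nrm (fun x => f x - \sum_i b i * e i x).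
Proof.
move=> Lf; rewrite !nrm_orthonormal_sub// -!addrA lerD2l -subr_ge0.
have key (c : I -> R) :
    0 <= - (2 * (\sum_i b i * c i)) + \sum_i b i ^+ 2 - (- (2 * (\sum_i c i * c i)) + \sum_i c i ^+ 2).
  rewrite !mulr_sumr -!sumrN -!big_split/= -sumrN -big_split/=.
  by apply: sumr_ge0 => i _; rewrite [leRHS](_ : _ = (b i - c i) ^+ 2) ?sqr_ge0//; ring.
exact: key.
Qed.

Lemma bessel_nrm f : L2 f ->
  nrm (fun x => f x - \sum_i (\int[mu]_x (f x * e i x)) * e i x) <= nrm f.
Proof.
move=> Lf; apply: le_trans (best_approximation (fun=> 0) Lf) _.
by rewrite (nrm_eq mu (g := f))// => x; rewrite big1 ?subr0// => i _; rewrite mul0r.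
Qed.

End best_approximation.

(** * Expansion in one of two variables *)

Section partial_expansion.
Context d1 d2 (T1 : measurableType d1) (T2 : measurableType d2) (R : realType).
Variables (m1 : {sigma_finite_measure set T1 -> \bar R}) (m2 : {sigma_finite_measure set T2 -> \bar R}).
Local Notation L2 m f := (square_integrable m setT f).

Lemma L2_prod (f : T1 -> R) (g : T2 -> R) : L2 m1 f -> L2 m2 g ->
  L2 (m1 \x m2)%E (fun z => f z.1 * g z.2) /\
  nrm (m1 \x m2)%E (fun z => f z.1 * g z.2) = nrm m1 f * nrm m2 g.
Proof.
move=> Lf Lg; have mf := L2_meas Lf; have mg := L2_meas Lg.
have mfg : measurable_fun setT (fun z : T1 * T2 => f z.1 * g z.2).
  by apply: measurable_funM; [apply: (measurableT_comp mf)|apply: (measurableT_comp mg)].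
have E : (\int[m1 \x m2]_z ((f z.1 * g z.2) ^+ 2)%:E = (nrm m1 f * nrm m2 g)%:E)%E.
  rewrite (fubini_tonelli1 (fun z : T1 * T2 => ((f z.1 * g z.2) ^+ 2)%:E)); last 2 first.
  - by apply/measurable_EFinP; exact: measurable_funX.
  - by move=> z; rewrite lee_fin sqr_ge0.
  have inner x : (\int[m2]_y ((f x * g y) ^+ 2)%:E = ((f x) ^+ 2)%:E * (nrm m2 g)%:E)%E.
    rewrite nrmE// -ge0_integralZl//.
    - by apply: eq_integral => y _; rewrite exprMn EFinM.
    - by apply/measurable_EFinP; exact: measurable_funX.
    - by move=> y _; rewrite lee_fin sqr_ge0.
    - by rewrite lee_fin sqr_ge0.
  rewrite /fubini_F/= EFinM (nrmE Lf) -ge0_integralZr//.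
  - by apply: eq_integral => x _; rewrite inner.
  - by apply/measurable_EFinP; exact: measurable_funX.
  - by move=> y _; rewrite lee_fin sqr_ge0.
  - by rewrite lee_fin nrm_ge0.
have L : L2 (m1 \x m2)%E (fun z => f z.1 * g z.2) by split=> //; rewrite E ltry.
by split=> //; apply: EFin_inj; rewrite nrmE.
Qed.

Variable phi : nat -> T1 -> R.
Hypothesis Lphi : forall j, L2 m1 (phi j).
Hypothesis orth : forall i j, \int[m1]_x (phi i x * phi j x) = (i == j)%:R.
Variables (g : T1 * T2 -> R) (D : set T2).
Hypothesis Lg : L2 (m1 \x m2)%E g.
Hypotheses (mD : measurable D) (finD : (m2 D < +oo)%E).
Hypothesis gD : forall z, ~ D z.2 -> g z = 0.
Hypothesis dense : forall y, L2 m1 (fun x => g (x, y)) -> forall e : R, 0 < e ->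
  exists (n : nat) (c : nat -> R), nrm m1 (fun x => g (x, y) - \sum_(j < n) c j * phi j x) < e.

Let a j y : R := \int[m1]_x (g (x, y) * phi j x).

Let mg2 : measurable_fun setT (fun z => (g z ^+ 2)%:E).
Proof. by apply/measurable_EFinP; apply: measurable_funX; exact: L2_meas Lg. Qed.

Let L2_slice : {ae m2, forall y, L2 m1 (fun x => g (x, y))}.
Proof.
have /L2_sqr Ig := Lg.
have := ae_integrable2 Ig; apply: filterS => y iy.
apply/L2P; split; last exact: iy.
by apply: (measurableT_comp (L2_meas Lg)); exact: measurable_pair2.
Qed.

Let orthI n (i j : 'I_n) : \int[m1]_x (phi i x * phi j x) = (i == j)%:R.
Proof. by rewrite orth. Qed.

(** g vanishes unless the second variable lies in D, and phi_j times the indicator of D is square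
    integrable because D has finite measure. Hence g phi_j is integrable on the product, and Fubini
    makes its partial integral measurable. *)
Let measurable_coefficient j : measurable_fun setT (a j).
Proof.
have L1 : L2 m2 (\1_D : T2 -> R).
  split; first exact: measurable_indic.
  rewrite (eq_integral (fun y => (\1_D y)%:E)); last first.
    by move=> y _; rewrite indicE; case: (_ \in _); rewrite ?expr1n ?expr0n.
  by rewrite integral_indic// setIT.
have [Lp _] := L2_prod (Lphi j) L1.
have I : (m1 \x m2)%E.-integrable setT (EFin \o (fun z => g z * phi j z.1)).
  apply: (mint_eq _ (L2M_int Lg Lp)) => z; rewrite mulrA indicE.
  have [zD|zD] := boolP (z.2 \in D); first by rewrite mulr1.
  by rewrite gD ?mul0r// => h; move: zD; rewrite mem_set.
have := measurable_fubini_G I.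
by move=> mG; apply: (measurableT_comp _ mG).
Qed.

Let slice_sum n y : L2 m1 (fun x => g (x, y)) ->
  L2 m1 (fun x => g (x, y) - \sum_(j < n) a j y * phi j x) /\
  nrm m1 (fun x => g (x, y) - \sum_(j < n) a j y * phi j x) <= nrm m1 (fun x => g (x, y)).
Proof.
move=> Ly; split; first by apply: L2B => //; apply: L2_sum => j _; exact: L2Z.
exact: (bessel_nrm (fun j : 'I_n => Lphi j) (@orthI n) Ly).
Qed.

Let coefficient_le j y : L2 m1 (fun x => g (x, y)) -> a j y ^+ 2 <= nrm m1 (fun x => g (x, y)).
Proof.
move=> Ly; have := Cauchy_Schwarz Ly (Lphi j).
have -> : nrm m1 (phi j) = 1.
  by rewrite /nrm (Rint_eq m1 (g := fun x => phi j x * phi j x)) ?orth ?eqxx.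
by rewrite mulr1.
Qed.

(** Almost every slice is expanded separately. The squared errors of the slices tend to 0 and are
    dominated, by Bessel's inequality, by the squared norms of the slices, so their integral tends
    to 0. *)
Lemma partial_expansion : exists a : nat -> T2 -> R,
  [/\ forall j, L2 m2 (a j), forall j y, ~ D y -> a j y = 0 &
    forall e : R, 0 < e -> exists n : nat,
      L2 (m1 \x m2)%E (fun z => g z - \sum_(j < n) a j z.2 * phi j z.1) /\
      nrm (m1 \x m2)%E (fun z => g z - \sum_(j < n) a j z.2 * phi j z.1) < e].
Proof.
pose G y := (\int[m1]_x (g (x, y) ^+ 2)%:E)%E.
have mG : measurable_fun setT G.
  by apply: (measurable_fun_fubini_tonelli_G (fun z => (g z ^+ 2)%:E)) => // z; rewrite lee_fin sqr_ge0.
have G0 y : (0 <= G y)%E by apply: integral_ge0 => x _; rewrite lee_fin sqr_ge0.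
have IG : m2.-integrable setT G.
  apply/integrableP; split=> //; case: Lg => _.
  rewrite (fubini_tonelli2 _ mg2) => [|z]; last by rewrite lee_fin sqr_ge0.
  by apply: le_lt_trans; apply: ge0_le_integral => //; [exact: measurableT_comp|move=> y _; rewrite gee0_abs ?G0//].
have GE y : L2 m1 (fun x => g (x, y)) -> G y = (nrm m1 (fun x => g (x, y)))%:E by move=> Ly; rewrite nrmE.
have mh n : measurable_fun setT (fun z : T1 * T2 => g z - \sum_(j < n) a j z.2 * phi j z.1).
  apply: measurable_funB; first exact: L2_meas Lg.
  apply: measurable_sum => j; apply: measurable_funM.
    exact: (measurableT_comp (measurable_coefficient j)).
  exact: (measurableT_comp (L2_meas (Lphi j))).
pose E n y := (\int[m1]_x ((g (x, y) - \sum_(j < n) a j y * phi j x) ^+ 2)%:E)%E.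
have mh2 n : measurable_fun setT (fun z : T1 * T2 => ((g z - \sum_(j < n) a j z.2 * phi j z.1) ^+ 2)%:E).
  by apply/measurable_EFinP; exact: measurable_funX.
have mE n : measurable_fun setT (E n).
  by apply: (measurable_fun_fubini_tonelli_G _ (mh2 n)) => z; rewrite lee_fin sqr_ge0.
have E0 n y : (0 <= E n y)%E by apply: integral_ge0 => x _; rewrite lee_fin sqr_ge0.
have EE n y : L2 m1 (fun x => g (x, y)) -> E n y = (nrm m1 (fun x => g (x, y) - \sum_(j < n) a j y * phi j x))%:E.
  by move=> Ly; have [L _] := slice_sum n Ly; rewrite nrmE.
have cE : (\int[m2]_y E n y)%E @[n --> \oo] --> (\int[m2]_y (fun=> 0) y)%E.
  have [] := @dominated_convergence _ _ _ m2 setT measurableT E (fun=> 0%E) G => //.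
  - move: L2_slice; apply: filterS => y Ly _.
    have H : (nrm m1 (fun x => g (x, y) - \sum_(j < n) a j y * phi j x))%:E @[n --> \oo] --> 0%E.
      apply: cvg_EFin; first exact: nearW.
      apply/cvgrPdist_lt => e /(dense Ly)[n0 [c Hc]].
      exists n0 => // n /= n0n; rewrite sub0r normrN ger0_norm ?nrm_ge0//.
      apply: le_lt_trans Hc.
      (* The approximation given by density, padded with zero coefficients, competes with the
         Fourier sum of the longer length n. *)
      pose b (j : 'I_n) := if (j < n0)%N then c j else 0.
      apply: le_trans (best_approximation (fun j : 'I_n => Lphi j) (@orthI n) b Ly) _.
      rewrite le_eqVlt; apply/orP; left; apply/eqP; apply: nrm_eq => x; congr (_ - _).
      rewrite (big_ord_widen n (fun j => c j * phi j x) n0n) [RHS]big_mkcond/=.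
      by apply: eq_bigr => j _; rewrite /b; case: ifP => //; rewrite mul0r.
    by apply: cvg_trans H; apply: near_eq_cvg; apply: nearW => n; rewrite EE.
  - move: L2_slice; apply: filterS => y Ly n _.
    by rewrite gee0_abs// EE// GE// lee_fin; have [] := slice_sum n Ly.
exists a; split.
- move=> j; split; first exact: measurable_coefficient.
  move/integrableP : IG => [_]; apply: le_lt_trans.
  apply: ae_ge0_le_integral => //.
  + by move=> y _; rewrite lee_fin sqr_ge0.
  + by apply/measurable_EFinP; apply: measurable_funX; exact: measurable_coefficient.
  + exact: measurableT_comp.
  + move: L2_slice; apply: filterS => y Ly _.
    by rewrite gee0_abs// GE// lee_fin coefficient_le.
- move=> j y Dy; rewrite /a (Rint_eq m1 (g := fun=> 0)) ?Rintegral_cst ?mul0r// => x.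
  by rewrite gD ?mul0r.
move=> e e0; move: cE; rewrite integral0 => /fine_cvgP[finE /cvgrPdist_lt/(_ e e0) smE].
have [n [fn sn]] : exists n : nat, (\int[m2]_y E n y)%E \is a fin_num /\ `|0 - fine (\int[m2]_y E n y)%E| < e.
  by near \oo => n; exists n; split; near: n.
have IE : (\int[m1 \x m2]_z ((g z - \sum_(j < n) a j z.2 * phi j z.1) ^+ 2)%:E = \int[m2]_y E n y)%E.
  by rewrite (fubini_tonelli2 _ (mh2 n))// => z; rewrite lee_fin sqr_ge0.
have L : L2 (m1 \x m2)%E (fun z => g z - \sum_(j < n) a j z.2 * phi j z.1).
  by split=> //; rewrite IE; move: fn; rewrite ge0_fin_numE// integral_ge0.
exists n; split=> //; rewrite /nrm /Rintegral IE.
by move: sn; rewrite sub0r normrN; apply: le_lt_trans; exact: ler_norm.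
Unshelve. all: by end_near. Qed.

End partial_expansion.

Section product_integrable.
Context d1 d2 (T1 : measurableType d1) (T2 : measurableType d2) (R : realType).
Variables (m1 : {sigma_finite_measure set T1 -> \bar R}) (m2 : {sigma_finite_measure set T2 -> \bar R}).

Lemma integrable_prod (f : T1 -> R) (g : T2 -> R) :
  m1.-integrable setT (EFin \o f) -> m2.-integrable setT (EFin \o g) ->
  (m1 \x m2)%E.-integrable setT (EFin \o (fun z => f z.1 * g z.2)) /\
  \int[(m1 \x m2)%E]_z (f z.1 * g z.2) = (\int[m1]_x f x) * (\int[m2]_y g y).
Proof.
move=> If Ig; have mf : measurable_fun setT f by apply/measurable_EFinP; exact: measurable_int If.
have mg : measurable_fun setT g by apply/measurable_EFinP; exact: measurable_int Ig.
have mfg : measurable_fun setT (EFin \o (fun z : T1 * T2 => f z.1 * g z.2)).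
  apply/measurable_EFinP; apply: measurable_funM; first exact: (measurableT_comp mf).
  exact: (measurableT_comp mg).
have I : (m1 \x m2)%E.-integrable setT (EFin \o (fun z => f z.1 * g z.2)).
  apply/(integrable12ltyP _ _ mfg).
  have c0 : (0 <= \int[m2]_y `|(g y)%:E|)%E by apply: integral_ge0.
  have finc : (\int[m2]_y `|(g y)%:E| < +oo)%E by case/integrableP : Ig.
  have inner x : (\int[m2]_y `|(EFin \o (fun z : T1 * T2 => (f z.1 * g z.2)%R)) (x, y)| =
      `|(f x)%:E| * \int[m2]_y `|(g y)%:E|)%E.
    rewrite -ge0_integralZl//.
    - by apply: eq_integral => y _; rewrite /= normrM EFinM.
    - by apply: measurableT_comp => //; exact/measurable_EFinP.
  rewrite (eq_integral (fun x => `|(f x)%:E| * \int[m2]_y `|(g y)%:E|)%E); last by move=> x _.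
  rewrite ge0_integralZr//; last by apply: measurableT_comp => //; exact/measurable_EFinP.
  rewrite lte_mul_pinfty//; first exact: integral_ge0.
  rewrite ge0_fin_numE; last exact: integral_ge0.
  by case/integrableP : If.
split=> //; rewrite /Rintegral -(integral12_prod_meas1 I).
have fg := integrable_fin_num measurableT Ig; have ff := integrable_fin_num measurableT If.
rewrite [X in fine X = _](eq_integral (fun x => (f x)%:E * (fine (\int[m2]_y (g y)%:E))%:E)%E); last first.
  move=> x _; rewrite fineK//.
  rewrite -(integralZl measurableT Ig); apply: eq_integral => y _ //.
rewrite (integralZr measurableT If).
by rewrite -(fineK ff).
Qed.

End product_integrable.

(** * Integration over tuples and tensor products *)

Section cons_transfer.
Context d (T : measurableType d) (R : realType).
Variables (m : {sigma_finite_measure set T -> \bar R}) (n : nat).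
Variable nu : {sigma_finite_measure set (n.-tuple T) -> \bar R}.
Local Notation L2 m f := (square_integrable m setT f).

Let comp_meas (f : n.+1.-tuple T -> R) : measurable_fun setT f ->
  measurable_fun setT (f \o @tuple_of_pair _ T n).
Proof. by move=> mf; apply: (measurableT_comp mf); exact: measurable_tuple_of_pair. Qed.

Lemma cons_integral_sqr (f : n.+1.-tuple T -> R) : measurable_fun setT f ->
  (\int[cons_measure m nu]_x (f x ^+ 2)%:E = \int[m \x nu]_z ((f \o @tuple_of_pair _ T n) z ^+ 2)%:E)%E.
Proof.
move=> mf; rewrite /cons_measure ge0_integral_pushforward//.
- exact: measurable_tuple_of_pair.
- by apply/measurable_EFinP; exact: measurable_funX.
- by move=> x _; rewrite lee_fin sqr_ge0.
Qed.

Lemma cons_L2 (f : n.+1.-tuple T -> R) : measurable_fun setT f ->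
  L2 (m \x nu)%E (f \o @tuple_of_pair _ T n) <-> L2 (cons_measure m nu) f.
Proof.
move=> mf; split=> -[_ h]; split=> //; first by rewrite cons_integral_sqr.
- exact: comp_meas.
- by rewrite -cons_integral_sqr.
Qed.

Lemma cons_nrm (f : n.+1.-tuple T -> R) : measurable_fun setT f ->
  nrm (cons_measure m nu) f = nrm (m \x nu)%E (f \o @tuple_of_pair _ T n).
Proof. by move=> mf; rewrite /nrm /Rintegral cons_integral_sqr. Qed.

Lemma cons_integrable (f : n.+1.-tuple T -> R) : measurable_fun setT f ->
  (m \x nu)%E.-integrable setT (EFin \o (f \o @tuple_of_pair _ T n)) ->
  (cons_measure m nu).-integrable setT (EFin \o f) /\
  \int[cons_measure m nu]_x f x = \int[(m \x nu)%E]_z (f \o @tuple_of_pair _ T n) z.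
Proof.
move=> mf If; have mt := @measurable_tuple_of_pair _ T n.
have mEf : measurable_fun setT (EFin \o f) by exact/measurable_EFinP.
split; first exact: (integrable_pushforward mt mEf (D := setT) If measurableT).
rewrite /Rintegral; congr fine.
exact: (integral_pushforward mt mEf (D := setT) If measurableT).
Qed.

End cons_transfer.

Section tuple_products.
Context (R : realType).
Local Notation mu := (@lebesgue_measure R).
Local Notation L2 m f := (square_integrable m setT f).

Lemma measurable_tuple_prod k (h : 'I_k -> R -> R) : (forall l, measurable_fun setT (h l)) ->
  measurable_fun setT (fun x : k.-tuple (measurableTypeR R) => \prod_(l < k) h l (tnth x l)).
Proof.
move=> mh; apply: measurable_prod => l _.
by apply: (measurableT_comp (mh l)); exact: measurable_tnth.
Qed.

Lemma tuple_prod_cons k (h : 'I_k.+1 -> R -> R) (z : measurableTypeR R * k.-tuple (measurableTypeR R)) :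
  \prod_(l < k.+1) h l (tnth (tuple_of_pair z) l) =
  h ord0 z.1 * \prod_(l < k) h (lift ord0 l) (tnth z.2 l).
Proof.
rewrite big_ord_recl tnth0; congr (_ * _); apply: eq_bigr => l _.
by rewrite tnthS.
Qed.

Lemma integral_tuple_prod k (h : 'I_k -> R -> R) :
  (forall l, mu.-integrable setT (EFin \o h l)) ->
  (lebesgue_tuple R k).-integrable setT (EFin \o (fun x => \prod_(l < k) h l (tnth x l))) /\
  \int[lebesgue_tuple R k]_x (\prod_(l < k) h l (tnth x l)) = \prod_(l < k) \int[mu]_x h l x.
Proof.
elim: k h => [|k IH] h Ih.
  have nuT : lebesgue_tuple R 0 setT = 1%E by exact: diracT.
  rewrite big_ord0; have E (x : 0.-tuple (measurableTypeR R)) : 1 = \prod_(l < 0) h l (tnth x l) :> R by rewrite big_ord0.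
  split.
    apply: (mint_eq (mu := lebesgue_tuple R 0) E); apply/integrableP; split; first exact: measurable_cst.
    by rewrite integral_cst//= nuT mule1 normr1 ltry.
  rewrite -(Rint_eq (lebesgue_tuple R 0) E); transitivity (1 * fine (lebesgue_tuple R 0 setT)); last by rewrite nuT mulr1.
  exact: Rintegral_cst.
have mh l : measurable_fun setT (h l) by apply/measurable_EFinP; exact: measurable_int (Ih l).
have [I1 E1] := IH (fun l => h (lift ord0 l)) (fun l => Ih (lift ord0 l)).
have [I2 E2] := integrable_prod (Ih ord0) I1.
have Ec z := tuple_prod_cons h z.
have [I3 E3] := cons_integrable (measurable_tuple_prod mh) (mint_eq (fun z => esym (Ec z)) I2).
split; first exact: I3.
rewrite [LHS]E3 big_ord_recl -E1 -E2; apply: Rint_eq => z; exact: Ec.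
Qed.

End tuple_products.

Section tensor_basis.
Context (R : realType) (t T : R).
Local Notation mu := (@lebesgue_measure R).
Local Notation L2 m f := (square_integrable m setT f).
Variable phi : nat -> R -> R.
Hypothesis Lphi : forall j, L2 mu (phi j).
Hypothesis orth : forall i j, \int[mu]_x (phi i x * phi j x) = (i == j)%:R.
Hypothesis dense : forall h, L2 mu h -> (forall x, x \notin `[t, T] -> h x = 0) ->
  forall e : R, 0 < e -> exists (n : nat) (c : nat -> R),
  nrm mu (fun x => h x - \sum_(j < n) c j * phi j x) < e.

Definition tensor k (j : 'I_k -> nat) (x : k.-tuple (measurableTypeR R)) : R :=
  \prod_(l < k) phi (j l) (tnth x l).

Lemma tensor_orth k (i j : 'I_k -> nat) :
  \int[lebesgue_tuple R k]_x (tensor i x * tensor j x) = \prod_(l < k) (i l == j l)%:R.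
Proof.
rewrite (Rint_eq (lebesgue_tuple R k) (g := fun x => \prod_(l < k) (phi (i l) (tnth x l) * phi (j l) (tnth x l)))); last first.
  by move=> x; rewrite -big_split.
have I (l : 'I_k) : mu.-integrable setT (EFin \o (fun x => phi (i l) x * phi (j l) x)) by exact: (L2M_int (Lphi _) (Lphi _)).
rewrite (integral_tuple_prod I).2.
by apply: eq_bigr => l _; exact: orth.
Qed.

Lemma tensor_L2 k (j : 'I_k -> nat) : L2 (lebesgue_tuple R k) (tensor j).
Proof.
apply/L2P; split; first exact: (measurable_tuple_prod (h := fun l => phi (j l)) (fun l => L2_meas (Lphi _))).
have [I _] := integral_tuple_prod (h := fun l x => phi (j l) x ^+ 2) (fun l => L2_sqr (Lphi (j l))).
by apply: (mint_eq _ I) => x; rewrite /tensor prodrXl.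
Qed.


Lemma cube_measurable k : measurable (@cube R k t T).
Proof.
rewrite (_ : @cube R k t T =
    \bigcap_(l in [set: 'I_k]) ((fun x : k.-tuple (measurableTypeR R) => tnth x l) @^-1` `[t, T])); last first.
  by apply/seteqP; split=> x h l => [_|]; exact: h.
apply: fin_bigcap_measurable => // l _; rewrite -[X in measurable X]setTI.
exact: measurable_tnth.
Qed.

Lemma cube_indic k (x : k.-tuple (measurableTypeR R)) :
  \1_(@cube R k t T) x = \prod_(l < k) \1_(`[t, T]%classic) (tnth x l) :> R.
Proof.
rewrite indicE; have [xc|xc] := boolP (x \in @cube R k t T).
  rewrite big1// => l _; rewrite indicE mem_set//=.
  by move: xc => /set_mem/(_ l).
have [l xl] : exists l, tnth x l \notin `[t, T].
  apply: contrapT => nh; move: xc; rewrite mem_set// => l; apply: contrapT => /negP xl.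
  by apply: nh; exists l.
by rewrite (bigD1 l)//= indicE memNset ?mul0r//=; exact/negP.
Qed.

(** The indicator of the cube is a product of integrable indicators. Finiteness is what
    [partial_expansion] asks of the domain of the remaining variables. *)
Lemma cube_finite k : (lebesgue_tuple R k (@cube R k t T) < +oo)%E.
Proof.
have I1 (l : 'I_k) : mu.-integrable setT (EFin \o (\1_(`[t, T]%classic) : R -> R)).
  exact: integrable_indic_itv.
have [I _] := integral_tuple_prod I1.
have := integrable_lty measurableT I.
rewrite (eq_integral (fun x => (\1_(@cube R k t T) x)%:E)); last by move=> x _; rewrite /= cube_indic.
by rewrite integral_indic ?setIT//; exact: cube_measurable.
Qed.

Lemma tensor_cons k (j0 : nat) (j : 'I_k -> nat) (z : measurableTypeR R * k.-tuple (measurableTypeR R)) :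
  tensor (fun l => if unlift ord0 l is Some l' then j l' else j0) (tuple_of_pair z) =
  phi j0 z.1 * tensor j z.2.
Proof.
rewrite /tensor (tuple_prod_cons (fun l => phi (if unlift ord0 l is Some l' then j l' else j0))).
by rewrite unlift_none; congr (_ * _); apply: eq_bigr => l _; rewrite liftK.
Qed.

(* Expand in the first variable, then approximate the finitely many coefficients,
   which are functions of the remaining variables. *)
Lemma tensor_dense k (f : k.-tuple (measurableTypeR R) -> R) :
  L2 (lebesgue_tuple R k) f -> (forall x, ~ cube t T x -> f x = 0) ->
  forall e : R, 0 < e -> exists s : seq (R * ('I_k -> nat)),
  nrm (lebesgue_tuple R k) (fun x => f x - \sum_(p <- s) p.1 * tensor p.2 x) < e.
Proof.
elim: k f => [|k IH] f Lf f0 e e0.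
  exists [:: (f [tuple], fun=> 0%N)].
  rewrite (nrm_eq (lebesgue_tuple R 0) (g := fun=> 0)) ?nrm0// => x.
  by rewrite big_seq1 /tensor big_ord0 mulr1 (tuple0 x) subrr.
have mf := L2_meas Lf.
pose g z := f (tuple_of_pair z).
have Lg : L2 (mu \x lebesgue_tuple R k)%E g by exact/(cons_L2 _ _ mf).
have gD z : ~ cube t T z.2 -> g z = 0.
  move=> nz; apply: f0 => h; apply: nz => l.
  by have := h (lift ord0 l); rewrite tnthS.
have dn y : L2 mu (fun x => g (x, y)) -> forall e : R, 0 < e ->
  exists (n : nat) (c : nat -> R), nrm mu (fun x => g (x, y) - \sum_(j < n) c j * phi j x) < e.
  move=> Ly; apply: dense => // x xI; apply: f0 => h.
  by have := h ord0; rewrite tnth0; apply/negP.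
have [a [La a0 Ha]] := partial_expansion Lphi orth Lg (@cube_measurable k) (@cube_finite k) gD dn.
have e40 : 0 < e / 4 by rewrite divr_gt0.
have [n [Ln Hn]] := Ha _ e40.
(* n^2 for the square of a sum of n terms with a common bound, and 2 from [nrmD2]; the total stays
   below 2 e/4 + e/4. *)
have c0 : 0 <= 2 * (n%:R * n%:R) :> R by rewrite mulr_ge0// mulr_ge0.
have [e1 e1P He1] := small_factor c0 e40.
have HS (j : nat) : exists s : seq (R * ('I_k -> nat)),
  nrm (lebesgue_tuple R k) (fun x => a j x - \sum_(p <- s) p.1 * tensor p.2 x) < e1.
  by apply: IH => // x; exact: a0.
have [s Hs] := choice HS.
pose s' : seq (R * ('I_k.+1 -> nat)) := [seq (p.1, fun l => if unlift ord0 l is Some l' then p.2 l' else j)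
   | j <- iota 0 n, p <- s j].
exists s'.
have LS j : L2 (lebesgue_tuple R k) (fun y => a j y - \sum_(p <- s j) p.1 * tensor p.2 y).
  by apply: L2B => //; apply: L2_sum => p _; apply: L2Z; exact: tensor_L2.
have mS : measurable_fun setT (fun x : k.+1.-tuple (measurableTypeR R) => f x - \sum_(p <- s') p.1 * tensor p.2 x).
  apply: measurable_funB => //.
  by apply: L2_meas; apply: L2_sum => p _; apply: L2Z; exact: tensor_L2.
rewrite (cons_nrm _ _ mS).
pose h (j : 'I_n) (z : measurableTypeR R * k.-tuple (measurableTypeR R)) :=
  phi j z.1 * (a j z.2 - \sum_(p <- s j) p.1 * tensor p.2 z.2).
have Lh j : L2 (mu \x lebesgue_tuple R k)%E (h j) /\ nrm (mu \x lebesgue_tuple R k)%E (h j) <= e1.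
  have [L E] := L2_prod (Lphi j) (LS j); split; first exact: L.
  rewrite E (_ : nrm mu (phi j) = 1) ?mul1r; first exact: ltW.
  by rewrite /nrm (Rint_eq mu (g := fun x => phi j x * phi j x)) ?orth ?eqxx.
rewrite (nrm_eq (mu \x lebesgue_tuple R k)%E (g := fun z => (g z - \sum_(j < n) a j z.2 * phi j z.1) +
   \sum_j h j z)); last first.
  move=> z; rewrite /= /g -addrA; congr (_ + _).
  rewrite big_allpairs_dep/= -(big_mkord xpredT (fun j => a j z.2 * phi j z.1)).
  rewrite /h -(big_mkord xpredT (fun j => phi j z.1 * (a j z.2 - \sum_(p <- s j) p.1 * tensor p.2 z.2))).
  rewrite /index_iota subn0 -!sumrN -big_split/=; apply: eq_bigr => j _.
  rewrite mulrBr addrA [a j _ * _]mulrC addNr add0r mulr_sumr; congr (- _).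
  by apply: eq_bigr => p _; rewrite tensor_cons; ring.
have LSh : L2 (mu \x lebesgue_tuple R k)%E (fun z => \sum_j h j z).
  by apply: L2_sum => j _; exact: (Lh j).1.
apply: le_lt_trans (nrmD2 Ln LSh) _.
have : nrm (mu \x lebesgue_tuple R k)%E (fun z => \sum_j h j z) <= n%:R * n%:R * e1.
  apply: le_trans (nrm_sum_le (fun j => (Lh j).1)) _; rewrite card_ord -mulrA ler_wpM2l//.
  apply: (@le_trans _ _ (\sum_(j < n) e1)); first by apply: ler_sum => j _; exact: (Lh j).2.
  by rewrite sumr_const card_ord mulr_natl.
move: He1 Hn; lra.
Qed.

(** The multi-indices of a finite tensor combination lie in one box. Every larger box contains them,
    and the Fourier sum over it is the best approximation, which gives convergence over
    independently growing boxes. *)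
Lemma fourier_convergence k (f : k.-tuple (measurableTypeR R) -> R) :
  L2 (lebesgue_tuple R k) f -> (forall x, ~ cube t T x -> f x = 0) ->
  forall e : R, 0 < e -> exists p0 : nat, forall p : 'I_k -> nat, (forall l, (p0 <= p l)%N) ->
  nrm (lebesgue_tuple R k) (fun x => f x - \sum_(j : {dffun forall l : 'I_k, 'I_(p l).+1})
    (\int[lebesgue_tuple R k]_y (f y * tensor (fun l => j l) y)) * tensor (fun l => j l) x) < e.
Proof.
move=> Lf f0 e /(tensor_dense Lf f0)[s Hs].
exists (\max_(q <- s) \max_(l < k) q.2 l) => p p0.
apply: le_lt_trans Hs.
pose I := {dffun forall l : 'I_k, 'I_(p l).+1}.
have orthI (i j : I) : \int[lebesgue_tuple R k]_x (tensor (fun l => i l) x * tensor (fun l => j l) x) = (i == j)%:R.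
  rewrite tensor_orth; have [->|ij] := eqVneq i j.
    by rewrite big1// => l _; rewrite eqxx.
  have [l il] : exists l, i l != j l.
    apply: contrapT => nh; move/eqP : ij; apply; apply/ffunP => l; apply/eqP; apply: contrapT => /negP il.
    by apply: nh; exists l.
  by rewrite (bigD1 l)//= (_ : _ == _ = false) ?mul0r//; apply/negbTE.
(* The list may repeat a multi-index; its coefficients are added up. *)
pose b (i : I) := \sum_(q <- s | [forall l, q.2 l == i l]) q.1.
apply: le_trans (best_approximation (fun i : I => tensor_L2 (fun l => i l)) orthI b Lf) _.
rewrite le_eqVlt; apply/orP; left; apply/eqP; apply: nrm_eq => x; congr (_ - _).
rewrite /b; under eq_bigr => i _ do rewrite mulr_suml.
rewrite (exchange_big_dep xpredT)//= big_seq [RHS]big_seq; apply: eq_bigr => q qs.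
have qp l : (q.2 l < (p l).+1)%N.
  rewrite ltnS; apply: leq_trans (p0 l); apply: (@leq_trans (\max_(l < k) q.2 l)).
    exact: (leq_bigmax l).
  by rewrite (big_rem q)//= leq_maxl.
pose i0 : I := [ffun l => Ordinal (qp l)].
have E l : q.2 l = i0 l by rewrite ffunE.
rewrite (big_pred1 i0); last first.
  move=> i /=; apply/forallP/eqP => [h|-> l]; last by rewrite E.
  by apply/ffunP => l; apply: val_inj; transitivity (q.2 l); [exact/esym/eqP/h|exact: E].
by congr (_ * _); apply: eq_bigr => l _; rewrite E.
Qed.

End tensor_basis.

(** * Multiple Riemann sums *)

Section tuple_riemann_sums.
Context (R : realType).
Variables (t T : R) (rho : R -> R).
Hypothesis tT : t < T.
Hypothesis rho0 : forall x, x \in `[t, T] -> 0 <= rho x.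
Hypothesis rhoC : {within `[t, T], continuous rho}.
Local Notation mu := (@lebesgue_measure R).
Local Notation Lam := (Lam t rho).
Variables (tau : nat -> nat -> R) (S : seq R) (k : nat).
Hypothesis ptau : partition_sequence t T tau.

(* The density rho vanishes at the finitely many points S, so that pointwise
   convergence is needed only off S. *)
Definition punctured_rho : R -> R := rho \_ (`[t, T[ `\` [set` S]).
Definition punctured_cell N j : R -> R := rho \_ (`[tau N j, tau N j.+1[ `\` [set` S]).

Lemma seq_null : measurable ([set` S] : set (measurableTypeR R)) /\ mu [set` S] = 0%E.
Proof.
have cS : countable [set` S] by apply: finite_set_countable; exact: finite_seq.
split; last exact: countable_lebesgue_measure0.
by apply: countable_measurable => // x; exact: measurable_set1.
Qed.

Lemma punctured_cellE N j : (j < N)%N ->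
  mu.-integrable setT (EFin \o punctured_cell N j) /\
  \int[mu]_x punctured_cell N j x = Lam (tau N j.+1) - Lam (tau N j).
Proof.
move=> jN; have N0 := leq_ltn_trans (leq0n _) jN.
have [mS nS] := seq_null.
have [/(_ N N0)[p0 pN] /(_ N) pS _] := ptau.
have [tj _] := partition_point_itv p0 pN pS (ltnW jN); have [_ jT] := partition_point_itv p0 pN pS jN.
have mD : measurable (`[tau N j, tau N j.+1[ `\` [set` S] : set (measurableTypeR R)) by exact: measurableD.
have Ic : mu.-integrable `[tau N j, tau N j.+1[ (EFin \o rho).
  apply: (integrableS _ _ _ (rho_integrable rhoC tj jT)) => //.
  by move=> x /=; rewrite !in_itv/= => /andP[-> /ltW ->].
have Id : mu.-integrable (`[tau N j, tau N j.+1[ `\` [set` S]) (EFin \o rho).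
  by apply: (integrableS _ _ _ Ic) => // x [].
split.
  by rewrite /punctured_cell -restrict_EFin; apply/integrable_restrict => //; rewrite setTI.
rewrite -(cell_rho_integral rhoC p0 pN pS jN) /punctured_cell /cell_rho -!Rintegral_mkcond.
by rewrite /Rintegral -(negligible_integral mS _ Ic nS).
Qed.

Lemma punctured_rho_integrable : mu.-integrable setT (EFin \o punctured_rho).
Proof.
have [mS nS] := seq_null.
have mD : measurable (`[t, T[ `\` [set` S] : set (measurableTypeR R)) by exact: measurableD.
rewrite /punctured_rho -restrict_EFin; apply/integrable_restrict => //; rewrite setTI.
apply: (integrableS _ _ _ (rho_integrable rhoC (lexx t) (lexx T))) => //.
by move=> x [] /=; rewrite !in_itv/= => /andP[-> /ltW ->].
Qed.

Lemma punctured_rho_ge0 x : 0 <= punctured_rho x.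
Proof.
rewrite /punctured_rho patchE; case: ifPn => // /set_mem[]/=; rewrite in_itv/= => /andP[tx xT] _.
by rewrite rho0// in_itv/= tx ltW.
Qed.

Lemma punctured_cell_rho N j x : (j < N)%N ->
  punctured_cell N j x = (tau N j <= x < tau N j.+1)%R%:R * punctured_rho x.
Proof.
move=> jN; have N0 := leq_ltn_trans (leq0n _) jN.
have [/(_ N N0)[p0 pN] /(_ N) pS _] := ptau.
have [tj _] := partition_point_itv p0 pN pS (ltnW jN); have [_ jT] := partition_point_itv p0 pN pS jN.
have [jx|njx] := boolP (tau N j <= x < tau N j.+1); last first.
  rewrite mul0r /punctured_cell patchE ifF//; apply/negbTE; rewrite notin_setE => -[]/=.
  by rewrite in_itv/= (negbTE njx).
rewrite mul1r /punctured_cell /punctured_rho !patchE; have /andP[j1 j2] := jx.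
have [xS|xS] := boolP (x \in S).
  by rewrite !ifF//; apply/negbTE; rewrite notin_setE => -[_]; exact.
rewrite !ifT// mem_set//; split; rewrite /= ?in_itv/= ?jx//; try exact/negP.
by rewrite (le_trans tj j1) (lt_le_trans j2 jT).
Qed.

Variables (a : forall N, {ffun 'I_k -> 'I_N} -> R) (A : R) (G : k.-tuple (measurableTypeR R) -> R).
Hypothesis A0 : 0 <= A.
Hypothesis aA : forall N l, `|@a N l| <= A.
Hypothesis aG : forall x : k.-tuple (measurableTypeR R),
  (forall g, [/\ t <= tnth x g, tnth x g < T & tnth x g \notin S]) ->
  forall e : R, 0 < e -> exists N0, forall N (l : {ffun 'I_k -> 'I_N}), (N0 <= N)%N ->
  (forall g, tau N (l g) <= tnth x g < tau N (l g).+1) -> `|a l - G x| < e.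

(** The sum is the integral of [W N], which at a point off S is the coefficient of the one product
    cell containing it times the density. These coefficients converge and are bounded, so dominated
    convergence applies. *)
Lemma tuple_riemann_sum_cvg :
  (lebesgue_tuple R k).-integrable setT (EFin \o (fun x => G x * \prod_(g < k) punctured_rho (tnth x g))) /\
  \sum_(l : {ffun 'I_k -> 'I_N}) a l * \prod_g (Lam (tau N (l g).+1) - Lam (tau N (l g))) @[N --> \oo] -->
  \int[lebesgue_tuple R k]_x (G x * \prod_(g < k) punctured_rho (tnth x g)).
Proof.
pose nu := lebesgue_tuple R k.
pose W N (x : k.-tuple (measurableTypeR R)) :=
  \sum_(l : {ffun 'I_k -> 'I_N}) a l * \prod_g punctured_cell N (l g) (tnth x g).
have IW N (l : {ffun 'I_k -> 'I_N}) :
  nu.-integrable setT (EFin \o (fun x => a l * \prod_g punctured_cell N (l g) (tnth x g))) /\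
  \int[nu]_x (a l * \prod_g punctured_cell N (l g) (tnth x g)) =
  a l * \prod_g (Lam (tau N (l g).+1) - Lam (tau N (l g))).
  have [I E] := integral_tuple_prod (fun g => (punctured_cellE (ltn_ord (l g))).1).
  split; first exact: mintZ.
  rewrite RintZ// E; congr (_ * _); apply: eq_bigr => g _.
  exact: (punctured_cellE (ltn_ord (l g))).2.
have EW N : \int[nu]_x W N x = \sum_(l : {ffun 'I_k -> 'I_N}) a l * \prod_g (Lam (tau N (l g).+1) - Lam (tau N (l g))).
  by rewrite Rint_sum => [|l _]; [apply: eq_bigr => l _; exact: (IW N l).2|exact: (IW N l).1].
have IWN N : nu.-integrable setT (EFin \o W N) by apply: mint_sum => l _; exact: (IW N l).1.
pose good (x : k.-tuple (measurableTypeR R)) := forall g, [/\ t <= tnth x g, tnth x g < T & tnth x g \notin S].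
have bad x : ~ good x -> \prod_(g < k) punctured_rho (tnth x g) = 0.
  move=> /existsNP[g ng]; rewrite (bigD1 g)//= {1}/punctured_rho patchE ifF ?mul0r//.
  apply/negbTE; rewrite notin_setE => -[]/=; rewrite in_itv/= => /andP[h1 h2] h3; apply: ng; split=> //.
  exact/negP.
have Wbad N x : ~ good x -> W N x = 0.
  move=> ng; rewrite /W big1// => l _.
  under eq_bigr do rewrite punctured_cell_rho//.
  by rewrite big_split/= bad// !mulr0.
have Wgood N x : (0 < N)%N -> good x -> exists l : {ffun 'I_k -> 'I_N},
    (forall g, tau N (l g) <= tnth x g < tau N (l g).+1) /\
    W N x = a l * \prod_(g < k) punctured_rho (tnth x g).
  move=> N0 gx; have [/(_ N N0)[p0 pN] /(_ N) pS _] := ptau.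
  have cell (g : 'I_k) : exists j : 'I_N, tau N j <= tnth x g < tau N j.+1.
    have [h1 h2 _] := gx g.
    have [||j jN jx] := partition_cell pS (x := tnth x g); rewrite ?p0 ?pN//.
    by exists (Ordinal jN).
  have [c Hc] := choice cell.
  pose l : {ffun 'I_k -> 'I_N} := [ffun g => c g].
  have Hl g : tau N (l g) <= tnth x g < tau N (l g).+1 by rewrite ffunE.
  exists l; split=> //; rewrite /W (bigD1 l)//= [X in _ + X]big1 ?addr0.
    congr (_ * _); apply: eq_bigr => g _.
    by rewrite punctured_cell_rho// Hl mul1r.
  move=> l' ll'; have [g lg] : exists g, l' g != l g.
    apply: contrapT => nh; move/eqP : ll'; apply; apply/ffunP => g; apply/eqP; apply: contrapT => /negP lg.
    by apply: nh; exists g.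
  rewrite (bigD1 g)//= punctured_cell_rho// (_ : (_ <= _ < _) = false) ?mul0r ?mulr0//.
  apply/negP => h; move/eqP : lg; apply; apply: val_inj.
  exact: (partition_cell_uniq pS (ltn_ord _) (ltn_ord _) h (Hl g)).
have rho_prod0 (x : k.-tuple (measurableTypeR R)) : 0 <= \prod_(g < k) punctured_rho (tnth x g).
  by apply: prodr_ge0 => g _; exact: punctured_rho_ge0.
have WA N x : (0 < N)%N -> `|W N x| <= A * \prod_(g < k) punctured_rho (tnth x g).
  move=> N0; have [gx|ng] := pselect (good x); last by rewrite Wbad// bad// normr0 mulr0.
  have [l [_ ->]] := Wgood N x N0 gx.
  by rewrite normrM (ger0_norm (rho_prod0 x)) ler_wpM2r.
have Wcvg x : W N.+1 x @[N --> \oo] --> G x * \prod_(g < k) punctured_rho (tnth x g).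
  have [gx|ng] := pselect (good x); last first.
    rewrite bad// mulr0; under eq_fun do rewrite Wbad//; exact: cvg_cst.
  apply/cvgrPdist_le => e e0.
  have [e1 e1P He1] := small_factor (rho_prod0 x) e0.
  have [N0 HN0] := aG gx e1P.
  exists N0 => // N /= nN; have [l [Hl ->]] := Wgood N.+1 x (ltn0Sn _) gx.
  rewrite -mulrBl normrM (ger0_norm (rho_prod0 x)) distrC; apply: le_trans He1.
  by rewrite mulrC ler_wpM2l//; apply: ltW; apply: HN0 => //; exact: leqW.
have Idom : nu.-integrable setT (fun x => (A * \prod_(g < k) punctured_rho (tnth x g))%:E).
  apply: mintZ; have [I _] := integral_tuple_prod (fun g : 'I_k => punctured_rho_integrable).
  exact: I.
have WcvgE x : (W N.+1 x)%:E @[N --> \oo] --> (G x * \prod_(g < k) punctured_rho (tnth x g))%:E.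
  by apply: cvg_EFin; [exact: nearW|exact: Wcvg].
have mW N : measurable_fun setT (fun x => (W N.+1 x)%:E) by exact: measurable_int (IWN N.+1).
(* G is not assumed measurable; its product with the density is, as a pointwise limit of the
   [W N]. *)
have mG : measurable_fun setT (fun x : k.-tuple (measurableTypeR R) => (G x * \prod_(g < k) punctured_rho (tnth x g))%:E).
  by apply: (emeasurable_fun_cvg (fun N x => (W N.+1 x)%:E)) => // x _; exact: WcvgE.
have WAE (x : k.-tuple (measurableTypeR R)) N : (`|(W N.+1 x)%:E| <= (A * \prod_(g < k) punctured_rho (tnth x g))%:E)%E.
  by rewrite lee_fin; exact: WA.
have [I _ cI] := @dominated_convergence _ _ _ nu setT measurableT (fun N x => (W N.+1 x)%:E)
  (fun x => (G x * \prod_(g < k) punctured_rho (tnth x g))%:E) _ mW mG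
  (aeW _ (fun x _ => WcvgE x)) Idom
  (aeW _ (fun x N _ => WAE x N)).
split; first exact: I.
rewrite -(cvg_shiftS _); under eq_fun do rewrite -EW.
apply: fine_cvg; rewrite /Rintegral fineK; last exact: integrable_fin_num.
exact: cI.
Qed.

End tuple_riemann_sums.

(** * The weighted system on the line and the kernel at partition points *)

Section restriction.
Context d (T : measurableType d) (R : realType).
Variables (nu : {measure set T -> \bar R}) (D : set T).
Hypothesis mD : measurable D.

Lemma restrict_sqr (f : T -> R) : (fun x => ((f \_ D) x ^+ 2)%:E) = (fun x => (f x ^+ 2)%:E) \_ D.
Proof. by apply/funext => x; rewrite !patchE; case: ifP => //; rewrite expr0n. Qed.

Lemma square_integrable_restrict (f : T -> R) : square_integrable nu D f ->
  square_integrable nu setT (f \_ D) /\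
  (nrm nu (f \_ D))%:E = (\int[nu]_(x in D) (f x ^+ 2)%:E)%E.
Proof.
move=> [mf If].
have L : square_integrable nu setT (f \_ D).
  split; first by apply/(measurable_restrictT _ mD).
  by rewrite restrict_sqr -integral_mkcond.
by split=> //; rewrite nrmE// restrict_sqr -integral_mkcond.
Qed.

End restriction.

Section extended_system.
Context (R : realType) (t T : R) (r : R -> R) (Psi : nat -> R -> R).
Local Notation mu := (@lebesgue_measure R).
Local Notation L2 m f := (square_integrable m setT f).
Hypothesis CO : complete_orthonormal_weight t T r Psi.

(** Extended by 0 to the whole line, so that the product measures need no restriction to the
    cube. *)
Definition weighted (j : nat) : R -> R := (fun x => Psi j x * Num.sqrt (r x)) \_ `[t, T].

Lemma weighted_L2 j : L2 mu (weighted j).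
Proof. by case: CO => _ _ [/(_ j) + _ _] => /square_integrable_restrict[]. Qed.

Lemma weighted_orth i j : \int[mu]_x (weighted i x * weighted j x) = (i == j)%:R.
Proof.
case: CO => _ _ [_ + _] => <-; rewrite [RHS]Rintegral_mkcond; apply: Rint_eq => x.
by rewrite /weighted !patchE; case: ifP => // _; rewrite mulr0.
Qed.

Lemma weighted_dense h : L2 mu h -> (forall x, x \notin `[t, T] -> h x = 0) ->
  forall e : R, 0 < e -> exists (n : nat) (c : nat -> R),
  nrm mu (fun x => h x - \sum_(j < n) c j * weighted j x) < e.
Proof.
move=> [mh Ih] h0 e e0; have [_ _ [Lw _ dn]] := CO.
have Lh : square_integrable mu `[t, T] h.
  split; first exact: measurable_funTS.
  apply: le_lt_trans Ih; apply: ge0_subset_integral => //; first by apply/measurable_EFinP; exact: measurable_funX.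
  by move=> x _; rewrite lee_fin sqr_ge0.
have [n [c Hc]] := dn h Lh e e0; exists n, c.
have E x : h x - \sum_(j < n) c j * weighted j x =
    ((fun x => h x - \sum_(j < n) c j * (Psi j x * Num.sqrt (r x))) \_ `[t, T]) x.
  rewrite patchE; case: ifPn => xI.
    by congr (_ - _); apply: eq_bigr => j _; rewrite /weighted patchE xI.
  rewrite h0; last by apply: contra xI => xI; rewrite mem_set.
  by rewrite big1 ?subr0// => j _; rewrite /weighted patchE (negbTE xI) mulr0.
rewrite (nrm_eq mu E) -lte_fin (square_integrable_restrict _ _).2//; split.
  apply: measurable_funB; first exact: measurable_funTS.
  by apply: measurable_sum => j; apply: measurable_funM => //; case: (Lw j).
exact: lt_trans Hc (ltry _).
Qed.

End extended_system.

Section finite_limits.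
Context (R : realType) (I : Type) (s : seq I) (F : I -> nat -> R) (a : I -> R).
Hypothesis Fa : forall i, F i N @[N --> \oo] --> a i.

Lemma cvg_finite_sum : \sum_(i <- s) F i N @[N --> \oo] --> \sum_(i <- s) a i.
Proof.
elim: s => [|i s' ih]; first by under eq_fun do rewrite big_nil; rewrite big_nil; exact: cvg_cst.
by under eq_fun do rewrite big_cons; rewrite big_cons; apply: cvgD.
Qed.

Lemma cvg_finite_prod : \prod_(i <- s) F i N @[N --> \oo] --> \prod_(i <- s) a i.
Proof.
elim: s => [|i s' ih]; first by under eq_fun do rewrite big_nil; rewrite big_nil; exact: cvg_cst.
by under eq_fun do rewrite big_cons; rewrite big_cons; apply: cvgM.
Qed.

End finite_limits.

Lemma sorted_tuple (R : realType) k (x : k.-tuple R) : sorted (fun u v : R => u < v) x =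
  [forall g : 'I_k, forall h : 'I_k, (g < h)%N ==> (tnth x g < tnth x h)].
Proof.
rewrite sorted_pairwise; last by move=> a b c; exact: lt_trans.
apply/(pairwiseP 0)/forallP => [H g|H i j].
  apply/forallP => h; apply/implyP => gh; rewrite !(tnth_nth 0).
  by apply: H; rewrite ?inE ?size_tuple.
rewrite !inE size_tuple => ik jk ij.
have /forallP/(_ (Ordinal jk)) := H (Ordinal ik).
by rewrite !(tnth_nth 0) /= ij.
Qed.

Section kernel_limit.
Context (R : realType) d (Omega : measurableType d).
Variables (t T : R) (k : nat) (tau : nat -> nat -> R).
Hypothesis tT : t < T.
Hypothesis ptau : partition_sequence t T tau.
Variables (psi : 'I_k -> R -> R) (I : finType) (c : I -> R) (h : I -> 'I_k -> R -> R) (S : seq R) (B : R).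
Hypothesis psiC : forall g, {within `[t, T], continuous (psi g)}.
Hypothesis hC : forall i g x, x \in `[t, T] -> x \notin S ->
  h i g y @[y --> within [set` `[t, T]] (nbhs x)] --> h i g x.
Hypothesis psiB : forall g x, x \in `[t, T] -> `|psi g x| <= B.
Hypothesis hB : forall i g x, x \in `[t, T] -> `|h i g x| <= B.

Definition increasing N (l : {ffun 'I_k -> 'I_N}) : bool :=
  [forall g : 'I_k, forall g' : 'I_k, (g < g')%N ==> (l g < l g')%N].

(** The coefficient K - sum_i c_i prod h_i at the partition points, with the condition t_1 < ... <
    t_k read off the indices. *)
Definition kernel_error N (l : {ffun 'I_k -> 'I_N}) : R :=
  (increasing l)%:R * \prod_g psi g (tau N (l g)) - \sum_i c i * \prod_g h i g (tau N (l g)).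

Lemma kernel_error_bound : exists2 A : R, 0 <= A & forall N l, `|@kernel_error N l ^+ 2| <= A.
Proof.
pose A := `|B| ^+ k + \sum_i `|c i| * `|B| ^+ k.
have A0 : 0 <= A by rewrite addr_ge0 ?exprn_ge0// sumr_ge0// => i _; rewrite mulr_ge0// exprn_ge0.
exists (A ^+ 2) => [|N l]; first exact: sqr_ge0.
have tl g : tau N (l g) \in `[t, T].
  by apply: (partition_seq_itv ptau _ (ltnW (ltn_ord _))); exact: leq_ltn_trans (ltn_ord (l g)).
have pB (f : 'I_k -> R -> R) : (forall g x, x \in `[t, T] -> `|f g x| <= B) -> `|\prod_g f g (tau N (l g))| <= `|B| ^+ k.
  move=> fB; rewrite normr_prod -[leRHS](_ : \prod_(g < k) `|B| = _); last by rewrite prodr_const card_ord.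
  by apply: ler_prod => g _; rewrite normr_ge0/= (le_trans (fB g _ (tl g)))// ler_norm.
rewrite normrX lerXn2r ?nnegrE//; apply: le_trans (ler_normB _ _) _; apply: lerD.
  rewrite normrM; apply: (@le_trans _ _ (1 * `|B| ^+ k)); last by rewrite mul1r.
  by apply: ler_pM => //; [case: increasing; rewrite /= ?normr1 ?normr0|exact: pB].
apply: le_trans (ler_norm_sum _ _ _) _; apply: ler_sum => i _.
by rewrite normrM ler_wpM2l//; apply: (pB (h i)) => g x; exact: hB.
Qed.

Variable x : k.-tuple (measurableTypeR R).
Hypothesis good : forall g, [/\ t <= tnth x g, tnth x g < T & tnth x g \notin S].

(** If x_g < x_g', a mesh below the gap puts the cells in strict order; if x_g >= x_g', they are
    never in strict order. So the diagonals of the cube need no exceptional set. *)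
Lemma increasing_eventually : exists N0, forall N (l : {ffun 'I_k -> 'I_N}), (N0 <= N)%N ->
  (forall g, tau N (l g) <= tnth x g < tau N (l g).+1) ->
  increasing l = sorted (fun u v : R => u < v) x.
Proof.
have H (z : 'I_k * 'I_k) : exists N0, forall N (l : {ffun 'I_k -> 'I_N}), (N0 <= N)%N ->
  (forall g, tau N (l g) <= tnth x g < tau N (l g).+1) ->
  (l z.1 < l z.2)%N = (tnth x z.1 < tnth x z.2).
  case: z => g g' /=; have [lt|ge] := ltP (tnth x g) (tnth x g').
    have d0 : 0 < tnth x g' - tnth x g by rewrite subr_gt0.
    have [N0 HN0] := partition_mesh ptau d0; exists N0 => N l nN Hl.
    have [_ /(_ N) pS _] := ptau.
    have /andP[a1 a2] := Hl g; have /andP[b1 b2] := Hl g'.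
    rewrite ltnNge; apply/negP; rewrite leq_eqVlt => /orP[/eqP E|ll].
      have := HN0 N nN _ (ltn_ord (l g)).
      rewrite -E in a1 a2 *; lra.
    have : tau N (l g').+1 <= tau N (l g) by exact: (partition_le pS ll (ltnW (ltn_ord _))).
    by move=> le; move: (lt_le_trans b2 (le_trans le a1)); rewrite ltNge ltW.
  exists 0%N => N l _ Hl; have [_ /(_ N) pS _] := ptau.
  have /andP[a1 a2] := Hl g; have /andP[b1 b2] := Hl g'.
  apply/negP => ll.
  have : tau N (l g).+1 <= tau N (l g') by exact: (partition_le pS ll (ltnW (ltn_ord _))).
  by move=> le; move: (lt_le_trans a2 (le_trans le b1)); rewrite ltNge ge.
have [N0 HN0] := choice H.
exists (\max_z N0 z) => N l nN Hl; rewrite sorted_tuple; apply: eq_forallb => g; apply: eq_forallb => g'.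
rewrite (HN0 (g, g') N l _ Hl)//; apply: leq_trans nN; exact: (leq_bigmax (g, g')).
Qed.

(** At a fixed x each factor is a left-point step function evaluated at a coordinate of x, so the
    convergence is that of finite sums and products. *)
Lemma kernel_error_cvg e : 0 < e -> exists N0, forall N (l : {ffun 'I_k -> 'I_N}), (N0 <= N)%N ->
  (forall g, tau N (l g) <= tnth x g < tau N (l g).+1) ->
  `|kernel_error l ^+ 2 - (iterated_kernel psi x - \sum_i c i * \prod_g h i g (tnth x g)) ^+ 2| < e.
Proof.
move=> e0; have [N1 H1] := increasing_eventually.
pose chi := (sorted (fun u v : R => u < v) x)%:R : R.
have xI g : tnth x g \in `[t, T] by have [h1 h2 _] := good g; rewrite in_itv/= h1 ltW.
have xTS g : tnth x g \notin T :: S.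
  by have [_ h2 h3] := good g; rewrite inE negb_or h3 andbT lt_eqF.
pose E N := (chi * \prod_g left_step (tau N) N (psi g) (tnth x g) -
   \sum_i c i * \prod_g left_step (tau N) N (h i g) (tnth x g)) ^+ 2.
have cE : E N @[N --> \oo] --> (iterated_kernel psi x - \sum_i c i * \prod_g h i g (tnth x g)) ^+ 2.
  have -> : iterated_kernel psi x = chi * \prod_g psi g (tnth x g).
    by rewrite /iterated_kernel /chi; case: ifP; rewrite ?mul1r ?mul0r.
  have H : chi * \prod_g left_step (tau N) N (psi g) (tnth x g) -
     \sum_i c i * \prod_g left_step (tau N) N (h i g) (tnth x g) @[N --> \oo] -->
     chi * \prod_g psi g (tnth x g) - \sum_i c i * \prod_g h i g (tnth x g).
    apply: cvgB.
      apply: cvgMr; apply: (cvg_finite_prod (F := fun g N => left_step (tau N) N (psi g) (tnth x g))) => g.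
      apply: (left_step_cvg Omega ptau (f := psi g) (S := S)) => //.
      by move=> y yI _; move/subspace_continuousP : (@psiC g); apply.
    apply: (cvg_finite_sum (F := fun i N => c i * \prod_g left_step (tau N) N (h i g) (tnth x g))) => i.
    apply: cvgMr; apply: (cvg_finite_prod (F := fun g N => left_step (tau N) N (h i g) (tnth x g))) => g.
    exact: (left_step_cvg Omega ptau (@hC i g)).
  rewrite expr2 /E; under eq_fun do rewrite expr2.
  exact: (cvgM H H).
have /cvgrPdist_lt/(_ e e0)[N2 _ H2] := cE.
exists (maxn N1 N2) => N l; rewrite geq_max => /andP[n1 n2] Hl.
have [_ /(_ N) pS _] := ptau.
have LS (f : R -> R) g : left_step (tau N) N f (tnth x g) = f (tau N (l g)).
  exact: (left_stepE Omega f pS (ltn_ord (l g)) (Hl g)).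
have -> : kernel_error l ^+ 2 = E N.
  rewrite /kernel_error /E (H1 N l n1 Hl); congr ((_ - _) ^+ 2).
    by congr (_ * _); apply: eq_bigr => g _; rewrite LS.
  by apply: eq_bigr => i _; congr (_ * _); apply: eq_bigr => g _; rewrite LS.
by rewrite distrC; exact: H2.
Qed.

End kernel_limit.

(** Finitely many bounds are replaced by their sum, for a property that is monotone in the bound. *)
Lemma common_bound (R : realType) (I : finType) (Q : I -> R -> Prop) :
  (forall i x y, x <= y -> Q i x -> Q i y) ->
  (forall i, exists2 B : R, 0 <= B & Q i B) -> exists2 B : R, 0 <= B & forall i, Q i B.
Proof.
move=> Qm QB; have /choice[B HB] : forall i, exists B : R, 0 <= B /\ Q i B.
  by move=> i; have [b b0 Qb] := QB i; exists b.
exists (\sum_i B i) => [|i]; first by apply: sumr_ge0 => i _; case: (HB i).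
apply: Qm (HB i).2; rewrite (bigD1 i)//= lerDl; apply: sumr_ge0 => j _.
by case: (HB j).
Qed.

(** * The expansion *)

Section expansion.
Context (R : realType) d (Omega : measurableType d) (P : probability Omega R).
Variables (t T : R) (F : R -> set_system Omega) (rho r : R -> R) (k : nat).
Variable M : 'I_k -> R -> Omega -> R.
Hypothesis tT : t < T.
Hypothesis filt : filtration F t T.
Hypothesis M2 : forall g, class_M2 P F rho t T (M g).
Hypothesis rho0 : forall x, x \in `[t, T] -> 0 <= rho x.
Hypothesis rhoC : {within `[t, T], continuous rho}.
Variable C : R.
Hypothesis C0 : 0 <= C.
Hypothesis CV : forall g, conditional_variance_bound P t T F rho (M g) C.
Local Notation L2 f := (square_integrable P setT f).
Local Notation Lam := (Lam t rho).
Variables (psi : 'I_k -> R -> R) (Psi : nat -> R -> R) (Cr : R).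
Hypothesis psiC : forall g, {within `[t, T], continuous (psi g)}.
Hypothesis CO : complete_orthonormal_weight t T r Psi.
Hypothesis PC : forall j, piecewise_right_continuous t T (Psi j).
Hypothesis Cr0 : 0 <= Cr.
Hypothesis rhor : forall x, x \in `[t, T] -> rho x <= Cr * r x.
Hypothesis LK : square_integrable (lebesgue_tuple R k) (cube t T)
    (fun x => iterated_kernel psi x * \prod_(l < k) Num.sqrt (r (tnth x l))).
Variable tau : nat -> nat -> R.
Hypothesis ptau : partition_sequence t T tau.
Variable xi : 'I_k -> nat -> Omega -> R.
Hypothesis Ixi : forall g j, stochastic_integral P F rho (M g) t T (fun s _ => Psi j s) (xi g j).

Lemma Psi_bound j : exists2 B : R, 0 <= B & forall x, x \in `[t, T] -> `|Psi j x| <= B.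
Proof. by apply: near_bounded_itv => x xI; exact: (piecewise_near_bounded (PC j) xI). Qed.

Lemma psi_bound g : exists2 B : R, 0 <= B & forall x, x \in `[t, T] -> `|psi g x| <= B.
Proof.
apply: near_bounded_itv => x xI; exists (`|psi g x| + 1); apply: within_near_bounded.
by move/subspace_continuousP : (@psiC g); apply.
Qed.

Lemma product_limit (j : 'I_k -> nat) : exists V : Omega -> R, [/\ L2 V,
  forall N, (0 < N)%N -> L2 (product_sum M tau (fun g => Psi (j g)) (distinct_indices k N)),
  cvg2 P (fun N => product_sum M tau (fun g => Psi (j g)) (distinct_indices k N)) V,
  ms_limit P (fun N => product_sum M tau (fun g => Psi (j g)) (coinciding_indices k N))
    (fun w => \prod_g xi g (j g) w - V w) & L2 (fun w => \prod_g xi g (j g) w)].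
Proof.
have [B B0 HB] : exists2 B : R, 0 <= B & forall g x, x \in `[t, T] -> `|Psi (j g) x| <= B.
  apply: common_bound => [g x y xy h z zI|g]; first exact: le_trans (h z zI) xy.
  exact: Psi_bound.
have lim g : [/\ L2 (xi g (j g)),
    cvg2 P (fun N => increment_sum (M g) (tau N) (fun i => Psi (j g) (tau N i)) N) (xi g (j g)) &
    bounded_moments P (fun N => increment_sum (M g) (tau N) (fun i => Psi (j g) (tau N i)) N)].
  have [S [SC _ _]] := PC (j g).
  exact: (stochastic_integral_limit tT filt (M2 g) C0 (@CV g) ptau (HB g) SC (Ixi g (j g))).
have Lx g : L2 (xi g (j g)) by case: (lim g).
have cx g : cvg2 P (fun N => increment_sum (M g) (tau N) (fun i => Psi (j g) (tau N i)) N) (xi g (j g)).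
  by case: (lim g).
have bx g : bounded_moments P (fun N => increment_sum (M g) (tau N) (fun i => Psi (j g) (tau N i)) N).
  by case: (lim g).
have [V [LV LN cV]] := distinct_sum_limit tT filt M2 rho0 rhoC C0 CV ptau HB Lx cx bx.
have [ms Lp] := coinciding_sum_limit Lx cx bx LV LN cV.
by exists V.
Qed.

Variable V : ('I_k -> nat) -> Omega -> R.
Hypothesis LV : forall j, L2 (V j).
Hypothesis cV : forall j, cvg2 P (fun N => product_sum M tau (fun g => Psi (j g)) (distinct_indices k N)) (V j).
Hypothesis LN : forall j N, (0 < N)%N -> L2 (product_sum M tau (fun g => Psi (j g)) (distinct_indices k N)).
Variable J : Omega -> R.
Hypothesis LJ : L2 J.
Hypothesis cJ : cvg2 P (fun N w => \sum_(l in distinct_indices k N)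
    (increasing l)%:R * \prod_g (psi g (tau N (l g)) * (M g (tau N (l g).+1) w - M g (tau N (l g)) w))) J.

Let K (x : k.-tuple (measurableTypeR R)) := iterated_kernel psi x * \prod_(l < k) Num.sqrt (r (tnth x l)).

(** For a fixed finite combination, N tends to infinity. The factor 2 comes from [cvg2_nrm_le], (k
    C)^k from peeling off k cells, and Cr^k from rho <= Cr r in each of the k variables. *)
Lemma expansion_error (I : finType) (c : I -> R) (q : I -> 'I_k -> nat) :
  nrm P (fun w => J w - \sum_i c i * V (q i) w) <=
  2 * ((k%:R * C) ^+ k * (Cr ^+ k * nrm (lebesgue_tuple R k)
    (fun x => (K \_ (cube t T)) x - \sum_i c i * tensor (weighted t T r Psi) (q i) x))).
Proof.
have [Bp Bp0 HBp] : exists2 B : R, 0 <= B & forall (g : 'I_k) x, x \in `[t, T] -> `|psi g x| <= B.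
  apply: common_bound => [g x y xy h z zI|g]; first exact: le_trans (h z zI) xy.
  exact: psi_bound.
have [Bh Bh0 HBh] : exists2 B : R, 0 <= B & forall (z : I * 'I_k) x, x \in `[t, T] -> `|Psi (q z.1 z.2) x| <= B.
  apply: common_bound => [g x y xy h z zI|g]; first exact: le_trans (h z zI) xy.
  exact: Psi_bound.
pose B := Bp + Bh.
have psiB g x : x \in `[t, T] -> `|psi g x| <= B.
  by move=> xI; apply: le_trans (HBp g x xI) _; rewrite lerDl.
have hB i g x : x \in `[t, T] -> `|Psi (q i g) x| <= B.
  by move=> xI; apply: le_trans (HBh (i, g) x xI) _; rewrite lerDr.
have [Sf HSf] := choice PC.
(* All the jump points of the finitely many Psi in the combination; removing them from rho changes
   no integral. *)
pose S := flatten [seq Sf (q z.1 z.2) | z <- enum {: I * 'I_k}].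
have hC i g x : x \in `[t, T] -> x \notin S ->
    Psi (q i g) y @[y --> within [set` `[t, T]] (nbhs x)] --> Psi (q i g) x.
  move=> xI xS; have [h _ _] := HSf (q i g); apply: h => //.
  by apply: contra xS => xS; apply/flattenP; exists (Sf (q i g)) => //; apply/mapP; exists (i, g); rewrite ?mem_enum.
pose h i g := Psi (q i g).
pose a N (l : {ffun 'I_k -> 'I_N}) := kernel_error tau psi c h l.
have [A A0 HA] := kernel_error_bound ptau c psiB hB.
have aG := kernel_error_cvg Omega ptau c psiC hC.
have [IG cG] := tuple_riemann_sum_cvg rho0 rhoC ptau (a := fun N l => a N l ^+ 2) HA aG.
pose G x := (iterated_kernel psi x - \sum_i c i * \prod_(g < k) h i g (tnth x g)) ^+ 2.
pose X N w := \sum_(l in distinct_indices k N) (increasing l)%:R *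
  \prod_g (psi g (tau N (l g)) * (M g (tau N (l g).+1) w - M g (tau N (l g)) w)) -
  \sum_i c i * product_sum M tau (fun g => Psi (q i g)) (distinct_indices k N) w.
have EX N w : X N w = \sum_(l in distinct_indices k N) a N l *
    \prod_g (M g (tau N (l g).+1) w - M g (tau N (l g)) w).
  rewrite /X /product_sum; under [X in _ - X]eq_bigr do rewrite mulr_sumr.
  rewrite exchange_big/= -sumrB; apply: eq_bigr => l _.
  rewrite /a /kernel_error mulrBl mulr_suml; congr (_ - _).
    by rewrite big_split/= mulrA.
  by apply: eq_bigr => i _; rewrite big_split/= mulrA.
have energy N : (0 < N)%N -> L2 (X N) /\ nrm P (X N) <= (k%:R * C) ^+ k *
    \sum_(l : {ffun 'I_k -> 'I_N}) a N l ^+ 2 * \prod_g (Lam (tau N (l g).+1) - Lam (tau N (l g))).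
  move=> N0; pose l0 : {ffun 'I_k -> 'I_N} := [ffun=> Ordinal N0].
  have ck : (#|[set: 'I_k]%SET| <= k)%N by rewrite cardsT card_ord.
  have [[_ LVN] nV] := inj_sum_energy filt M2 rho0 rhoC C0 CV ptau (a N) l0 ck N0 (leqnn N).
  have EV w : inj_sum (a N) (fun g j => M g (tau N j.+1) w - M g (tau N j) w) [set: 'I_k]%SET N l0 = X N w.
    by rewrite inj_sumT EX.
  split; first exact: (L2_eq EV LVN).
  rewrite -(nrm_eq P EV); apply: le_trans nV _; rewrite cardsT card_ord ler_wpM2l ?exprn_ge0 ?mulr_ge0//.
  rewrite inj_sumT [leRHS](bigID (mem (distinct_indices k N)))/= lerDl.
  apply: sumr_ge0 => l _; rewrite mulr_ge0 ?sqr_ge0// prodr_ge0// => g _.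
  have [_ /(_ N) pS _] := ptau; have lg := ltn_ord (l g).
  have [u1 _] := partition_sequence_itv ptau N0 (ltnW lg); have [_ u2] := partition_sequence_itv ptau N0 lg.
  by rewrite subr_ge0 (Lam_le rho0 rhoC u1 (ltW (pS _ lg)) u2).
have LS : L2 (fun w => \sum_i c i * V (q i) w) by apply: L2_sum => i _; exact: L2Z.
have LJ1 N : L2 (fun w => \sum_(l in distinct_indices k N.+1) (increasing l)%:R *
    \prod_g (psi g (tau N.+1 (l g)) * (M g (tau N.+1 (l g).+1) w - M g (tau N.+1 (l g)) w))).
  have [L _] := energy N.+1 (ltn0Sn _).
  have L' : L2 (fun w => \sum_i c i * product_sum M tau (fun g => Psi (q i g)) (distinct_indices k N.+1) w).
    by apply: L2_sum => i _; apply: L2Z; exact: LN.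
  by apply: (L2_eq _ (L2D L L')) => w; rewrite /X subrK.
have shift (Z : nat -> Omega -> R) Y : cvg2 P Z Y -> cvg2 P (fun N => Z N.+1) Y.
  by move=> cZ e /cZ[n0 Hn0]; exists n0 => n nn; apply: Hn0; exact: leqW.
have cX : cvg2 P (fun N => X N.+1) (fun w => J w - \sum_i c i * V (q i) w).
  have c1 : cvg2 P (fun N w => \sum_i - c i * product_sum M tau (fun g => Psi (q i g)) (distinct_indices k N.+1) w)
      (fun w => \sum_i - c i * V (q i) w).
    apply: cvg2_sum => [i n|i|i]; [by apply: L2Z; exact: LN|exact: L2Z|].
    by apply: cvg2Z; [move=> n; exact: LN|exact: LV|exact: (shift _ _ (cV (q i)))].
  have L1 n : L2 (fun w => \sum_i - c i * product_sum M tau (fun g => Psi (q i g)) (distinct_indices k n.+1) w).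
    by apply: L2_sum => i _; apply: L2Z; exact: LN.
  have L1' : L2 (fun w => \sum_i - c i * V (q i) w) by apply: L2_sum => i _; exact: L2Z.
  have := cvg2D LJ1 LJ L1 L1' (shift _ _ cJ) c1.
  have E (Y Z : I -> R) : \sum_i - Y i * Z i = - \sum_i Y i * Z i.
    by rewrite -sumrN; apply: eq_bigr => i _; rewrite mulNr.
  move=> H e /H[n0 Hn0]; exists n0 => n /Hn0; congr (_ < e); apply: nrm_eq => w.
  by rewrite /X !E.
have cst0 : 0 <= (k%:R * C) ^+ k by rewrite exprn_ge0// mulr_ge0.
have main : \int[lebesgue_tuple R k]_x (G x * \prod_(g < k) punctured_rho t T rho S (tnth x g)) <=
  Cr ^+ k * nrm (lebesgue_tuple R k) (fun x => (K \_ (cube t T)) x - \sum_i c i * tensor (weighted t T r Psi) (q i) x).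
  have [LKc _] := square_integrable_restrict (@cube_measurable R t T k) LK.
  have LD : square_integrable (lebesgue_tuple R k) setT
      (fun x => (K \_ (cube t T)) x - \sum_i c i * tensor (weighted t T r Psi) (q i) x).
    by apply: L2B => //; apply: L2_sum => i _; apply: L2Z; exact: (tensor_L2 (weighted_L2 CO)).
  rewrite /nrm -RintZ; last exact: L2_sqr.
  apply: Rint_le; [exact: IG|by apply: mintZ; exact: L2_sqr|move=> x].
  (* Where a punctured density vanishes the left integrand is 0; elsewhere x lies in the cube and
     the weights sqrt r factor out. *)
  have [gx|] := pselect (forall g, punctured_rho t T rho S (tnth x g) != 0); last first.
    move=> /existsNP[g /negP]; rewrite negbK => /eqP g0.
    by rewrite (bigD1 g)//= g0 mul0r mulr0 mulr_ge0 ?sqr_ge0// exprn_ge0.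
  have xI g : tnth x g \in `[t, T].
    move: (gx g); rewrite /punctured_rho patchE; case: ifPn; last by rewrite eqxx.
    by move=> /set_mem[] /=; rewrite !in_itv/= => /andP[-> /ltW ->].
  have r0 g : 0 <= r (tnth x g) by case: CO => _ + _; apply.
  have -> : (K \_ (cube t T)) x - \sum_i c i * tensor (weighted t T r Psi) (q i) x =
      (iterated_kernel psi x - \sum_i c i * \prod_(g < k) h i g (tnth x g)) * \prod_(g < k) Num.sqrt (r (tnth x g)).
    rewrite mulrBl mulr_suml patchE ifT; last by rewrite mem_set.
    congr (_ - _); apply: eq_bigr => i _; rewrite -mulrA -big_split/=; congr (_ * _).
    by apply: eq_bigr => g _; rewrite /weighted patchE ifT// mem_set//; exact: (xI g).
  rewrite exprMn mulrCA ler_wpM2l ?sqr_ge0//.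
  rewrite -prodrXl -[Cr ^+ k](_ : \prod_(g < k) Cr = _); last by rewrite prodr_const card_ord.
  rewrite -big_split/=; apply: ler_prod => g _; rewrite (punctured_rho_ge0 rho0)/= sqr_sqrtr//.
  apply: le_trans (rhor (xI g)); rewrite /punctured_rho patchE; case: ifP => // _.
  exact: rho0.
apply: (@le_trans _ _ (2 * ((k%:R * C) ^+ k * \int[lebesgue_tuple R k]_x (G x * \prod_(g < k) punctured_rho t T rho S (tnth x g))))); last first.
  by rewrite ler_wpM2l// ler_wpM2l.
apply/ler_addgt0Pr => e e0.
have c20 : 0 <= 2 * (k%:R * C) ^+ k by rewrite mulr_ge0.
have [e1 e1P He1] := small_factor c20 e0.
have /cvgrPdist_lt/(_ e1 e1P)[N0 _ HN0] := cG.
set IGx := \int[lebesgue_tuple R k]_x _ in HN0 *.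
apply: (@le_trans _ _ (2 * ((k%:R * C) ^+ k * (IGx + e1)))); last first.
  by rewrite mulrDr mulrDr lerD2l mulrA.
(* The shift by N0 makes the bound [IGx + e1] hold for every index, and the successor keeps the
   number of cells positive. *)
apply: (@cvg2_nrm_le _ _ _ P (fun N => X (N0 + N).+1)).
- by move=> n; case: (energy (N0 + n).+1 (ltn0Sn _)).
- exact: L2B.
- by move=> e' /cX[n0 Hn0]; exists n0 => n nn; apply: Hn0; exact: leq_trans nn (leq_addl _ _).
move=> n; have [_ nX] := energy (N0 + n).+1 (ltn0Sn _); apply: le_trans nX _; rewrite ler_wpM2l//.
have := HN0 (N0 + n).+1 (leqW (leq_addr _ _)); rewrite /= distrC => /ltW /ler_normlW; lra.
Qed.

Lemma expansion_convergence e : 0 < e -> exists p0 : nat, forall p : 'I_k -> nat, (forall l, (p0 <= p l)%N) ->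
  nrm P (fun w => J w - \sum_(j : {dffun forall l : 'I_k, 'I_(p l).+1})
    fourier_coefficient t T psi r Psi (fun l => j l) * V (fun l => j l) w) < e.
Proof.
move=> e0.
have c0 : 0 <= 2 * ((k%:R * C) ^+ k * Cr ^+ k).
  by rewrite mulr_ge0// mulr_ge0 ?exprn_ge0// mulr_ge0.
have e20 : 0 < e / 2 by rewrite divr_gt0.
have [e1 e1P He1] := small_factor c0 e20.
have [LKc _] := square_integrable_restrict (@cube_measurable R t T k) LK.
have K0 x : ~ cube t T x -> (K \_ (cube t T)) x = 0 by move=> nx; rewrite patchE ifF//; exact/memNset.
have [p0 Hp0] := fourier_convergence (weighted_L2 CO) (weighted_orth CO) (weighted_dense CO) LKc K0 e1P.
exists p0 => p /Hp0 Hp.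
apply: le_lt_trans (expansion_error (fun j : {dffun forall l : 'I_k, 'I_(p l).+1} =>
  fourier_coefficient t T psi r Psi (fun l => j l)) (fun j l => j l)) _.
(* The sqrt r of the weighted system and the sqrt r attached to the kernel multiply to the r in the
   Fourier coefficient. *)
have cE (j : 'I_k -> nat) : \int[lebesgue_tuple R k]_y ((K \_ (cube t T)) y * tensor (weighted t T r Psi) j y) =
    fourier_coefficient t T psi r Psi j.
  rewrite /fourier_coefficient [RHS]Rintegral_mkcond; apply: Rint_eq => x.
  rewrite !patchE; case: ifPn => [/set_mem xc|_]; last by rewrite mul0r.
  rewrite /K -mulrA -big_split/=; congr (_ * _); apply: eq_bigr => g _.
  have r0 : 0 <= r (tnth x g) by case: CO => _ + _; apply; exact: xc.
  rewrite /weighted patchE ifT; last by rewrite mem_set//; exact: (xc g).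
  by rewrite mulrCA -expr2 sqr_sqrtr.
have {}Hp : nrm (lebesgue_tuple R k) (fun x => (K \_ (cube t T)) x -
    \sum_(j : {dffun forall l : 'I_k, 'I_(p l).+1}) fourier_coefficient t T psi r Psi (fun l => j l) *
      tensor (weighted t T r Psi) (fun l => j l) x) < e1.
  apply: le_lt_trans Hp; rewrite le_eqVlt; apply/orP; left; apply/eqP; apply: nrm_eq => x.
  by congr (_ - _); apply: eq_bigr => j _; rewrite cE.
apply: (@le_lt_trans _ _ (e / 2)); last by rewrite ltr_pdivrMr// ltr_pMr// ltr1n.
apply: le_trans He1; rewrite -[leRHS]mulrA ler_wpM2l// -[leRHS]mulrA ler_wpM2l ?exprn_ge0 ?mulr_ge0//.
by rewrite ler_wpM2l ?exprn_ge0// ltW.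
Qed.

End expansion.

Lemma conditional_variance_bound_le (R : realType) d (Omega : measurableType d) (P : probability Omega R)
    (t T : R) F (rho : R -> R) M (C C' : R) :
  (forall x, x \in `[t, T] -> 0 <= rho x) -> {within `[t, T], continuous rho} -> C <= C' ->
  conditional_variance_bound P t T F rho M C -> conditional_variance_bound P t T F rho M C'.
Proof.
move=> rho0 rhoC CC' CV u v Z tu uv vT AZ; have [L N] := CV u v Z tu uv vT AZ.
split=> //; apply: le_trans N _; rewrite ler_wpM2r ?nrm_ge0// ler_wpM2r//.
by rewrite subr_ge0 (Lam_le rho0 rhoC).
Qed.

Theorem theorem9 (R : realType) (d : measure_display)
    (Omega : measurableType d) (P : probability Omega R)
    (t T : R) (F : R -> set_system Omega)
    (k m : nat) (i : 'I_k -> 'I_m)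
    (rho r : R -> R) (psi : 'I_k -> R -> R) (Psi : nat -> R -> R)
    (M : 'I_k -> 'I_m -> R -> Omega -> R)
    (xi : 'I_k -> 'I_m -> nat -> Omega -> R)
    (tau : nat -> nat -> R) (J : Omega -> R) :
  0 <= t -> t < T -> (0 < k)%N ->
  filtration F t T ->
  independent_families P
    (fun i' => [set Z | exists l, exists2 s, s \in `[t, T] & Z = M l i' s]) ->
  (forall l, {within `[t, T], continuous (psi l)}) ->
  (forall l i', class_Q4 P F rho t T (M l i')) ->
  (forall l i', class_G P (2 ^ k.+1) F rho t T (M l i')) ->
  complete_orthonormal_weight t T r Psi ->
  (forall j, piecewise_right_continuous t T (Psi j)) ->
  (* rho / r <= C, with no division by the possible zeros of r *)
  (exists C : R, forall x, x \in `[t, T] -> rho x <= C * r x) ->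
  square_integrable (lebesgue_tuple R k) (cube t T)
    (fun x => iterated_kernel psi x * \prod_(l < k) Num.sqrt (r (tnth x l))) ->
  partition_sequence t T tau ->
  (forall l i' j,
    stochastic_integral P F rho (M l i') t T (fun s _ => Psi j s) (xi l i' j)) ->
  iterated_integral P F rho t T psi (fun l => M l (i l)) J ->
  [/\ independent_families P
        (fun i' => [set Z | exists l, exists j, Z = xi l i' j]),
      (forall x, x \in `[t, T] -> rho x = r x) ->
        forall l i' j j', j != j' ->
        covariance P (xi l i' j) (xi l i' j') = 0%E &
      exists2 D : ('I_k -> nat) -> Omega -> R,
        forall j, ms_limit P (fun N w =>
          \sum_(l in coinciding_indices k N) \prod_(g < k)
            (Psi (j g) (tau N (l g)) *
             (M g (i g) (tau N (l g).+1) w - M g (i g) (tau N (l g)) w))) (D j) &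
        ms_limit_multi P (fun p w =>
          \sum_(j : {dffun forall l : 'I_k, 'I_(p l).+1})
            fourier_coefficient t T psi r Psi (fun l => j l) *
            (\prod_(l < k) xi l (i l) (j l) w - D (fun l => j l) w)) J].
Proof.
move=> _ tT k0 filt indep psiC MQ _ CO PC [Cr hCr] LK ptau Ixi IJ.
have M2 l i' : class_M2 P F rho t T (M l i') := (MQ l i').1.
pose g0 := Ordinal k0.
have rho0 := M2_rho0 (M2 g0 (i g0)); have rhoC := M2_rhoC (M2 g0 (i g0)).
have [C C0 CV] : exists2 C : R, 0 <= C & forall z : 'I_k * 'I_m,
    conditional_variance_bound P t T F rho (M z.1 z.2) C.
  apply: common_bound => [z x y|z]; first exact: (conditional_variance_bound_le rho0 rhoC).
  exact: (class_Q4_conditional_variance tT filt (MQ z.1 z.2)).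
have PsiB j : exists2 B : R, 0 <= B & forall x, x \in `[t, T] -> `|Psi j x| <= B.
  exact: (Psi_bound PC).
have lim l i' j : [/\ square_integrable P setT (xi l i' j),
    cvg2 P (fun N => increment_sum (M l i') (tau N) (fun q => Psi j (tau N q)) N) (xi l i' j) &
    bounded_moments P (fun N => increment_sum (M l i') (tau N) (fun q => Psi j (tau N q)) N)].
  have [B _ HB] := PsiB j; have [S [SC _ _]] := PC j.
  exact: (stochastic_integral_limit tT filt (M2 l i') C0 (CV (l, i')) ptau HB SC (Ixi l i' j)).
split.
- apply: independent_families_limits indep => i' Z.
    move=> [l [s + ->]]; rewrite in_itv/= => /andP[ts sT].
    exact: (martingale_measurable filt (M2_mart (M2 l i')) ts sT).
  move=> [l [j ->]]; have [Lx cx bx] := lim l i' j.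
  split; first exact: L2_meas Lx.
  (* A subsequence of the integral sums converges almost everywhere, and each sum is measurable with
     respect to the martingales of index i'. *)
  have [n [_ Hn]] := cvg2_ae_subseq (fun N => bounded_moments_L2 N bx) Lx cx.
  exists (fun N => increment_sum (M l i') (tau (n N)) (fun q => Psi j (tau (n N) q)) (n N)) => // N.
  set X := [set Z | _]; have sX := sigma_generated_sigma X.
  apply: (measurable_wrt_sum sX) => q _; have q0 := leq_ltn_trans (leq0n _) (ltn_ord q).
  apply: (measurable_wrtM sX); first exact: (measurable_wrt_cst sX).
  have XM p : (p <= n N)%N -> measurable_wrt (sigma_generated X) (M l i' (tau (n N) p)).
    move=> pn; apply: sigma_generated_wrt; exists l, (tau (n N) p) => //.
    exact: (partition_seq_itv ptau q0 pn).
  by apply: (measurable_wrtB sX); apply: XM; [exact: ltn_ord|exact: ltnW (ltn_ord q)].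
- move=> rr l i' j j' jj'.
  have [B _ HB] := PsiB j; have [B' _ HB'] := PsiB j'.
  have [S [SC _ _]] := PC j; have [S' [SC' _ _]] := PC j'.
  rewrite (covariance_stochastic_integrals tT filt (M2 l i') C0 (CV (l, i')) ptau HB HB' SC SC'
    (Ixi l i' j) (Ixi l i' j')).
  (* For rho = r the covariance is the orthogonality relation of the weighted system. *)
  have [_ r0 [_ orth _]] := CO; have := orth j j'; rewrite (negbTE jj') => o.
  congr EFin; rewrite -[RHS]o; apply: eq_Rintegral => x /set_mem xI.
  by rewrite rr// -{1}(sqr_sqrtr (r0 x xI)); ring.
have rhor x : x \in `[t, T] -> rho x <= `|Cr| * r x.
  move=> xI; apply: le_trans (hCr x xI) _; rewrite ler_wpM2r ?ler_norm//.
  by case: CO => _ + _; apply.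
have CVi g : conditional_variance_bound P t T F rho (M g (i g)) C := CV (g, i g).
have HV := product_limit tT filt (fun g => M2 g (i g)) rho0 rhoC C0 CVi PC ptau (fun g j => Ixi g (i g) j).
have [V HV'] := choice HV.
exists (fun j w => \prod_g xi g (i g) (j g) w - V j w) => [j|]; first by case: (HV' j).
have [Bp Bp0 HBp] : exists2 B : R, 0 <= B & forall g x, x \in `[t, T] -> `|psi g x| <= B.
  apply: common_bound => [g x y xy h z zI|g]; first exact: le_trans (h z zI) xy.
  exact: (psi_bound psiC).
have [LJ cJ] := iterated_integral_limit tT filt (fun g => M2 g (i g)) rho0 rhoC C0 CVi psiC HBp ptau IJ.
split; first exact: L2_meas LJ.
move=> e e0.
have LV j : square_integrable P setT (V j) by case: (HV' j).
have [p0 Hp0] := expansion_convergence filt (fun g => M2 g (i g)) rho0 rhoC C0 CVi psiC CO PC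
  (normr_ge0 Cr) rhor LK ptau LV
  (fun j => let: And5 _ _ c _ _ := HV' j in c) (fun j => let: And5 _ l _ _ _ := HV' j in l) LJ cJ e0.
exists p0 => p /Hp0; set S := fun w => J w - _ => HS.
have LS : square_integrable P setT S.
  by apply: L2B => //; apply: L2_sum => j _; exact: L2Z.
rewrite (_ : (fun w => _) = fun w => (- S w) ^+ 2) ?expectation_sqr ?nrmN ?lte_fin//; first exact: L2N.
apply/funext => w; rewrite /S opprB; congr ((_ - _) ^+ 2).
by apply: eq_bigr => j _; rewrite subKr.
Qed.
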